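(* Let $x_N\in\Sigma_N$, $N\ge1$, be a sequence converging to $x\in\Sigma$. Then $\mathbb{P}^N_{x_N}$ converges to $\mathbb{P}_x$ in the Skorohod topology (i.e. weakly as probability measures on $D(\mathbb{R}_+,\Sigma)$ endowed with the Skorohod topology), where $\mathbb{P}_x$ is the unique solution of the $\mathfrak{L}$-martingale problem starting at $x$.
   Context: Setting. $S=\{1,\dots,L\}$ is a finite set; $r(j,k)\ge 0$, $j,k\in S$, with $r(j,j)=0$, are the jump rates of an irreducible continuous-time Markov chain on $S$; $\mathbf m=(m_j)_{j\in S}$ is a (nonzero, hence strictly positive) invariant measure, i.e. $\sum_{j} m_j r(j,k)=m_k\sum_\ell r(k,\ell)$ for all $k$ (neither a probability nor reversible in general); $b>1$ is fixed. $\Sigma=\{x\in\mathbb{R}^S: x_j\ge 0,\ \sum_{j\in S}x_j=1\}$, $\Sigma_N=\{x\in\Sigma:Nx_j\in\mathbb{N}\ \forall j\in S\}$, $\mathbb{N}=\{0,1,2,\dots\}$. $\{\mathbf e_j\}$ is the canonical basis of $\mathbb{R}^S$ and $\mathbf v_j=\sum_{k\in S}r(j,k)(\mathbf e_k-\mathbf e_j)$. Zero-range process. For each $j\in S$, $g_j:\mathbb{N}\to\mathbb{R}_+$ satisfies $g_j(0)=0$ and $\lim_{n\to\infty}n\left(\frac{g_j(n)}{m_j}-1\right)=b$. The rescaled condensing zero-range process is the $\Sigma_N$-valued continuous-time Markov chain $(X^N_t)_{t\ge0}$ with generator $$(\mathfrak{L}_NF)(x)=N^2\sum_{j,k\in S}g_j(Nx_j)\,r(j,k)\Big[F\big(x+\tfrac{\mathbf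 e_k-\mathbf e_j}{N}\big)-F(x)\Big],\quad F:\Sigma_N\to\mathbb{R},$$ and $\mathbb{P}^N_x$, $x\in\Sigma_N$, is the law on $D(\mathbb{R}_+,\Sigma)$ (right-continuous paths with left limits, Skorohod topology) of this chain started from $x$. Limit. $C^n(\Sigma)$ is the set of $n$-times continuously differentiable functions on $\Sigma$ (up to the boundary; only derivatives tangent to $\Sigma$ are used). $\mathcal D_S$ is the set of $H\in C^2(\Sigma)$ such that for every $j\in S$ the map $x\mapsto \frac{\mathbf v_j\cdot\nabla H(x)}{x_j}\mathbf 1\{x_j>0\}$ (equal to $0$ when $x_j=0$) is continuous on $\Sigma$. For $F\in C^2(\Sigma)$, $$(\mathfrak{L}F)(x)=b\sum_{j\in S}\mathbf 1\{x_j\ne 0\}\frac{m_j}{x_j}\,\mathbf v_j\cdot\nabla F(x)+\frac12\sum_{j,k\in S}m_j r(j,k)(\partial_{x_k}-\partial_{x_j})^2F(x).$$ A probability $\mathbb{P}$ on $C(\mathbb{R}_+,\Sigma)$ (continuous paths, coordinate maps $X_t$, $\mathcal F_t=\sigma(X_s:s\le t)$) starts at $x$ if $\mathbb{P}[X_0=x]=1$ and is a solution of the $\mathfrak{L}$-martingale problem if for every $H\in\mathcal D_S$, $H(X_t)-\int_0^t(\mathfrak{L}H)(X_s)\,ds$ is a $\mathbb{P}$-martingale w.r.t. $(\mathcal F_t)$. For each $x\in\Sigma$ there is exactly one solution starting at $x$, denoted $\mathbb{P}_x$; it is viewed as a measure on $D(\mathbb{R}_+,\Sigma)$ concentrated on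 continuous trajectories. *)

(* Defs.v *)
From HB Require Import structures.
From mathcomp Require Import all_boot all_order all_algebra.
From mathcomp Require Import all_classical all_reals all_analysis.

Set Implicit Arguments.
Unset Strict Implicit.
Unset Printing Implicit Defensive.
Import Order.TTheory GRing.Theory Num.Theory.
Import numFieldNormedType.Exports.
Local Open Scope classical_set_scope.
Local Open Scope ring_scope.

(* The site set S = {1, ..., L}, L >= 1, is 'I_n.+1 with L = n.+1, and R^S is
   'rV[R]_n.+1. Functions on Sigma are represented by functions on R^S whose
   values outside Sigma play no role. *)

Section Simplex.
Variables (R : realType) (n : nat).
Local Notation V := 'rV[R]_n.+1.

Definition simplex : set V :=
  [set x | (forall j, 0 <= x 0 j) /\ \sum_j x 0 j = 1].

Definition simplex_int : set V :=
  [set x | (forall j, 0 < x 0 j) /\ \sum_j x 0 j = 1].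

Definition simplex_grid (N : nat) : set V :=
  [set x | simplex x /\ forall j, N%:R * x 0 j \is a Num.nat].

Definition evec (j : 'I_n.+1) : V := delta_mx 0 j.

Definition tangent (u : V) := \sum_j u 0 j = 0.

(* C^k(Sigma): the directional derivatives along the directions tangent to
   Sigma exist in the relative interior of Sigma and extend to functions in
   C^(k-1)(Sigma). *)
Fixpoint Cn_simplex (k : nat) (F : V -> R) : Prop :=
  {within simplex, continuous F} /\
  (if k is k'.+1 then
     forall u, tangent u ->
       exists2 G : V -> R,
         forall x, simplex_int x -> is_derive x u F (G x) & Cn_simplex k' G
   else True).

(* u . grad F on Sigma for a tangent direction u; at the boundary of Sigma it is
   the continuous extension of the derivative taken in the relative interior. *)
Definition Dtan (u : V) (F : V -> R) (x : V) : R :=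
  lim ('D_u F y @[y --> within simplex_int (nbhs x)]).

End Simplex.
Arguments simplex {R n}.
Arguments simplex_int {R n}.
Arguments simplex_grid {R n}.
Arguments evec {R n}.

Section PathSpace.
Variables (R : realType) (n : nat).
Local Notation V := 'rV[R]_n.+1.

(* An element of D(R_+, Sigma), as a function on R that is constant on
   ]-oo, 0]: equality of paths is then equality on R_+. *)
Record cadlag_path := CadlagPath {
  path_fun :> R -> V ;
  path_simplex : forall t, simplex (path_fun t) ;
  path_neg : forall t, t <= 0 -> path_fun t = path_fun 0 ;
  path_right_continuous : forall t, path_fun s @[s --> t^'+] --> path_fun t ;
  path_left_limit : forall t, cvg (path_fun s @[s --> t^'-]) }.

HB.instance Definition _ := gen_eqMixin cadlag_path.
HB.instance Definition _ := gen_choiceMixin cadlag_path.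

Lemma simplex_evec (j : 'I_n.+1) : simplex (evec j : V).
Proof.
split=> [k|]; first by rewrite mxE ler0n.
rewrite (bigD1 j)//= mxE !eqxx big1 ?addr0// => k /negPf kj.
by rewrite mxE kj andbF.
Qed.

Definition cst_path : cadlag_path :=
  @CadlagPath (fun=> evec ord0) (fun=> simplex_evec ord0) (fun _ _ => erefl)
    (fun=> cvg_cst _) (fun=> is_cvg_cst _).

HB.instance Definition _ := isPointed.Build cadlag_path cst_path.

Definition time_change (lam : R -> R) :=
  [/\ forall t, 0 <= t -> 0 <= lam t,
      forall s t, 0 <= s -> s < t -> lam s < lam t
    & forall u, 0 <= u -> exists2 t, 0 <= t & lam t = u].

(* Neighbourhood base of the Skorohod (J1) topology on D(R_+, Sigma); the
   sequences converging for it are those of Ethier and Kurtz, Markov Processes,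
   Proposition 3.5.3 (c). *)
Definition skorohod_ball (w : cadlag_path) (T e : R) : set cadlag_path :=
  [set v | exists2 lam, time_change lam &
     forall t, 0 <= t <= T ->
       `|lam t - t| < e /\ `|(v t : V) - w (lam t)| < e].

Definition skorohod_open : set (set cadlag_path) :=
  [set O | forall w, O w ->
     exists T e, 0 < e /\ skorohod_ball w T e `<=` O].

Lemma skorohod_openT : skorohod_open setT.
Proof. by move=> w _; exists 0, 1. Qed.

Lemma skorohod_openI : setI_closed skorohod_open.
Proof.
move=> A B oA oB w [/oA[T1 [e1 [e10 sA]]] /oB[T2 [e2 [e20 sB]]]].
exists (Num.max T1 T2), (Num.min e1 e2); split; first by rewrite lt_min e10.
move=> v [lam tc H]; split; [apply: sA|apply: sB]; exists lam => // t /andP[t0 tT].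
  have [] := H t; first by rewrite t0 le_max tT.
  by rewrite !lt_min => /andP[-> _] /andP[-> _].
have [] := H t; first by rewrite t0 le_max tT orbT.
by rewrite !lt_min => /andP[_ ->] /andP[_ ->].
Qed.

Lemma skorohod_open_bigcup (I : Type) (f : I -> set cadlag_path) :
  (forall i, skorohod_open (f i)) -> skorohod_open (\bigcup_i f i).
Proof.
move=> fo w [i _ /fo[T [e [e0 sf]]]]; exists T, e; split=> // v /sf fv.
by exists i.
Qed.

HB.instance Definition _ := isOpenTopological.Build cadlag_path
  skorohod_openT skorohod_openI skorohod_open_bigcup.

(* sigma(X_s : 0 <= s <= t) *)
Definition natural_filtration (t : R) : set (set cadlag_path) :=
  <<s [set A | exists s U, [/\ 0 <= s <= t, open U &
                               A = [set w : cadlag_path | U (w s : V)]] ]>>.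

End PathSpace.

Notation borel T := (g_sigma_algebraType (@open T)).

Definition weak_cvg (R : realType) (T : ptopologicalType)
    (mu_ : nat -> probability (borel T) R) (mu : probability (borel T) R) :=
  forall f : T -> R, continuous f -> (exists M, forall x, `|f x| <= M) ->
    \int[mu_ k]_x f x @[k --> \oo] --> \int[mu]_x f x.

(* M is a martingale, indexed by R_+, for the filtration Fil. *)
Definition martingale d (T : measurableType d) (R : realType)
    (P : probability T R) (Fil : R -> set (set T)) (M : R -> T -> R) :=
  [/\ forall t (B : set R), 0 <= t -> measurable B -> Fil t (M t @^-1` B),
      forall t, 0 <= t -> P.-integrable setT (EFin \o M t)
    & forall s t A, 0 <= s -> s <= t -> Fil s A ->
        \int[P]_(w in A) M t w = \int[P]_(w in A) M s w].

Section Processes.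
Variables (R : realType) (n : nat).
Local Notation S := 'I_n.+1.
Local Notation V := 'rV[R]_n.+1.
Local Notation D := (cadlag_path R n).
Variables (r : S -> S -> R) (m : S -> R) (b : R) (g : S -> nat -> R).

(* When x is in Sigma_N and x_j = 0, the summand vanishes because g_j(0) = 0;
   hence only the values of F on Sigma_N matter. *)
Definition zrp_gen (N : nat) (F : V -> R) (x : V) : R :=
  N%:R ^+ 2 * \sum_j \sum_k
    g j (Num.truncn (N%:R * x 0 j)) * r j k *
    (F (x + N%:R^-1 *: (evec k - evec j)) - F x).

(* p_t(x, y) = (e^{t L_N} 1_{y})(x), where L_N is the generator; for x in
   Sigma_N this is an entry of the exponential of a finite matrix. *)
Definition zrp_trans (N : nat) (t : R) (x y : V) : R :=
  limn (series (fun i =>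
    t ^+ i / i`!%:R * iter i (zrp_gen N) (fun z => (z == y)%:R) x)).

(* P is the law of the Sigma_N-valued Markov chain with generator zrp_gen N
   started at x: Markov property with transition function zrp_trans N. *)
Definition zrp_law (N : nat) (x : V) (P : probability (borel D) R) :=
  [/\ P [set w : D | w 0 = x] = 1%E,
      {ae P, forall w : D, forall t, 0 <= t -> simplex_grid N (w t)}
    & forall s t (A : set D) y, 0 <= s -> 0 <= t ->
        natural_filtration s A -> simplex_grid N y ->
        P (A `&` [set w : D | w (s + t) = y]) =
        (\int[P]_(w in A) (zrp_trans N t ((w : D) s) y)%:E)%E].

Definition vvec (j : S) : V := \sum_k r j k *: (evec k - evec j).

Definition DS (H : V -> R) :=
  Cn_simplex 2 H /\
  forall j, {within simplex, continuous (fun x : V =>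
    if 0 < x 0 j then Dtan (vvec j) H x / x 0 j else 0)}.

Definition limit_gen (F : V -> R) (x : V) : R :=
  b * \sum_j (if x 0 j != 0 then m j / x 0 j * Dtan (vvec j) F x else 0) +
  2^-1 * \sum_j \sum_k
    m j * r j k * Dtan (evec k - evec j) (Dtan (evec k - evec j) F) x.

(* A probability on C(R_+, Sigma) is identified with a probability on
   D(R_+, Sigma) concentrated on continuous trajectories. *)
Definition martingale_solution (x : V) (P : probability (borel D) R) :=
  [/\ {ae P, forall w : D, continuous w},
      P [set w : D | w 0 = x] = 1%E
    & forall H, DS H ->
        martingale P (@natural_filtration R n) (fun t (w : D) =>
          H (w t) - \int[lebesgue_measure]_(s in `[0, t]) limit_gen H (w s))].

(* Equality of measures is required on measurable sets only, since a measure is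
   here a function on all sets, arbitrary on the non-measurable ones. *)
Definition unique_martingale_solution (x : V) (P : probability (borel D) R) :=
  martingale_solution x P /\
  forall Q, martingale_solution x Q -> forall A, measurable A -> Q A = P A.

End Processes.

(* Main.v *)
(* Put d_j(x) = g_j(N x_j) - m_j, which is bounded and of order 1 / (N x_j). By the
   invariance of m the generator of the chain applied to a linear functional only
   involves the d_j, and it is bounded when the functional is harmonic at the
   nearly empty sites. This yields barrier functions, bounded by 1, null at a given
   point and equal to 1 away from it, whose drift is bounded and whose square has a
   drift controlled by the function itself; hence the chain leaves a given ball
   within time h with probability O(h (h + N^-2)).

   For H in D_S, the generator applied to H is LH + (1/2) sum_j d_j Psi_j + o(1)
   with Psi_j continuous. The second term is not small where x_j is of order 1/N,
   but it is averaged out by a corrector (1/N) sum_i kappa_i x_i, where kappa solves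
   a Poisson equation for the underlying chain. So H(X_t) - int_0^t LH(X_s) ds is
   almost a martingale.

   Limit points are built by hand. A path is encoded by countably many bits, the
   binary digits of its values at dyadic times. An ultrafilter U on the integers
   provides a limit of the probability of each finite pattern of bits, and random
   bits with these limit probabilities are defined on [0, 1[ by nested intervals.
   By the exit bound, they are almost surely those of a continuous path, whose law
   solves the martingale problem and hence is Px. If the integrals of some bounded
   continuous function did not converge, U could be chosen to contain infinitely
   many N that violate the convergence by a fixed amount, which contradicts the
   portmanteau inequality along U. *)
Require Import Defs.
From HB Require Import structures.
From mathcomp Require Import all_boot all_order all_algebra.
From mathcomp Require Import all_classical all_reals all_analysis.
From mathcomp Require Import measurable_realfun.
From mathcomp Require Import ring lra.
Set Implicit Arguments.
Unset Strict Implicit.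
Unset Printing Implicit Defensive.
Import Order.TTheory GRing.Theory Num.Theory.
Import numFieldNormedType.Exports.
Local Open Scope classical_set_scope.
Local Open Scope ring_scope.

(** * Dirichlet and Poisson problems for the underlying chain *)

Section Chain.
Variables (R : realType) (n : nat).
Local Notation S := 'I_n.+1.
Variable (r : S -> S -> R).
Hypothesis r_ge0 : forall j k, 0 <= r j k.
Hypothesis r_irr : forall j k, connect (fun i l => 0 < r i l) j k.

(** A linear functional with coefficients c has drift N sum_j d_j (rgen c)_j. Where x_j is bounded
    below, N d_j is bounded; at a nearly empty site it can be of order N. This is the obstacle
    behind barriers and corrector. For the barriers harmonicity removes it; for H in D_S the
    first-order part is tamed because v_j . grad H vanishes on the face x_j = 0, and only the
    second-order part needs averaging.

    The exit probability must be quadratic in h: a bounded time span contains about 1/h windows of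
    length h, so a bound of order h would not survive the union over them, whereas h (h + N^-2)
    leaves a total of order h + N^-2. A first pass bounds the mean of the barrier by a multiple of
    h; a second one feeds this into the drift of its square.

    Bits are not continuous functionals of the path. Statements about the limit are therefore
    reduced to events on finitely many bits, with an error 2^-l in position, and a modulus of
    continuity uniform in N controls the path between dyadic times. *)

Definition rgen (h : S -> R) (i : S) : R := \sum_k r i k * (h k - h i).

(** If the maximum exceeded [c], every site attaining it would lie in [A], where [0 <= rgen h]
    forces all sites reachable in one jump to attain it too; irreducibility carries this to a site
    outside [A]. *)
Lemma max_principle (A : {set S}) (h : S -> R) (c : R) :
  (exists b, b \notin A) -> (forall i, i \in A -> 0 <= rgen h i) ->
  (forall i, i \notin A -> h i <= c) -> forall i, h i <= c.
Proof.
move=> [b bA] hA hc i; rewrite leNgt; apply/negP => ci.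
have [s _ smax] := @Order.TotalTheory.arg_maxP _ _ S i predT h isT.
have hs : c < h s by apply: (lt_le_trans ci); exact: smax.
have /connectP[p] := r_irr s b.
suff H : forall p x, h x = h s -> path (fun i l => 0 < r i l) x p -> h (last x p) = h s.
  by move=> /(H _ _ erefl) Hp bE; have := hc b bA; rewrite bE Hp leNgt hs.
elim=> //= k q IH x hx /andP[rxk pq]; apply: IH => //.
have xA : x \in A by apply/negPn/negP => /hc; rewrite hx leNgt hs.
have le0 l : r x l * (h l - h x) <= 0.
  by rewrite mulr_ge0_le0// subr_le0 hx; exact: smax.
have := hA x xA; rewrite /rgen (bigD1 k)//= => H.
have /eqP : r x k * (h k - h x) = 0.
  apply/le_anti/andP; split => //; apply: (le_trans H).
  by rewrite gerDl; apply: sumr_le0.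
by rewrite mulf_eq0 (gt_eqF rxk)/= subr_eq0 => /eqP ->.
Qed.

Lemma min_principle (A : {set S}) (h : S -> R) (c : R) :
  (exists b, b \notin A) -> (forall i, i \in A -> rgen h i <= 0) ->
  (forall i, i \notin A -> c <= h i) -> forall i, c <= h i.
Proof.
move=> Ab hA hc i; rewrite -lerN2.
apply: (@max_principle A (fun i => - h i)) => // [k kA|k kA]; last by rewrite lerN2 hc.
have -> : rgen (fun i => - h i) k = - rgen h k.
  by rewrite /rgen -sumrN; apply: eq_bigr => l _; ring.
by rewrite oppr_ge0 hA.
Qed.

(** It acts on row vectors from the right, as the generator on [A] and the identity elsewhere. The
    maximum and minimum principles make its kernel trivial. *)
Definition dirichlet_mx (A : {set S}) : 'M[R]_n.+1 :=
  \matrix_(k, i) if i \in A then r i k - (k == i)%:R * \sum_l r i l else (k == i)%:R.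

Lemma mul_dirichlet_mx (A : {set S}) (h : 'rV[R]_n.+1) i :
  (h *m dirichlet_mx A) 0 i = if i \in A then rgen (h 0) i else h 0 i.
Proof.
rewrite mxE; case: ifPn => iA.
  under eq_bigr do rewrite mxE iA mulrBr.
  rewrite sumrB /rgen; under [RHS]eq_bigr do rewrite mulrBr.
  rewrite sumrB; congr (_ - _); first by apply: eq_bigr => k _; rewrite mulrC.
  rewrite (bigD1 i)//= eqxx mul1r [X in _ + X]big1 ?addr0; last first.
    by move=> k /negPf ->; rewrite mul0r mulr0.
  by rewrite mulrC mulr_suml.
rewrite (bigD1 i)//= !mxE (negPf iA) eqxx mulr1 big1 ?addr0// => k /negPf ki.
by rewrite mxE (negPf iA) ki mulr0.
Qed.

Lemma dirichlet_mx_unit (A : {set S}) :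
  (exists b, b \notin A) -> dirichlet_mx A \in unitmx.
Proof.
move=> Ab; rewrite -row_free_unit; apply: inj_row_free => v vA.
have H i : (if i \in A then rgen (v 0) i else v 0 i) = 0.
  by rewrite -mul_dirichlet_mx vA mxE.
apply/rowP => i; rewrite mxE; apply/le_anti/andP; split.
  apply: (@max_principle A (v 0)) => // k kA; have := H k.
    by rewrite kA => ->.
  by rewrite (negPf kA) => ->.
apply: (@min_principle A (v 0)) => // k kA; have := H k.
  by rewrite kA => ->.
by rewrite (negPf kA) => ->.
Qed.

Lemma dirichlet_problem (A : {set S}) (f phi : S -> R) :
  (exists b, b \notin A) -> exists h : S -> R,
  (forall i, i \notin A -> h i = f i) /\ (forall i, i \in A -> rgen h i = phi i).
Proof.
move=> Ab; pose v : 'rV[R]_n.+1 := \row_i if i \in A then phi i else f i.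
pose h := v *m invmx (dirichlet_mx A).
have hv : h *m dirichlet_mx A = v by rewrite /h mulmxKV// dirichlet_mx_unit.
exists (h 0); split => i iA; have := mul_dirichlet_mx A h i;
  by rewrite hv mxE ?iA ?(negPf iA) => ->.
Qed.

Variable m : S -> R.
Hypothesis m_ge0 : forall j, 0 <= m j.
Hypothesis m_neq0 : exists j, m j != 0.
Hypothesis m_inv : forall k, \sum_j m j * r j k = m k * \sum_l r k l.

Lemma invariant_gt0 j : 0 < m j.
Proof.
have [i mi] := m_neq0.
have {}mi : 0 < m i by rewrite lt_def mi m_ge0.
have /connectP[p] := r_irr i j.
elim: p i mi => [i mi _ ->//|k p IH i mi /= /andP[rik pp]]; apply: IH => //.
rewrite lt_def m_ge0 andbT; apply/eqP => mk0.
have := m_inv k; rewrite mk0 mul0r => /eqP.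
rewrite psumr_eq0; last by move=> l _; rewrite mulr_ge0.
move=> /allP/(_ i); rewrite mem_index_enum => /(_ isT)/=.
by rewrite mulf_eq0 (gt_eqF mi) (gt_eqF rik).
Qed.

Lemma sum_invariant_rgen (h : S -> R) : \sum_j m j * rgen h j = 0.
Proof.
under eq_bigr do rewrite /rgen mulr_sumr.
under eq_bigr => j _ do under eq_bigr do rewrite mulrBr mulrBr !mulrA.
under eq_bigr do rewrite sumrB.
rewrite sumrB exchange_big/= -sumrB big1// => k _.
by rewrite -mulr_suml m_inv -mulr_suml -mulr_sumr subrr.
Qed.

(** The solution is pinned to 0 at [ord0] and solves the equation elsewhere; the equation at [ord0]
    then follows because both sides have zero sum against [m]. [C] is the sum of all entries of the
    inverse matrix, hence independent of [f]. *)
Lemma poisson_problem : exists2 C : R, 0 <= C & forall (f : S -> R) (B : R),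
  \sum_j m j * f j = 0 -> (forall j, `|f j| <= B) ->
  exists kappa : S -> R, (forall j, rgen kappa j = f j) /\
    forall j, `|kappa j| <= C * B.
Proof.
pose A : {set S} := (~: [set ord0])%SET.
have Ab : exists b, b \notin A by exists ord0; rewrite /A finset.in_setC finset.in_set1 eqxx.
exists (\sum_i \sum_j `|invmx (dirichlet_mx A) i j|).
  by apply: sumr_ge0 => i _; apply: sumr_ge0.
move=> f B mf fB.
have B0 : 0 <= B := le_trans (normr_ge0 _) (fB ord0).
pose v : 'rV[R]_n.+1 := \row_i if i \in A then f i else 0.
pose h := v *m invmx (dirichlet_mx A).
have hv : h *m dirichlet_mx A = v by rewrite /h mulmxKV// dirichlet_mx_unit.
exists (h 0); split => [j|j]; last first.
  rewrite /h mxE; apply: (le_trans (ler_norm_sum _ _ _)).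
  rewrite mulr_suml; apply: ler_sum => i _; rewrite normrM mulrC.
  apply: ler_pM => //; last by rewrite mxE; case: ifP; rewrite ?normr0.
  by rewrite (bigD1 j)//= lerDl; apply: sumr_ge0.
have hA i : i \in A -> rgen (h 0) i = f i.
  by move=> iA; have := mul_dirichlet_mx A h i; rewrite hv mxE iA.
have [jA|jA] := boolP (j \in A); first exact: hA.
have j0 : j = ord0 by move: jA; rewrite /A finset.in_setC finset.in_set1 negbK => /eqP.
have E := sum_invariant_rgen (h 0).
rewrite (bigD1 ord0)//= in mf; rewrite (bigD1 ord0)//= in E.
have sE : \sum_(i < n.+1 | i != ord0) m i * rgen (h 0) i =
          \sum_(i < n.+1 | i != ord0) m i * f i.
  by apply: eq_bigr => i i0; rewrite hA// /A finset.in_setC finset.in_set1.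
have E' : m ord0 * rgen (h 0) ord0 = m ord0 * f ord0.
  by apply: (addIr (\sum_(i < n.+1 | i != ord0) m i * f i)); rewrite mf -sE.
by rewrite j0; apply: (mulfI _ E'); rewrite gt_eqF// invariant_gt0.
Qed.

End Chain.

(** * The generator on sums of squares of positive parts *)

Section QuadraticGenerator.
Variables (R : realType) (n : nat).
Local Notation S := 'I_n.+1.
Local Notation V := 'rV[R]_n.+1.
Variables (r : S -> S -> R) (m : S -> R) (g : S -> nat -> R) (Cg : R).
Hypothesis r_ge0 : forall j k, 0 <= r j k.
Hypothesis m_inv : forall k, \sum_j m j * r j k = m k * \sum_l r k l.
Hypothesis m_ge0 : forall j, 0 <= m j.
Hypothesis g_ge0 : forall j k, 0 <= g j k.
Hypothesis gC : forall j k, `|g j k - m j| <= Cg.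
Hypothesis ngC : forall j k, k%:R * `|g j k - m j| <= Cg.

Definition lin (c : S -> R) (x : V) : R := \sum_i x 0 i * c i.

Definition jump N (x : V) (j k : S) : V := x + N%:R^-1 *: (evec k - evec j).

Lemma jumpE N (x : V) j k i :
  jump N x j k 0 i = x 0 i + N%:R^-1 * ((k == i)%:R - (j == i)%:R).
Proof. by rewrite /jump /evec !mxE !eqxx/= ![i == _]eq_sym. Qed.

Lemma sum_evec (f : S -> R) (k : S) : \sum_i (k == i)%:R * f i = f k.
Proof.
rewrite (bigD1 k)//= eqxx mul1r big1 ?addr0// => i.
by rewrite eq_sym => /negPf ->; rewrite mul0r.
Qed.

Lemma lin_jump c N (x : V) j k :
  lin c (jump N x j k) = lin c x + N%:R^-1 * (c k - c j).
Proof.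
rewrite /lin; under eq_bigr do rewrite jumpE mulrDl -mulrA mulrBl.
by rewrite big_split/= -mulr_sumr sumrB !sum_evec.
Qed.

Definition occ N (x : V) j : nat := Num.truncn (N%:R * x 0 j).

Lemma occE N (x : V) j : simplex_grid N x -> (occ N x j)%:R = N%:R * x 0 j.
Proof. by move=> [_ xN]; rewrite /occ truncnK. Qed.

Definition rate_sum := \sum_j \sum_k r j k.

Lemma rate_sum_ge0 : 0 <= rate_sum.
Proof. by apply: sumr_ge0 => j _; apply: sumr_ge0. Qed.

Definition rate_bound := Cg + \sum_j m j.

Lemma rate_boundP j k : g j k <= rate_bound.
Proof.
have -> : g j k = (g j k - m j) + m j by ring.
apply: lerD; first exact: le_trans (ler_norm _) (gC _ _).
by rewrite (bigD1 j)//= lerDl; apply: sumr_ge0.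
Qed.

Lemma rate_bound_ge0 : 0 <= rate_bound.
Proof. exact: le_trans (g_ge0 ord0 0) (rate_boundP _ _). Qed.

Lemma Cg_ge0 : 0 <= Cg. Proof. exact: le_trans (normr_ge0 _) (gC ord0 0). Qed.

Ltac nonneg := repeat first [ done | exact: sqr_ge0 | exact: normr_ge0
  | exact: rate_sum_ge0 | exact: rate_bound_ge0 | exact: Cg_ge0 | exact: ltW
  | apply: addr_ge0 | apply: mulr_ge0 | rewrite invr_ge0 | apply: exprn_ge0 ].

Lemma zrp_genE N (F : V -> R) x : zrp_gen r g N F x =
  N%:R ^+ 2 * \sum_j \sum_k g j (occ N x j) * r j k * (F (jump N x j k) - F x).
Proof. by []. Qed.

Lemma rates_sum_le (F : S -> S -> R) B (x : V) N :
  (forall j k, F j k <= B) -> 0 <= B ->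
  \sum_j \sum_k g j (occ N x j) * r j k * F j k <= rate_bound * rate_sum * B.
Proof.
move=> FB B0; rewrite /rate_sum mulr_sumr mulr_suml; apply: ler_sum => j _.
rewrite mulr_sumr mulr_suml; apply: ler_sum => k _.
apply: (@le_trans _ _ (g j (occ N x j) * r j k * B)).
  by rewrite ler_wpM2l// mulr_ge0.
by rewrite ler_wpM2r// ler_wpM2r// rate_boundP.
Qed.

Lemma norm_rgen_le c K j : 0 <= K -> (forall i k, `|c i - c k| <= K) ->
  `|rgen r c j| <= rate_sum * K.
Proof.
move=> K0 cK; rewrite /rgen; apply: (le_trans (ler_norm_sum _ _ _)).
apply: (@le_trans _ _ (\sum_k r j k * K)).
  by apply: ler_sum => k _; rewrite normrM ger0_norm// ler_wpM2l.
rewrite -mulr_suml ler_wpM2r// /rate_sum [leRHS](bigD1 j)//= lerDl.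
by apply: sumr_ge0 => i _; apply: sumr_ge0.
Qed.

(** By invariance [m] can be subtracted from the rates at no cost, and the difference is small at
    crowded sites. *)
Lemma rates_rgen (x : V) N c :
  \sum_j g j (occ N x j) * rgen r c j = \sum_j (g j (occ N x j) - m j) * rgen r c j.
Proof.
under [RHS]eq_bigr do rewrite mulrBl.
by rewrite sumrB (sum_invariant_rgen m_inv) subr0.
Qed.

Definition posp (u : R) : R := Num.max u 0.

Lemma posp_ge0 u : 0 <= posp u.
Proof. by rewrite /posp le_max lexx orbT. Qed.

(** The square of the positive part stays below its second-order expansion even across the kink. The
    first-order term keeps its sign, so that the terms of opposite jumps can still cancel after
    summation. *)
Lemma posp_sqr_le u d : posp (u + d) ^+ 2 <= posp u ^+ 2 + 2 * posp u * d + d ^+ 2.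
Proof.
rewrite /posp; have [u0|u0] := leP u 0; have [ud0|ud0] := leP (u + d) 0; nra.
Qed.

Lemma posp_sqr_dist u d :
  `|posp (u + d) ^+ 2 - posp u ^+ 2| <= 2 * posp u * `|d| + d ^+ 2.
Proof.
rewrite ler_norml; apply/andP; split; last first.
  rewrite lerBlDl addrA; apply: (le_trans (posp_sqr_le u d)).
  by rewrite lerD2r lerD2l ler_wpM2l ?ler_norm// mulr_ge0// posp_ge0.
have e1 := ler_norm d; have e2 := ler_norm (- d); rewrite normrN in e2.
have e0 := normr_ge0 d; set e := `|d| in e0 e1 e2 *.
rewrite /posp; have [u0|u0] := leP u 0.
  by have := sqr_ge0 (Num.max (u + d) 0); have := sqr_ge0 d; lra.
have [ud0|ud0] := leP (u + d) 0; first by have := sqr_ge0 d; nra.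
have : 0 <= u * (e + d) by rewrite mulr_ge0; lra.
have := sqr_ge0 d; lra.
Qed.

Variables (K eta : R) (M : nat).
Hypothesis K_ge0 : 0 <= K.
Hypothesis eta_gt0 : 0 < eta.

Definition quad (I : seq ((S -> R) * R)) (x : V) : R :=
  \sum_(a <- I) posp (lin a.1 x - a.2) ^+ 2.

Lemma quad_ge0 I x : 0 <= quad I x.
Proof. by apply: sumr_ge0 => a _; rewrite sqr_ge0. Qed.

Definition bar I (x : V) : R := Num.min (quad I x) 1.

Lemma bar_ge0 I x : 0 <= bar I x.
Proof. by rewrite /bar le_min quad_ge0 ler01. Qed.

Lemma bar_le1 I x : bar I x <= 1.
Proof. by rewrite /bar ge_min lexx orbT. Qed.

(** [C1] bounds the drift of [quad]: at most [M] terms, each with a first-order and a second-order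
    part. [C2] adds the squared increments of [quad], which enter the drift of its square. *)
Let C1 := M%:R * (2 * (n.+1%:R * (Cg / eta * (rate_sum * K))) +
                   rate_bound * rate_sum * K ^+ 2).
Let C2 := 2 * C1 + rate_bound * rate_sum * (8 * M%:R ^+ 2 * K ^+ 2 + 2 * M%:R ^+ 2 * K ^+ 4).

Section Fixed.
Variables (I : seq ((S -> R) * R)) (N : nat) (x : V).
Hypothesis N_gt0 : (0 < N)%N.
Hypothesis sizeI : (size I <= M)%N.
Hypothesis IK : forall a, a \in (I : seq ((S -> R) * R)) -> forall i k, `|a.1 i - a.1 k| <= K.
Hypothesis x_grid : simplex_grid N x.
Hypothesis I_active : forall a, a \in (I : seq ((S -> R) * R)) ->
  a.2 < lin a.1 x -> forall j, rgen r a.1 j = 0 \/ eta <= x 0 j.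
Hypothesis quad_lt1 : quad I x < 1.

Let N0 : N%:R != 0 :> R. Proof. by rewrite pnatr_eq0 -lt0n. Qed.
Let f (a : (S -> R) * R) := posp (lin a.1 x - a.2).

Let f_sq a : a \in (I : seq ((S -> R) * R)) -> f a ^+ 2 <= quad I x.
Proof.
move=> aI; rewrite /quad (big_rem a)//= lerDl; apply: sumr_ge0 => *; exact: sqr_ge0.
Qed.

Let f_le1 a : a \in (I : seq ((S -> R) * R)) -> f a <= 1.
Proof.
move=> aI; rewrite -(@ler_pXn2r _ 2) ?nnegrE ?posp_ge0// expr1n.
by apply: ltW; apply: le_lt_trans quad_lt1; exact: f_sq.
Qed.

(** Only the sites where the functional is not harmonic contribute. They carry mass at least [eta],
    and there N |g_j - m_j| is at most (N x_j) |g_j - m_j| / eta, hence at most [Cg / eta]. *)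
Let drift_le a : a \in (I : seq ((S -> R) * R)) ->
  f a * (N%:R * \sum_j g j (occ N x j) * rgen r a.1 j) <=
  n.+1%:R * (Cg / eta * (rate_sum * K)).
Proof.
move=> aI; rewrite rates_rgen !mulr_sumr.
have -> : n.+1%:R * (Cg / eta * (rate_sum * K)) = \sum_(j < n.+1) Cg / eta * (rate_sum * K).
  by rewrite sumr_const card_ord -[RHS]mulr_natl.
apply: ler_sum => j _.
have B0 : 0 <= Cg / eta * (rate_sum * K).
  by nonneg.
have [fa0|fa0] := leP (lin a.1 x) a.2.
  by rewrite /f /posp max_r ?mul0r// subr_le0.
have [->|xj] := I_active aI fa0 j; first by rewrite !mulr0.
apply: (le_trans (ler_norm _)); rewrite !normrM -[leRHS]mul1r.
apply: ler_pM => //.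
  by rewrite ger0_norm ?posp_ge0// f_le1.
rewrite mulrA; apply: ler_pM => //.
  rewrite ger0_norm// ler_pdivlMr//.
  apply: le_trans (ngC j (occ N x j)); rewrite occE// mulrAC.
  by rewrite ler_wpM2r// ler_wpM2l.
by apply: norm_rgen_le => //; exact: IK.
Qed.

Let term_gen a : a \in (I : seq ((S -> R) * R)) ->
  zrp_gen r g N (fun y => posp (lin a.1 y - a.2) ^+ 2) x <=
  2 * (n.+1%:R * (Cg / eta * (rate_sum * K))) + rate_bound * rate_sum * K ^+ 2.
Proof.
move=> aI; rewrite zrp_genE.
apply: (@le_trans _ _ (N%:R ^+ 2 * \sum_j \sum_k g j (occ N x j) * r j k *
   (2 * f a * (N%:R^-1 * (a.1 k - a.1 j)) + (N%:R^-1 * (a.1 k - a.1 j)) ^+ 2))).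
  rewrite ler_wpM2l ?sqr_ge0//; apply: ler_sum => j _; apply: ler_sum => k _.
  rewrite ler_wpM2l ?mulr_ge0// lin_jump lerBlDl addrA.
  by rewrite -[_ + _ - a.2]addrAC; exact: posp_sqr_le.
have -> : N%:R ^+ 2 * \sum_j \sum_k g j (occ N x j) * r j k *
   (2 * f a * (N%:R^-1 * (a.1 k - a.1 j)) + (N%:R^-1 * (a.1 k - a.1 j)) ^+ 2) =
   2 * (f a * (N%:R * \sum_j g j (occ N x j) * rgen r a.1 j)) +
   \sum_j \sum_k g j (occ N x j) * r j k * (a.1 k - a.1 j) ^+ 2.
  rewrite !mulr_sumr -big_split/=; apply: eq_bigr => j _.
  rewrite /rgen !mulr_sumr -big_split/=; apply: eq_bigr => k _.
  by field.
apply: lerD; first by rewrite ler_wpM2l// drift_le.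
apply: rates_sum_le => [j k|]; last exact: sqr_ge0.
by rewrite -real_normK ?num_real// lerXn2r ?nnegrE// IK.
Qed.

Let quad_gen : zrp_gen r g N (quad I) x <= C1.
Proof.
have -> : zrp_gen r g N (quad I) x =
  \sum_(a <- I) zrp_gen r g N (fun y => posp (lin a.1 y - a.2) ^+ 2) x.
  under [RHS]eq_bigr do rewrite zrp_genE.
  rewrite -mulr_sumr exchange_big/=; congr (_ * _); apply: eq_bigr => j _.
  rewrite exchange_big/=; apply: eq_bigr => k _.
  by rewrite -mulr_sumr sumrB.
apply: (@le_trans _ _ (\sum_(a <- I) (2 * (n.+1%:R * (Cg / eta * (rate_sum * K))) +
                   rate_bound * rate_sum * K ^+ 2))).
  by rewrite big_seq [leRHS]big_seq; apply: ler_sum => a /term_gen.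
rewrite big_const_seq count_predT iter_addr_0 -[leLHS]mulr_natl ler_wpM2r ?ler_nat//.
by nonneg.
Qed.

(** Each positive part is at most the square root [z] of [quad], so the increment is of order z / N
    + 1 / N^2. Its square is then proportional to [quad] itself, up to N^-4: this makes the drift of
    the squared barrier small where the barrier is small. *)
Let quad_diff j k : (quad I (jump N x j k) - quad I x) ^+ 2 <=
  (8 * M%:R ^+ 2 * K ^+ 2 * quad I x + 2 * M%:R ^+ 2 * K ^+ 4 / N%:R ^+ 2) / N%:R ^+ 2.
Proof.
pose z := Num.sqrt (quad I x).
have z0 : 0 <= z by exact: sqrtr_ge0.
have z2 : z ^+ 2 = quad I x by rewrite sqr_sqrtr ?quad_ge0.
pose i : R := N%:R^-1.
have i0 : 0 <= i by rewrite invr_ge0.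
have D : `|quad I (jump N x j k) - quad I x| <= M%:R * (2 * z * (i * K) + (i * K) ^+ 2).
  rewrite /quad -sumrB; apply: (le_trans (ler_norm_sum _ _ _)).
  apply: (@le_trans _ _ (\sum_(a <- I) (2 * z * (i * K) + (i * K) ^+ 2))).
    rewrite big_seq [leRHS]big_seq; apply: ler_sum => a aI.
    rewrite lin_jump -[_ + _ - a.2]addrAC; apply: (le_trans (posp_sqr_dist _ _)).
    have d : `|i * (a.1 k - a.1 j)| <= i * K.
      by rewrite normrM ger0_norm// ler_wpM2l// IK.
    apply: lerD; last by rewrite -real_normK ?num_real// lerXn2r ?nnegrE ?mulr_ge0.
    apply: ler_pM => //; first by rewrite mulr_ge0 ?posp_ge0.
    rewrite ler_wpM2l// -(@ler_pXn2r _ 2) ?nnegrE ?posp_ge0// z2; exact: f_sq.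
  rewrite big_const_seq count_predT iter_addr_0 -[leLHS]mulr_natl ler_wpM2r ?ler_nat//.
  by nonneg.
rewrite -real_normK ?num_real//; apply: (@le_trans _ _ ((M%:R * (2 * z * (i * K) + (i * K) ^+ 2)) ^+ 2)).
  by rewrite lerXn2r ?nnegrE//; nonneg.
rewrite -z2.
have -> : (8 * M%:R ^+ 2 * K ^+ 2 * z ^+ 2 + 2 * M%:R ^+ 2 * K ^+ 4 / N%:R ^+ 2) / N%:R ^+ 2
  = (M%:R * (i * K)) ^+ 2 * (8 * z ^+ 2 + 2 * (i * K) ^+ 2).
  by rewrite /i; field.
have -> : (M%:R * (2 * z * (i * K) + (i * K) ^+ 2)) ^+ 2 =
  (M%:R * (i * K)) ^+ 2 * (2 * z + i * K) ^+ 2 by ring.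
rewrite ler_wpM2l ?sqr_ge0//.
have := sqr_ge0 (2 * z - i * K); nra.
Qed.

Let quad2_gen : zrp_gen r g N (fun y => quad I y ^+ 2) x <= C2 * (quad I x + N%:R^-1 ^+ 2).
Proof.
(* The product rule for a jump generator, the last sum being its carré du champ. *)
have E (q : V -> R) : zrp_gen r g N (fun y => q y ^+ 2) x =
  2 * q x * zrp_gen r g N q x + N%:R ^+ 2 *
  \sum_j \sum_k g j (occ N x j) * r j k * (q (jump N x j k) - q x) ^+ 2.
  rewrite !zrp_genE !mulr_sumr -big_split/=; apply: eq_bigr => j _.
  rewrite !mulr_sumr -big_split/=; apply: eq_bigr => k _; ring.
rewrite E.
have q0 := quad_ge0 I x.
have H1 : 2 * quad I x * zrp_gen r g N (quad I) x <= 2 * C1 * quad I x.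
  by rewrite [leRHS]mulrAC ler_wpM2l ?mulr_ge0// quad_gen.
set a := 8 * M%:R ^+ 2 * K ^+ 2; set b := 2 * M%:R ^+ 2 * K ^+ 4.
have a0 : 0 <= a by rewrite /a; nonneg.
have b0 : 0 <= b by rewrite /b; nonneg.
have i0 : 0 <= N%:R^-1 ^+ 2 :> R by rewrite sqr_ge0.
have H2 : N%:R ^+ 2 *
  (\sum_j \sum_k g j (occ N x j) * r j k * (quad I (jump N x j k) - quad I x) ^+ 2) <=
  rate_bound * rate_sum * (a * quad I x + b * N%:R^-1 ^+ 2).
  apply: (@le_trans _ _ (N%:R ^+ 2 * (rate_bound * rate_sum *
    ((a * quad I x + b / N%:R ^+ 2) / N%:R ^+ 2)))).
    rewrite ler_wpM2l ?sqr_ge0//; apply: rates_sum_le => [j k|]; first exact: quad_diff.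
    by nonneg.
  by rewrite le_eqVlt; apply/orP; left; apply/eqP; field.
apply: (le_trans (lerD H1 H2)); rewrite /C2 -/a -/b.
have P0 : 0 <= rate_bound * rate_sum by nonneg.
have C10 : 0 <= C1.
  by rewrite /C1; nonneg.
set P := _ * rate_sum in P0 *.
have := mulr_ge0 P0 (mulr_ge0 b0 q0); have := mulr_ge0 P0 (mulr_ge0 a0 i0).
have := mulr_ge0 C10 i0; lra.
Qed.

(** Truncation at 1 preserves the value at [x] and can only lower the values after a jump, hence
    lowers the generator. *)
Lemma bar_gen_lt1 : zrp_gen r g N (bar I) x <= C1 /\
  zrp_gen r g N (fun y => bar I y ^+ 2) x <= C2 * (bar I x + N%:R^-1 ^+ 2).
Proof.
have bx : bar I x = quad I x by rewrite /bar min_l// ltW.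
rewrite bx; split.
  apply: le_trans quad_gen; rewrite !zrp_genE ler_wpM2l ?sqr_ge0//.
  apply: ler_sum => j _; apply: ler_sum => k _; rewrite ler_wpM2l ?mulr_ge0// bx.
  by rewrite lerD2r /bar ge_min lexx.
apply: le_trans quad2_gen; rewrite !zrp_genE ler_wpM2l ?sqr_ge0//.
apply: ler_sum => j _; apply: ler_sum => k _; rewrite ler_wpM2l ?mulr_ge0// bx.
by rewrite lerD2r lerXn2r ?nnegrE ?bar_ge0 ?quad_ge0// /bar ge_min lexx.
Qed.

End Fixed.

Lemma bar_gen : exists2 C : R, 0 <= C & forall I N x, (0 < N)%N ->
  (size I <= M)%N ->
  (forall a, a \in (I : seq ((S -> R) * R)) -> forall i k, `|a.1 i - a.1 k| <= K) ->
  simplex_grid N x ->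
  (quad I x < 1 -> forall a, a \in (I : seq ((S -> R) * R)) ->
     a.2 < lin a.1 x -> forall j, rgen r a.1 j = 0 \/ eta <= x 0 j) ->
  zrp_gen r g N (bar I) x <= C /\
  zrp_gen r g N (fun y => bar I y ^+ 2) x <= C * (bar I x + N%:R^-1 ^+ 2).
Proof.
exists (`|C1| + `|C2|); first by rewrite addr_ge0.
move=> I N x N0 sI IK xg act.
have b0 := bar_ge0 I x.
have i0 : 0 <= bar I x + N%:R^-1 ^+ 2 by rewrite addr_ge0// sqr_ge0.
have [q1|q1] := ltP (quad I x) 1.
  have [h1 h2] := bar_gen_lt1 N0 sI IK xg (act q1) q1; split.
    by apply: (le_trans h1); apply: (le_trans (ler_norm _)); rewrite lerDl.
  apply: (le_trans h2); rewrite ler_wpM2r//.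
  by apply: (le_trans (ler_norm _)); rewrite lerDr.
have bx : bar I x = 1 by rewrite /bar min_r.
(* Where [quad] is at least 1 the barrier is at its maximum, and a generator is nonpositive at a
   maximum. *)
have neg (F : V -> R) : (forall y, F y <= F x) -> zrp_gen r g N F x <= 0.
  move=> FF; rewrite zrp_genE mulr_ge0_le0 ?sqr_ge0//.
  apply: sumr_le0 => j _; apply: sumr_le0 => k _.
  by rewrite mulr_ge0_le0 ?mulr_ge0// subr_le0.
split; first by apply: le_trans (neg _ _) _ => [y|]; rewrite ?bx ?bar_le1 ?addr_ge0.
apply: le_trans (neg _ _) _ => [y|]; last by rewrite mulr_ge0// addr_ge0.
by rewrite lerXn2r ?nnegrE ?bar_ge0// bx bar_le1.
Qed.

End QuadraticGenerator.

Lemma finite_lower_bound (R : realType) (T : finType) (P : pred T) (f : T -> R) :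
  (forall t, P t -> 0 < f t) ->
  exists2 k : R, 0 < k <= 1 & forall t, P t -> k <= f t.
Proof.
move=> f0; exists (\big[Num.min/1]_(t | P t) f t).
  by rewrite bigmin_le_id andbT; apply/bigmin_gtP; split.
by move=> t Pt; apply: bigmin_le_cond.
Qed.

(** * Exit times, hitting probabilities and nearly empty sites *)

Section Barrier.
Variables (R : realType) (n : nat).
Local Notation S := 'I_n.+1.
Local Notation V := 'rV[R]_n.+1.
Variable (r : S -> S -> R).
Hypothesis r_ge0 : forall j k, 0 <= r j k.
Hypothesis r_irr : forall j k, connect (fun i l => 0 < r i l) j k.

Lemma superharmonic_gt0 (h : S -> R) i :
  (forall k, 0 <= h k) -> rgen r h i < 0 -> 0 < h i.
Proof.
move=> h0 hi; rewrite lt_def h0 andbT; apply/eqP => hi0.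
move: hi; rewrite ltNge => /negP; apply; apply: sumr_ge0 => k _.
by rewrite hi0 subr0 mulr_ge0.
Qed.

Lemma rgenB (h1 h2 : S -> R) i :
  rgen r (fun k => h1 k - h2 k) i = rgen r h1 i - rgen r h2 i.
Proof. by rewrite /rgen -sumrB; apply: eq_bigr => k _; ring. Qed.

Lemma rgenZ a (h : S -> R) i : rgen r (fun k => a * h k) i = a * rgen r h i.
Proof. by rewrite /rgen mulr_sumr; apply: eq_bigr => k _; ring. Qed.

Definition is_exit_time (A : {set S}) (q : S -> R) :=
  (forall i, i \notin A -> q i = 0) /\
  (forall i, i \in A -> rgen r q i = -1 /\ 0 < q i).

(** For [k] outside [A], the probability of leaving [A] at [k]. Thus [lin p x] is the mass at [k]
    once the mass of [A] has been sent to its exit points. *)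
Definition is_hitting (A : {set S}) (k : S) (p : S -> R) :=
  [/\ forall i, i \notin A -> p i = (i == k)%:R,
      forall i, i \in A -> rgen r p i = 0 & forall i, 0 <= p i <= 1].

(** [c i] is the expectation of [q] at the first visit of [C] or of the complement of [A]; it is
    smaller than [q i] by the mean time spent before that visit. *)
Definition is_stopped (A C : {set S}) (q c : S -> R) :=
  [/\ forall i, i \in C -> c i = q i, forall i, i \notin A -> c i = 0,
      forall i, i \in A -> i \notin C -> rgen r c i = 0 /\ c i < q i
    & forall i, 0 <= c i].

Lemma exit_time (A : {set S}) : (exists b, b \notin A) -> exists q, is_exit_time A q.
Proof.
move=> Ab; have [q [q0 q1]] := dirichlet_problem r_ge0 r_irr (fun=> 0) (fun=> -1) Ab.
exists q; split=> // i iA; split; first exact: q1.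
apply: superharmonic_gt0; last by rewrite q1// oppr_lt0.
apply: (min_principle r_ge0 r_irr Ab) => [k kA|k kA]; last by rewrite q0.
by rewrite q1// oppr_le0.
Qed.

Lemma hitting (A : {set S}) k : (exists b, b \notin A) -> exists p, is_hitting A k p.
Proof.
move=> Ab; have [p [p0 p1]] := dirichlet_problem r_ge0 r_irr (fun i => (i == k)%:R) (fun=> 0) Ab.
exists p; split=> // i; apply/andP; split.
  apply: (min_principle r_ge0 r_irr Ab) => [l lA|l lA]; first by rewrite p1.
  by rewrite p0.
apply: (max_principle r_ge0 r_irr Ab) => [l lA|l lA]; first by rewrite p1.
by rewrite p0//; case: (_ == _).
Qed.

Lemma stopped (A C : {set S}) q : (exists b, b \notin A) -> C \subset A ->
  is_exit_time A q -> exists c, is_stopped A C q c.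
Proof.
move=> [b bA] CA [q0 q1].
have Db : exists b, b \notin (A :\: C)%SET by exists b; rewrite finset.in_setD (negPf bA) andbF.
have qge0 i : 0 <= q i.
  by have [iA|/q0 ->//] := boolP (i \in A); exact/ltW/(q1 i iA).2.
have [c [c0 c1]] := dirichlet_problem r_ge0 r_irr q (fun=> 0) Db.
have D i : (i \in (A :\: C)%SET) = (i \notin C) && (i \in A) by rewrite finset.in_setD.
exists c; split.
- by move=> i iC; apply: c0; rewrite D iC.
- by move=> i iA; rewrite c0 ?D ?(negPf iA) ?andbF// q0.
- move=> i iA iC; have iD : i \in (A :\: C)%SET by rewrite D iC iA.
  split; first exact: c1.
  rewrite -subr_gt0; apply: (@superharmonic_gt0 (fun k => q k - c k)); last first.
    by rewrite rgenB c1// (q1 i iA).1 subr0 oppr_lt0.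
  apply: (min_principle r_ge0 r_irr Db) => [k kD|k kD].
    by rewrite rgenB c1// subr0; move: kD; rewrite D => /andP[_ /q1[-> _]]; rewrite oppr_le0.
  by rewrite c0// subrr.
- apply: (min_principle r_ge0 r_irr Db) => [k kD|k kD]; first by rewrite c1.
  by rewrite c0.
Qed.

Definition nonfull (A : {set S}) := exists b, b \notin A.

(** As there are finitely many pairs of sets, the strict inequalities become uniform. This is what
    lets the constant of the barrier not depend on the centre. *)
Lemma stopped_data : exists (q : {set S} -> S -> R) (p : {set S} -> S -> S -> R)
   (c : {set S} -> {set S} -> S -> R) (kappa q0 q1 : R),
  [/\ 0 < kappa <= 1, 0 < q0, 0 < q1,
   forall A, nonfull A -> is_exit_time A (q A) /\ forall k, is_hitting A k (p A k)
  & forall A, nonfull A ->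
     (forall i, i \in A -> q0 <= q A i <= q1) /\
     forall C : {set S}, C \subset A -> is_stopped A C (q A) (c A C) /\
     forall i, i \in A -> i \notin C -> c A C i <= (1 - kappa) * q A i].
Proof.
have /choice[q qP] (A : {set S}) : exists q, nonfull A -> is_exit_time A q.
  have [pA|pA] := pselect (nonfull A); last by exists (fun=> 0).
  by have [q qP] := exit_time pA; exists q.
have /choice[p pP] (Ak : {set S} * S) : exists p, nonfull Ak.1 -> is_hitting Ak.1 Ak.2 p.
  have [pA|pA] := pselect (nonfull Ak.1); last by exists (fun=> 0).
  by have [p pP] := hitting Ak.2 pA; exists p.
have /choice[c cP] (AC : {set S} * {set S}) : exists c, nonfull AC.1 ->
    AC.2 \subset AC.1 -> is_stopped AC.1 AC.2 (q AC.1) c.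
  have [pA|pA] := pselect (nonfull AC.1); last by exists (fun=> 0).
  have [sA|/negP sA] := boolP (AC.2 \subset AC.1); last by exists (fun=> 0).
  by have [c cP] := stopped pA sA (qP _ pA); exists c.
have [q0 /andP[q00 _] q0P] := @finite_lower_bound R ({set S} * S)%type
  (fun Ai => `[< nonfull Ai.1 >] && (Ai.2 \in Ai.1)) (fun Ai => q Ai.1 Ai.2)
  (fun Ai H => let: conj a b := andP H in ((qP _ (asboolW a)).2 _ b).2).
have kap (ACi : ({set S} * {set S}) * S) :
   [&& `[< nonfull ACi.1.1 >], ACi.1.2 \subset ACi.1.1, ACi.2 \in ACi.1.1 & ACi.2 \notin ACi.1.2] ->
   0 < 1 - c ACi.1 ACi.2 / q ACi.1.1 ACi.2.
  case: ACi => [[A C] i]/= /and4P[/asboolP pA CA iA iC].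
  have qi := ((qP _ pA).2 _ iA).2.
  have [_ _ /(_ i iA iC)[_ ci] _] := cP (A, C) pA CA.
  by rewrite subr_gt0 ltr_pdivrMr// mul1r.
have [kappa k01 kP] := finite_lower_bound kap.
exists q, (fun A k => p (A, k)), (fun A C => c (A, C)), kappa, q0,
  (1 + \sum_A \sum_i `|q A i|).
split => //.
- by rewrite ltr_pwDl// sumr_ge0// => A _; rewrite sumr_ge0.
- by move=> A pA; split; [exact: qP|move=> k; exact: (pP (A, k))].
- move=> A pA; split.
    move=> i iA; apply/andP; split.
      by apply: (q0P (A, i)); rewrite /= iA andbT; exact/asboolP.
    apply: (le_trans (ler_norm _)); rewrite ler_wpDl//.
    rewrite (bigD1 A)//= (bigD1 i)//= -addrA lerDl addr_ge0// sumr_ge0// => B _.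
    by rewrite sumr_ge0.
  move=> C CA; split; first exact: (cP (A, C)).
  move=> i iA iC; have := kP ((A, C), i).
  have qi := ((qP _ pA).2 _ iA).2.
  rewrite /= iA iC CA !andbT => /(_ (asboolT pA)).
  by rewrite lerBrDl -lerBrDr ler_pdivrMr.
Qed.

(* The functionals indexed by C and by C :\ j are both at most t (1 + s), and
   the one indexed by C exceeds t; since the weights grow geometrically as C
   shrinks, this forces the j-th coordinate to carry a fixed share of t. *)
Lemma active_coordinate (A C : {set S}) (q : S -> R) (c : {set S} -> S -> R)
    (kappa s t : R) (x : V) (j : S) (rho := kappa / 16) :
  0 < kappa <= 1 -> 0 <= s <= rho ^+ n.+2 -> 0 < t -> simplex x ->
  C \subset A -> j \in C -> is_exit_time A q ->
  (forall D : {set S}, D \subset A -> is_stopped A D q (c D) /\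
     forall i, i \in A -> i \notin D -> c D i <= (1 - kappa) * q i) ->
  (forall D : {set S}, D \subset A ->
     (1 + rho ^+ #|D|.+1) * lin (c D) x <= t * (1 + s)) ->
  t < (1 + rho ^+ #|C|.+1) * lin (c C) x ->
  t * (rho ^+ n.+1 / 4) <= x 0 j * q j.
Proof.
move=> /andP[k0 k1] /andP[s0 srho] t0 [x0 _] CA jC [q0 q1] cP ub tC.
have rho0 : 0 < rho by rewrite divr_gt0.
have rho1 : rho <= 1 by rewrite /rho; lra.
have qge0 i : 0 <= q i.
  by have [iA|/q0 ->//] := boolP (i \in A); exact/ltW/(q1 i iA).2.
pose U := lin q x; pose W := \sum_(i | i \notin C) x 0 i * q i.
have UW : U = \sum_(i in C) x 0 i * q i + W by rewrite /U /lin (bigID (mem C)).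
have W0 : 0 <= W by apply: sumr_ge0 => i _; rewrite mulr_ge0.
have cAU : lin (c A) x = U.
  have [[cA _ _ _] _] := cP A (subxx _).
  have [[_ cnA _ _] _] := cP A (subxx _).
  rewrite /lin /U /lin; apply: eq_bigr => i _; have [/cA ->//|iA] := boolP (i \in A).
  by rewrite cnA// q0.
have cCU : lin (c C) x <= U - kappa * W.
  have [[cC cnA _ _] cK] := cP C CA.
  rewrite UW /lin (bigID (mem C))/= -addrA lerD//.
    by apply: ler_sum => i iC; rewrite cC.
  rewrite /W mulr_sumr -sumrB; apply: ler_sum => i iC.
  have [iA|iA] := boolP (i \in A); last by rewrite cnA// q0// !mulr0 subrr.
  by have := ler_wpM2l (x0 i) (cK i iA iC); lra.
have CjA : (C :\ j)%SET \subset A by apply: fintype.subset_trans CA; exact: finset.subsetDl.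
have cCj : U - x 0 j * q j - W <= lin (c (C :\ j)%SET) x.
  have [[cC _ _ cge0] _] := cP _ CjA.
  rewrite UW (big_setD1 j)//= /lin [leRHS](bigID (mem (C :\ j)%SET))/=.
  set X := \sum_(i in (C :\ j)%SET) _.
  have -> : x 0 j * q j + X + W - x 0 j * q j - W = X by ring.
  rewrite -[X]addr0 lerD//.
    by apply: ler_sum => i iC; rewrite cC.
  by apply: sumr_ge0 => i _; rewrite mulr_ge0.
have Ck : #|C| = #|(C :\ j)%SET|.+1 by rewrite (cardsD1 j) jC.
have CL : (#|C| <= n.+1)%N by rewrite -[X in (_ <= X)%N](card_ord n.+1) max_card.
pose E := rho ^+ #|C|.
have E0 : 0 < E by rewrite exprn_gt0.
have E1 : E <= 1 by apply: exprn_ile1 => //; exact: ltW.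
have sE : s <= rho * E.
  by apply: (le_trans srho); rewrite -exprS ler_wiXn2l ?(ltW rho0).
have En : rho ^+ n.+1 <= E by rewrite ler_wiXn2l ?(ltW rho0).
have uA : U <= t * (1 + s).
  have := ub A (subxx _); rewrite cAU; apply: le_trans.
  have U0 : 0 <= U by apply: sumr_ge0 => i _; rewrite mulr_ge0.
  by rewrite ler_peMl// lerDl exprn_ge0// ltW.
have uC := ub _ CjA; rewrite -Ck -/E in uC.
rewrite exprS -/E in tC.
have tC2 : t < (1 + rho * E) * (U - kappa * W).
  apply: (lt_le_trans tC); rewrite ler_wpM2l//.
  by rewrite addr_ge0// mulr_ge0// ltW.
have uC2 : (1 + E) * (U - x 0 j * q j - W) <= t * (1 + s).
  by apply: le_trans uC; rewrite ler_wpM2l// addr_ge0// ltW.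
apply: (@le_trans _ _ (t * (E / 4))).
  by rewrite ler_wpM2l ?(ltW t0)// ler_pM2r.
set u := x 0 j * q j in uC2 *.
have rE : rho * E <= E / 16.
  by rewrite mulrC ler_wpM2l ?(ltW E0)// /rho; lra.
have rE0 : 0 < rho * E by rewrite mulr_gt0.
(* [H1] and [uA] place [U] within a small multiple of t E of t, and make [W] at most t E / 8. On the
   other hand [uC2] keeps U - u - W below about t / (1 + E), that is a drop of at least t E / 2. The
   losses E/16, E/8 and E/16 leave t E / 4 for [u]. *)
have H1 : t * (1 - rho * E) < U - kappa * W.
  have p1 : 0 < 1 + rho * E by lra.
  rewrite -(ltr_pM2l p1); apply: le_lt_trans tC2.
  rewrite mulrCA -[leRHS]mulr1 ler_wpM2l ?(ltW t0)//.
  by have := sqr_ge0 (rho * E); lra.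
have H2 : kappa * W < t * (2 * rho * E).
  have : t * s <= t * (rho * E) by rewrite ler_wpM2l ?(ltW t0).
  lra.
have H3 : W <= t * (E / 8).
  rewrite -(ler_pM2l k0) mulrCA ltW//; apply: (lt_le_trans H2).
  by rewrite ler_wpM2l ?(ltW t0)// /rho; lra.
have H4 : t * (1 - E / 16) <= U.
  have : 0 <= kappa * W by rewrite mulr_ge0// ltW.
  have : t * (rho * E) <= t * (E / 16) by rewrite ler_wpM2l ?(ltW t0).
  lra.
have H5 : U - u - W <= t * (1 - E / 2 + E / 16).
  have p1 : 0 < 1 + E by lra.
  rewrite -(ler_pM2l p1); apply: (le_trans uC2).
  rewrite mulrCA ler_wpM2l ?(ltW t0)//.
  have : E ^+ 2 <= E by rewrite expr2 ler_piMl// ltW.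
  have := sqr_ge0 E; lra.
lra.
Qed.

(** Pigeonhole: the sets of sites below the successive thresholds decrease, and having at most n + 1
    elements they cannot shrink strictly n + 2 times. *)
Lemma threshold_gap (x : V) (eps D : R) : 1 <= D -> 0 < eps ->
  exists2 l, (l <= n.+1)%N &
    forall k, x 0 k <= eps / D ^+ l -> x 0 k <= eps / D ^+ l.+1.
Proof.
move=> D1 eps0; apply: contrapT => H.
pose A l := [set k : S | x 0 k <= eps / D ^+ l]%SET.
have D0 : 0 < D by apply: lt_le_trans D1.
have sub l : A l.+1 \subset A l.
  apply/fintype.subsetP => k; rewrite !inE => h; apply: (le_trans h).
  rewrite ler_pM2l// lef_pV2 ?posrE ?exprn_gt0//.
  by rewrite ler_weXn2l.
have P l : (l <= n.+2)%N -> (#|A l| + l <= #|A 0|)%N.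
  elim: l => [_|l IH ln]; first by rewrite addn0.
  have := IH (ltnW ln); rewrite addnS; apply: leq_trans.
  rewrite ltn_add2r; apply: proper_card; rewrite properE sub/=.
  apply/negP => /fintype.subsetP h; apply: H; exists l => // k hk.
  by have := h k; rewrite !inE; apply.
have := P n.+2 (leqnn _); rewrite leqNgt => /negP; apply.
apply: (@leq_ltn_trans n.+1); last by rewrite addnC ltn_addr.
by rewrite -[X in (_ <= X)%N](card_ord n.+1) max_card.
Qed.

End Barrier.

Ltac clra := clear; move=> *; lra.

Ltac positive := repeat first [ assumption | done | apply: mulr_gt0
  | apply: exprn_gt0 | rewrite invr_gt0 | lra ].

Section BarrierFunction.
Variables (R : realType) (n : nat).
Local Notation S := 'I_n.+1.
Local Notation V := 'rV[R]_n.+1.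
Variable r : S -> S -> R.

Lemma linZ a (c : S -> R) (x : V) : lin (fun i => a * c i) x = a * lin c x.
Proof. by rewrite /lin mulr_sumr; apply: eq_bigr => i _; ring. Qed.

Lemma quad_lt1_le (I : seq ((S -> R) * R)) (x : V) a :
  quad I x < 1 -> a \in (I : seq ((S -> R) * R)) -> lin a.1 x <= a.2 + 1.
Proof.
move=> q1 aI; have : posp (lin a.1 x - a.2) ^+ 2 < 1.
  apply: le_lt_trans q1; rewrite /quad (big_rem a)//= lerDl.
  by apply: sumr_ge0 => *; exact: sqr_ge0.
rewrite -[X in _ < X](expr1n R 2) ltr_pXn2r ?nnegrE ?posp_ge0// => h.
rewrite -lerBlDl; apply: le_trans (ltW h).
by rewrite /posp le_max lexx.
Qed.

Lemma lin_hitting (A : {set S}) k (p : S -> R) (x : V) : simplex x ->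
  k \notin A -> is_hitting r A k p ->
  x 0 k <= lin p x <= x 0 k + \sum_(i in A) x 0 i.
Proof.
move=> [x0 _] kA [p0 _ p01].
have -> : lin p x = x 0 k + \sum_(i in A) x 0 i * p i.
  rewrite /lin (bigID (mem A))/= addrC; congr (_ + _).
  rewrite (bigD1 k)//= p0// eqxx mulr1 big1 ?addr0// => i /andP[iA ik].
  by rewrite p0// (negPf ik) mulr0.
rewrite lerDl lerD2l; apply/andP; split.
  by apply: sumr_ge0 => i _; rewrite mulr_ge0//; have /andP[] := p01 i.
by apply: ler_sum => i _; rewrite ler_piMr//; have /andP[] := p01 i.
Qed.

End BarrierFunction.

(* F = min(Z, 1), where Z is a sum of squares of positive parts of affine
   functions, of two kinds. Let A be the set of sites that are nearly empty at x0.
   The first kind measures the displacement of the harmonic extension to A of the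
   coordinates outside A; the second one, for nonempty C in A, detects
   sum_(i in A) c_i x_i > t, where c is the mean exit time from A on C, vanishes
   outside A and is harmonic on A \ C. Since A is separated from the other sites
   by a gap between two thresholds, where Z < 1 and a term is active every site at
   which that term is not harmonic carries a mass bounded from below; there
   N (g_j - m_j) is bounded, so that the term has a bounded drift. *)
Lemma barrier (R : realType) (n : nat) (r : 'I_n.+1 -> 'I_n.+1 -> R)
    (m : 'I_n.+1 -> R) (g : 'I_n.+1 -> nat -> R) (Cg eps : R)
    (S := 'I_n.+1) (V := 'rV[R]_n.+1) :
  (forall j k, 0 <= r j k) ->
  (forall j k, connect (fun i l => 0 < r i l) j k) ->
  (forall k, \sum_j m j * r j k = m k * \sum_l r k l) ->
  (forall j, 0 <= m j) -> (forall j k, 0 <= g j k) ->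
  (forall j k, `|g j k - m j| <= Cg) ->
  (forall j k, k%:R * `|g j k - m j| <= Cg) ->
  0 < eps -> exists2 C : R, 0 <= C &
  forall x0 : V, simplex x0 -> exists F : V -> R,
  [/\ forall x, 0 <= F x <= 1, F x0 = 0,
      forall x, simplex x -> (exists k, eps < `|x 0 k - x0 0 k|) -> F x = 1
    & forall N x, (0 < N)%N -> simplex_grid N x ->
      zrp_gen r g N F x <= C /\
      zrp_gen r g N (fun y => F y ^+ 2) x <= C * (F x + N%:R^-1 ^+ 2)].
Proof.
move=> r_ge0 r_irr m_inv m_ge0 g_ge0 gC ngC eps0.
have [q [p [c [kappa [q0 [q1 [k01 q00 q10 qpP cP]]]]]]] := stopped_data r_ge0 r_irr.
have /andP[k0 k1] := k01.
pose L : R := n.+1%:R.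
have L1 : 1 <= L by rewrite /L ler1n.
(* The second bound ensures that the sites cannot all be nearly empty, total mass being 1. *)
pose e := Num.min eps (2 * L)^-1.
have e0 : 0 < e by rewrite /e lt_min eps0 invr_gt0; lra.
have e_eps : e <= eps by rewrite /e ge_min lexx.
have eL : L * e <= 1 / 2.
  have h : e <= (2 * L)^-1 by rewrite /e ge_min lexx orbT.
  have -> : 1 / 2 = L * (2 * L)^-1 by field; rewrite gt_eqF//; lra.
  by rewrite ler_wpM2l//; lra.
(* The factor 16 L makes the total mass of [A] at [x0] at most b / 16; the factor in q1 / q0 keeps
   this mass below b / 4 as long as [quad] is below 1. *)
pose D := 16 * L * (1 + q1 / q0).
have qq0 : 0 < q1 / q0 by rewrite divr_gt0.
have D16 : 16 * L <= D by rewrite /D ler_peMr; lra.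
have D0 : 0 < D by lra.
pose rho := kappa / 16.
have rho0 : 0 < rho by rewrite /rho; lra.
have rho1 : rho <= 1 by rewrite /rho; lra.
pose sg := rho ^+ n.+2.
have sg0 : 0 < sg by rewrite exprn_gt0.
have sg1 : sg <= 1 by apply: exprn_ile1 => //; exact: ltW.
pose bmin := e / D ^+ n.+1.
have bmin0 : 0 < bmin by rewrite divr_gt0// exprn_gt0.
pose tmin := 2 * q1 * L * (bmin / D).
have tmin0 : 0 < tmin by rewrite /tmin; apply: mulr_gt0; [apply: mulr_gt0; lra|apply: divr_gt0].
pose K := 2 * q1 / (tmin * sg) + 4 / bmin.
have K10 : 0 < 2 * q1 / (tmin * sg) by positive.
have K20 : 0 < 4 / bmin by rewrite divr_gt0.
(* The first bound is the mass kept by the sites outside [A], the second one the mass that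
   [active_coordinate] gives to a site of [A]; both use the smallest possible threshold. *)
pose eta := Num.min (bmin / 2) (tmin * (rho ^+ n.+1 / 4) / q1).
have eta0 : 0 < eta.
  by rewrite /eta lt_min; apply/andP; split; positive.
pose M := (#|{: {set S}}| + (n.+1 + n.+1))%N.
have [C C0 CP] := @bar_gen R n r m g Cg r_ge0 m_inv m_ge0 g_ge0 gC ngC K eta M
  (ltW (addr_gt0 K10 K20)) eta0.
exists C => // x0 x0S.
have [l ln gap] := @threshold_gap R n x0 e D ltac:(lra) e0.
pose b := e / D ^+ l.
have b0 : 0 < b by rewrite divr_gt0// exprn_gt0.
have bb : bmin <= b.
  rewrite /bmin /b ler_pM2l// lef_pV2 ?posrE ?exprn_gt0//.
  by rewrite ler_weXn2l//; lra.
have be : b <= e.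
  rewrite /b ler_pdivrMr ?exprn_gt0// ler_peMr ?(ltW e0)//.
  by apply: exprn_ege1; lra.
have gap' k : x0 0 k <= b -> x0 0 k <= b / D.
  by move=> /gap; rewrite /b exprS invfM mulrA [_ / _ * _]mulrAC.
pose A := [set k : S | x0 0 k <= b / D]%SET.
have AP k : (k \in A) = (x0 0 k <= b / D) by rewrite inE.
have bD : b / D <= b / (16 * L).
  by rewrite ler_pM2l// lef_pV2 ?posrE//; lra.
have bL : b / (16 * L) * L = b / 16 by field; apply/eqP; lra.
have bDL : b / D * L <= b / 16 by rewrite -bL ler_pM2r//; lra.
have bD0 : 0 < b / D by rewrite divr_gt0.
have sumA (x : V) : simplex x -> forall i, i \in A -> x 0 i <= \sum_(i in A) x 0 i.
  move=> [xp _] i iA; rewrite (bigD1 i)//= lerDl; apply: sumr_ge0 => *; exact: xp.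
have x0A : \sum_(i in A) x0 0 i <= b / 16.
  apply: le_trans bDL.
  apply: (@le_trans _ _ (\sum_(i in A) b / D)); first by apply: ler_sum => i; rewrite AP.
  rewrite sumr_const -mulr_natr ler_wpM2l ?(ltW bD0)// ler_nat.
  by rewrite -[X in (_ <= X)%N](card_ord n.+1) max_card.
have pA : nonfull A.
  apply: contrapT => /forallNP H.
  have : \sum_i x0 0 i <= b / 16.
    apply: le_trans x0A; rewrite le_eqVlt; apply/orP; left; apply/eqP.
    by apply: eq_bigl => i; apply/esym/negPn/negP => /H.
  rewrite x0S.2.
  have : e <= L * e by rewrite ler_peMl// ltW.
  lra.
have [qP pP] := qpP _ pA.
have [qb cAP] := cP _ pA.
(* Twice the largest value at [x0] of the functionals of the second kind, which leaves room for a
   weight of at most 2: these terms vanish at [x0]. *)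
pose t := 2 * q1 * L * (b / D).
have tt : tmin <= t.
  by rewrite /t /tmin ler_wpM2l ?ler_pM2r ?invr_gt0// !mulr_ge0//; move: q10 L1; clra.
have t0 : 0 < t by apply: lt_le_trans tt.
(* With this weight and the offset [sg^-1], a term is active when (1 + rho^(#C + 1)) lin c exceeds
   t, and [quad < 1] keeps it below t (1 + sg): exactly the two hypotheses of
   [active_coordinate]. *)
pose w (C : {set S}) := (1 + rho ^+ #|C|.+1) / (t * sg).
have wE (B : {set S}) : 0 <= rho ^+ #|B|.+1 <= 1.
  by apply/andP; split; [apply: exprn_ge0|apply: exprn_ile1] => //; exact: ltW.
have tsg : 0 < t * sg by rewrite mulr_gt0.
have w0 B : 0 <= w B by rewrite /w divr_ge0 ?(ltW tsg)//; have := wE B; clra.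
pose IC := [seq (fun i => w B * c A B i, sg^-1) | B <- enum (powerset A)].
pose Ip := [seq (fun i => 4 / b * p A k i, 4 / b * lin (p A k) x0) | k <- enum S].
pose Im := [seq (fun i => - (4 / b) * p A k i, - (4 / b) * lin (p A k) x0) | k <- enum S].
pose I := IC ++ (Ip ++ Im) : seq ((S -> R) * R).
have inIC (B : {set S}) : B \subset A -> ((fun i => w B * c A B i, sg^-1) : (S -> R) * R) \in I.
  move=> BA; rewrite mem_cat; apply/orP; left; apply/mapP; exists B => //.
  by rewrite mem_enum powersetE.
have inIp k : ((fun i => 4 / b * p A k i, 4 / b * lin (p A k) x0) : (S -> R) * R) \in I.
  rewrite !mem_cat; apply/orP; right; apply/orP; left; apply/mapP; exists k => //.
  by rewrite mem_enum.
have inIm k : ((fun i => - (4 / b) * p A k i, - (4 / b) * lin (p A k) x0) : (S -> R) * R) \in I.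
  rewrite !mem_cat; apply/orP; right; apply/orP; right; apply/mapP; exists k => //.
  by rewrite mem_enum.
have inIP a : a \in I ->
  [\/ exists2 B : {set S}, B \subset A & a = (fun i => w B * c A B i, sg^-1),
      exists k, a = (fun i => 4 / b * p A k i, 4 / b * lin (p A k) x0) |
      exists k, a = (fun i => - (4 / b) * p A k i, - (4 / b) * lin (p A k) x0)].
  rewrite !mem_cat => /orP[/mapP[B]|/orP[/mapP[k _ ->]|/mapP[k _ ->]]].
  - by rewrite mem_enum powersetE => BA ->; apply: Or31; exists B.
  - by apply: Or32; exists k.
  - by apply: Or33; exists k.
have b4 : 0 < 4 / b by rewrite divr_gt0.
have stp (B : {set S}) : B \subset A -> forall i, 0 <= c A B i <= q1.
  move=> BA i; have [[cB cnA cN c0] cle] := cAP B BA; rewrite c0/=.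
  have [iA|iA] := boolP (i \in A); last by rewrite cnA// ltW.
  have /andP[_ qi] := qb _ iA; apply: le_trans qi.
  have [iB|iB] := boolP (i \in B); first by rewrite cB.
  by apply: ltW; exact: (cN i iA iB).2.
have activeC x : simplex x -> quad I x < 1 -> forall B : {set S}, B \subset A ->
    (1 + rho ^+ #|B|.+1) * lin (c A B) x <= t * (1 + sg).
  move=> xS q1' B BA; have := quad_lt1_le q1' (inIC B BA); rewrite /= linZ /w.
  rewrite mulrAC ler_pdivrMr//; congr (_ <= _).
  by field; rewrite !gt_eqF.
have activeA x : simplex x -> quad I x < 1 -> \sum_(i in A) x 0 i <= b / 4.
  move=> xS q1'.
  have := activeC x xS q1' A (subxx _).
  have [[cA _ _ c0] _] := cAP A (subxx _).
  have lA : q0 * (\sum_(i in A) x 0 i) <= lin (c A A) x.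
    rewrite mulr_sumr /lin [leRHS](bigID (mem A))/= -[leLHS]addr0; apply: lerD.
      apply: ler_sum => i iA; rewrite mulrC ler_wpM2l ?xS.1// cA//.
      by have /andP[] := qb _ iA.
    by apply: sumr_ge0 => i _; rewrite mulr_ge0 ?xS.1.
  have l0 : 0 <= lin (c A A) x by apply: sumr_ge0 => i _; rewrite mulr_ge0 ?xS.1.
  have := mulr_ge0 (andP (wE A)).1 l0.
  have ts : t * sg <= t by rewrite ler_piMr// ltW.
  have tq : t * 2 = q0 * (4 * (q1 / q0) * (b / D) * L).
    by rewrite /t; field; rewrite !gt_eqF.
  move=> h1 h2.
  have : q0 * (\sum_(i in A) x 0 i) <= q0 * (4 * (q1 / q0) * (b / D) * L) by rewrite -tq; move: lA ts h1 h2; clra.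
  rewrite ler_pM2l// => /le_trans; apply.
  have -> : 4 * (q1 / q0) * (b / D) * L = b / 4 * ((q1 / q0) / (1 + q1 / q0)).
    by rewrite /D; field; rewrite !gt_eqF//; move: L1 qq0 q00 q10; clra.
  apply: ler_piMr; first by rewrite divr_ge0 ?(ltW b0).
  by rewrite ler_pdivrMr; move: qq0; clra.
have dev x : simplex x -> quad I x < 1 -> forall k,
    `|lin (p A k) x - lin (p A k) x0| <= b / 4.
  move=> xS q1' k; have := quad_lt1_le q1' (inIp k); have := quad_lt1_le q1' (inIm k).
  rewrite /= !linZ => h1 h2.
  rewrite -(@ler_pM2l _ (4 / b))// (_ : 4 / b * (b / 4) = 1); last by field; rewrite gt_eqF.
  rewrite -[4 / b]gtr0_norm// -normrM ler_norml; move: h1 h2; clra.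
have nA k : k \notin A -> b < x0 0 k.
  by rewrite AP ltNge; apply: contra; exact: gap'.
have x0dev k : k \notin A -> x0 0 k <= lin (p A k) x0 <= x0 0 k + b / 16.
  move=> kA; have /andP[h1 h2] := lin_hitting x0S kA (pP k).
  by rewrite h1/=; apply: (le_trans h2); rewrite lerD2l.
have xdev x : simplex x -> quad I x < 1 -> forall k, k \notin A ->
    x 0 k <= lin (p A k) x <= x 0 k + b / 4.
  move=> xS q1' k kA; have /andP[h1 h2] := lin_hitting xS kA (pP k).
  by rewrite h1/=; apply: (le_trans h2); rewrite lerD2l activeA.
have far x : simplex x -> quad I x < 1 -> forall k, k \notin A -> b / 2 <= x 0 k.
  move=> xS q1' k kA; have := dev x xS q1' k; rewrite ler_norml.
  have := x0dev k kA; have := xdev x xS q1' k kA; have := nA k kA; move: b0; clra.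
exists (bar I); split.
- by move=> x; rewrite bar_ge0 bar_le1.
- rewrite /bar (_ : quad I x0 = 0) ?min_l ?ler01//.
  rewrite /quad big_seq big1// => a /inIP aI.
  rewrite /posp max_r ?expr0n// subr_le0.
  case: aI => [[B BA ->]|[k ->]|[k ->]]/=; rewrite linZ// /w.
  rewrite mulrAC ler_pdivrMr// [leRHS]mulrCA mulVf ?gt_eqF// mulr1.
  have [[cB cnA cN c0] cle] := cAP B BA.
  have h : lin (c A B) x0 <= q1 * L * (b / D).
    apply: (@le_trans _ _ (\sum_(i in A) b / D * q1)).
      rewrite /lin [leLHS](bigID (mem A))/= [X in _ + X]big1 ?addr0; last first.
        by move=> i iA; rewrite cnA// mulr0.
      apply: ler_sum => i iA; apply: ler_pM; [exact: x0S.1|exact: c0|by rewrite -AP|].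
      by have /andP[] := stp B BA i.
    rewrite sumr_const -mulr_natr -mulrA [leRHS](_ : _ = b / D * (q1 * L)); last by ring.
    rewrite ler_wpM2l ?(ltW bD0)// ler_wpM2l ?(ltW q10)// ler_nat.
    by rewrite -[X in (_ <= X)%N](card_ord n.+1) max_card.
  have l0 : 0 <= lin (c A B) x0 by apply: sumr_ge0 => i _; rewrite mulr_ge0 ?x0S.1.
  have : rho ^+ #|B|.+1 * lin (c A B) x0 <= lin (c A B) x0.
    by rewrite ler_piMl//; have /andP[] := wE B.
  by rewrite /t; move: h l0; clra.
- move=> x xS [k hk]; rewrite /bar min_r// leNgt; apply/negP => q1'.
  move: hk; rewrite ltNge => /negP; apply; apply: le_trans e_eps; apply: le_trans be.
  rewrite ler_norml; have [kA|kA] := boolP (k \in A); last first.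
    have := dev x xS q1' k; rewrite ler_norml.
    have := x0dev k kA; have := xdev x xS q1' k kA; move: b0; clra.
  have := sumA x xS k kA; have := activeA x xS q1'.
  have := sumA x0 x0S k kA; have := xS.1 k; have := x0S.1 k; move: bD bL b0 L1 x0A; clra.
- move=> N x N0 xg; have xS := xg.1; apply: CP => //.
  + rewrite /I !size_cat !size_map -!enumT -!cardE card_ord /M leq_add2r.
    exact: max_card.
  + have pd k i i' : `|p A k i - p A k i'| <= 1.
      have [_ _ pb] := pP k.
      by have := pb i; have := pb i'; rewrite ler_norml; clra.
    have bK : 4 / b * 1 <= K.
      rewrite mulr1 /K; apply: (@le_trans _ _ (4 / bmin)).
        by rewrite ler_pM2l// lef_pV2.
      by rewrite lerDr ltW.
    move=> a /inIP[[B BA ->]|[k ->]|[k ->]] i i' /=.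
    * rewrite -mulrBr normrM ger0_norm//.
      apply: (@le_trans _ _ (2 / (t * sg) * q1)).
        apply: ler_pM => //.
          by rewrite /w ler_pM2r ?invr_gt0//; have := wE B; clra.
        by have := stp B BA i; have := stp B BA i'; rewrite ler_norml; clra.
      rewrite mulrAC /K; apply: (@le_trans _ _ (2 * q1 / (tmin * sg))); last by rewrite lerDl ltW.
      have ts0 : 0 < tmin * sg by exact: mulr_gt0.
      have ts1 : tmin * sg <= t * sg by rewrite ler_pM2r.
      by apply: ler_wpM2l; [exact/ltW/mulr_gt0|rewrite lef_pV2].
    * rewrite -mulrBr normrM [`|4 / b|]gtr0_norm//; apply: le_trans bK.
      by rewrite ler_pM2l.
    * rewrite -mulrBr normrM normrN [`|4 / b|]gtr0_norm//; apply: le_trans bK.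
      by rewrite ler_pM2l.
  + move=> q1' a /inIP aI act j.
    have [jA|jA] := boolP (j \in A); last first.
      right; apply: (@le_trans _ _ (bmin / 2)); first by rewrite /eta ge_min lexx.
      by have := far x xS q1' j jA; move: bb; clra.
    case: aI act => [[B BA ->]|[k ->]|[k ->]]/=; last 2 first.
      by move=> _; left; rewrite rgenZ; have [_ E _] := pP k; rewrite (E _ jA) mulr0.
      by move=> _; left; rewrite rgenZ; have [_ E _] := pP k; rewrite (E _ jA) mulr0.
    have [[cB cnA cN c0] cle] := cAP B BA.
    rewrite linZ /w => act; have [jB|jB] := boolP (j \in B); last first.
      by left; rewrite rgenZ (cN j jA jB).1 mulr0.
    right; apply: (@le_trans _ _ (tmin * (rho ^+ n.+1 / 4) / q1)).
      by rewrite /eta ge_min lexx orbT.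
    rewrite ler_pdivrMr//.
    have r4 : 0 <= rho ^+ n.+1 / 4 by rewrite divr_ge0// exprn_ge0// ltW.
    apply: (@le_trans _ _ (t * (rho ^+ n.+1 / 4))); first by rewrite ler_wpM2r.
    apply: (@le_trans _ _ (x 0 j * q A j)); last first.
      by rewrite ler_wpM2l ?xS.1//; have /andP[] := qb _ jA.
    apply: (@active_coordinate R n r A B (q A) (c A) kappa sg t x j) => //.
    * by rewrite (ltW sg0)/=.
    * exact: activeC.
    * move: act; rewrite -/rho mulrAC ltr_pdivlMr// mulrCA mulVf ?gt_eqF// mulr1.
      by [].
Qed.

(** * The transition function as an exponential on the grid *)

Lemma cvg_sum_seq (R : realType) (I : Type) (s : seq I) (u : I -> nat -> R) (l : I -> R) :
  (forall i, u i k @[k --> \oo] --> l i) ->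
  (\sum_(i <- s) u i k) @[k --> \oo] --> \sum_(i <- s) l i.
Proof.
move=> ul; elim: s => [|i s IH].
  by rewrite big_nil; under eq_fun do rewrite big_nil; exact: cvg_cst.
by rewrite big_cons; under eq_fun do rewrite big_cons; exact: cvgD.
Qed.

Lemma is_derive_sum_seq (R : realType) (I : eqType) (s : seq I) (f : I -> R -> R)
    (df : I -> R) (x : R) :
  (forall i, i \in s -> is_derive x (1 : R) (f i) (df i)) ->
  is_derive x (1 : R) (fun t => \sum_(i <- s) f i t) (\sum_(i <- s) df i).
Proof.
elim: s => [|i s IH] fd.
  rewrite big_nil; under eq_fun do rewrite big_nil; exact: is_derive_cst.
rewrite big_cons; under eq_fun do rewrite big_cons; apply: is_deriveD.
  by apply: fd; rewrite mem_head.
by apply: IH => k ks; apply: fd; rewrite in_cons ks orbT.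
Qed.

Section Semigroup.
Variables (R : realType) (n : nat).
Local Notation S := 'I_n.+1.
Local Notation V := 'rV[R]_n.+1.
Variables (r : S -> S -> R) (m : S -> R) (g : S -> nat -> R) (Cg : R).
Hypothesis r_ge0 : forall j k, 0 <= r j k.
Hypothesis m_ge0 : forall j, 0 <= m j.
Hypothesis g_ge0 : forall j k, 0 <= g j k.
Hypothesis g_0 : forall j, g j 0%N = 0.
Hypothesis gC : forall j k, `|g j k - m j| <= Cg.
Variable N : nat.
Hypothesis N_gt0 : (0 < N)%N.

Local Notation gen := (zrp_gen r g N).

Let N0 : N%:R != 0 :> R. Proof. by rewrite pnatr_eq0 -lt0n. Qed.

Lemma jump_grid (x : V) j k : simplex_grid N x -> 0 < x 0 j ->
  simplex_grid N (jump N x j k).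
Proof.
move=> xg xj; have [[x0 x1] xN] := xg.
have occj : 1 <= N%:R * x 0 j.
  rewrite -occE// ler1n -(@ltr0n R) occE//.
  by rewrite mulr_gt0// ltr0n.
split; [split|] => [i||i].
- rewrite jumpE; case: (j =P i) => [<-|_]; last first.
    by rewrite subr0 addr_ge0 ?x0// mulr_ge0.
  case: (k == j); first by rewrite subrr mulr0 addr0 x0.
  rewrite sub0r mulrN1 subr_ge0 -(@ler_pM2l _ N%:R) ?ltr0n//.
  by rewrite divff.
- under eq_bigr do rewrite jumpE.
  rewrite big_split/= x1 -mulr_sumr sumrB.
  have E (a : S) : \sum_i (a == i)%:R = 1 :> R.
    by rewrite -[RHS](sum_evec (fun=> 1) a); apply: eq_bigr => i _; rewrite mulr1.
  by rewrite !E subrr mulr0 addr0.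
- rewrite jumpE mulrDr mulrA divff// mul1r -occE//.
  case: (j =P i) => [<-|_]; last by rewrite subr0 -natrD.
  have o1 : (1 <= occ N x j)%N by rewrite -(@ler_nat R) occE.
  case: (k == j); first by rewrite subrr addr0.
  by rewrite sub0r -natrB.
Qed.

Lemma rate_grid (x : V) j : simplex_grid N x ->
  g j (occ N x j) = 0 \/ 0 < x 0 j.
Proof.
move=> xg; have [[x0 x1] xN] := xg.
have [xj|xj] := ltP 0 (x 0 j); first by right.
left; have /eqP xj0 : x 0 j == 0 by rewrite eq_le xj x0.
by rewrite /occ xj0 mulr0 truncn0 g_0.
Qed.

(** A jump out of an empty site would leave the grid, but its rate is zero since [g j 0 = 0]. *)
Lemma gen_local (F G : V -> R) (x : V) :
  (forall y, simplex_grid N y -> F y = G y) -> simplex_grid N x ->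
  gen F x = gen G x.
Proof.
move=> FG xg; rewrite !zrp_genE; congr (_ * _).
apply: eq_bigr => j _; apply: eq_bigr => k _.
have [->|xj] := rate_grid j xg; first by rewrite !mul0r.
by rewrite !FG//; exact: jump_grid.
Qed.

Lemma iter_gen_local i (F G : V -> R) (x : V) :
  (forall y, simplex_grid N y -> F y = G y) -> simplex_grid N x ->
  iter i gen F x = iter i gen G x.
Proof.
move=> FG; elim: i x => [|i IH] x xg /=; first exact: FG.
exact: gen_local.
Qed.

Lemma gen_sum (I : Type) (s : seq I) (c : I -> R) (F : I -> V -> R) x :
  gen (fun z => \sum_(i <- s) c i * F i z) x = \sum_(i <- s) c i * gen (F i) x.
Proof.
under [RHS]eq_bigr do rewrite zrp_genE.
rewrite zrp_genE; under [RHS]eq_bigr do rewrite mulrCA.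
rewrite -mulr_sumr; congr (_ * _).
under [RHS]eq_bigr do rewrite mulr_sumr.
rewrite [RHS]exchange_big/=; apply: eq_bigr => j _.
under [RHS]eq_bigr do rewrite mulr_sumr.
rewrite [RHS]exchange_big/=; apply: eq_bigr => k _.
by rewrite -sumrB mulr_sumr; apply: eq_bigr => i _; ring.
Qed.

Lemma iter_gen_sum l (I : Type) (s : seq I) (c : I -> R) (F : I -> V -> R) x :
  iter l gen (fun z => \sum_(i <- s) c i * F i z) x =
  \sum_(i <- s) c i * iter l gen (F i) x.
Proof.
elim: l x => [//|l IH] x /=; rewrite -gen_sum.
by congr (gen _ x); apply/funext => y; exact: IH.
Qed.

Definition gen_norm : R := N%:R ^+ 2 * (n.+1%:R * (n.+1%:R * (rate_bound m Cg * rate_sum r * 2))).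

Lemma gen_norm_ge0 : 0 <= gen_norm.
Proof.
rewrite /gen_norm !mulr_ge0 ?sqr_ge0//; first exact: (rate_bound_ge0 m_ge0 g_ge0 gC).
exact: rate_sum_ge0.
Qed.

Lemma gen_bound (F : V -> R) B (x : V) : 0 <= B ->
  (forall y, simplex_grid N y -> `|F y| <= B) -> simplex_grid N x ->
  `|gen F x| <= gen_norm * B.
Proof.
move=> B0 FB xg; rewrite zrp_genE normrM ger0_norm ?sqr_ge0// /gen_norm -mulrA.
rewrite ler_wpM2l ?sqr_ge0//.
have cst (c : R) : n.+1%:R * c = \sum_(j < n.+1) c.
  by rewrite sumr_const card_ord mulr_natl.
apply: (le_trans (ler_norm_sum _ _ _)).
rewrite -mulrA cst; apply: ler_sum => j _.
apply: (le_trans (ler_norm_sum _ _ _)).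
rewrite -mulrA cst; apply: ler_sum => k _.
have P0 : 0 <= rate_bound m Cg * rate_sum r * 2 * B.
  rewrite !mulr_ge0//; first exact: (rate_bound_ge0 m_ge0 g_ge0 gC).
  exact: rate_sum_ge0.
have [->|xj] := rate_grid j xg; first by rewrite !mul0r normr0.
rewrite normrM -[leRHS]mulrA; apply: ler_pM => //.
  rewrite ger0_norm; last by rewrite mulr_ge0.
  apply: ler_pM => //; first exact: rate_boundP.
  rewrite /rate_sum (bigD1 j)//= (bigD1 k)//= -addrA lerDl addr_ge0//.
    exact: sumr_ge0.
  by apply: sumr_ge0 => i _; exact: sumr_ge0.
apply: (le_trans (ler_normB _ _)); rewrite mulr2n mulrDl mul1r lerD ?FB//.
exact: jump_grid.
Qed.

Lemma iter_gen_bound i (F : V -> R) B (x : V) : 0 <= B ->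
  (forall y, simplex_grid N y -> `|F y| <= B) -> simplex_grid N x ->
  `|iter i gen F x| <= gen_norm ^+ i * B.
Proof.
move=> B0 FB; elim: i x => [|i IH] x xg /=; first by rewrite mul1r FB.
rewrite exprS -mulrA; apply: gen_bound => //.
by rewrite mulr_ge0// exprn_ge0// gen_norm_ge0.
Qed.

(** Occupation numbers are at most N, so the grid is covered by the image of a finite type; [undup]
    lets sums over it count each point once. *)
Definition grid_pts : seq V := undup
  [seq y <- [seq \row_j (((s : {ffun S -> 'I_N.+1}) j)%:R / N%:R) | s : {ffun S -> 'I_N.+1}]
  | `[< simplex_grid N y >]].

Lemma grid_ptsP y : reflect (simplex_grid N y) (y \in grid_pts).
Proof.
apply: (iffP idP); rewrite mem_undup mem_filter; first by move=> /andP[/asboolP].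
move=> yg; apply/andP; split; first exact/asboolP.
have [[y0 y1] yN] := yg.
have oN j : (occ N y j < N.+1)%N.
  rewrite ltnS -(@ler_nat R) occE// ler_piMr// -y1 (bigD1 j)//= lerDl.
  by apply: sumr_ge0 => i _; exact: y0.
apply/fintype.imageP; exists [ffun j => Ordinal (oN j)] => //.
by apply/rowP => j; rewrite mxE ffunE/= occE// mulrC mulKf.
Qed.

Lemma grid_pts_uniq : uniq grid_pts. Proof. exact: undup_uniq. Qed.

Lemma sum_grid_pts (F : V -> R) x : simplex_grid N x ->
  \sum_(y <- grid_pts) F y * (x == y)%:R = F x.
Proof.
move=> /grid_ptsP xg; rewrite (bigD1_seq x)//= ?grid_pts_uniq// eqxx mulr1.
by rewrite big1 ?addr0// => y /negPf yx; rewrite eq_sym yx mulr0.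
Qed.

Definition expgen (F : V -> R) (t : R) (x : V) : R :=
  limn (pseries (fun i => iter i gen F x / i`!%:R) t).

Lemma grid_bounded (F : V -> R) :
  exists2 B, 0 <= B & forall y, simplex_grid N y -> `|F y| <= B.
Proof.
exists (\sum_(y <- grid_pts) `|F y|); first by apply: sumr_ge0.
move=> y /grid_ptsP yg; rewrite (big_rem y)//= lerDl; exact: sumr_ge0.
Qed.

Lemma expgen_is_cvg F t x : simplex_grid N x ->
  cvgn (pseries (fun i => iter i gen F x / i`!%:R) t).
Proof.
move=> xg; have [B B0 FB] := grid_bounded F.
apply: normed_cvg.
have c : cvgn (series (fun i => B * exp_coeff (gen_norm * `|t|) i)).
  have -> : (fun i => B * exp_coeff (gen_norm * `|t|) i) = B *: exp_coeff (gen_norm * `|t|) by [].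
  exact/is_cvg_seriesZ/is_cvg_series_exp_coeff.
apply: (series_le_cvg _ _ _ c) => // i.
  exact: normr_ge0.
  rewrite /exp_coeff/=; apply: mulr_ge0 => //; apply: divr_ge0 => //; apply: exprn_ge0; apply: mulr_ge0 => //; exact: gen_norm_ge0.
rewrite /= normrM normrX normrM [`|_^-1|]ger0_norm// /exp_coeff /= exprMn.
have := iter_gen_bound i B0 FB xg => h.
rewrite [leRHS](_ : _ = gen_norm ^+ i * B / i`!%:R * `|t| ^+ i); last by ring.
by rewrite ler_wpM2r ?exprn_ge0// ler_wpM2r.
Qed.

(** Differentiating the power series in [t] term by term shifts its coefficients, which amounts to
    replacing [F] by [gen F]. *)
Lemma expgen_derive (F : V -> R) (t : R) (x : V) : simplex_grid N x ->
  is_derive t (1 : R) (fun u : R => expgen F u x) (expgen (gen F) t x).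
Proof.
move=> xg.
have dE G : pseries_diffs (fun i => iter i gen G x / i`!%:R) =
    (fun i => iter i gen (gen G) x / i`!%:R).
  apply/funext => i; rewrite /pseries_diffs factS natrM -iterSr invfM.
  by rewrite mulrCA [X in _ * X]mulrA divff ?pnatr_eq0// mul1r.
have := @pseries_snd_diffs R (fun i => iter i gen F x / i`!%:R) (`|t| + 1) t.
rewrite !dE; apply; do ?[exact: expgen_is_cvg].
by rewrite [X in _ < X]ger0_norm ?addr_ge0// ltrDl.
Qed.

(** On the grid [F] is a finite combination of indicators of points, and the exponential is
    linear. *)
Lemma expgen_trans F t x : simplex_grid N x ->
  \sum_(y <- grid_pts) F y * zrp_trans r g N t x y = expgen F t x.
Proof.
move=> xg.
have E y : zrp_trans r g N t x y = expgen (fun z => (z == y)%:R) t x.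
  rewrite /zrp_trans /expgen /pseries; congr (limn (series _)).
  by apply/funext => i; rewrite mulrC mulrA mulrAC.
under eq_bigr do rewrite E.
apply/esym/cvg_lim => //.
have -> : pseries (fun i => iter i gen F x / i`!%:R) t =
  (fun k => \sum_(y <- grid_pts)
     F y * pseries (fun i => iter i gen (fun z => (z == y)%:R) x / i`!%:R) t k).
  apply/funext => k; rewrite /pseries /series/=.
  under [RHS]eq_bigr do rewrite mulr_sumr.
  rewrite exchange_big/=; apply: eq_bigr => i _.
  rewrite (@iter_gen_local _ F (fun z => \sum_(y <- grid_pts) F y * (z == y)%:R))//.
    by rewrite iter_gen_sum !mulr_suml; apply: eq_bigr => y _; rewrite !mulrA.
  by move=> y yg; rewrite sum_grid_pts.
apply: cvg_sum_seq => y; apply: cvgMr; exact: expgen_is_cvg.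
Qed.

End Semigroup.

(** * Borel sets of the path space and the natural filtration *)

Section PathMeasurability.
Variables (R : realType) (n : nat).
Local Notation V := 'rV[R]_n.+1.
Local Notation D := (cadlag_path R n).

Lemma open_normP (U : set V) y : open U -> U y ->
  exists2 e : R, 0 < e & forall z, `|z - y| < e -> U z.
Proof.
move=> oU Uy; have /nbhs_normP[e e0 He] : nbhs y U by apply: open_nbhs_nbhs.
by exists e => // z zy; apply: He; rewrite /= distrC.
Qed.

Lemma normP_open (U : set V) :
  (forall y, U y -> exists2 e : R, 0 < e & forall z, `|z - y| < e -> U z) -> open U.
Proof.
move=> H; rewrite openE => y /H[e e0 He]; rewrite /interior.
apply: (iffRL (nbhs_normP (y : V) U)); exists e => // z.
by rewrite /= distrC => /He.
Qed.

Lemma skorohod_openE (O : set D) : open O <->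
  forall w, O w -> exists T e, 0 < e /\ skorohod_ball w T e `<=` O.
Proof. by []. Qed.

Definition visits (a b : R) (U : set V) : set D :=
  [set w | exists2 s, a < s < b & U (w s)].

(** The time interval and [U] are both open, so a visit at an interior time survives a small
    deformation of time and of space. *)
Lemma visits_open a b U : 0 <= a -> open U -> open (visits a b U).
Proof.
move=> a0 oU; apply/skorohod_openE => w [s /andP[as_ sb] Us].
have [e e0 He] := open_normP oU Us.
have b0 : 0 <= b by apply/ltW; apply: lt_trans sb; exact: le_lt_trans as_.
pose d := Num.min (Num.min e 1) (Num.min (s - a) (b - s)).
have d0 : 0 < d by rewrite !lt_min e0 !subr_gt0 as_ sb ltr01.
have de : d <= e by rewrite !ge_min lexx.
have d1 : d <= 1 by rewrite !ge_min lexx orbT.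
have da : d <= s - a by rewrite !ge_min lexx !orbT.
have db : d <= b - s by rewrite !ge_min lexx !orbT.
exists (b + 1), d; split=> // v [lam [lam0 lam_inc lam_surj] H].
have s0 : 0 <= s by apply: ltW; exact: le_lt_trans as_.
have [s' s'0 ls] := lam_surj s s0.
(* Proximity is only known on the bounded horizon. A later [s'] would give lam (b + 1) < s < b,
   although [lam] moves b + 1 by less than [d <= 1]. *)
have s'b : s' <= b + 1.
  rewrite leNgt; apply/negP => bs'.
  have b10 : 0 <= b + 1 by rewrite addr_ge0.
  have := lam_inc _ _ b10 bs'; rewrite ls => l1.
  have [] := H (b + 1); first by rewrite b10/=.
  by rewrite ltr_norml => /andP[l2 _] _; move: l1 l2 sb d1; lra.
have [] := H s'; first by rewrite s'0.
rewrite ls ltr_norml => /andP[h1 h2] h3.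
exists s'; first by apply/andP; split; lra.
by apply: He; apply: lt_le_trans de.
Qed.

Definition near_compl (U : set V) (k : nat) : set V :=
  [set y | exists2 z, ~ U z & `|y - z| < k.+1%:R^-1].

Lemma near_compl_open U k : open (near_compl U k).
Proof.
apply: normP_open => y [z Uz yz]; exists (k.+1%:R^-1 - `|y - z|).
  by rewrite subr_gt0.
move=> y' yy'; exists z => //.
rewrite (_ : y' - z = (y' - y) + (y - z)); last by rewrite addrA subrK.
by apply: (le_lt_trans (ler_normD _ _)); rewrite -ltrBrDr.
Qed.

(* Right continuity turns the value at t into a condition on an open time
   interval, and the latter is expressed through sets open for J1. *)
Lemma eval_setE t (U : set V) : 0 <= t -> open U ->
  [set w : D | U (w t)] = \bigcup_k ~` visits t (t + k.+1%:R^-1) (near_compl U k).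
Proof.
move=> t0 oU; apply/seteqP; split => w /=.
  move=> /(open_normP oU)[e e0 He].
  have := @path_right_continuous R n w t.
  move=> /cvgrPdist_lt/(_ (e / 2)); rewrite divr_gt0// => /(_ isT).
  rewrite near_withinE => /nbhs_normP[d d0 Hd].
  have [k kd] : exists k, k.+1%:R^-1 < Num.min d (e / 2).
    have m0 : 0 < Num.min d (e / 2) by rewrite lt_min d0 divr_gt0.
    have [k _ /(_ k (leqnn _))] := near_infty_natSinv_lt (PosNum m0).
    by move=> h; exists k.
  move: kd; rewrite lt_min => /andP[kd ke]; exists k => //.
  move=> [s /andP[ts sk]] [z Uz wz]; apply: Uz; apply: He.
  have sd : `|w t - w s| < e / 2.
    by apply: Hd => //=; rewrite distrC ger0_norm; move: ts sk kd; set ki := _^-1; clear; lra.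
  rewrite (_ : z - w t = - (w s - z) - (w t - w s)); last by rewrite opprB opprB addrA subrK.
  by apply: (le_lt_trans (ler_normB _ _)); rewrite normrN; move: wz ke sd; set ki := _^-1; clear; lra.
move=> [k _ H]; apply: contrapT => Uwt; apply: H.
have := @path_right_continuous R n w t.
have k0 : 0 < k.+1%:R^-1 :> R by rewrite invr_gt0.
move=> /cvgrPdist_lt/(_ _ k0).
rewrite near_withinE => /nbhs_normP[d d0 Hd].
pose s := t + Num.min (d / 2) (k.+1%:R^-1 / 2).
have m0 : 0 < Num.min (d / 2) (k.+1%:R^-1 / 2) by rewrite lt_min !divr_gt0.
have md : Num.min (d / 2) (k.+1%:R^-1 / 2) <= d / 2 by rewrite ge_min lexx.
have mk : Num.min (d / 2) (k.+1%:R^-1 / 2) <= k.+1%:R^-1 / 2 by rewrite ge_min lexx orbT.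
set ki := _^-1 in k0 m0 md mk *.
exists s; first by rewrite /s; apply/andP; split; move: m0 md mk k0; clear; lra.
exists (w t) => //; rewrite distrC; apply: Hd; last by rewrite /s /=; move: m0; clear; lra.
by rewrite /= distrC ger0_norm /s; move: m0 md d0; clear; lra.
Qed.

Lemma eval_measurable t (U : set V) : open U ->
  measurable ([set w : D | U (w t)] : set (borel D)).
Proof.
move=> oU; wlog t0 : t / 0 <= t.
  move=> H; have [/H//|t0] := leP 0 t.
  rewrite (_ : [set w | _] = [set w : D | U (w 0)]); first exact: H.
  by apply/seteqP; split => w /=; rewrite (path_neg w (ltW t0)).
rewrite eval_setE//; apply: bigcup_measurable => k _; apply: measurableC.
by apply: sub_sigma_algebra; apply: visits_open => //; exact: near_compl_open.
Qed.

(* The measurable sets of past t are definitionally those of the natural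
   filtration, which gives access to the theory of measurable sets. *)
Definition coord_gen (t : R) : set (set D) :=
  [set A | exists s U, [/\ 0 <= s <= t, open U & A = [set w : D | U (w s : V)]]].
Definition past (t : R) := g_sigma_algebraType (coord_gen t).

Lemma pastE t (A : set D) : natural_filtration t A = measurable (A : set (past t)).
Proof. by []. Qed.

Lemma natural_filtration_measurable t (A : set D) :
  natural_filtration t A -> measurable (A : set (borel D)).
Proof.
apply: smallest_sub; first exact: sigma_algebra_measurable.
by move=> B [s [U [_ oU ->]]]; exact: eval_measurable.
Qed.

Lemma natural_filtration_le s t (A : set D) : s <= t ->
  natural_filtration s A -> natural_filtration t A.
Proof.
move=> st; apply: smallest_sub; first exact: smallest_sigma_algebra.
move=> B [u [U [/andP[u0 us] oU ->]]]; apply: sub_sigma_algebra.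
by exists u, U; split=> //; rewrite u0 (le_trans us).
Qed.

Lemma natural_filtration_eval t s (U : set V) : 0 <= s <= t -> open U ->
  natural_filtration t [set w : D | U (w s)].
Proof. by move=> st oU; apply: sub_sigma_algebra; exists s, U. Qed.

Lemma natural_filtration_eq t s (y : V) : 0 <= s <= t ->
  natural_filtration t [set w : D | w s = y].
Proof.
move=> st; rewrite pastE -[[set w : D | _]]setCK; apply: measurableC.
rewrite (_ : ~` _ = [set w : D | (~` [set y]) (w s)]); last first.
  by apply/seteqP; split.
rewrite -pastE; apply: natural_filtration_eval => //; apply: normP_open => z zy.
exists `|z - y|; first by rewrite normr_gt0 subr_eq0; apply/eqP.
by move=> z' H z'y; move: H; rewrite z'y distrC ltxx.
Qed.

Lemma natural_filtrationI t (A B : set D) :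
  natural_filtration t A -> natural_filtration t B -> natural_filtration t (A `&` B).
Proof. exact: (@measurableI _ (past t)). Qed.

Lemma natural_filtrationC t (A : set D) :
  natural_filtration t A -> natural_filtration t (~` A).
Proof. exact: (@measurableC _ (past t)). Qed.

End PathMeasurability.

(** * Real-valued probabilities and finite partitions *)

Lemma seq_bigcup_measurable d (T : measurableType d) (I : eqType) (s : seq I)
    (E : I -> set T) : (forall i, i \in s -> measurable (E i)) ->
  measurable [set t | exists2 i, i \in s & E i t].
Proof.
elim: s => [|i s IH] mE.
  by rewrite (_ : [set t | _] = set0)//; apply/seteqP; split => // t [].
rewrite (_ : [set t | exists2 i0, i0 \in i :: s & E i0 t] =
   E i `|` [set t | exists2 i, i \in s & E i t]).
  apply: measurableU; first by apply: mE; rewrite mem_head.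
  by apply: IH => k ks; apply: mE; rewrite in_cons ks orbT.
apply/seteqP; split => t /=.
  by move=> [k]; rewrite in_cons => /orP[/eqP -> Ei|ks Ek]; [left|right; exists k].
by move=> [Ei|[k ks Ek]]; [exists i; rewrite ?mem_head|exists k; rewrite ?in_cons ?ks ?orbT].
Qed.

Section RealProbability.
Context d (T : measurableType d) (R : realType) (P : probability T R).

Definition pr (A : set T) : R := fine (P A).

Lemma prK A : measurable A -> P A = (pr A)%:E.
Proof. by move=> mA; rewrite /pr fineK// fin_num_measure. Qed.

Lemma pr_ge0 A : 0 <= pr A. Proof. exact/fine_ge0/measure_ge0. Qed.

Lemma prT : pr setT = 1. Proof. by rewrite /pr probability_setT. Qed.

Lemma pr0 : pr set0 = 0. Proof. by rewrite /pr measure0. Qed.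

Lemma prS A B : measurable A -> measurable B -> A `<=` B -> pr A <= pr B.
Proof.
by move=> mA mB AB; rewrite -lee_fin -!prK// le_measure// inE.
Qed.

Lemma pr_le1 A : measurable A -> pr A <= 1.
Proof. by move=> mA; rewrite -prT; apply: prS. Qed.

Lemma prU A B : measurable A -> measurable B -> A `&` B = set0 ->
  pr (A `|` B) = pr A + pr B.
Proof.
move=> mA mB AB; rewrite /pr measureU ?fineD// fin_num_measure//.
Qed.

Lemma pr_split A B : measurable A -> measurable B ->
  pr A = pr (A `&` B) + pr (A `&` ~` B).
Proof.
move=> mA mB; rewrite -prU; [|exact: measurableI|apply: measurableI => //; exact: measurableC|].
  by rewrite -setIUr setUv setIT.
by rewrite setIACA setICr setI0.
Qed.

Lemma pr_null A B : measurable A -> measurable B -> pr (~` B) = 0 ->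
  pr (A `&` B) = pr A.
Proof.
move=> mA mB B0; rewrite [RHS](pr_split mA mB).
have mC := measurableC mB.
suff -> : pr (A `&` ~` B) = 0 by rewrite addr0.
apply/le_anti; rewrite pr_ge0 andbT -B0; apply: prS => //; exact: measurableI.
Qed.

Lemma prUle A B : measurable A -> measurable B -> pr (A `|` B) <= pr A + pr B.
Proof.
move=> mA mB; 
rewrite (_ : A `|` B = A `|` (B `&` ~` A)).
  have mC := measurableC mA; have mD : measurable (B `&` ~` A) by exact: measurableI.
  rewrite prU//; last by rewrite setIC -setIA [_ `&` A]setIC setICr setI0.
  by rewrite lerD2l prS.
apply/seteqP; split => t /=; last by move=> [|[]]; [left|right].
by have [At|At] := pselect (A t); [left|move=> [//|Bt]; right].
Qed.

Lemma pr_bigcup (I : eqType) (s : seq I) (E : I -> set T) :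
  (forall i, i \in s -> measurable (E i)) ->
  pr [set t | exists2 i, i \in s & E i t] <= \sum_(i <- s) pr (E i).
Proof.
elim: s => [|i s IH] mE.
  by rewrite big_nil (_ : [set t | _] = set0) ?pr0//; apply/seteqP; split => // t [].
have ms k : k \in s -> measurable (E k) by move=> ks; apply: mE; rewrite in_cons ks orbT.
have mi : measurable (E i) by apply: mE; rewrite mem_head.
have mS := seq_bigcup_measurable ms.
rewrite big_cons; apply: le_trans (_ : pr (E i) + pr [set t | exists2 i, i \in s & E i t] <= _).
  apply: le_trans (prUle mi mS); apply: prS; [exact: seq_bigcup_measurable|exact: measurableU|].
  by move=> t /= [k]; rewrite in_cons => /orP[/eqP -> Ei|ks Ek]; [left|right; exists k].
by rewrite lerD2l IH.
Qed.

Lemma pr_partition (U : eqType) (s : seq U) (f : T -> U) A :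
  uniq s -> measurable A -> (forall y, y \in s -> measurable [set t | f t = y]) ->
  pr (A `&` [set t | f t \in s]) = \sum_(y <- s) pr (A `&` [set t | f t = y]).
Proof.
move=> us mA; elim: s us => [_ _|y s IH /= /andP[ys us] mf].
  rewrite big_nil (_ : A `&` _ = set0) ?pr0//.
  by apply/seteqP; split => // t [].
have my : measurable [set t | f t = y] by apply: mf; rewrite mem_head.
have mf' z : z \in s -> measurable [set t | f t = z].
  by move=> zs; apply: mf; rewrite in_cons zs orbT.
have ms : measurable [set t | f t \in s].
  rewrite (_ : [set t | f t \in s] = [set t | exists2 i, i \in s & [set t | f t = i] t]).
    exact: seq_bigcup_measurable.
  by apply/seteqP; split => t /=; [move=> fs; exists (f t)|move=> [i si /= ->]].
rewrite big_cons -IH// -prU; [|exact: measurableI|exact: measurableI|].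
  congr pr; rewrite -setIUr; congr (_ `&` _); apply/seteqP; split => t /=.
    by rewrite in_cons => /orP[/eqP|]; [left|right].
  by move=> [->|fs]; rewrite in_cons ?eqxx ?fs ?orbT.
apply/seteqP; split => // t [[_ /= fy] [_ /= fs]].
by move: ys; rewrite -fy fs.
Qed.

End RealProbability.

(** * Dynkin's formula on past events *)

Section Dynkin.
Variables (R : realType) (n : nat).
Local Notation S := 'I_n.+1.
Local Notation V := 'rV[R]_n.+1.
Local Notation D := (cadlag_path R n).
Variables (r : S -> S -> R) (m : S -> R) (g : S -> nat -> R) (Cg : R).
Hypothesis r_ge0 : forall j k, 0 <= r j k.
Hypothesis m_ge0 : forall j, 0 <= m j.
Hypothesis g_ge0 : forall j k, 0 <= g j k.
Hypothesis g_0 : forall j, g j 0%N = 0.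
Hypothesis gC : forall j k, `|g j k - m j| <= Cg.
Variable N : nat.
Hypothesis N_gt0 : (0 < N)%N.
Variables (x_init : V) (P : probability (borel D) R).
Hypothesis P_law : zrp_law r g N x_init P.

Local Notation gen := (zrp_gen r g N).
Local Notation pts := (grid_pts R n N).
Local Notation at_ t y := [set w : D | w t = y].
Local Notation nf := (@natural_filtration R n).
Let nfm := @natural_filtration_measurable R n.

(** The expectation of [F] at time [t] restricted to [A], as a finite sum, since the chain lives on
    the grid almost surely. *)
Definition Ex (A : set D) (t : R) (F : V -> R) : R :=
  \sum_(y <- pts) F y * pr P (A `&` at_ t y).

Lemma at_measurable t y : 0 <= t -> measurable (at_ t y : set (borel D)).
Proof. by move=> t0; apply: (@nfm t); apply: natural_filtration_eq; rewrite t0/=. Qed.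

Lemma grid_ae A t : 0 <= t -> measurable (A : set (borel D)) ->
  pr P (A `&` [set w : D | w t \in pts]) = pr P A.
Proof.
move=> t0 mA.
have mG : measurable ([set w : D | w t \in pts] : set (borel D)).
  rewrite (_ : [set w : D | w t \in pts] = [set w | exists2 y, y \in pts & at_ t y w]).
    by apply: seq_bigcup_measurable => y _; exact: at_measurable.
  by apply/seteqP; split => w /=; [move=> h'; exists (w t)|move=> [y yp /= ->]].
apply: pr_null => //.
have [_ [Z [mZ PZ HZ]] _] := P_law.
apply/le_anti; rewrite pr_ge0 andbT (_ : 0 = pr P Z); last by rewrite /pr PZ.
apply: prS => //; first exact: measurableC.
move=> w /= wp; apply: HZ => /= H; apply: wp; apply/(grid_ptsP N_gt0) => //; exact: H.
Qed.

Lemma pr_sum_grid A t : 0 <= t -> measurable (A : set (borel D)) ->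
  pr P A = \sum_(y <- pts) pr P (A `&` at_ t y).
Proof.
move=> t0 mA; rewrite -(grid_ae t0 mA) pr_partition//; first exact: grid_pts_uniq.
by move=> y _; exact: at_measurable.
Qed.

Lemma ExD A t F G : Ex A t (fun y => F y + G y) = Ex A t F + Ex A t G.
Proof. by rewrite /Ex -big_split/=; apply: eq_bigr => y _; rewrite mulrDl. Qed.

Lemma ExZ A t c F : Ex A t (fun y => c * F y) = c * Ex A t F.
Proof. by rewrite /Ex mulr_sumr; apply: eq_bigr => y _; rewrite mulrA. Qed.

Lemma Ex_le A t F G : (forall y, simplex_grid N y -> F y <= G y) ->
  Ex A t F <= Ex A t G.
Proof.
move=> FG; rewrite /Ex big_seq [leRHS]big_seq; apply: ler_sum => y /(grid_ptsP N_gt0) yg.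
by rewrite ler_wpM2r ?pr_ge0// FG.
Qed.

Lemma Ex_cst A t c : 0 <= t -> measurable (A : set (borel D)) ->
  Ex A t (fun=> c) = c * pr P A.
Proof. by move=> t0 mA; rewrite (pr_sum_grid t0 mA) mulr_sumr. Qed.

Lemma Ex_split A B t F : 0 <= t -> measurable (A : set (borel D)) ->
  measurable (B : set (borel D)) -> Ex A t F = Ex (A `&` B) t F + Ex (A `&` ~` B) t F.
Proof.
move=> t0 mA mB; rewrite /Ex -big_split/=; apply: eq_bigr => y _.
rewrite -mulrDr; congr (_ * _).
rewrite (pr_split P (measurableI _ _ mA (at_measurable y t0)) mB).
by rewrite -!setIA [at_ t y `&` B]setIC [at_ t y `&` ~` B]setIC.
Qed.

Lemma Ex_at A t x F : simplex_grid N x -> A `<=` at_ t x -> Ex A t F = F x * pr P A.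
Proof.
move=> xg Ax; rewrite /Ex (bigD1_seq x)/= ?grid_pts_uniq//; last exact/(grid_ptsP N_gt0).
rewrite big1 ?addr0 => [|y yx]; first by rewrite setIidl.
rewrite (_ : A `&` _ = set0) ?pr0 ?mulr0//; apply/seteqP; split => // w [/Ax/= wx /= wy].
by move: yx; rewrite -wx wy eqxx.
Qed.

Lemma Ex_ge A t (Q : V -> Prop) F : 0 <= t -> measurable (A : set (borel D)) ->
  (forall w : D, A w -> Q (w t)) -> (forall y, simplex_grid N y -> Q y -> 1 <= F y) ->
  pr P A <= Ex A t F.
Proof.
move=> t0 mA AQ QF; rewrite (pr_sum_grid t0 mA) /Ex big_seq [leRHS]big_seq.
apply: ler_sum => y /(grid_ptsP N_gt0) yg; have [Qy|Qy] := pselect (Q y).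
  by rewrite ler_peMl ?pr_ge0// QF.
rewrite (_ : A `&` _ = set0) ?pr0 ?mulr0//; apply/seteqP; split => // w [/AQ /= Qw /= wy].
by apply: Qy; rewrite -wy.
Qed.

(** Adding the state at time [s] to the conditioning event makes the integrand of the Markov
    property constant. *)
Lemma markov_step A s t x y : 0 <= s -> 0 <= t -> nf s A ->
  simplex_grid N y ->
  pr P (A `&` at_ s x `&` at_ (s + t) y) = zrp_trans r g N t x y * pr P (A `&` at_ s x).
Proof.
move=> s0 t0 nA yg; have [_ _ law] := P_law.
have nAx : nf s (A `&` at_ s x).
  by apply: natural_filtrationI => //; apply: natural_filtration_eq; rewrite s0/=.
rewrite /pr law//.
rewrite (@eq_integral _ _ _ _ _ (cst (zrp_trans r g N t x y)%:E)); last first.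
  by move=> w; rewrite inE => -[_ /= ->].
rewrite integral_cst; last exact: nfm nAx.
by rewrite fineM// fin_num_measure//; exact: nfm nAx.
Qed.

Lemma Ex_markov A s t F : 0 <= s -> 0 <= t -> nf s A ->
  Ex A (s + t) F = \sum_(x <- pts) pr P (A `&` at_ s x) * expgen r g N F t x.
Proof.
move=> s0 t0 nA; have mA := nfm nA.
have st0 : 0 <= s + t by rewrite addr_ge0.
transitivity (\sum_(y <- pts) \sum_(x <- pts)
   pr P (A `&` at_ s x) * (F y * zrp_trans r g N t x y)).
  rewrite /Ex big_seq [RHS]big_seq; apply: eq_bigr => y /(grid_ptsP N_gt0) yg.
  rewrite (pr_sum_grid s0 (measurableI _ _ mA (at_measurable y st0))) mulr_sumr.
  apply: eq_bigr => x _; rewrite -setIA (setIC (at_ (s + t) y)) setIA markov_step//.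
    by ring.
rewrite exchange_big/= big_seq [RHS]big_seq; apply: eq_bigr => x /(grid_ptsP N_gt0) xg.
by rewrite -mulr_sumr (expgen_trans r_ge0 m_ge0 g_ge0 g_0 gC).
Qed.

Lemma dynkin_le A s t F c : 0 <= s -> 0 <= t -> nf s A ->
  (forall u, 0 <= u <= t -> Ex A (s + u) (gen F) <= c) ->
  Ex A (s + t) F <= Ex A s F + c * t.
Proof.
move=> s0 t0 nA H.
(* This extends the expectation at time [s + u] to all real [u], with [psi (gen F)] as derivative
   everywhere; the mean value theorem then applies up to the endpoint 0. *)
pose psi G u := \sum_(x <- pts) pr P (A `&` at_ s x) * expgen r g N G u x.
have psiE G u : 0 <= u -> Ex A (s + u) G = psi G u by move=> u0; exact: Ex_markov.
have dpsi u : is_derive u (1 : R) (psi F) (psi (gen F) u).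
  apply: is_derive_sum_seq => x /(grid_ptsP N_gt0) xg.
  have := @expgen_derive R n r m g Cg r_ge0 m_ge0 g_ge0 g_0 gC N N_gt0 F u x xg.
  by move=> h; have := @is_deriveZ _ _ _ _ (pr P (A `&` at_ s x)) _ _ _ h.
rewrite -[s in X in _ <= X + _]addr0 !psiE//.
have [->|tn0] := eqVneq t 0; first by rewrite mulr0 addr0.
have t_gt0 : 0 < t by rewrite lt_def tn0 t0.
have [|u ut E] := @MVT R (psi F) (psi (gen F)) 0 t t_gt0.
  apply: continuous_subspaceT => x.
  have [dx _] := dpsi x.
  by apply: differentiable_continuous; exact/derivable1_diffP.
move: ut; rewrite in_itv/= => /andP[u0 ut].
rewrite -lerBlDl E subr0 ler_wpM2r// -psiE ?(ltW u0)// H// (ltW u0)/= ltW//.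
Qed.

Lemma dynkin_near A s t F a c : 0 <= s -> 0 <= t -> nf s A ->
  (forall u, 0 <= u <= t -> `|Ex A (s + u) (gen F) - a| <= c) ->
  `|Ex A (s + t) F - Ex A s F - a * t| <= c * t.
Proof.
move=> s0 t0 nA H.
have H1 u : 0 <= u <= t -> - c + a <= Ex A (s + u) (gen F) <= c + a.
  by move=> /H; rewrite ler_distlC => /andP[h1 h2]; apply/andP; split; lra.
have h1 : Ex A (s + t) F <= Ex A s F + (c + a) * t.
  by apply: dynkin_le => // u ut; have /andP[] := H1 u ut.
have EN G u : Ex A u (fun y => -1 * G y) = - Ex A u G by rewrite ExZ mulN1r.
have gN G : gen (fun y => -1 * G y) = (fun y => -1 * gen G y).
  apply/funext => y; have := gen_sum r g N [:: G] (fun=> -1) (fun G => G) y.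
  by rewrite !big_seq1 => <-; congr (zrp_gen _ _ _ _ y); apply/funext => z; rewrite big_seq1.
have := @dynkin_le A s t (fun y => -1 * F y) (c - a) s0 t0 nA.
rewrite gN !EN => h; have {}h : - Ex A (s + t) F <= - Ex A s F + (c - a) * t.
  by apply: h => u ut; rewrite EN; have /andP[] := H1 u ut; lra.
by rewrite ler_norml; apply/andP; split; lra.
Qed.

Lemma Ex_abs_le A t (Q : V -> Prop) F c : 0 <= t -> measurable (A : set (borel D)) ->
  (forall w : D, A w -> Q (w t)) -> (forall y, simplex_grid N y -> Q y -> `|F y| <= c) ->
  `|Ex A t F| <= c * pr P A.
Proof.
move=> t0 mA AQ QF; rewrite (pr_sum_grid t0 mA) /Ex mulr_sumr.
apply: (le_trans (ler_norm_sum _ _ _)).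
rewrite big_seq [leRHS]big_seq; apply: ler_sum => y /(grid_ptsP N_gt0) yg.
rewrite normrM [`|pr _ _|]ger0_norm ?pr_ge0//; have [Qy|Qy] := pselect (Q y).
  by rewrite ler_wpM2r ?pr_ge0// QF.
rewrite (_ : A `&` _ = set0) ?pr0 ?mulr0//; apply/seteqP; split => // w [/AQ /= Qw /= wy].
by apply: Qy; rewrite -wy.
Qed.

End Dynkin.

(** * Exit probabilities from a ball *)

Section Exit.
Variables (R : realType) (n : nat).
Local Notation S := 'I_n.+1.
Local Notation V := 'rV[R]_n.+1.
Local Notation D := (cadlag_path R n).
Variables (r : S -> S -> R) (m : S -> R) (g : S -> nat -> R) (Cg : R).
Hypothesis r_ge0 : forall j k, 0 <= r j k.
Hypothesis r_irr : forall j k, connect (fun i l => 0 < r i l) j k.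
Hypothesis m_inv : forall k, \sum_j m j * r j k = m k * \sum_l r k l.
Hypothesis m_ge0 : forall j, 0 <= m j.
Hypothesis g_ge0 : forall j k, 0 <= g j k.
Hypothesis g_0 : forall j, g j 0%N = 0.
Hypothesis gC : forall j k, `|g j k - m j| <= Cg.
Hypothesis ngC : forall j k, k%:R * `|g j k - m j| <= Cg.

Local Notation nf := (@natural_filtration R n).
Let nfm := @natural_filtration_measurable R n.

Definition far (x : V) (eps : R) : set V := [set y | exists k, eps < `|y 0 k - x 0 k|].

Lemma coord_le_norm (y : V) k : `|y 0 k| <= `|y|.
Proof. by rewrite [leRHS]mx_normrE; apply: (le_bigmax _ (fun ij => `|y ij.1 ij.2|) (0, k)). Qed.

Lemma far_open x eps : open (far x eps).
Proof.
apply: normP_open => y [k yk]; exists (`|y 0 k - x 0 k| - eps).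
  by rewrite subr_gt0.
move=> z zy; exists k.
have h : `|z 0 k - y 0 k| < `|y 0 k - x 0 k| - eps.
  apply: le_lt_trans zy; have := coord_le_norm (z - y) k.
  by rewrite !mxE.
have := ler_normD (y 0 k - z 0 k) (z 0 k - x 0 k).
rewrite addrA subrK [`|y 0 k - z 0 k|]distrC => h2.
by move: h h2; lra.
Qed.

Section Stopped.
Variables (x : V) (eps : R) (A : set D) (u d : R).
Hypothesis u_ge0 : 0 <= u.
Hypothesis d_ge0 : 0 <= d.
Hypothesis A_past : nf u A.

Definition tick i : R := u + i%:R * d.

Lemma tick_ge0 i : 0 <= tick i.
Proof. by rewrite addr_ge0// mulr_ge0. Qed.

Lemma tickS i : tick i.+1 = tick i + d.
Proof. by rewrite /tick -addrA; congr (_ + _); rewrite -natr1 mulrDl mul1r. Qed.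

(** A discrete substitute for a stopping time: exits are looked for at the ticks 1, ..., i only, and
    each of these events belongs to the past of its last tick. *)
Fixpoint stay i : set D :=
  if i is k.+1 then stay k `&` ~` [set w : D | far x eps (w (tick k.+1))] else A.

Lemma stay_past i : nf (tick i) (stay i).
Proof.
elim: i => [|i IH] /=; first by rewrite /tick mul0r addr0.
apply: natural_filtrationI.
  by apply: natural_filtration_le IH; rewrite tickS lerDl.
apply: natural_filtrationC; apply: natural_filtration_eval; last exact: far_open.
by rewrite tick_ge0/=.
Qed.

Lemma stay_measurable i : measurable (stay i : set (borel D)).
Proof. exact: nfm (@stay_past i). Qed.

Lemma stay_sub i : stay i `<=` A.
Proof. by elim: i => [|i IH] //= w [/IH]. Qed.

Lemma stayE l : A `&` ~` stay l =
  A `&` [set w : D | exists2 i, (0 < i <= l)%N & far x eps (w (tick i))].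
Proof.
elim: l => [|l IH] /=.
  apply/seteqP; split => w [Aw]; first by [].
  by move=> [[|i]].
rewrite setCI setCK setIUr IH; apply/seteqP; split => w /=.
  move=> [[Aw [i il fi]]|[Aw fl]]; split=> //.
    by exists i => //; case/andP: il => -> /leqW ->.
  by exists l.+1 => //; rewrite leqnn.
move=> [Aw [i /andP[i0]]]; rewrite leq_eqVlt => /orP[/eqP -> fl|il fi]; [right|left] => //.
by split=> //; exists i => //; rewrite i0.
Qed.

Section Law.
Variables (N : nat) (x_init : V) (P : probability (borel D) R).
Hypothesis N_gt0 : (0 < N)%N.
Hypothesis P_law : zrp_law r g N x_init P.

(** Discrete optional stopping: over each tick Dynkin's formula moves the remaining mass, and the
    part that is then far, where [G] is 1, is converted into probability. *)
Lemma stopping_le (G : V -> R) c l :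
  (forall y, simplex_grid N y -> far x eps y -> G y = 1) ->
  (forall y, 0 <= G y) ->
  (forall i v, (i < l)%N -> 0 <= v <= d -> Ex N P (stay i) (tick i + v) (zrp_gen r g N G) <= c) ->
  Ex N P (stay l) (tick l) G + pr P (A `&` ~` stay l) <= Ex N P A u G + c * (l%:R * d).
Proof.
move=> G1 G0; elim: l => [|l IH] H.
  by rewrite /= setICr pr0 /tick mul0r mulr0 !addr0.
have {}IH := IH (fun i v il => H i v (leqW il)).
have := @dynkin_le _ _ r m g Cg r_ge0 m_ge0 g_ge0 g_0 gC N N_gt0 x_init P P_law (stay l) (tick l) d G c
  (tick_ge0 l) d_ge0 (@stay_past l) (fun v => H l v (leqnn _)).
rewrite -tickS => h.
have mF : measurable ([set w : D | far x eps (w (tick l.+1))] : set (borel D)).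
  by apply: eval_measurable; exact: far_open.
have mSl := stay_measurable l.
have E1 := Ex_split N P G (tick_ge0 l.+1) mSl mF.
have mSlF : measurable (stay l `&` [set w : D | far x eps (w (tick l.+1))] : set (borel D)).
  exact: measurableI.
have G1' y : simplex_grid N y -> far x eps y -> 1 <= G y by move=> yg yf; rewrite G1.
have E2 := Ex_ge N_gt0 P_law (tick_ge0 l.+1) mSlF (fun w h => h.2) G1'.
have mA := nfm A_past.
have E3 : pr P (A `&` ~` stay l.+1) =
    pr P (A `&` ~` stay l) + pr P (stay l `&` [set w : D | far x eps (w (tick l.+1))]).
  rewrite -prU//.
  - congr pr; rewrite /= setCI setCK setIUr; apply/seteqP; split => w /=.
      move=> [[Aw nS]|[Aw F]]; first by left.
      by have [Sw|nS] := pselect (stay l w); [right|left].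
    by move=> [[Aw nS]|[Sw F]]; [left|right; split=> //; exact: stay_sub Sw].
  - by apply: measurableI => //; exact: measurableC.
  - by apply/seteqP; split => // w [[_ h1] [h2 _]].
rewrite E3 /= -natr1 mulrDl mul1r mulrDr.
by move: E1 E2 h IH; lra.
Qed.

End Law.
End Stopped.

(** The barrier is 0 at the start and 1 in the far set, so its mean dominates the exit probability.
    Its drift gives the linear bound; the drift of its square, itself controlled by the barrier,
    gives the quadratic one. Neither depends on the mesh of the ticks. *)
Lemma exit_bound (eps : R) : 0 < eps -> exists2 C : R, 0 <= C &
  forall N x_init (P : probability (borel D) R) x A u d l,
  (0 < N)%N -> zrp_law r g N x_init P -> 0 <= u -> 0 <= d -> nf u A ->
  simplex_grid N x -> A `<=` [set w : D | w u = x] ->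
  pr P (A `&` [set w : D | far x eps (w (u + d))]) <= C * d * pr P A /\
  pr P (A `&` [set w : D | exists2 i, (0 < i <= l)%N & far x eps (w (tick u d i))]) <=
    C * (l%:R * d) * (l%:R * d + N%:R^-1 ^+ 2) * pr P A.
Proof.
move=> eps0.
have [C C0 CP] := barrier r_ge0 r_irr m_inv m_ge0 g_ge0 gC ngC eps0.
exists (C + C ^+ 2) => [|N xi P x A u d l N0 law u0 d0 nA xg Ax].
  by rewrite addr_ge0// sqr_ge0.
have [F [F01 Fx F1 FC]] := CP x xg.1.
have F0 y : 0 <= F y by have /andP[] := F01 y.
have mA := nfm nA.
have farF y : simplex_grid N y -> far x eps y -> F y = 1.
  by move=> yg fy; apply: F1 => //; exact: yg.1.
have mst i := stay_measurable x eps u0 d0 nA i.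
have pst i : pr P (stay x eps A u d i) <= pr P A by apply: prS => //; exact: stay_sub.
have p0 : 0 <= pr P A := pr_ge0 _ _.
have Ex0 B t : 0 <= t -> 0 <= Ex N P B t F.
  by move=> t0; apply: sumr_ge0 => y _; rewrite mulr_ge0// pr_ge0.
have genF B t : 0 <= t -> measurable (B : set (borel D)) -> pr P B <= pr P A ->
    Ex N P B t (zrp_gen r g N F) <= C * pr P A.
  move=> t0 mB BA; apply: (@le_trans _ _ (Ex N P B t (fun=> C))).
    by apply: Ex_le => // y yg; exact: (FC N y N0 yg).1.
  by rewrite (Ex_cst N0 law)// ler_wpM2l.
have ExA : Ex N P A u F = 0 by rewrite (Ex_at N0 P _ xg Ax)// Fx mul0r.
(* The first pass: both the probability of having left and the mean of [F] on the remaining event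
   are bounded by C times the elapsed time. *)
have first k : Ex N P (stay x eps A u d k) (tick u d k) F + pr P (A `&` ~` stay x eps A u d k)
    <= C * pr P A * (k%:R * d).
  have := @stopping_le x eps A u d u0 d0 nA N xi P N0 law F (C * pr P A) k farF F0.
  rewrite ExA add0r; apply=> i v _ /andP[v0 vd]; apply: genF => //.
  by rewrite addr_ge0// tick_ge0.
split.
  have := first 1%N; rewrite mul1r => h.
  apply: (@le_trans _ _ (C * d * pr P A)); last first.
    by rewrite -!mulrA ler_wpM2r ?mulr_ge0// lerDl sqr_ge0.
  have {}h : pr P (A `&` ~` stay x eps A u d 1) <= C * pr P A * d.
    by apply: le_trans h; rewrite lerDr Ex0// tick_ge0.
  rewrite mulrAC; apply: le_trans h; apply: prS.
  - by apply: measurableI => //; apply: eval_measurable; exact: far_open.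
  - by apply: measurableI => //; apply: measurableC; exact: mst.
  - by move=> w [Aw /= fw]; split=> // -[_]; apply; rewrite /tick mul1r.
rewrite -stayE.
have i0 : 0 <= N%:R^-1 ^+ 2 :> R by rewrite sqr_ge0.
pose h := l%:R * d.
have h0 : 0 <= h by rewrite mulr_ge0.
(* The second pass, with F^2. Before the exit the mean of [F] is at most [C * h], so the drift of
   F^2 is at most C (C h + N^-2) times the probability of [A]. *)
have := @stopping_le x eps A u d u0 d0 nA N xi P N0 law (fun y => F y ^+ 2)
   (C * (C * h + N%:R^-1 ^+ 2) * pr P A) l.
have -> : Ex N P A u (fun y => F y ^+ 2) = 0.
  by rewrite (Ex_at N0 P _ xg Ax)// Fx expr0n mul0r.
rewrite add0r => H.
apply: (@le_trans _ _ (C * (C * h + N%:R^-1 ^+ 2) * pr P A * (l%:R * d))); last first.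
  rewrite -/h.
  have H1 : (0 <= C * h * h * pr P A) by rewrite !mulr_ge0.
  have H2 : (0 <= C ^+ 2 * h * N%:R^-1 ^+ 2 * pr P A) by rewrite !mulr_ge0// sqr_ge0.
  by move: H1 H2; set q := _^-1 ^+ 2; set p := pr P A; lra.
apply: le_trans (H _ _ _).
- by rewrite lerDr; apply: sumr_ge0 => y _; rewrite mulr_ge0 ?pr_ge0 ?sqr_ge0.
- by move=> y yg fy; rewrite farF// expr1n.
- by move=> y; exact: sqr_ge0.
move=> i v il /andP[v0 vd].
have ti0 : 0 <= tick u d i + v by rewrite addr_ge0// tick_ge0.
apply: (@le_trans _ _ (Ex N P (stay x eps A u d i) (tick u d i + v)
    (fun y => C * F y + C * N%:R^-1 ^+ 2))).
  by apply: Ex_le => // y yg; rewrite -mulrDr; exact: (FC N y N0 yg).2.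
rewrite ExD ExZ (Ex_cst N0 law)//.
have E1 : Ex N P (stay x eps A u d i) (tick u d i + v) F <= C * pr P A * h.
  apply: (@le_trans _ _ (Ex N P (stay x eps A u d i) (tick u d i) F + C * pr P A * v)).
    apply: (@dynkin_le _ _ r m g Cg r_ge0 m_ge0 g_ge0 g_0 gC N N0 xi P law) => //.
    - exact: tick_ge0.
    - exact: stay_past.
    - move=> u' /andP[u'0 u'v]; apply: genF => //.
      by rewrite addr_ge0// tick_ge0.
  have := first i; have := pr_ge0 P (A `&` ~` stay x eps A u d i).
  have C1 : 0 <= C * pr P A by rewrite mulr_ge0.
  have h1 : C * pr P A * v + C * pr P A * (i%:R * d) <= C * pr P A * h.
    rewrite -mulrDr ler_wpM2l//; apply: (@le_trans _ _ (i.+1%:R * d)).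
      by rewrite -natr1 mulrDl mul1r addrC lerD2l.
    by rewrite /h ler_wpM2r// ler_nat.
  by move: h1; lra.
have E2 := ler_wpM2l C0 E1.
have E3 : C * N%:R^-1 ^+ 2 * pr P (stay x eps A u d i) <= C * N%:R^-1 ^+ 2 * pr P A.
  by rewrite ler_wpM2l// mulr_ge0.
by move: E2 E3; set q := _^-1 ^+ 2; set p := pr P A; lra.
Qed.

End Exit.

(** * Functions on the simplex *)

Section SimplexAnalysis.
Variables (R : realType) (n : nat).
Local Notation S := 'I_n.+1.
Local Notation V := 'rV[R]_n.+1.

(** Restricted to the simplex, outside of which the values of a function are arbitrary. *)
Definition unif_cts (f : V -> R) := forall eta, 0 < eta -> exists2 d, 0 < d &
  forall x y, simplex x -> simplex y -> `|x - y| < d -> `|f x - f y| < eta.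

Lemma simplex_coord_le1 (x : V) j : simplex x -> 0 <= x 0 j <= 1.
Proof.
move=> [x0 x1]; rewrite x0/= -x1 (bigD1 j)//= lerDl.
by apply: sumr_ge0 => *; exact: x0.
Qed.

Lemma norm_le (x : V) B : 0 <= B -> (forall j, `|x 0 j| <= B) -> `|x| <= B.
Proof.
move=> B0 xB; rewrite [leLHS]mx_normrE; apply/bigmax_leP; split => // -[i j] _ /=.
by rewrite (ord1 i) xB.
Qed.

Lemma norm_lt (x : V) B : 0 < B -> (forall j, `|x 0 j| < B) -> `|x| < B.
Proof.
move=> B0 xB; rewrite [ltLHS]mx_normrE; apply/bigmax_ltP; split => // -[i j] _ /=.
by rewrite (ord1 i) xB.
Qed.

Lemma simplex_compact : compact (simplex : set V).
Proof.
apply: bounded_closed_compact.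
  exists 1; split => // M M1 x xS; apply: norm_le => [|j].
    by rewrite (le_trans _ (ltW M1)).
  have /andP[x0 x1] := simplex_coord_le1 j xS.
  by rewrite ger0_norm// (le_trans x1)// ltW.
have -> : (simplex : set V) = ~` ([set x | exists j, x 0 j < 0] `|`
    [set x | \sum_j x 0 j != 1]).
  apply/seteqP; split => x /=.
    move=> [x0 x1] [[j]|]; first by rewrite ltNge x0.
    by rewrite x1 eqxx.
  move=> /not_orP[/forallNP h1 /negP/negPn/eqP h2]; split=> // j.
  by rewrite leNgt; apply/negP/h1.
apply: open_closedC; apply: openU; apply: normP_open => y /=.
  move=> [j yj]; exists (- y 0 j); first by rewrite oppr_gt0.
  move=> z zy; exists j; have := le_lt_trans (coord_le_norm (z - y) j) zy.
  by rewrite !mxE; have := ler_norm (z 0 j - y 0 j); lra.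
move=> y1; exists (`|\sum_j y 0 j - 1| / n.+1%:R).
  by rewrite divr_gt0// normr_gt0 subr_eq0.
move=> z zy; apply/eqP => z1; move: zy; rewrite ltNge => /negP; apply.
rewrite ler_pdivrMr// mulrC.
have -> : \sum_j y 0 j - 1 = \sum_j (y 0 j - z 0 j) by rewrite sumrB z1.
apply: (le_trans (ler_norm_sum _ _ _)).
have -> : n.+1%:R * `|z - y| = \sum_(j < n.+1) `|z - y|.
  by rewrite sumr_const card_ord mulr_natl.
apply: ler_sum => j _; rewrite distrC; apply: le_trans (coord_le_norm _ j).
by rewrite !mxE.
Qed.

Lemma within_simplexP (f : V -> R) : {within simplex, continuous f} ->
  forall x, simplex x -> forall eta, 0 < eta -> exists2 d, 0 < d &
  forall y, simplex y -> `|x - y| < d -> `|f x - f y| < eta.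
Proof.
move=> /subspace_continuousP cf x xS eta eta0.
have /cvgrPdist_lt/(_ _ eta0) := cf x xS.
rewrite near_withinE => /(@nbhs_normP R)[d d0 Hd].
by exists d => // y yS xy; apply: Hd.
Qed.

Lemma within_simplexI (f : V -> R) :
  (forall x, simplex x -> forall eta, 0 < eta -> exists2 d, 0 < d &
    forall y, simplex y -> `|x - y| < d -> `|f x - f y| < eta) ->
  {within simplex, continuous f}.
Proof.
move=> H; apply/subspace_continuousP => x xS; apply/cvgrPdist_lt => eta eta0.
have [d d0 Hd] := H x xS eta eta0.
rewrite near_withinE; apply: (iffRL (nbhs_normP (x : V) _)); exists d => // y /= xy yS.
exact: Hd.
Qed.

(** Heine's theorem, from the compactness of the simplex used in its near-covering form with the
    filter of radii tending to 0. *)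
Lemma unif_ctsP (f : V -> R) : {within simplex, continuous f} <-> unif_cts f.
Proof.
split=> [cf eta eta0|uf]; last first.
  apply: within_simplexI => x xS eta /uf[d d0 Hd].
  by exists d => // y yS; exact: Hd.
have /compact_near_coveringP/(_ R (0^'+)
  (fun d x => simplex x -> forall y, simplex y -> `|x - y| < d -> `|f x - f y| < eta)) :=
  simplex_compact.
have eta2 : 0 < eta / 2 by rewrite divr_gt0.
case=> [x xS|].
  have [d d0 Hd] := within_simplexP cf xS eta2.
  have d2 : 0 < d / 2 by rewrite divr_gt0.
  exists ([set x' | `|x - x'| < d / 2], [set e | e < d / 2]) => /=.
    split; first by apply: (iffRL (nbhs_normP (x : V) _)); exists (d / 2).
    exact: nbhs_right_lt.
  move=> [x' e] /= [xx' ed] x'S y yS x'y.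
  have h1 : `|f x - f x'| < eta / 2 by apply: Hd => //; move: xx' d0; lra.
  have h2 : `|f x - f y| < eta / 2.
    apply: Hd => //; rewrite -[x](subrK x') -addrA.
    by apply: (le_lt_trans (ler_normD _ _)); move: xx' ed x'y; lra.
  rewrite -[f x'](subrK (f x)) -addrA.
  apply: (le_lt_trans (ler_normD _ _)); rewrite distrC.
  by move: h1 h2; lra.
move=> d0 /= [] d00 H.
exists (d0 / 2) => [|x y xS yS xy]; first by rewrite divr_gt0.
have := H (d0 / 2); apply => //=.
  by rewrite sub0r normrN gtr0_norm ?divr_gt0//; move: d00 => /=; lra.
by rewrite divr_gt0.
Qed.

Lemma unif_cts_bounded f : unif_cts f ->
  exists2 B, 0 <= B & forall x, simplex x -> `|f x| <= B.
Proof.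
move=> /unif_ctsP cf.
have /compact_bounded : compact (f @` (simplex : set V)).
  by apply: continuous_compact => //; exact: simplex_compact.
move=> [B [_ fB]]; exists (Num.max B 0 + 1) => [|x xS].
  by rewrite addr_ge0// le_max lexx orbT.
apply: (fB (Num.max B 0 + 1)); last by exists x.
by rewrite (@le_lt_trans _ _ (Num.max B 0)) ?le_max ?lexx// ltrDl.
Qed.

Lemma unif_cts_cst c : unif_cts (fun=> c).
Proof. by move=> eta eta0; exists 1 => // x y _ _ _; rewrite subrr normr0. Qed.

Lemma unif_ctsD f g : unif_cts f -> unif_cts g -> unif_cts (fun x => f x + g x).
Proof.
move=> uf ug eta eta0; have eta2 : 0 < eta / 2 by rewrite divr_gt0.
have [d1 d10 H1] := uf _ eta2; have [d2 d20 H2] := ug _ eta2.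
exists (Num.min d1 d2) => [|x y xS yS]; first by rewrite lt_min d10.
rewrite lt_min => /andP[/(H1 _ _ xS yS) h1 /(H2 _ _ xS yS) h2].
rewrite [X in `|X|](_ : _ = (f x - f y) + (g x - g y)); last by ring.
by apply: (le_lt_trans (ler_normD _ _)); move: h1 h2; lra.
Qed.

Lemma unif_ctsM f g : unif_cts f -> unif_cts g -> unif_cts (fun x => f x * g x).
Proof.
move=> uf ug eta eta0.
have [B B0 fB] := unif_cts_bounded uf; have [C C0 gC] := unif_cts_bounded ug.
have e1 : 0 < eta / (2 * (C + 1)) by rewrite divr_gt0// mulr_gt0//; move: C0; lra.
have e2 : 0 < eta / (2 * (B + 1)) by rewrite divr_gt0// mulr_gt0//; move: B0; lra.
have [d1 d10 H1] := uf _ e1; have [d2 d20 H2] := ug _ e2.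
exists (Num.min d1 d2) => [|x y xS yS]; first by rewrite lt_min d10.
rewrite lt_min => /andP[/(H1 _ _ xS yS) h1 /(H2 _ _ xS yS) h2].
rewrite [X in `|X|](_ : _ = (f x - f y) * g x + f y * (g x - g y)); last by ring.
apply: (le_lt_trans (ler_normD _ _)); rewrite !normrM.
have l1 : `|f x - f y| * `|g x| <= eta / (2 * (C + 1)) * C.
  by apply: ler_pM => //; [exact: ltW|exact: gC].
have l2 : `|f y| * `|g x - g y| <= B * (eta / (2 * (B + 1))).
  by apply: ler_pM => //; [exact: fB|exact: ltW].
have l3 : eta / (2 * (C + 1)) * C < eta / 2.
  rewrite -mulrA ltr_pM2l// ltr_pdivrMl; last by move: C0; lra.
  by move: C0; lra.
have l4 : B * (eta / (2 * (B + 1))) < eta / 2.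
  rewrite mulrCA ltr_pM2l// ltr_pdivrMr; last by move: B0; lra.
  by move: B0; lra.
by move: l1 l2 l3 l4; lra.
Qed.

Lemma unif_cts_sum (I : Type) (s : seq I) (f : I -> V -> R) :
  (forall i, unif_cts (f i)) -> unif_cts (fun x => \sum_(i <- s) f i x).
Proof.
move=> uf; elim: s => [|i s IH].
  by under [X in unif_cts X]eq_fun do rewrite big_nil; exact: unif_cts_cst.
by under [X in unif_cts X]eq_fun do rewrite big_cons; exact: unif_ctsD.
Qed.

Lemma unif_cts_coord j : unif_cts (fun x => x 0 j).
Proof.
move=> eta eta0; exists eta => // x y _ _; apply: le_lt_trans.
by have := coord_le_norm (x - y) j; rewrite !mxE.
Qed.

Definition center : V := \row_j n.+1%:R^-1.

(** A homothety towards the centre, which pushes the whole simplex into its relative interior: it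
    transfers identities and estimates from the interior to the boundary. *)
Definition shrink (t : R) (x : V) : V := x + t *: (center - x).

Lemma shrinkE t (x : V) j : shrink t x 0 j = (1 - t) * x 0 j + t * n.+1%:R^-1.
Proof. by rewrite /shrink /center !mxE; ring. Qed.

Lemma shrink_int t (x : V) : 0 < t <= 1 -> simplex x -> simplex_int (shrink t x).
Proof.
move=> /andP[t0 t1] [x0 x1]; split => [j|].
  by rewrite shrinkE ltr_wpDl ?mulr_ge0 ?subr_ge0// mulr_gt0// invr_gt0.
under eq_bigr do rewrite shrinkE.
rewrite big_split/= -mulr_sumr x1 sumr_const card_ord mulr1 -[X in _ + X]mulr_natl mulrCA divff ?mulr1//.
by rewrite subrK.
Qed.

Lemma int_simplex (x : V) : simplex_int x -> simplex x.
Proof. by move=> [x0 x1]; split=> // j; exact: ltW. Qed.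

Lemma shrink_dist t (x : V) : 0 <= t -> simplex x -> `|x - shrink t x| <= t.
Proof.
move=> t0 xS; rewrite /shrink opprD addNKr normrN normrZ ger0_norm// ler_piMr//.
apply: norm_le => // j; rewrite !mxE ler_norml.
have /andP[x0 x1] := simplex_coord_le1 j xS.
have c0 : 0 <= n.+1%:R^-1 :> R by rewrite invr_ge0.
have c1 : n.+1%:R^-1 <= 1 :> R by rewrite invf_le1// ler1n.
by move: x0 x1 c0 c1; set c := _^-1; lra.
Qed.

Lemma unif_cts_eq f g : unif_cts f -> unif_cts g ->
  (forall x, simplex_int x -> f x = g x) -> forall x, simplex x -> f x = g x.
Proof.
move=> uf ug fg x xS; apply/eqP; rewrite -subr_eq0 -normr_le0.
apply/ler_addgt0Pl => eta eta0; rewrite addr0.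
have eta2 : 0 < eta / 2 by rewrite divr_gt0.
have [d1 d10 H1] := uf _ eta2; have [d2 d20 H2] := ug _ eta2.
pose t := Num.min (Num.min d1 d2 / 2) 1.
have m0 : 0 < Num.min d1 d2 by rewrite lt_min d10.
have t0 : 0 < t by rewrite lt_min divr_gt0//=.
have t1 : t <= 1 by rewrite ge_min lexx orbT.
have tm : t < Num.min d1 d2.
  by apply: (@le_lt_trans _ _ (Num.min d1 d2 / 2)); [rewrite ge_min lexx|move: m0; lra].
have xI := shrink_int (introT andP (conj t0 t1)) xS.
have := shrink_dist (ltW t0) xS => /le_lt_trans/(_ tm).
rewrite lt_min => /andP[/(H1 _ _ xS (int_simplex xI)) h1 /(H2 _ _ xS (int_simplex xI)) h2].
rewrite (_ : f x - g x = (f x - f (shrink t x)) - (g x - g (shrink t x))); last first.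
  by rewrite (fg _ xI); ring.
by apply: (le_trans (ler_normB _ _)); move: h1 h2; lra.
Qed.

Lemma tangent_jump (j k : S) : tangent (evec k - evec j : V).
Proof.
rewrite /tangent; under eq_bigr do rewrite /evec !mxE !eqxx/=.
have E (a : S) : \sum_(i < n.+1) (i == a)%:R = 1 :> R.
  by rewrite -[RHS](sum_evec (fun=> 1) a); apply: eq_bigr => i _; rewrite mulr1 eq_sym.
by rewrite sumrB !E subrr.
Qed.

Lemma int_segment (y u : V) : simplex_int y -> tangent u ->
  exists2 d : R, 0 < d & forall h, `|h| < d -> simplex_int (y + h *: u).
Proof.
move=> [y0 y1] tu.
have [k /andP[k0 _] ky] := @finite_lower_bound R 'I_n.+1 xpredT (fun j => y 0 j) (fun j _ => y0 j).
have u1 : 0 < `|u| + 1 by rewrite ltr_wpDl.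
exists (k / (`|u| + 1)); first by rewrite divr_gt0.
move=> h hd; split => [j|]; last first.
  under eq_bigr do rewrite !mxE.
  by rewrite big_split/= -mulr_sumr tu mulr0 addr0.
rewrite !mxE.
have : `|h * u 0 j| < k.
  rewrite normrM; apply: (@le_lt_trans _ _ (`|h| * (`|u| + 1))).
    by rewrite ler_wpM2l// (le_trans (coord_le_norm _ _))// lerDl.
  by rewrite -ltr_pdivlMr.
by rewrite ltr_norml => /andP[h1 _]; have := ky j isT; move: h1; lra.
Qed.

Lemma simplex_int_convex (y u : V) (e s : R) : simplex_int y -> simplex_int (y + e *: u) ->
  0 <= s <= e -> simplex_int (y + s *: u).
Proof.
move=> [y0 y1] [z0 z1] /andP[s0 se].
have [e0|e0] := eqVneq e 0.
  have -> : s = 0 by apply/le_anti; rewrite s0 -e0 se.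
  by rewrite scale0r addr0; split.
have ep : 0 < e by rewrite lt_def e0 (le_trans s0 se).
have tu : \sum_j u 0 j = 0.
  move: z1; under eq_bigr do rewrite !mxE.
  rewrite big_split/= y1 -mulr_sumr => /eqP; rewrite -subr_eq0 addrAC subrr add0r.
  by rewrite mulf_eq0 (negPf e0) => /eqP.
split => [j|]; last first.
  under eq_bigr do rewrite !mxE.
  by rewrite big_split/= -mulr_sumr tu mulr0 addr0.
have := z0 j; have := y0 j; rewrite !mxE => yj zj.
have := mulr_ge0 s0 (ltW zj).
rewrite -(pmulr_rgt0 _ ep) mulrDr => h.
have [->|sn] := eqVneq s 0; first by rewrite !(mul0r, mulr0, addr0) ?mulr_gt0.
have sp : 0 < s by rewrite lt_def sn.
have h1 : 0 < s * (y 0 j + e * u 0 j) by rewrite mulr_gt0.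
have h2 : 0 <= (e - s) * y 0 j by rewrite mulr_ge0 ?subr_ge0// ltW.
by move: h1 h2; lra.
Qed.

Lemma is_derive_line (F : V -> R) (y u : V) (s d : R) :
  is_derive (y + s *: u) u F d -> is_derive s (1 : R) (fun t : R => F (y + t *: u)) d.
Proof.
have E : (fun h : R => h^-1 *: (((fun t : R => F (y + t *: u)) \o shift s) (h *: (1 : R)) - F (y + s *: u))) =
    (fun h : R => h^-1 *: ((F \o shift (y + s *: u)) (h *: u) - F (y + s *: u))).
  apply/funext => h /=; congr (_ *: (F _ - _)).
  by rewrite /shift/= [h *: 1]mulr1 scalerDl addrCA.
move=> [df <-]; split; last by rewrite /derive E.
by move: df; rewrite /derivable E.
Qed.

(** At an interior point, small moves along a tangent direction stay in the simplex, so the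
    derivative ignores the values outside. *)
Lemma is_derive_simplex_eq (F G : V -> R) (y u : V) d : simplex_int y -> tangent u ->
  (forall z, simplex z -> F z = G z) -> is_derive y u G d -> is_derive y u F d.
Proof.
move=> yI tu FG [dG <-].
have [e e0 He] := int_segment yI tu.
have E : \forall h \near (0 : R)^', h^-1 *: ((G \o shift y) (h *: u) - G y) =
   h^-1 *: ((F \o shift y) (h *: u) - F y).
  rewrite /dnbhs near_withinE; apply: (iffRL (nbhs_normP (0 : R) _)).
  exists e => // h; rewrite /= sub0r normrN => hd _.
  rewrite (FG y (int_simplex yI)) FG//; apply: int_simplex.
  by rewrite addrC; exact: He.
have cF : (fun h : R => h^-1 *: ((F \o shift y) (h *: u) - F y)) @ (0 : R)^' --> 'D_u G y.
  apply: cvg_trans dG; apply: near_eq_cvg.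
  exact: E.
split; first by apply/cvg_ex; exists ('D_u G y).
exact/cvg_lim.
Qed.

Lemma Dtan_eq (u : V) (F G : V -> R) : {within simplex, continuous G} ->
  (forall x, simplex_int x -> is_derive x u F (G x)) ->
  forall x, simplex x -> Dtan u F x = G x.
Proof.
move=> cG dG x xS; rewrite /Dtan.
(* Shrunk copies of [x] are interior points arbitrarily close to it, so the limit defining [Dtan] is
   taken along a proper filter and is unique. *)
have PF : ProperFilter (within simplex_int (nbhs x)).
  apply: Build_ProperFilter_ex => A; rewrite /within/= => /(@nbhs_normP R)[e e0 He].
  pose t := Num.min (e / 2) 1.
  have t0 : 0 < t by rewrite lt_min divr_gt0//=.
  have t1 : t <= 1 by rewrite ge_min lexx orbT.
  have te : t < e by apply: (@le_lt_trans _ _ (e / 2)); [rewrite ge_min lexx|move: e0 => /=; lra].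
  exists (shrink t x); apply: He.
    by apply: le_lt_trans te; apply: shrink_dist => //; exact: ltW.
  by apply: shrink_int => //; rewrite t0.
apply: cvg_lim => //; apply/cvgrPdist_lt => eta eta0.
have [d d0 Hd] := within_simplexP cG xS eta0.
rewrite near_withinE; apply: (iffRL (nbhs_normP (x : V) _)); exists d => // y /= xy yI.
have [_ ->] := dG y yI.
by apply: Hd => //; exact: int_simplex.
Qed.

End SimplexAnalysis.

(** * Second-order expansions, uniform up to the boundary *)

Section Taylor.
Variables (R : realType) (n : nat).
Local Notation V := 'rV[R]_n.+1.

Lemma MVT_bound (f df : R -> R) (e B : R) : 0 <= e ->
  (forall s, 0 <= s <= e -> is_derive s (1 : R) f (df s)) ->
  (forall s, 0 <= s <= e -> `|df s| <= B) -> `|f e - f 0| <= B * e.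
Proof.
move=> e0 fd fB; have [->|en] := eqVneq e 0; first by rewrite subrr normr0 mulr0.
have ep : 0 < e by rewrite lt_def en.
have [x||c ce ->] := @MVT_segment R f df 0 e e0.
- by rewrite in_itv/= => /andP[x0 xe]; apply: fd; rewrite !ltW.
- apply: derivable_within_continuous => x; rewrite in_itv/= => xe.
  by have [] := fd x xe.
move: ce; rewrite in_itv/= => ce.
by rewrite subr0 normrM [`|e|]ger0_norm// ler_wpM2r// fB.
Qed.

Lemma shrink_cvg (F : V -> R) (z : V) : unif_cts F -> simplex z ->
  F (shrink i.+1%:R^-1 z) @[i --> \oo] --> F z.
Proof.
move=> uF zS; apply/cvgrPdist_lt => eta /uF[d d0 Hd].
have := near_infty_natSinv_lt (PosNum d0); apply: filterS => i /= id.
have i0 : 0 < i.+1%:R^-1 :> R by rewrite invr_gt0.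
have i1 : i.+1%:R^-1 <= 1 :> R by rewrite invf_le1// ler1n.
apply: Hd => //; first by apply: int_simplex; apply: shrink_int => //; rewrite i0.
by apply: le_lt_trans id; apply: shrink_dist => //; exact: ltW.
Qed.

Section Order2.
Variables (F G GG : V -> R) (u : V).
Hypothesis uF : unif_cts F.
Hypothesis uG : unif_cts G.
Hypothesis uGG : unif_cts GG.
Hypothesis dF : forall x, simplex_int x -> is_derive x u F (G x).
Hypothesis dG : forall x, simplex_int x -> is_derive x u G (GG x).

(** Two applications of the mean value bound, to the first-order remainder of [G] and then to the
    remainder of [F]. The modulus of continuity of [GG] alone fixes [e0], whence the uniformity in
    [x]. *)
Lemma taylor2_int eta : 0 < eta -> exists2 e0 : R, 0 < e0 &
  forall e x, 0 <= e <= e0 -> simplex_int x -> simplex_int (x + e *: u) ->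
  `|F (x + e *: u) - F x - e * G x - e ^+ 2 / 2 * GG x| <= eta * e ^+ 2.
Proof.
move=> /uGG[d d0 Hd].
have u1 : 0 < `|u| + 1 by rewrite ltr_wpDl.
exists (d / 2 / (`|u| + 1)); first by rewrite !divr_gt0.
move=> e x /andP[e0 ed] xI xeI.
have seg s : 0 <= s <= e -> simplex_int (x + s *: u) by apply: simplex_int_convex.
have GGs s : 0 <= s <= e -> `|GG (x + s *: u) - GG x| <= eta.
  move=> /andP[s0 se]; rewrite distrC; apply/ltW/Hd.
  - exact: int_simplex.
  - by apply/int_simplex/seg; rewrite s0.
  rewrite opprD addNKr normrN normrZ ger0_norm//.
  apply: (@le_lt_trans _ _ (d / 2)); last by move: d0; lra.
  apply: (@le_trans _ _ (e * (`|u| + 1))); last by rewrite -ler_pdivlMr.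
  by apply: ler_pM => //; rewrite lerDl.
pose psi1 s := G (x + s *: u) - G x - s * GG x.
have dpsi1 s : 0 <= s <= e -> is_derive s (1 : R) psi1 (GG (x + s *: u) - GG x).
  move=> /seg xs; have h := is_derive_line (dG xs).
  have h2 : is_derive s (1 : R) (fun s : R => s * GG x) (GG x).
    by apply: is_derive_eq; rewrite /GRing.scale/=; ring.
  have h3 := is_deriveB (is_deriveB h (is_derive_cst (G x) s 1)) h2.
  by apply: is_derive_eq; rewrite subr0.
have psi1_le s : 0 <= s <= e -> `|psi1 s| <= eta * e.
  move=> /andP[s0 se].
  have E0 : psi1 0 = 0 by rewrite /psi1 scale0r addr0 mul0r subr0 subrr.
  rewrite -[psi1 s]subr0 -E0.
  apply: (@le_trans _ _ (eta * s)).
    apply: (MVT_bound s0) => t /andP[t0 ts]; first by apply: dpsi1; rewrite t0 (le_trans ts).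
    by apply: GGs; rewrite t0 (le_trans ts).
  rewrite ler_wpM2l//; have := GGs 0; rewrite lexx e0 => /(_ isT); apply: le_trans.
  exact: normr_ge0.
pose psi s := F (x + s *: u) - F x - s * G x - s ^+ 2 / 2 * GG x.
have dpsi s : 0 <= s <= e -> is_derive s (1 : R) psi (psi1 s).
  move=> /seg xs; have h := is_derive_line (dF xs).
  have h2 : is_derive s (1 : R) (fun s : R => s * G x) (G x).
    by apply: is_derive_eq; rewrite /GRing.scale/=; ring.
  have h4 : is_derive s (1 : R) (fun s : R => s ^+ 2 / 2 * GG x) (s * GG x).
    apply: is_derive_eq; rewrite /GRing.scale/=. by field.
  have h3 := is_deriveB (is_deriveB (is_deriveB h (is_derive_cst (F x) s 1)) h2) h4.
  by apply: is_derive_eq; rewrite subr0.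
have E0 : psi 0 = 0.
  by rewrite /psi scale0r addr0 expr0n/= !mul0r !subr0 subrr.
have := MVT_bound e0 dpsi psi1_le; rewrite E0 subr0 /psi => h.
by apply: (le_trans h); rewrite expr2 mulrA.
Qed.

(** Shrinking sends the segment to an interior one, with the same direction and length multiplied by
    1 - t; the estimate passes to the limit as t tends to 0. *)
Lemma taylor2 eta : 0 < eta -> exists2 e0 : R, 0 < e0 &
  forall e x, 0 <= e <= e0 -> simplex x -> simplex (x + e *: u) ->
  `|F (x + e *: u) - F x - e * G x - e ^+ 2 / 2 * GG x| <= eta * e ^+ 2.
Proof.
move=> eta0; have [e0 e00 H] := taylor2_int eta0; exists e0 => // e x /andP[ep ee0] xS xeS.
pose t i : R := i.+1%:R^-1.
have t0 i : 0 < t i by rewrite invr_gt0.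
have t1 i : t i <= 1 by rewrite invf_le1// ler1n.
have tc : t i @[i --> \oo] --> (0 : R) by exact: cvg_harmonic.
pose e_ i := (1 - t i) * e.
have ec : e_ i @[i --> \oo] --> e.
  have : e_ i @[i --> \oo] --> (1 - 0) * e.
    by apply: cvgMl; apply: cvgB => //; exact: cvg_cst.
  by rewrite subr0 mul1r.
pose E i := F (shrink (t i) (x + e *: u)) - F (shrink (t i) x) - e_ i * G (shrink (t i) x) -
  e_ i ^+ 2 / 2 * GG (shrink (t i) x).
have cE : E i @[i --> \oo] --> F (x + e *: u) - F x - e * G x - e ^+ 2 / 2 * GG x.
  apply: cvgB; first apply: cvgB; first apply: cvgB.
  - exact: shrink_cvg.
  - exact: shrink_cvg.
  - by apply: cvgM => //; exact: shrink_cvg.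
  - apply: cvgM; last exact: shrink_cvg.
    by apply: cvgMl; rewrite expr2; under eq_fun do rewrite expr2; exact: cvgM.
have EH i : `|E i| <= eta * e ^+ 2.
  have ei0 : 0 <= e_ i by rewrite mulr_ge0// subr_ge0.
  have eie : e_ i <= e by rewrite ler_piMl// gerBl ltW.
  have shE : shrink (t i) (x + e *: u) = shrink (t i) x + e_ i *: u.
    by apply/rowP => j; rewrite shrinkE [RHS]mxE shrinkE !mxE /e_; ring.
  have tt : 0 < t i <= 1 by rewrite t0 t1.
  have := H (e_ i) (shrink (t i) x); rewrite ei0 (le_trans eie ee0) => /(_ isT).
  move=> /(_ (shrink_int tt xS)); rewrite -shE => /(_ (shrink_int tt xeS)) h.
  by apply: (le_trans h); rewrite ler_wpM2l ?(ltW eta0)// lerXn2r.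
by apply: (ler_cvg_to (cvg_norm cE) (cvg_cst _)); exact: nearW.
Qed.

End Order2.
End Taylor.

(** * Additivity of directional derivatives *)

Section DirectionalSum.
Variables (R : realType) (n : nat).
Local Notation V := 'rV[R]_n.+1.
Variable H : V -> R.

(** A one-sided directional derivative. [Cn_simplex] provides each direction separately, so
    linearity in the direction has to be derived; the one-sided notion suffices as only nonnegative
    combinations occur. *)
Definition slope (y u : V) (d : R) := forall eta, 0 < eta ->
  exists2 e0 : R, 0 < e0 & forall e, 0 < e <= e0 ->
    `|H (y + e *: u) - H y - e * d| <= eta * e.

Lemma slope_unique y u d d' : slope y u d -> slope y u d' -> d = d'.
Proof.
move=> h h'; apply/eqP; rewrite -subr_eq0 -normr_le0.
apply/ler_addgt0Pl => eta eta0; rewrite addr0.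
have eta2 : 0 < eta / 2 by rewrite divr_gt0.
have [e1 e10 H1] := h _ eta2; have [e2 e20 H2] := h' _ eta2.
pose e := Num.min e1 e2.
have e0 : 0 < e by rewrite lt_min e10.
have h1 := H1 e; have h2 := H2 e.
rewrite e0 ge_min lexx in h1; rewrite e0 ge_min lexx orbT in h2.
have {}h1 := h1 isT; have {}h2 := h2 isT.
rewrite -(ler_pM2l e0) -[X in X * `|_|](gtr0_norm e0) -normrM.
rewrite [X in `|X|](_ : _ = (H (y + e *: u) - H y - e * d') - (H (y + e *: u) - H y - e * d)); last by ring.
by apply: (le_trans (ler_normB _ _)); move: h1 h2; lra.
Qed.

Lemma slope0 y : slope y 0 0.
Proof.
move=> eta eta0; exists 1 => // e /andP[e0 _].
by rewrite scaler0 addr0 subrr mulr0 subr0 normr0 mulr_ge0// ltW.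
Qed.

Lemma slope_derive y u d : is_derive y u H d -> slope y u d.
Proof.
move=> [dH <-] eta eta0.
have /cvgrPdist_le/(_ _ eta0) : (fun h : R => h^-1 *: ((H \o shift y) (h *: u) - H y)) @ (0 : R)^' --> 'D_u H y.
  exact: dH.
rewrite /dnbhs near_withinE => /(@nbhs_normP R)[d0 /= d00 Hd].
exists (d0 / 2) => [|e /andP[e0 ed]]; first by rewrite divr_gt0.
have ed0 : e < d0 by apply: (le_lt_trans ed); move: d00; lra.
have en0 : e != 0 by rewrite gt_eqF.
have h : `|'D_u H y - e^-1 *: (H (e *: u + y) - H y)| <= eta.
  by apply: Hd => //=; rewrite sub0r normrN gtr0_norm.
rewrite [y + _]addrC.
have -> : H (e *: u + y) - H y - e * 'D_u H y =
    e * - ('D_u H y - e^-1 *: (H (e *: u + y) - H y)).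
  by rewrite /GRing.scale/=; field.
by rewrite normrM normrN gtr0_norm// mulrC ler_wpM2r// ltW.
Qed.

Variables (u : V) (G GG : V -> R).
Hypothesis uH : unif_cts H.
Hypothesis uG : unif_cts G.
Hypothesis uGG : unif_cts GG.
Hypothesis dH : forall x, simplex_int x -> is_derive x u H (G x).
Hypothesis dG : forall x, simplex_int x -> is_derive x u G (GG x).

(** Move along [w] first, then along [u] from the displaced point: the Taylor expansion is uniform
    in its base point, and [G] there is close to [G y] by continuity. *)
Lemma slopeD y w d a : simplex_int y -> tangent u -> tangent w -> 0 <= a ->
  slope y w d -> slope y (w + a *: u) (d + a * G y).
Proof.
move=> yI tu tw a0 hw.
have [->|an] := eqVneq a 0; first by rewrite scale0r mul0r !addr0.
have {an}a0 : 0 < a by rewrite lt_def an.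
move=> eta eta0.
have eta4 : 0 < eta / 4 by rewrite divr_gt0.
have [e1 e10 H1] := hw _ eta4.
have [e2 e20 H2] := taylor2 uH uG uGG dH dG (@ltr01 R).
have [d3 d30 H3] := uG (divr_gt0 eta4 a0).
have tu' : tangent (w + a *: u).
  rewrite /tangent; under eq_bigr do rewrite !mxE.
  by rewrite big_split/= -mulr_sumr tu tw mulr0 addr0.
have [d4 d40 H4] := int_segment yI tw.
have [d5 d50 H5] := int_segment yI tu'.
have [B B0 GB] := unif_cts_bounded uGG.
have w1 : 0 < `|w| + 1 by rewrite ltr_wpDl.
have c0 : 0 < a ^+ 2 * (B + 1) by rewrite mulr_gt0 ?exprn_gt0//; move: B0; lra.
pose e0 := Num.min (Num.min e1 (e2 / a)) (Num.min (Num.min (d3 / 2 / (`|w| + 1)) (d4 / 2))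
   (Num.min (d5 / 2) (eta / 4 / (a ^+ 2 * (B + 1))))).
exists e0 => [|e /andP[ep]]; first by rewrite !lt_min !divr_gt0// e10.
rewrite !le_min => /andP[/andP[l1 l2] /andP[/andP[l3 l4] /andP[l5 l6]]].
have P1 := int_simplex (H4 e _); have P2 := int_simplex (H5 e _).
have {}P1 : simplex (y + e *: w) by apply: P1; rewrite gtr0_norm//; move: l4 d40; lra.
have {}P2 : simplex (y + e *: (w + a *: u)).
  by apply: P2; rewrite gtr0_norm//; move: l5 d50; lra.
have E : y + e *: (w + a *: u) = (y + e *: w) + (e * a) *: u by rewrite scalerDr scalerA addrA.
rewrite E in P2 *.
have ea : 0 <= e * a <= e2 by apply/andP; split; [apply: mulr_ge0; exact: ltW|rewrite -ler_pdivlMr].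
have h2 := H2 _ _ ea P1 P2.
have h1 := H1 e (introT andP (conj ep l1)).
have h3 : `|G y - G (y + e *: w)| < eta / 4 / a.
  apply: H3 => //; first exact: int_simplex.
  rewrite opprD addNKr normrN normrZ gtr0_norm//.
  apply: (@le_lt_trans _ _ (d3 / 2)); last by move: d30; lra.
  apply: (@le_trans _ _ (e * (`|w| + 1))); last by rewrite -ler_pdivlMr.
  by rewrite ler_wpM2l ?(ltW ep)// lerDl.
have h3' : `|e * a * (G (y + e *: w) - G y)| <= eta / 4 * e.
  rewrite normrM gtr0_norm ?mulr_gt0// [leLHS](_ : _ = `|G (y + e *: w) - G y| * a * e); last by ring.
  by apply: ler_wpM2r; [exact: ltW|rewrite -ler_pdivlMr// distrC ltW].
have h4 : `|(e * a) ^+ 2 / 2 * GG (y + e *: w)| <= (e * a) ^+ 2 / 2 * B.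
  rewrite normrM ger0_norm ?divr_ge0 ?sqr_ge0// ler_wpM2l ?divr_ge0 ?sqr_ge0//.
  exact: GB.
have h5 : a ^+ 2 * (B + 1) * e ^+ 2 <= eta / 4 * e.
  by rewrite expr2 mulrA ler_wpM2r ?(ltW ep)// mulrC -ler_pdivlMr.
have h6 : 0 <= a ^+ 2 * e ^+ 2 * B by apply: mulr_ge0 => //; apply: mulr_ge0; exact: sqr_ge0.
rewrite mul1r exprMn in h2; rewrite exprMn in h4.
set X := H (_ + (e * a) *: u) in h2 *; set Y := H (y + e *: w) in h1 h2.
set g2 := GG (y + _) in h2 h4; set g1 := G (y + _) in h2 h3'.
rewrite [Z in `|Z|](_ : _ = (X - Y - e * a * g1 - e ^+ 2 * a ^+ 2 / 2 * g2) +
  (Y - H y - e * d) + e * a * (g1 - G y) + e ^+ 2 * a ^+ 2 / 2 * g2); last by field.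
apply: (le_trans (ler_normD _ _)); move: h4; set N4 := `|e ^+ 2 * _ / 2 * g2|.
have := ler_normD ((X - Y - e * a * g1 - e ^+ 2 * a ^+ 2 / 2 * g2) +
  (Y - H y - e * d)) (e * a * (g1 - G y)).
have := ler_normD (X - Y - e * a * g1 - e ^+ 2 * a ^+ 2 / 2 * g2) (Y - H y - e * d).
have etae : 0 <= eta * e by rewrite mulr_ge0// ltW.
by move: h1 h2 h3' h5 h6 etae; lra.
Qed.

End DirectionalSum.

(** * Expansion of the generator on D_S *)

Section GeneratorExpansion.
Variables (R : realType) (n : nat).
Local Notation S := 'I_n.+1.
Local Notation V := 'rV[R]_n.+1.
Variables (r : S -> S -> R) (m : S -> R) (b : R) (g : S -> nat -> R) (Cg : R).
Hypothesis r_ge0 : forall j k, 0 <= r j k.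
Hypothesis m_inv : forall k, \sum_j m j * r j k = m k * \sum_l r k l.
Hypothesis m_ge0 : forall j, 0 <= m j.
Hypothesis g_ge0 : forall j k, 0 <= g j k.
Hypothesis g_0 : forall j, g j 0%N = 0.
Hypothesis gC : forall j k, `|g j k - m j| <= Cg.
Hypothesis ngC : forall j k, k%:R * `|g j k - m j| <= Cg.
Hypothesis g_lim : forall j, k%:R * (g j k - m j) @[k --> \oo] --> b * m j.

Lemma unif_cts_ext (f h : V -> R) : (forall x, simplex x -> f x = h x) ->
  unif_cts f -> unif_cts h.
Proof.
move=> fh uf eta /uf[d d0 H]; exists d => // x y xS yS xy.
by rewrite -!fh//; exact: H.
Qed.

Lemma tangent_sum (I : Type) (s : seq I) (a : I -> R) (u : I -> V) :
  (forall i, tangent (u i)) -> tangent (\sum_(i <- s) a i *: u i).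
Proof.
move=> tu; rewrite /tangent; under eq_bigr do rewrite summxE.
rewrite exchange_big/= big1// => i _.
under eq_bigr do rewrite mxE.
by rewrite -mulr_sumr tu mulr0.
Qed.

Section Slopes.
Variables (H : V -> R) (I : Type) (u : I -> V) (G GG : I -> V -> R).
Hypothesis uH : unif_cts H.
Hypothesis uG : forall i, unif_cts (G i).
Hypothesis uGG : forall i, unif_cts (GG i).
Hypothesis tu : forall i, tangent (u i).
Hypothesis dH : forall i x, simplex_int x -> is_derive x (u i) H (G i x).
Hypothesis dG : forall i x, simplex_int x -> is_derive x (u i) (G i) (GG i x).

Lemma slope_sum (s : seq I) (a : I -> R) y : simplex_int y ->
  (forall i, 0 <= a i) ->
  slope H y (\sum_(i <- s) a i *: u i) (\sum_(i <- s) a i * G i y).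
Proof.
move=> yI a0; elim: s => [|i s IH]; first by rewrite !big_nil; exact: slope0.
rewrite !big_cons addrC [X in slope _ _ _ X]addrC.
by apply: (slopeD uH (uG i) (uGG i) (dH i) (dG i)) => //; exact: tangent_sum.
Qed.

End Slopes.

(** Moving all the mass of [j] to another site reaches the face at distance at most x_j, where [W]
    vanishes. *)
Lemma near_face (W : V -> R) j : unif_cts W ->
  (forall x, simplex x -> x 0 j = 0 -> W x = 0) ->
  forall eta, 0 < eta -> exists2 d, 0 < d &
  forall x, simplex x -> x 0 j < d -> `|W x| < eta.
Proof.
move=> uW W0 eta /uW[d d0 Hd].
exists (Num.min d 1) => [|x xS]; first by rewrite lt_min d0 ltr01.
rewrite lt_min => /andP[xd x1].
(* A single site would carry mass 1, which the bound [x 0 j < 1] excludes. *)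
have [k kj] : exists k, k != j.
  apply: contrapT => /forallNP H; have [_] := xS; rewrite (bigD1 j)//= big1.
    by rewrite addr0 => E; move: x1; rewrite E ltxx.
  by move=> k kj; have := H k.
pose z := x + x 0 j *: (evec k - evec j).
have zE i : z 0 i = x 0 i + x 0 j * ((k == i)%:R - (j == i)%:R).
  by rewrite /z /evec !mxE !eqxx/= ![i == _]eq_sym.
have [x0 xs] := xS.
have zS : simplex z.
  split => [i|].
    rewrite zE; case: (j =P i) => [<-|_]; last by rewrite subr0 addr_ge0// mulr_ge0.
    by rewrite (negPf kj) sub0r mulrN1 subrr.
  under eq_bigr do rewrite zE.
  rewrite big_split/= xs -mulr_sumr sumrB.
  have E (a : S) : \sum_i (a == i)%:R = 1 :> R.
    by rewrite -[RHS](sum_evec (fun=> 1) a); apply: eq_bigr => i _; rewrite mulr1.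
  by rewrite !E subrr mulr0 addr0.
have zj : z 0 j = 0 by rewrite zE eqxx (negPf kj) sub0r mulrN1 subrr.
have := Hd x z xS zS; rewrite (W0 z zS zj) subr0; apply.
apply: norm_lt => // i; rewrite !mxE opprD addrA subrr sub0r normrN !eqxx/=.
rewrite normrM ger0_norm//; apply: le_lt_trans xd; rewrite ler_piMr//.
by do 2 case: (i == _); rewrite ?subrr ?sub0r ?subr0 ?normrN ?normr1 ?normr0.
Qed.

(** Either the occupation number is large and k (g_j(k) - m_j) is close to b m_j, or it is bounded,
    in which case x_j is of order 1/N and [W j] is small; the other factor is bounded in both
    cases. *)
Lemma boundary_drift (W : S -> V -> R) : (forall j, unif_cts (W j)) ->
  (forall j x, simplex x -> x 0 j = 0 -> W j x = 0) ->
  forall eta, 0 < eta -> exists N0, forall N y, (N0 <= N)%N -> (0 < N)%N ->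
  simplex_grid N y ->
  `|\sum_j ((occ N y j)%:R * (g j (occ N y j) - m j) - b * m j) * W j y| <= eta.
Proof.
move=> uW W0 eta eta0.
have /choice[B HB] (j : S) : exists B, 0 <= B /\ forall x, simplex x -> `|W j x| <= B.
  by have [B B0 HB] := unif_cts_bounded (uW j); exists B.
pose BB := 1 + \sum_j B j.
have BB0 : 0 < BB by rewrite ltr_pwDl// sumr_ge0// => j _; exact: (HB j).1.
have BBj j : B j <= BB.
  rewrite /BB (bigD1 j)//= addrCA lerDl addr_ge0// sumr_ge0// => k _; exact: (HB k).1.
pose L : R := n.+1%:R.
have L0 : 0 < L by rewrite ltr0n.
pose e1 := eta / L / BB.
have e10 : 0 < e1 by rewrite !divr_gt0.
have /choice[M HM] (j : S) : exists M, forall k, (M <= k)%N ->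
    `|k%:R * (g j k - m j) - b * m j| <= e1.
  have /cvgrPdist_le/(_ _ e10)[M _ HM] := @g_lim j.
  by exists M => k Mk; rewrite distrC; exact: HM.
pose C := Cg + `|b| * \sum_j m j + 1.
have mj (j : S) : m j <= \sum_j m j.
  by rewrite (bigD1 j)//= lerDl sumr_ge0.
have Cge0 : 0 <= Cg := le_trans (normr_ge0 _) (gC ord0 0).
have bm0 : 0 <= `|b| * \sum_j m j by rewrite mulr_ge0// sumr_ge0.
have C0 : 0 < C by rewrite /C; lra.
have HC j k : `|k%:R * (g j k - m j) - b * m j| <= C.
  apply: (le_trans (ler_normB _ _)); rewrite !normrM /C.
  have := ngC j k; rewrite normr_nat.
  have : `|b| * `|m j| <= `|b| * \sum_j m j.
    by rewrite ler_wpM2l// ger0_norm.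
  lra.
have e20 : 0 < eta / L / C by rewrite !divr_gt0.
have /choice[d Hd] (j : S) : exists d, 0 < d /\
    forall x, simplex x -> x 0 j < d -> `|W j x| < eta / L / C.
  by have [d d0 Hd] := near_face (uW j) (W0 j) e20; exists d.
have [dm /andP[dm0 _] dmP] := @finite_lower_bound R S xpredT d (fun j _ => (Hd j).1).
pose MM := (\sum_j M j).+1.
exists (Num.truncn (MM%:R / dm)).+1 => N y NN N0 yg.
apply: (le_trans (ler_norm_sum _ _ _)).
have -> : eta = \sum_(j < n.+1) eta / L.
  by rewrite sumr_const card_ord -[RHS]mulr_natr -mulrA mulVf ?mulr1// gt_eqF.
apply: ler_sum => j _; rewrite normrM.
have [Mo|Mo] := leqP (M j) (occ N y j).
  apply: (@le_trans _ _ (e1 * BB)); last by rewrite /e1 divfK// gt_eqF.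
  apply: ler_pM => //; first exact: HM.
  by apply: le_trans (BBj j); apply: (HB j).2; exact: yg.1.
apply: (@le_trans _ _ (C * (eta / L / C))); last by rewrite mulrC divfK// gt_eqF.
apply: ler_pM => //; apply/ltW/(Hd j).2; first exact: yg.1.
apply: lt_le_trans (dmP j isT).
have N0' : 0 < N%:R :> R by rewrite ltr0n.
rewrite -(ltr_pM2l N0') -occE//.
apply: (@lt_trans _ _ MM%:R).
  rewrite ltr_nat /MM ltnS; apply: (leq_trans (ltnW Mo)).
  by rewrite (bigD1 j)//= leq_addr.
rewrite -ltr_pdivrMr//; apply: lt_le_trans (_ : (Num.truncn (MM%:R / dm)).+1%:R <= _); last first.
  by rewrite ler_nat.
by rewrite truncnS_gt.
Qed.

Lemma tangent_vvec j : tangent (vvec r j).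
Proof.
rewrite /vvec; have := tangent_sum (index_enum _) (r j) (fun k => tangent_jump R j k).
by [].
Qed.

(** [W j] is v_j . grad H / x_j and [Psi j] collects the second derivatives. The first-order Taylor
    term is N sum_j (g_j - m_j) x_j W_j, and N x_j is the occupation number, so [boundary_drift]
    applies. The second-order term carries g_j in place of m_j; the difference is the remaining
    error. *)
Lemma gen_expansion (H : V -> R) : DS r H -> unif_cts H /\ exists Psi : S -> V -> R,
  [/\ forall j, unif_cts (Psi j), unif_cts (limit_gen r m b H)
    & forall eta, 0 < eta -> exists N0, forall N y, (N0 <= N)%N -> (0 < N)%N ->
      simplex_grid N y ->
      `|zrp_gen r g N H y - limit_gen r m b H y -
        2^-1 * \sum_j (g j (occ N y j) - m j) * Psi j y| <= eta].
Proof.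
move=> [[cH HC1] HW].
have uH : unif_cts H by exact/unif_ctsP.
split=> //.
have D1 (u : V) : tangent u -> exists G : V -> R, [/\ unif_cts G,
   forall x, simplex_int x -> is_derive x u H (G x) &
   exists GG, unif_cts GG /\ forall x, simplex_int x -> is_derive x u G (GG x)].
  move=> tu; have [G dH [cG HG]] := HC1 u tu; exists G; split => //; first exact/unif_ctsP.
  by have [GG dG [cGG _]] := HG u tu; exists GG; split=> //; exact/unif_ctsP.
pose du (p : S * S) : V := evec p.2 - evec p.1.
have /choice[G /all_and3[uG dH /choice[GG /all_and2[uGG dG]]]] (p : S * S) :=
  D1 (du p) (tangent_jump R p.1 p.2).
have /choice[Gv /all_and3[uGv dHv _]] (j : S) := D1 (vvec r j) (tangent_vvec j).
pose W (j : S) (x : V) : R := if 0 < x 0 j then Dtan (vvec r j) H x / x 0 j else 0.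
have uW j : unif_cts (W j) by apply/unif_ctsP; exact: HW.
have Dv j x : simplex x -> Dtan (vvec r j) H x = Gv j x.
  by apply: (@Dtan_eq _ _ _ _ (Gv j)) => //; exact/unif_ctsP.
(* True by definition in the interior and by continuity elsewhere: v_j . grad H vanishes on the face
   x_j = 0. *)
have GvW j x : simplex x -> Gv j x = x 0 j * W j x.
  apply: (@unif_cts_eq _ _ (Gv j) (fun x => x 0 j * W j x)) => //.
    by apply: unif_ctsM => //; exact: unif_cts_coord.
  move=> {}x xI; rewrite /W (xI.1 j) Dv; last exact: int_simplex.
  by rewrite mulrC divfK// gt_eqF// xI.1.
have D2 (p : S * S) x : simplex x -> Dtan (du p) (Dtan (du p) H) x = GG p x.
  apply: (@Dtan_eq _ _ _ _ (GG p)) => [|z zI]; first exact/unif_ctsP.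
  apply: (@is_derive_simplex_eq _ _ _ (G p)) => //; first exact: tangent_jump.
    by apply: (@Dtan_eq _ _ _ _ (G p)) => //; exact/unif_ctsP.
  exact: dG.
have GvG j x : simplex x -> Gv j x = \sum_k r j k * G (j, k) x.
  apply: (@unif_cts_eq _ _ (Gv j) (fun x => \sum_k r j k * G (j, k) x)) => //.
    apply: unif_cts_sum => k; apply: unif_ctsM => //; exact: unif_cts_cst.
  move=> {}x xI; apply: (@slope_unique _ _ H x (vvec r j)); first by apply: slope_derive; exact: dHv.
  apply: (@slope_sum H S (fun k => du (j, k)) (fun k => G (j, k)) (fun k => GG (j, k))) => //.
  by move=> k; exact: tangent_jump.
(* By invariance the combination of the v_j with weights m_j is the zero vector, along which the
   slope is 0. *)
have GvM x : simplex x -> \sum_j m j * Gv j x = 0.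
  apply: (@unif_cts_eq _ _ (fun x => \sum_j m j * Gv j x) (fun=> 0)) => //.
  - by apply: unif_cts_sum => k; apply: unif_ctsM => //; exact: unif_cts_cst.
  - exact: unif_cts_cst.
  move=> {}x xI; apply: (@slope_unique _ _ H x 0); last exact: slope0.
  have := @slope_sum H (S * S)%type du G GG uH uG uGG (fun p => tangent_jump R p.1 p.2) dH dG
    (index_enum _) (fun p => m p.1 * r p.1 p.2) x xI (fun p => mulr_ge0 (m_ge0 _) (r_ge0 _ _)).
  rewrite (_ : \sum_(p <- _) _ * G p x = \sum_j m j * Gv j x); last first.
    transitivity (\sum_j \sum_k m j * r j k * G (j, k) x).
      by rewrite pair_big/=; apply: eq_bigr => -[j k].
    apply: eq_bigr => j _; rewrite GvG; last exact: int_simplex.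
    by rewrite mulr_sumr; apply: eq_bigr => k _; rewrite mulrA.
  rewrite (_ : \sum_(p <- _) _ *: du p = 0)//.
  transitivity (\sum_j \sum_k (m j * r j k) *: (evec k - evec j : V)).
    by rewrite pair_big/=; apply: eq_bigr => -[j k].
  under eq_bigr do under eq_bigr do rewrite scalerBr.
  under eq_bigr do rewrite sumrB.
  rewrite sumrB exchange_big/= -sumrB big1// => k _.
  by rewrite -!scaler_suml -scalerBl m_inv -mulr_sumr subrr scale0r.
pose Psi j x := \sum_k r j k * GG (j, k) x.
have uPsi j : unif_cts (Psi j).
  by apply: unif_cts_sum => k; apply: unif_ctsM => //; exact: unif_cts_cst.
have LE x : simplex x -> limit_gen r m b H x = b * \sum_j m j * W j x + 2^-1 * \sum_j m j * Psi j x.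
  move=> xS; rewrite /limit_gen; congr (_ * _ + _ * _); apply: eq_bigr => j _.
    rewrite /W lt_def xS.1 andbT; case: eqP => _ /=; last by rewrite mulrA mulrAC.
    by rewrite mulr0.
  rewrite /Psi mulr_sumr; apply: eq_bigr => k _.
  by rewrite (D2 (j, k) x xS) mulrA.
exists Psi; split => //.
  apply: (@unif_cts_ext (fun x => b * \sum_j m j * W j x + 2^-1 * \sum_j m j * Psi j x)).
    by move=> x xS; rewrite LE.
  apply: unif_ctsD; apply: unif_ctsM; do ?exact: unif_cts_cst;
    by apply: unif_cts_sum => j; apply: unif_ctsM => //; exact: unif_cts_cst.
have W0 j x : simplex x -> x 0 j = 0 -> W j x = 0 by move=> _ xj; rewrite /W xj ltxx.
move=> eta eta0.
have eta2 : 0 < eta / 2 by rewrite divr_gt0.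
have [N1 HN1] := boundary_drift uW W0 eta2.
pose RB := rate_bound m Cg * rate_sum r.
have RB0 : 0 <= RB.
  by apply: mulr_ge0; [exact: (rate_bound_ge0 m_ge0 g_ge0 gC)|exact: rate_sum_ge0].
have e0 : 0 < eta / 2 / (RB + 1) by rewrite divr_gt0//; move: RB0; lra.
have /choice[ee Hee] (p : S * S) : exists e, 0 < e /\ forall e' x, 0 <= e' <= e ->
    simplex x -> simplex (x + e' *: du p) ->
    `|H (x + e' *: du p) - H x - e' * G p x - e' ^+ 2 / 2 * GG p x| <= eta / 2 / (RB + 1) * e' ^+ 2.
  by have [e e0' He] := taylor2 uH (uG p) (uGG p) (dH p) (dG p) e0; exists e.
have [em /andP[em0 _] emP] := @finite_lower_bound R (S * S)%type xpredT ee (fun p _ => (Hee p).1).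
exists (maxn N1 (Num.truncn em^-1).+1) => N y; rewrite geq_max => /andP[NN1 NN2] N0 yg.
have N0' : 0 < N%:R :> R by rewrite ltr0n.
have Nn0 : N%:R != 0 :> R by rewrite gt_eqF.
have Nem : N%:R^-1 <= em.
  rewrite invf_ple ?posrE//; apply: (@le_trans _ _ (Num.truncn em^-1).+1%:R).
    by apply/ltW; exact: truncnS_gt.
  by rewrite ler_nat.
have yS := yg.1.
pose T j k := H (jump N y j k) - H y - N%:R^-1 * G (j, k) y - N%:R^-1 ^+ 2 / 2 * GG (j, k) y.
pose gg j := g j (occ N y j).
have TE : `|\sum_j \sum_k gg j * r j k * (N%:R ^+ 2 * T j k)| <= eta / 2.
  apply: (@le_trans _ _ (RB * (eta / 2 / (RB + 1)))); last first.
    by rewrite mulrCA ler_piMr ?(ltW eta2)// ler_pdivrMr; move: RB0; lra.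
  apply: (le_trans (ler_norm_sum _ _ _)).
  apply: (@le_trans _ _ (\sum_j \sum_k gg j * r j k * (eta / 2 / (RB + 1)))).
    apply: ler_sum => j _; apply: (le_trans (ler_norm_sum _ _ _)); apply: ler_sum => k _.
    have [g0|yj] := rate_grid g_0 j yg; first by rewrite /gg g0 !mul0r normr0.
    rewrite normrM ger0_norm; last by rewrite mulr_ge0// /gg.
    apply: ler_wpM2l; first by rewrite mulr_ge0// /gg.
    have jg := jump_grid N0 k yg yj.
    have hN : 0 <= (N%:R^-1 : R) <= ee (j, k).
      rewrite (le_trans Nem (emP (j, k) isT)) andbT; apply: ltW; by rewrite invr_gt0.
    have := (Hee (j, k)).2 N%:R^-1 y hN yS jg.1; rewrite -/(T j k) => hT.
    rewrite normrM ger0_norm ?sqr_ge0// -(@ler_pM2l _ (N%:R^-1 ^+ 2)) ?exprn_gt0 ?invr_gt0//.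
    by rewrite mulrA -exprMn mulVf// expr1n mul1r mulrC.
  exact: (rates_sum_le r_ge0 m_ge0 g_ge0 gC y N (fun _ _ => lexx _) (ltW e0)).
have yo j : N%:R * y 0 j = (occ N y j)%:R by rewrite occE.
have D1E : N%:R * (\sum_j gg j * Gv j y) = \sum_j (occ N y j)%:R * (gg j - m j) * W j y.
  have -> : \sum_j gg j * Gv j y = \sum_j (gg j - m j) * Gv j y.
    under [RHS]eq_bigr do rewrite mulrBl.
    by rewrite sumrB GvM// subr0.
  rewrite mulr_sumr; apply: eq_bigr => j _.
  by rewrite GvW// -yo; ring.
have zE : zrp_gen r g N H y = \sum_j \sum_k gg j * r j k * (N%:R ^+ 2 * T j k) +
   (N%:R * (\sum_j gg j * Gv j y) + 2^-1 * \sum_j gg j * Psi j y).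
  rewrite zrp_genE !mulr_sumr -!big_split/=; apply: eq_bigr => j _.
  rewrite GvG// /Psi !mulr_sumr -!big_split/=; apply: eq_bigr => k _.
  by rewrite /T /gg; field.
rewrite zE D1E LE//.
have HN := HN1 N y NN1 N0 yg.
set TT := \sum_j \sum_k _ in TE *.
rewrite [X in `|X|](_ : _ = TT +
  \sum_j ((occ N y j)%:R * (g j (occ N y j) - m j) - b * m j) * W j y); last first.
  have -> : \sum_j ((occ N y j)%:R * (g j (occ N y j) - m j) - b * m j) * W j y =
     \sum_j (occ N y j)%:R * (gg j - m j) * W j y - b * \sum_j m j * W j y.
    by rewrite mulr_sumr -sumrB; apply: eq_bigr => j _; rewrite /gg; ring.
  have -> : \sum_j (g j (occ N y j) - m j) * Psi j y =
     \sum_j gg j * Psi j y - \sum_j m j * Psi j y.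
    by rewrite -sumrB; apply: eq_bigr => j _; rewrite /gg; ring.
  by ring.
by apply: (le_trans (ler_normD _ _)); move: TE HN; lra.
Qed.

End GeneratorExpansion.

(** * The corrector and the one-step estimate *)

Section OneStep.
Variables (R : realType) (n : nat).
Local Notation S := 'I_n.+1.
Local Notation V := 'rV[R]_n.+1.
Local Notation D := (cadlag_path R n).
Variables (r : S -> S -> R) (m : S -> R) (b : R) (g : S -> nat -> R) (Cg : R).
Hypothesis r_ge0 : forall j k, 0 <= r j k.
Hypothesis r_irr : forall j k, connect (fun i l => 0 < r i l) j k.
Hypothesis m_inv : forall k, \sum_j m j * r j k = m k * \sum_l r k l.
Hypothesis m_ge0 : forall j, 0 <= m j.
Hypothesis m_neq0 : exists j, m j != 0.
Hypothesis g_ge0 : forall j k, 0 <= g j k.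
Hypothesis g_0 : forall j, g j 0%N = 0.
Hypothesis gC : forall j k, `|g j k - m j| <= Cg.
Hypothesis ngC : forall j k, k%:R * `|g j k - m j| <= Cg.
Hypothesis g_lim : forall j, k%:R * (g j k - m j) @[k --> \oo] --> b * m j.

Local Notation nf := (@natural_filtration R n).
Local Notation LH H := (limit_gen r m b H).

(* kappa x is chosen so that the generator applied to the corrector
   (1/N) sum_i kappa_i x_i cancels the error term of the expansion of the
   generator up to a multiple of sum_j d_j x_j, which is of order 1/N because
   d_j = g_j - m_j is of order 1/(N x_j). *)
Lemma corrector (Psi : S -> V -> R) : (forall j, unif_cts (Psi j)) ->
  exists K, [/\ 0 <= K & forall x, simplex x -> exists2 kappa : S -> R,
    forall j, `|kappa j| <= K &
    exists2 theta, `|theta| <= K & forall j, rgen r kappa j = - (2^-1 * Psi j x) + theta * (x 0 j / m j)].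
Proof.
move=> uPsi.
have m0 := invariant_gt0 r_ge0 r_irr m_ge0 m_neq0 m_inv.
have [C C0 CP] := poisson_problem r_ge0 r_irr m_ge0 m_neq0 m_inv.
have /choice[B HB] (j : S) : exists B, 0 <= B /\ forall x, simplex x -> `|Psi j x| <= B.
  by have [B B0 HB] := unif_cts_bounded (uPsi j); exists B.
pose BB := \sum_j B j.
have B0 j : 0 <= B j := (HB j).1.
have BBj j : B j <= BB by rewrite /BB (bigD1 j)//= lerDl sumr_ge0.
have BB0 : 0 <= BB by apply: sumr_ge0.
pose M := \sum_j m j.
have M0 : 0 <= M by apply: sumr_ge0.
pose mi := \sum_j (m j)^-1.
have mi0 : 0 <= mi by apply: sumr_ge0 => j _; rewrite invr_ge0.
have mij j : (m j)^-1 <= mi.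
  by rewrite /mi (bigD1 j)//= lerDl sumr_ge0// => k _; rewrite invr_ge0.
have MB : 0 <= M * BB by rewrite mulr_ge0.
have MBm : 0 <= M * BB * mi by rewrite mulr_ge0.
pose Bf := BB + M * BB * mi.
have Bf0 : 0 <= Bf by rewrite addr_ge0.
exists (M * BB + C * Bf); split; first by rewrite addr_ge0// mulr_ge0.
(* The weighted mean of the right-hand side. Since the x_j sum to 1, adding theta x_j / m_j restores
   the solvability condition of the Poisson equation. *)
move=> x xS; pose theta := 2^-1 * \sum_j m j * Psi j x.
have th : `|theta| <= M * BB.
  rewrite /theta normrM gtr0_norm ?invr_gt0//.
  have : `|\sum_j m j * Psi j x| <= M * BB.
    apply: (le_trans (ler_norm_sum _ _ _)); rewrite mulr_suml; apply: ler_sum => j _.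
    by rewrite normrM ger0_norm// ler_wpM2l// (le_trans _ (BBj j))// (HB j).2.
  have := normr_ge0 (\sum_j m j * Psi j x); lra.
pose f j := - (2^-1 * Psi j x) + theta * (x 0 j / m j).
have mf : \sum_j m j * f j = 0.
  rewrite /f; under eq_bigr do rewrite mulrDr mulrN.
  rewrite big_split/= sumrN.
  have -> : \sum_j m j * (2^-1 * Psi j x) = theta.
    by rewrite /theta mulr_sumr; apply: eq_bigr => j _; ring.
  have -> : \sum_j m j * (theta * (x 0 j / m j)) = theta.
    rewrite -[RHS]mulr1 -xS.2 mulr_sumr; apply: eq_bigr => j _.
    by field; rewrite gt_eqF.
  by rewrite addNr.
have fB j : `|f j| <= Bf.
  rewrite /f; apply: (le_trans (ler_normD _ _)); rewrite normrN; apply: lerD.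
    rewrite normrM gtr0_norm ?invr_gt0//.
    have := (HB j).2 x xS; have := BBj j; have := normr_ge0 (Psi j x); lra.
  rewrite normrM; apply: ler_pM => //.
  have /andP[x0 x1] := simplex_coord_le1 j xS.
  rewrite ger0_norm ?divr_ge0//; apply: le_trans (mij j).
  by rewrite ler_piMl// invr_ge0.
have [kappa [hk kB]] := CP f Bf mf fB.
exists kappa => [j|]; first by apply: (le_trans (kB j)); rewrite lerDr.
by exists theta => //; apply: (le_trans th); rewrite lerDl mulr_ge0.
Qed.

Lemma gen_lin N (kappa : S -> R) y : (0 < N)%N ->
  N%:R^-1 * zrp_gen r g N (lin kappa) y =
  \sum_j (g j (occ N y j) - m j) * rgen r kappa j.
Proof.
move=> N0; have Nn : N%:R != 0 :> R by rewrite pnatr_eq0 -lt0n.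
rewrite -(rates_rgen g m_inv) zrp_genE !mulr_sumr; apply: eq_bigr => j _.
rewrite /rgen !mulr_sumr; apply: eq_bigr => k _.
by rewrite lin_jump; field.
Qed.

Lemma lin_bound (kappa : S -> R) K y : simplex y ->
  (forall j, `|kappa j| <= K) -> `|lin kappa y| <= K.
Proof.
move=> [y0 y1] kK; rewrite /lin; apply: (le_trans (ler_norm_sum _ _ _)).
rewrite -[K]mul1r -y1 mulr_suml; apply: ler_sum => j _.
by rewrite normrM ger0_norm// ler_wpM2l.
Qed.

Lemma genDZ N (F G : V -> R) a y :
  zrp_gen r g N (fun z => F z + a * G z) y = zrp_gen r g N F y + a * zrp_gen r g N G y.
Proof.
have := gen_sum r g N [:: (1, F); (a, G)] (fun p => p.1) (fun p => p.2) y.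
rewrite !big_cons !big_nil/= !addr0 mul1r => <-.
by congr (zrp_gen _ _ _ _ y); apply/funext => z; rewrite !big_cons big_nil/= mul1r addr0.
Qed.

(** The corrector is frozen at the starting point [x], so the error is small only while the chain
    stays close to [x]; elsewhere it is merely bounded. *)
Lemma corrected_gen (H : V -> R) : DS r H -> exists2 K, 0 <= K & forall eta, 0 < eta ->
  exists eps N0, 0 < eps /\ forall N x, (N0 <= N)%N -> (0 < N)%N -> simplex x ->
  exists2 kappa : S -> R, forall j, `|kappa j| <= K &
  forall y, simplex_grid N y ->
  let E := zrp_gen r g N (fun z => H z + N%:R^-1 * lin kappa z) y - LH H x in
  `|E| <= K + eta /\ (~ far x eps y -> `|E| <= eta).
Proof.
move=> /(gen_expansion r_ge0 m_inv m_ge0 g_ge0 g_0 gC ngC g_lim)[uH [Psi [uPsi uL exp]]].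
have [K1 [K10 cor]] := corrector uPsi.
have m0 := invariant_gt0 r_ge0 r_irr m_ge0 m_neq0 m_inv.
have Cg0 : 0 <= Cg := le_trans (normr_ge0 _) (gC ord0 0).
pose L : R := n.+1%:R.
have L0 : 0 < L by rewrite ltr0n.
have /choice[B HB] (j : S) : exists B, 0 <= B /\ forall x, simplex x -> `|Psi j x| <= B.
  by have [B B0 HB] := unif_cts_bounded (uPsi j); exists B.
have [BL BL0 HBL] := unif_cts_bounded uL.
pose BB := \sum_j B j.
have B0 j : 0 <= B j := (HB j).1.
have BBj j : B j <= BB by rewrite /BB (bigD1 j)//= lerDl sumr_ge0.
have BB0 : 0 <= BB by apply: sumr_ge0.
pose mi := \sum_j (m j)^-1.
have mi0 : 0 <= mi by apply: sumr_ge0 => j _; rewrite invr_ge0.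
have mij j : (m j)^-1 <= mi.
  by rewrite /mi (bigD1 j)//= lerDl sumr_ge0// => k _; rewrite invr_ge0.
have cst (c : R) : \sum_(j < n.+1) c = L * c by rewrite sumr_const card_ord -mulr_natl.
pose Q := K1 * (L * (mi * Cg)).
have Q0 : 0 <= Q by rewrite !mulr_ge0// ltW.
pose K := K1 + (2 * BL + L * (Cg * BB) + Q).
have LCB : 0 <= L * (Cg * BB) by rewrite !mulr_ge0// ltW.
exists K; first by rewrite /K; lra.
(* Five shares: the expansion error, the oscillation of the limit generator, that of [Psi], and two
   for the residual [E4]. *)
move=> eta eta0; pose e := eta / 5.
have e0 : 0 < e by rewrite divr_gt0.
have [N1 HN1] := exp e e0.
have [d1 d10 Hd1] := uL e e0.
have LC0 : 0 < L * Cg + 1 by have := mulr_ge0 (ltW L0) Cg0; lra.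
have e20 : 0 < e / (L * Cg + 1) by rewrite divr_gt0.
have /choice[d Hd] (j : S) : exists d, 0 < d /\ forall x y, simplex x -> simplex y ->
    `|x - y| < d -> `|Psi j x - Psi j y| < e / (L * Cg + 1).
  by have [d d0 Hd] := uPsi j _ e20; exists d.
have [dm /andP[dm0 _] dmP] := @finite_lower_bound R S xpredT d (fun j _ => (Hd j).1).
pose eps := Num.min (Num.min (d1 / 2) (dm / 2)) (e / (Q + 1)).
have Q10 : 0 < Q + 1 by move: Q0; lra.
have eps0 : 0 < eps by rewrite !lt_min !divr_gt0.
exists eps, (maxn N1 (Num.truncn (Q / e)).+1); split=> // N x.
rewrite geq_max => /andP[NN1 NN2] N0 xS.
have N0' : 0 < N%:R :> R by rewrite ltr0n.
have [kappa kK [theta thK hk]] := cor x xS.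
exists kappa => [j|y yg /=].
  by apply: (le_trans (kK j)); rewrite /K lerDl !addr_ge0// mulr_ge0.
have yS := yg.1.
pose dd j := g j (occ N y j) - m j.
have ddC j : `|dd j| <= Cg by exact: gC.
have ddy j : `|dd j * y 0 j| <= Cg / N%:R.
  rewrite ler_pdivlMr// normrM [`|y 0 j|]ger0_norm ?yS.1//.
  apply: le_trans (ngC j (occ N y j)); rewrite occE//.
  by rewrite le_eqVlt; apply/orP; left; apply/eqP; rewrite /dd; ring.
pose E1 := zrp_gen r g N H y - LH H y - 2^-1 * \sum_j dd j * Psi j y.
pose E2 := LH H y - LH H x.
pose E3 := 2^-1 * \sum_j dd j * (Psi j y - Psi j x).
pose E4 := theta * \sum_j dd j * (x 0 j / m j).
have EE : zrp_gen r g N (fun z => H z + N%:R^-1 * lin kappa z) y - LH H x = E1 + E2 + E3 + E4.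
  rewrite genDZ gen_lin// /E1 /E2 /E3 /E4.
  have -> : \sum_j (g j (occ N y j) - m j) * rgen r kappa j =
      - (2^-1 * \sum_j dd j * Psi j x) + theta * \sum_j dd j * (x 0 j / m j).
    rewrite !mulr_sumr -sumrN -big_split/=; apply: eq_bigr => j _.
    by rewrite hk /dd; ring.
  have -> : \sum_j dd j * (Psi j y - Psi j x) = \sum_j dd j * Psi j y - \sum_j dd j * Psi j x.
    by rewrite -sumrB; apply: eq_bigr => j _; rewrite mulrBr.
  by ring.
have hE1 : `|E1| <= e by exact: HN1.
have E3le (c : R) : (forall j, `|Psi j y - Psi j x| <= c) -> `|E3| <= 2^-1 * (L * (Cg * c)).
  move=> hc; rewrite /E3 normrM gtr0_norm ?invr_gt0// ler_wpM2l ?invr_ge0//.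
  apply: (le_trans (ler_norm_sum _ _ _)); rewrite -cst; apply: ler_sum => j _.
  by rewrite normrM; apply: ler_pM.
have E4le (c : R) : (forall j, `|dd j * x 0 j| <= Cg * c) -> `|E4| <= Q * c.
  move=> hc; rewrite /E4 normrM [leRHS](_ : _ = K1 * (L * (Cg * c * mi))); last by rewrite /Q; ring.
  apply: ler_pM => //; apply: (le_trans (ler_norm_sum _ _ _)).
  rewrite -cst; apply: ler_sum => j _; rewrite mulrA normrM; apply: ler_pM => //.
  by rewrite ger0_norm ?invr_ge0.
rewrite EE; split.
  have h2 : `|E2| <= 2 * BL.
    rewrite /E2; apply: (le_trans (ler_normB _ _)).
    by have := HBL y yS; have := HBL x xS; lra.
  have h3 : `|E3| <= L * (Cg * BB).
    have h : `|E3| <= 2^-1 * (L * (Cg * (BB + BB))).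
      apply: E3le => j; apply: (le_trans (ler_normB _ _)).
      by rewrite lerD// (le_trans _ (BBj j))// (HB j).2.
    by move: h; lra.
  have h4 : `|E4| <= Q * 1.
    apply: E4le => j; rewrite normrM; apply: ler_pM => //.
    by have /andP[x0 x1] := simplex_coord_le1 j xS; rewrite ger0_norm.
  apply: (le_trans (ler_normD _ _)); apply: (@le_trans _ _ (`|E1| + `|E2| + `|E3| + `|E4|)).
    by rewrite lerD2r (le_trans (ler_normD _ _))// lerD2r ler_normD.
  by rewrite /K /e in hE1 *; move: hE1 h2 h3 h4 K10 eta0; lra.
move=> nfar.
have near_ k : `|y 0 k - x 0 k| <= eps.
  by rewrite leNgt; apply/negP => h; apply: nfar; exists k.
have yx : `|y - x| <= eps.
  by apply: norm_le => [|j]; [exact: ltW|have := near_ j; rewrite !mxE].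
have yx1 : `|y - x| < d1.
  apply: (le_lt_trans yx); apply: (@le_lt_trans _ _ (d1 / 2)); last by move: d10; lra.
  by rewrite /eps !ge_min lexx.
have yx2 j : `|y - x| < d j.
  apply: (le_lt_trans yx); apply: (@lt_le_trans _ _ dm); last exact: dmP.
  apply: (@le_lt_trans _ _ (dm / 2)); last by move: dm0; lra.
  by rewrite /eps !ge_min lexx orbT.
have h2 : `|E2| <= e by apply/ltW/Hd1.
have h3 : `|E3| <= e.
  have h : `|E3| <= 2^-1 * (L * (Cg * (e / (L * Cg + 1)))).
    by apply: E3le => j; apply/ltW/(Hd j).2.
  have : L * (Cg * (e / (L * Cg + 1))) <= e.
    rewrite mulrA mulrCA ler_piMr ?(ltW e0)// ler_pdivrMr; lra.
  by move: h e0; lra.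
have h4 : `|E4| <= Q * (N%:R^-1 + eps).
  (* The part with [y] is of order 1/N since y_j d_j is; the part with y - x is small because [y] is
     close to [x]. *)
  apply: E4le => j; rewrite (_ : dd j * x 0 j = dd j * y 0 j - dd j * (y 0 j - x 0 j)); last by ring.
  apply: (le_trans (ler_normB _ _)); rewrite [leRHS]mulrDr; apply: lerD; first exact: ddy.
  by rewrite normrM; apply: ler_pM.
have q1 : Q * N%:R^-1 <= e.
  rewrite ler_pdivrMr// mulrC -ler_pdivrMr//.
  apply: (@le_trans _ _ (Num.truncn (Q / e)).+1%:R); last by rewrite ler_nat.
  by apply/ltW; exact: truncnS_gt.
have q2 : Q * eps <= e.
  apply: (@le_trans _ _ (Q * (e / (Q + 1)))).
    by rewrite ler_wpM2l// /eps ge_min lexx orbT.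
  by rewrite mulrCA ler_piMr ?(ltW e0)// ler_pdivrMr//; lra.
apply: (le_trans (ler_normD _ _)); apply: (@le_trans _ _ (`|E1| + `|E2| + `|E3| + `|E4|)).
  by rewrite lerD2r (le_trans (ler_normD _ _))// lerD2r ler_normD.
by rewrite /e in hE1 h2 h3 q1 q2; move: hE1 h2 h3 h4 q1 q2; lra.
Qed.

(** Dynkin's formula is applied to the corrected function. Within time [h] the chain gets far from
    [x] with probability of order [h], which costs h^2 after integration in time; adding and
    removing the corrector costs order 1/N. *)
Lemma one_step (H : V -> R) : DS r H -> forall eta, 0 < eta ->
  exists C N0, 0 <= C /\ forall N x_init (P : probability (borel D) R) x A u h,
  (N0 <= N)%N -> (0 < N)%N -> zrp_law r g N x_init P -> 0 <= u -> 0 <= h ->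
  nf u A -> simplex_grid N x -> A `<=` [set w : D | w u = x] ->
  `|Ex N P A (u + h) H - (H x + h * LH H x) * pr P A| <=
    (h * (eta + C * h) + C / N%:R) * pr P A.
Proof.
move=> HDS eta eta0.
have [K K0 /(_ _ eta0)[eps [N0 [eps0 HN]]]] := corrected_gen HDS.
have [C0 C00 exitP] := exit_bound r_ge0 r_irr m_inv m_ge0 g_ge0 g_0 gC ngC eps0.
pose C := (K + eta) * C0 + 2 * K.
have KC : 0 <= (K + eta) * C0 by rewrite mulr_ge0// addr_ge0// ltW.
exists C, N0; split; first by rewrite /C; lra.
move=> N xi P x A u h NN N_gt0 law u0 h0 nA xg Ax.
have mA := natural_filtration_measurable nA.
have [kappa kK HE] := HN N x NN N_gt0 xg.1.
pose F z := H z + N%:R^-1 * lin kappa z.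
have p0 : 0 <= pr P A := pr_ge0 _ _.
have uh0 : 0 <= u + h by rewrite addr_ge0.
have N0' : 0 < N%:R :> R by rewrite ltr0n.
have := @dynkin_near _ _ r m g Cg r_ge0 m_ge0 g_ge0 g_0 gC N N_gt0 xi P law A u h F
  (LH H x * pr P A) ((eta + (K + eta) * C0 * h) * pr P A) u0 h0 nA.
have step v : 0 <= v <= h ->
  `|Ex N P A (u + v) (zrp_gen r g N F) - LH H x * pr P A| <= (eta + (K + eta) * C0 * h) * pr P A.
  move=> /andP[v0 vh]; have uv0 : 0 <= u + v by rewrite addr_ge0.
  have -> : Ex N P A (u + v) (zrp_gen r g N F) - LH H x * pr P A =
      Ex N P A (u + v) (fun y => zrp_gen r g N F y + (- LH H x)).
    by rewrite ExD (Ex_cst N_gt0 law)// mulNr.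
  have mF : measurable ([set w : D | far x eps (w (u + v))] : set (borel D)).
    by apply: eval_measurable; exact: far_open.
  rewrite (Ex_split N P _ uv0 mA mF).
  apply: (le_trans (ler_normD _ _)).
  have h1 : `|Ex N P (A `&` [set w : D | far x eps (w (u + v))]) (u + v)
      (fun y => zrp_gen r g N F y + (- LH H x))| <= (K + eta) * (C0 * v * pr P A).
    apply: (@le_trans _ _ ((K + eta) * pr P (A `&` [set w : D | far x eps (w (u + v))]))).
      apply: (@Ex_abs_le _ _ r g N N_gt0 xi P law _ _ (fun=> True)) => //.
        exact: measurableI.
      by move=> y yg _; exact: (HE y yg).1.
    rewrite ler_wpM2l ?addr_ge0 ?(ltW eta0)//.
    exact: (exitP N xi P x A u v 0%N N_gt0 law u0 v0 nA xg Ax).1.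
  have h2 : `|Ex N P (A `&` ~` [set w : D | far x eps (w (u + v))]) (u + v)
      (fun y => zrp_gen r g N F y + (- LH H x))| <= eta * pr P A.
    have mC := measurableC mF.
    apply: (@le_trans _ _ (eta * pr P (A `&` ~` [set w : D | far x eps (w (u + v))]))).
      apply: (@Ex_abs_le _ _ r g N N_gt0 xi P law _ _ (fun y => ~ far x eps y)) => //.
      - exact: measurableI.
      - by move=> w [].
      - by move=> y yg; exact: (HE y yg).2.
    by rewrite ler_wpM2l ?(ltW eta0)// prS//; exact: measurableI.
  have h3 : (K + eta) * (C0 * v * pr P A) <= (K + eta) * C0 * h * pr P A.
    by rewrite !mulrA ler_wpM2r// ler_wpM2l.
  by move: h1 h2 h3; lra.
move=> /(_ step) {step} hd.
have E1 t : Ex N P A t F = Ex N P A t H + N%:R^-1 * Ex N P A t (lin kappa).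
  by rewrite ExD ExZ.
have bl t : 0 <= t -> `|N%:R^-1 * Ex N P A t (lin kappa)| <= K / N%:R * pr P A.
  move=> t0; rewrite normrM gtr0_norm ?invr_gt0// [leRHS](_ : _ = N%:R^-1 * (K * pr P A)); last by ring.
  rewrite ler_wpM2l ?invr_ge0 ?(ltW N0')//.
  apply: (@Ex_abs_le _ _ r g N N_gt0 xi P law _ _ (fun=> True)) => //.
  by move=> y yg _; apply: lin_bound => //; exact: yg.1.
have b1 := bl _ uh0; have b2 := bl _ u0.
rewrite !E1 (Ex_at N_gt0 P H xg Ax) in hd.
rewrite [X in `|X|](_ : _ =
  (Ex N P A (u + h) H + N%:R^-1 * Ex N P A (u + h) (lin kappa) -
   (H x * pr P A + N%:R^-1 * Ex N P A u (lin kappa)) - LH H x * pr P A * h) -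
  N%:R^-1 * Ex N P A (u + h) (lin kappa) + N%:R^-1 * Ex N P A u (lin kappa)); last by ring.
apply: (le_trans (ler_normD _ _)).
apply: (@le_trans _ _ ((eta + (K + eta) * C0 * h) * pr P A * h + K / N%:R * pr P A + K / N%:R * pr P A)).
  by apply: lerD => //; apply: (le_trans (ler_normB _ _)); apply: lerD.
have i0 : 0 <= N%:R^-1 :> R by rewrite invr_ge0 ltW.
have t1 : 0 <= 2 * K * h * h * pr P A by rewrite !mulr_ge0.
have t2 : 0 <= (K + eta) * C0 * N%:R^-1 * pr P A by rewrite !mulr_ge0// addr_ge0// ltW.
by rewrite /C; move: t1 t2; set iN := N%:R^-1; set p := pr P A; lra.
Qed.

End OneStep.

(** * Ultrafilter limits and random bits *)

(** Compactness yields a cluster point, and along an ultrafilter a cluster point is a limit. *)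
Lemma ultra_cvg (R : realType) (U : set_system nat) (q : nat -> R) :
  UltraFilter U -> (forall N, 0 <= q N <= 1) ->
  exists2 p : R, 0 <= p <= 1 & q N @[N --> U] --> p.
Proof.
move=> UU q01; have PF : ProperFilter (q @ U) by exact: fmap_proper_filter.
have cpt : compact `[(0 : R), 1]%classic by exact: segment_compact.
have [|p [p01 clp]] := cpt (q @ U) PF.
  by apply: (@filterS _ U _ setT) => [N _|]; [rewrite /= in_itv/= q01|exact: filterT].
exists p; first by move: p01; rewrite /= in_itv.
move=> W pW; have [//|H] := in_ultra_setVsetC (q @^-1` W) UU.
have [x [/= h1 h2]] := clp (~` W) W H pW.
by case: h1.
Qed.

Lemma cvg_sum_filter (R : realType) (F : set_system nat) (FF : ProperFilter F) (I : Type)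
    (s : seq I) (u : I -> nat -> R) (l : I -> R) :
  (forall i, u i k @[k --> F] --> l i) ->
  (\sum_(i <- s) u i k) @[k --> F] --> \sum_(i <- s) l i.
Proof.
move=> ul; elim: s => [|i s IH].
  by rewrite big_nil; under eq_fun do rewrite big_nil; exact: cvg_cst.
by rewrite big_cons; under eq_fun do rewrite big_cons; exact: cvgD.
Qed.

Definition cyl (T : Type) (db : nat -> T -> bool) (s : seq bool) : set T :=
  [set w | forall i, (i < size s)%N -> db i w = nth false s i].

Definition bits (T : Type) (db : nat -> T -> bool) (w : T) : nat -> bool :=
  fun i => db i w.

Section UnitInterval.
Variable R : realType.

Definition unit_mu := mrestr (@lebesgue_measure R) (measurable_itv `[(0 : R), 1[).

HB.instance Definition _ := Measure.on unit_mu.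

Let unit_muT : unit_mu setT = 1%E.
Proof.
by rewrite /unit_mu /mrestr setTI lebesgue_measure_itv/= lte_fin ltr01 oppr0 addr0.
Qed.

HB.instance Definition _ := Measure_isProbability.Build _ _ R unit_mu unit_muT.

Definition unitP : probability (g_sigma_algebraType R.-ocitv.-measurable) R := unit_mu.

Lemma unitP_itv (a b : R) : 0 <= a -> a <= b -> b <= 1 ->
  pr unitP `[a, b[%classic = b - a.
Proof.
move=> a0 ab b1; rewrite /pr /unitP /= /unit_mu /mrestr (_ : _ `&` _ = `[a, b[%classic); last first.
  apply/seteqP; split => u /=; rewrite !in_itv/=; first by case.
  move=> /andP[au ub]; split; first by rewrite au.
  by rewrite (le_trans a0 au) (lt_le_trans ub b1).
rewrite lebesgue_measure_itv/= lte_fin; case: ltP => // ba.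
by have -> : a = b by [apply/le_anti; rewrite ab ba]; rewrite subrr.
Qed.

End UnitInterval.

Section RandomBits.
Context d (T : measurableType d) (R : realType) (PN : nat -> probability T R).
Variable db : nat -> T -> bool.
Hypothesis mdb : forall i, measurable [set w | db i w].
Variable U : set_system nat.
Hypothesis UU : UltraFilter U.

Let FU : ProperFilter U. Proof. exact: ultra_proper. Qed.
#[local] Existing Instance FU.

Lemma cyl_nil : cyl db [::] = setT.
Proof. by apply/seteqP; split => // w _ i. Qed.

Lemma cyl_rcons s c : cyl db (rcons s c) = cyl db s `&` [set w | db (size s) w = c].
Proof.
apply/seteqP; split => w /=.
  rewrite /cyl /= size_rcons => H; split; last first.
    by rewrite H// nth_rcons ltnn eqxx.
  by move=> i is_; rewrite H ?nth_rcons ?is_// ltnW.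
move=> [H Hs] i; rewrite size_rcons ltnS leq_eqVlt => /orP[/eqP ->|is_].
  by rewrite nth_rcons ltnn eqxx.
by rewrite nth_rcons is_; exact: H.
Qed.

Lemma db_measurable i c : measurable [set w | db i w = c].
Proof.
case: c; first exact: mdb.
rewrite (_ : [set w | _] = ~` [set w | db i w]); first exact: measurableC.
by apply/seteqP; split => w /=; case: (db i w) => // h; exfalso; exact: h.
Qed.

Lemma cyl_measurable s : measurable (cyl db s).
Proof.
elim/last_ind: s => [|s c IH]; first by rewrite cyl_nil.
by rewrite cyl_rcons; apply: measurableI => //; exact: db_measurable.
Qed.

Definition plim (s : seq bool) : R := lim (pr (PN N) (cyl db s) @[N --> U]).

Let pr01 N s : 0 <= pr (PN N) (cyl db s) <= 1.
Proof. by rewrite pr_ge0 pr_le1//; exact: cyl_measurable. Qed.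

Lemma plimP s : pr (PN N) (cyl db s) @[N --> U] --> plim s.
Proof.
have [p _ cp] := ultra_cvg UU (pr01 ^~ s).
by rewrite /plim (_ : lim _ = p)//; apply/cvg_lim.
Qed.

Lemma plim01 s : 0 <= plim s <= 1.
Proof.
have [p p01 cp] := ultra_cvg UU (pr01 ^~ s).
by rewrite /plim (_ : lim _ = p)//; apply/cvg_lim.
Qed.

Lemma plim_nil : plim [::] = 1.
Proof.
apply/cvg_lim => //; rewrite cyl_nil; under eq_fun do rewrite prT; exact: cvg_cst.
Qed.

(** Additivity passes to the limit and is the consistency condition that lets the two children of a
    word share its interval. *)
Lemma plim_rcons s : plim (rcons s false) + plim (rcons s true) = plim s.
Proof.
have h := cvgD (@plimP (rcons s false)) (@plimP (rcons s true)).
suff h2 : (fun N => pr (PN N) (cyl db (rcons s false))) + (fun N => pr (PN N) (cyl db (rcons s true))) =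
  fun N => pr (PN N) (cyl db s).
  by rewrite h2 in h; rewrite [RHS]/plim; apply/esym/cvg_lim => //; exact: h.
apply/funext => N; rewrite /= fctE -prU; do ?exact: cyl_measurable.
  congr pr; rewrite !cyl_rcons -setIUr -[RHS]setIT; congr (_ `&` _).
  by apply/seteqP; split => // w _ /=; case: (db _ w); [right|left].
by rewrite !cyl_rcons; apply/seteqP; split => // w [[_ /= ->] []].
Qed.

(* Nested subdivision of [0, 1[: the words extending s share out an interval of
   length plim s starting at left_end s. *)
Definition left_end (s : seq bool) : R :=
  \sum_(i < size s) if nth false s i then plim (rcons (take i s) false) else 0.

Lemma left_end_rcons s c :
  left_end (rcons s c) = left_end s + if c then plim (rcons s false) else 0.
Proof.
rewrite /left_end size_rcons big_ord_recr/=; congr (_ + _).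
  apply: eq_bigr => i _; rewrite nth_rcons ltn_ord; case: ifP => // _.
  by rewrite -(cats1 s c) takel_cat// ltnW.
by rewrite nth_rcons ltnn eqxx -(cats1 s c) take_size_cat.
Qed.

(** The address of [u] in the nested intervals: the next bit says on which side of the common
    endpoint of the two children [u] lies. *)
Fixpoint word (k : nat) (u : R) : seq bool :=
  if k is k'.+1 then
    let s := word k' u in rcons s (left_end s + plim (rcons s false) <= u)
  else [::].

Lemma size_word k u : size (word k u) = k.
Proof. by elim: k => //= k IH; rewrite size_rcons IH. Qed.

Definition ob (i : nat) (u : R) : bool := nth false (word i.+1 u) i.

Lemma nth_word k u i : (i < k)%N -> nth false (word k u) i = ob i u.
Proof.
elim: k => // k IH; rewrite ltnS leq_eqVlt => /orP[/eqP -> //|ik].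
by rewrite /= nth_rcons size_word ik IH.
Qed.

Lemma left_end_bounds s : 0 <= left_end s /\ left_end s + plim s <= 1.
Proof.
elim/last_ind: s => [|s c [IH1 IH2]].
  by rewrite /left_end big_ord0 plim_nil add0r.
rewrite left_end_rcons; have := plim_rcons s.
have /andP[f0 _] := plim01 (rcons s false); have /andP[t0 _] := plim01 (rcons s true).
by case: c => /= h; split; lra.
Qed.

Lemma word_itv s :
  [set u : R | 0 <= u < 1 /\ word (size s) u = s] = `[left_end s, left_end s + plim s[%classic.
Proof.
elim/last_ind: s => [|s c IH].
  rewrite /left_end big_ord0 plim_nil add0r /=.
  apply/seteqP; split => u /=; rewrite in_itv/=; first by case.
  by split.
have /andP[f0 _] := plim01 (rcons s false); have /andP[t0 _] := plim01 (rcons s true).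
have ps := plim_rcons s.
rewrite size_rcons left_end_rcons; apply/seteqP; split => u /=.
  move=> [u01 /rcons_inj[ws cs]].
  have : u \in `[left_end s, left_end s + plim s[.
    by have : [set u : R | 0 <= u < 1 /\ word (size s) u = s] u by []; rewrite IH.
  rewrite ws in cs; rewrite !in_itv/= => /andP[u1 u2].
  by case: c cs => [|/negbT]; rewrite -?ltNge => cs; apply/andP; split => //; lra.
rewrite in_itv/= => /andP[u1 u2].
have us : u \in `[left_end s, left_end s + plim s[.
  by rewrite in_itv/=; case: c u1 u2 => u1 u2; apply/andP; split; lra.
have [u01 ws] : [set u : R | 0 <= u < 1 /\ word (size s) u = s] u by rewrite IH.
split => //; rewrite ws; congr rcons.
by case: c u1 u2 => // u1 u2; apply/negbTE; rewrite -ltNge; lra.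
Qed.

Definition ocyl (s : seq bool) : set R :=
  [set u | forall i, (i < size s)%N -> ob i u = nth false s i].

Lemma ocylE s : ocyl s = [set u | word (size s) u = s].
Proof.
apply/seteqP; split => u /=.
  move=> H; apply: (@eq_from_nth _ false); rewrite size_word// => i il.
  by rewrite nth_word// H.
by move=> <- i; rewrite size_word => il; rewrite nth_word.
Qed.

(** An arbitrary set [B] of words is allowed so that the induction can be used with singletons; the
    set of all words is countable. *)
Lemma left_end_plim_measurable k (B : set (seq bool)) :
  measurable [set u : R | word k u \in B].
Proof.
elim: k B => [|k IH] B.
  have [h|h] := pselect ([::] \in B).
    by rewrite (_ : [set u | _] = setT)//; apply/seteqP; split.
  by rewrite (_ : [set u | _] = set0)//; apply/seteqP; split.
have E : [set u : R | word k.+1 u \in B] = \bigcup_(s : seq bool)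
   (([set u | word k u \in [set s]] `&`
      ([set u | rcons s (left_end s + plim (rcons s false) <= u) \in B]))).
  apply/seteqP; split => u /=; first by move=> uB; exists (word k u) => //=; rewrite inE.
  by move=> [s _ [/=]]; rewrite inE => <-.
rewrite E; apply: countable_bigcupT_measurable => [|s]; first exact: countableP.
apply: measurableI; first exact: IH.
set a := left_end s + _.
have -> : [set u | rcons s (a <= u) \in B] =
  (if rcons s true \in B then `[a, +oo[%classic else set0) `|`
  (if rcons s false \in B then `]-oo, a[%classic else set0).
  apply/seteqP; split => u /=.
    have [au|ua] := leP a u => h; [left|right]; rewrite h //= in_itv/= ?au//.
  by move=> []; case: ifP => //= h; rewrite in_itv/= ?andbT => au; rewrite ?au// leNgt au.
by apply: measurableU; case: ifP.
Qed.

Lemma ob_measurable i : measurable [set u : R | ob i u].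
Proof.
have := left_end_plim_measurable i.+1 [set s | nth false s i].
by congr measurable; apply/seteqP; split => u; rewrite /= inE.
Qed.

Lemma pr_ocyl s : pr (@unitP R) (ocyl s) = plim s.
Proof.
have [l0 l1] := left_end_bounds s; have /andP[p0 _] := plim01 s.
rewrite -[RHS](@addrK _ (left_end s)) [plim s + _]addrC -(@unitP_itv R)//; last by rewrite lerDl.
rewrite -word_itv /pr; congr fine; rewrite /unitP /= /unit_mu /mrestr ocylE; congr lebesgue_measure.
by apply/seteqP; split => u /=; rewrite in_itv/= => -[h1 h2]; split => //; case: h1.
Qed.

End RandomBits.

(** * Events and functions of finitely many bits *)

Section FiniteBits.
Variable R : realType.

Definition depends (X : Type) (M : nat) (psi : (nat -> bool) -> X) :=
  forall f h, (forall i, (i < M)%N -> f i = h i) -> psi f = psi h.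

Context d (T : measurableType d) (P : probability T R) (db : nat -> T -> bool).
Hypothesis mdb : forall i, measurable [set w | db i w].

Local Notation bits := (bits db).

(** The expectation of a function of the first [M] bits: a finite combination of cylinder
    probabilities, hence convergent along [U]. *)
Definition bitsum M (psi : (nat -> bool) -> R) : R :=
  \sum_(s : M.-tuple bool) psi (nth false s) * pr P (cyl db s).

Lemma tuple_of_cyl M (s : M.-tuple bool) w : cyl db s w <-> [tuple db i w | i < M] = s.
Proof.
split => [H|<- i]; last first.
  by rewrite size_tuple => iM; rewrite -[i]/(nat_of_ord (Ordinal iM)) -tnth_nth tnth_mktuple.
apply: eq_from_tnth => i; rewrite tnth_mktuple (tnth_nth false) H//.
by rewrite size_tuple.
Qed.

Lemma pr_sum_cyl M (A : set T) : measurable A ->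
  pr P A = \sum_(s : M.-tuple bool) pr P (A `&` cyl db s).
Proof.
move=> mA; have := @pr_partition _ T R P _ (index_enum (M.-tuple bool))
  (fun w => [tuple db i w | i < M]) A (index_enum_uniq _) mA.
have E (s : M.-tuple bool) : [set t | [tuple db i t | i < M] = s] = cyl db s.
  by apply/seteqP; split => w /= /tuple_of_cyl.
rewrite (_ : A `&` _ = A); last first.
  by apply/seteqP; split => [w []//|w Aw]; split=> //=; rewrite mem_index_enum.
move=> -> => [|s _]; last by rewrite E; exact: cyl_measurable.
by apply: eq_bigr => s _; rewrite E.
Qed.

Lemma depends_cyl (X : Type) M (psi : (nat -> bool) -> X) (s : M.-tuple bool) w :
  depends M psi -> cyl db s w -> psi (bits w) = psi (nth false s).
Proof. by move=> dp H; apply: dp => i iM; apply: H; rewrite size_tuple. Qed.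

Lemma depends_measurable M (Phi : (nat -> bool) -> Prop) : depends M Phi ->
  measurable [set w | Phi (bits w)].
Proof.
move=> dp.
pose l := [seq s : M.-tuple bool <- index_enum (M.-tuple bool) | `[< Phi (nth false s) >]].
have E : [set w | Phi (bits w)] =
    [set w | exists2 s : M.-tuple bool, s \in l & cyl db s w].
  apply/seteqP; split => w /=.
    move=> Pw; exists [tuple db i w | i < M]; last exact/tuple_of_cyl.
    rewrite mem_filter mem_index_enum andbT; apply/asboolP.
    by rewrite -(depends_cyl dp (iffRL (tuple_of_cyl [tuple db i w | i < M] w) erefl)).
  move=> [s]; rewrite mem_filter => /andP[/asboolP Ps _] sw.
  by rewrite (depends_cyl dp sw).
by rewrite E; apply: seq_bigcup_measurable => s _; exact: cyl_measurable.
Qed.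

Lemma pr_depends M (Phi : (nat -> bool) -> Prop) : depends M Phi ->
  pr P [set w | Phi (bits w)] = bitsum M (fun f => (`[< Phi f >])%:R).
Proof.
move=> dp; rewrite (pr_sum_cyl M (depends_measurable dp)) /bitsum.
apply: eq_bigr => s _; case: asboolP => Ps; rewrite ?mul1r ?mul0r.
  by congr pr; apply/seteqP; split => [w []//|w sw]; split=> //=; rewrite (depends_cyl dp sw).
rewrite (_ : _ `&` _ = set0) ?pr0//; apply/seteqP; split => // w [/= Pw sw]; apply: Ps.
by rewrite -(depends_cyl dp sw).
Qed.

End FiniteBits.

Section FiniteBitsLimit.
Context d (T : measurableType d) (R : realType) (PN : nat -> probability T R).
Variable db : nat -> T -> bool.
Hypothesis mdb : forall i, measurable [set w | db i w].
Variable U : set_system nat.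
Hypothesis UU : UltraFilter U.

Let FU : ProperFilter U. Proof. exact: ultra_proper. Qed.
#[local] Existing Instance FU.

Local Notation ob := (ob PN db U).

Lemma bitsum_cvg M psi :
  bitsum (PN N) db M psi @[N --> U] --> bitsum (@unitP R) ob M psi.
Proof.
apply: cvg_sum_filter => s; apply: cvgMr.
rewrite (_ : pr _ _ = plim PN db U s); first exact: plimP.
by rewrite -(pr_ocyl PN mdb UU s).
Qed.

Lemma pr_bits_cvg M Phi : depends M Phi ->
  pr (PN N) [set w | Phi (bits db w)] @[N --> U] --> pr (@unitP R) [set u | Phi (bits ob u)].
Proof.
move=> dp.
have -> := pr_depends (@unitP R) (ob_measurable PN db U) dp.
under eq_fun do rewrite (pr_depends _ mdb dp).
exact: bitsum_cvg.
Qed.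

Lemma pr_bits_le M Phi (c : R) : depends M Phi ->
  U [set N | pr (PN N) [set w | Phi (bits db w)] <= c] ->
  pr (@unitP R) [set u | Phi (bits ob u)] <= c.
Proof.
move=> dp Uc; have h := pr_bits_cvg dp.
by apply: (ler_cvg_to h (cvg_cst _)).
Qed.

End FiniteBitsLimit.

Lemma dependsW (X : Type) M M' (psi : (nat -> bool) -> X) : (M <= M')%N ->
  depends M psi -> depends M' psi.
Proof. by move=> MM dp f h fh; apply: dp => i iM; apply: fh; apply: leq_trans MM. Qed.

Lemma dep_common (X I : Type) (psi : I -> (nat -> bool) -> X) (J : eqType) (s : seq J) (F : J -> I) :
  (forall i, exists M, depends M (psi i)) ->
  exists M, forall j, j \in s -> depends M (psi (F j)).
Proof.
move=> dp; elim: s => [|j s [M HM]]; first by exists 0%N.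
have [M' HM'] := dp (F j); exists (maxn M M') => i.
rewrite in_cons => /orP[/eqP ->|/HM h]; first by apply: dependsW HM'; rewrite leq_maxr.
by apply: dependsW h; rewrite leq_maxl.
Qed.

(** * Coding of paths by bits at dyadic times *)

Section Bits.
Variables (R : realType) (n : nat).
Local Notation S := 'I_n.+1.
Local Notation V := 'rV[R]_n.+1.
Local Notation D := (cadlag_path R n).
Local Notation nf := (@natural_filtration R n).

Definition tm (l a : nat) : R := a%:R / 2 ^+ l.

Lemma two_exp_gt0 l : 0 < 2 ^+ l :> R. Proof. by rewrite exprn_gt0. Qed.

Lemma tm_ge0 l a : 0 <= tm l a.
Proof. by rewrite divr_ge0// ltW// two_exp_gt0. Qed.

Definition decode (i : nat) : option (nat * nat * S * nat) := unpickle i.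
Definition code (l a : nat) (j : S) (c : nat) : nat := pickle (l, a, j, c).

Lemma codeK l a j c : decode (code l a j c) = Some (l, a, j, c).
Proof. exact: pickleK. Qed.

Definition bit_time (i : nat) : R :=
  if decode i is Some (l, a, _, _) then tm l a else 0.

(* Bit number code l a j c of a path w tells whether the j-th coordinate of
   w (a / 2^l) lies in [c / 2^l, (c + 1) / 2^l[. *)
Definition db (i : nat) (w : D) : bool :=
  if decode i is Some (l, a, j, c) then Num.truncn (2 ^+ l * w (tm l a) 0 j) == c
  else false.

Lemma coord_lt_open j (a : R) : open [set y : V | y 0 j < a].
Proof.
apply: normP_open => y /= ya; exists (a - y 0 j); first by rewrite subr_gt0.
move=> z; have := coord_le_norm (z - y) j; rewrite !mxE.
by have := ler_norm (z 0 j - y 0 j); lra.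
Qed.

Lemma db_past s i : bit_time i <= s -> nf s [set w | db i w].
Proof.
rewrite /bit_time /db; case: decode => [[[[l a] j] c]|]/= ts; last first.
  rewrite (_ : [set w | _] = set0); last by apply/seteqP; split.
  by rewrite pastE; exact: measurable0.
have tms : 0 <= tm l a <= s by rewrite tm_ge0.
have E (v : S -> R) : 0 <= v j -> (Num.truncn (2 ^+ l * v j) == c) =
    (v j < c.+1%:R / 2 ^+ l) && ~~ (v j < c%:R / 2 ^+ l).
  move=> w0; rewrite -leNgt ltr_pdivlMr ?two_exp_gt0// ler_pdivrMr ?two_exp_gt0//.
  by rewrite truncn_eq ?mulr_ge0 ?exprn_ge0// andbC mulrC.
rewrite (_ : [set w | _] = [set w : D | w (tm l a) 0 j < c.+1%:R / 2 ^+ l] `&`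
   ~` [set w : D | w (tm l a) 0 j < c%:R / 2 ^+ l]).
  have ev c' : nf s [set w : D | w (tm l a) 0 j < c'].
    exact: (@natural_filtration_eval R n s (tm l a) _ tms (@coord_lt_open j c')).
  exact: (@natural_filtrationI R n s _ _ (ev _) (@natural_filtrationC R n s _ (ev _))).
apply/seteqP; split => w /=; rewrite (E (fun j => w (tm l a) 0 j)) ?(path_simplex w _).1//.
  by move=> /andP[-> /negP].
by move=> [-> /negP ->].
Qed.

Lemma db_measurable' i : measurable ([set w | db i w] : set (borel D)).
Proof. exact: natural_filtration_measurable (@db_past (bit_time i) i (lexx _)). Qed.

(** Position read from the bits at level [l]: for the bits of a path exactly one [c] contributes to
    each coordinate, and c = 2^l occurs when the coordinate is 1. For arbitrary bits this need not
    lie near the simplex. *)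
Definition xh (l a : nat) (f : nat -> bool) : V :=
  \row_j \sum_(c < (2 ^ l).+1) (f (code l a j c))%:R * (c%:R / 2 ^+ l).

Lemma xh_db l a (w : D) : `|xh l a (bits db w) - w (tm l a)| <= 2 ^- l.
Proof.
apply: norm_le => [|j]; first by rewrite invr_ge0 ltW// two_exp_gt0.
rewrite !mxE; have := path_simplex w (tm l a).
set y := w (tm l a) => yS.
have /andP[y0 y1] := simplex_coord_le1 j yS.
have p0 := two_exp_gt0 l.
have c0 : 0 <= 2 ^+ l * y 0 j by rewrite mulr_ge0// ltW.
pose c := Num.truncn (2 ^+ l * y 0 j).
have /andP[h1 h2] := truncn_itv c0.
have cl : (c < (2 ^ l).+1)%N.
  rewrite ltnS -(@ler_nat R) natrX; apply: (le_trans h1).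
  by rewrite ler_piMr// ltW.
rewrite (bigD1 (Ordinal cl))//= big1 ?addr0 => [|c' c'c].
  rewrite /bits /db codeK -/y eqxx mul1r -[y 0 j](@mulfK _ (2 ^+ l)) ?gt_eqF//.
  rewrite -mulrBl normrM [`|(2 ^+ l)^-1|]gtr0_norm ?invr_gt0// ler_piMl ?invr_ge0 ?(ltW p0)//.
  rewrite [y 0 j * _]mulrC ler_norml; apply/andP; split.
    by move: h2; rewrite -/c -natr1; lra.
  by move: h1; rewrite -/c; lra.
rewrite /bits /db codeK -/y; case: eqP => [E|]; last by rewrite mul0r.
by move: c'c; rewrite -val_eqE /= -E eqxx.
Qed.

Lemma xh_depends l a : exists M, depends M (xh l a).
Proof.
exists (\sum_j \sum_(c < (2 ^ l).+1) code l a j c).+1 => f h fh.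
apply/rowP => j; rewrite !mxE; apply: eq_bigr => c _; rewrite fh// ltnS.
by rewrite (bigD1 j)//= (bigD1 c)//= -addnA leq_addr.
Qed.

Definition depends_upto (X : Type) (s : R) (M : nat) (psi : (nat -> bool) -> X) :=
  forall f h, (forall i, (i < M)%N -> bit_time i <= s -> f i = h i) -> psi f = psi h.

Lemma depends_upto_depends X s M (psi : (nat -> bool) -> X) :
  depends_upto s M psi -> depends M psi.
Proof. by move=> dp f h fh; apply: dp => i iM _; exact: fh. Qed.

Lemma xh_depends_upto l a s : tm l a <= s -> exists M, depends_upto s M (xh l a).
Proof.
move=> ts; have [M _] := xh_depends l a.
exists (\sum_j \sum_(c < (2 ^ l).+1) code l a j c).+1 => f h fh.
apply/rowP => j; rewrite !mxE; apply: eq_bigr => c _; rewrite fh//.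
  by rewrite ltnS (bigD1 j)//= (bigD1 c)//= -addnA leq_addr.
by rewrite /bit_time codeK.
Qed.

Lemma depends_past s M (Phi : (nat -> bool) -> Prop) : depends_upto s M Phi ->
  nf s [set w | Phi (bits db w)].
Proof.
(* Bits of times later than [s] are replaced by false, which [Phi] does not see, so that all the
   bits become measurable for the past of [s]. *)
move=> dp; pose db' i (w : past n s) := if bit_time i <= s then db i w else false.
have mdb' i : measurable [set w | db' i w].
  rewrite /db'; have [is_|is_] := boolP (bit_time i <= s); first exact: (db_past is_).
  by rewrite (_ : [set w | _] = set0)//; apply/seteqP; split.
have := depends_measurable mdb' (depends_upto_depends dp).
rewrite -pastE; congr (nf s); apply/seteqP; split => w /=;
  by rewrite (dp (bits db' w) (bits db w))// /bits /db' => i _ ->.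
Qed.

(** Failure of a modulus of continuity on [0, K], tested up to level [L] only so as to depend on
    finitely many bits. *)
Definition osc (K k L : nat) (e : R) (f : nat -> bool) : Prop :=
  exists l l' a a', [/\ [/\ (k <= l <= L)%N, (k <= l' <= L)%N, tm l a <= K%:R & tm l' a' <= K%:R],
    `|tm l a - tm l' a'| <= 2 ^- k & e < `|xh l a f - xh l' a' f|].

Lemma tm_le l a K : tm l a <= K%:R -> (a <= K * 2 ^ l)%N.
Proof.
by rewrite /tm ler_pdivrMr ?two_exp_gt0// -natrX -natrM ler_nat.
Qed.

Lemma osc_depends K k L e : exists M, depends M (osc K k L e).
Proof.
pose J := ('I_L.+1 * 'I_(K * 2 ^ L).+1)%type.
have [M HM] := @dep_common _ _ (fun la : nat * nat => xh la.1 la.2) J (index_enum J)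
  (fun j => (nat_of_ord j.1, nat_of_ord j.2)) (fun la => xh_depends la.1 la.2).
exists M; suff imp f h : (forall i, (i < M)%N -> f i = h i) -> osc K k L e f -> osc K k L e h.
  by move=> f h fh; apply/propext; split; apply: imp => // i iM; rewrite fh.
move=> fh [l [l' [a [a' [[kl kl' aK aK'] d ee]]]]].
exists l, l', a, a'; split => //.
have E l0 a0 : (k <= l0 <= L)%N -> tm l0 a0 <= K%:R -> xh l0 a0 f = xh l0 a0 h.
  move=> /andP[_ lL] /tm_le aKl.
  have l1 : (l0 < L.+1)%N by rewrite ltnS.
  have a1 : (a0 < (K * 2 ^ L).+1)%N.
    by rewrite ltnS (leq_trans aKl)// leq_mul2l leq_exp2l// lL orbT.
  exact: (HM (Ordinal l1, Ordinal a1) (mem_index_enum _)).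
by rewrite -!E.
Qed.

Lemma tm_refine l L a : (l <= L)%N -> tm l a = tm L (a * 2 ^ (L - l)).
Proof.
move=> lL; rewrite /tm natrM natrX -{2}(subnK lL) exprD invfM mulrA mulfK//.
Qed.

End Bits.

(** * Modulus of continuity, uniformly in N *)

Section Oscillation.
Variables (R : realType) (n : nat).
Local Notation S := 'I_n.+1.
Local Notation V := 'rV[R]_n.+1.
Local Notation D := (cadlag_path R n).
Variables (r : S -> S -> R) (m : S -> R) (g : S -> nat -> R) (Cg : R).
Hypothesis r_ge0 : forall j k, 0 <= r j k.
Hypothesis r_irr : forall j k, connect (fun i l => 0 < r i l) j k.
Hypothesis m_inv : forall k, \sum_j m j * r j k = m k * \sum_l r k l.
Hypothesis m_ge0 : forall j, 0 <= m j.
Hypothesis g_ge0 : forall j k, 0 <= g j k.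
Hypothesis g_0 : forall j, g j 0%N = 0.
Hypothesis gC : forall j k, `|g j k - m j| <= Cg.
Hypothesis ngC : forall j k, k%:R * `|g j k - m j| <= Cg.

(** [exit_bound] is summed over the grid values of [w u]; values off the grid have probability 0.
    The event is enclosed in a measurable set built from these pieces. *)
Lemma window_bound (eps : R) : 0 < eps -> exists2 C : R, 0 <= C &
  forall N x_init (P : probability (borel D) R) u d l,
  (0 < N)%N -> zrp_law r g N x_init P -> 0 <= u -> 0 <= d ->
  exists B : set (borel D), [/\ measurable B,
    [set w : D | exists2 i, (0 < i <= l)%N & far (w u) eps (w (tick u d i))] `<=` B &
    pr P B <= C * (l%:R * d) * (l%:R * d + N%:R^-1 ^+ 2)].
Proof.
move=> eps0.
have [C C0 CP] := exit_bound r_ge0 r_irr m_inv m_ge0 g_ge0 g_0 gC ngC eps0.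
exists C => // N xi P u d l N0 law u0 d0.
pose E x := [set w : D | exists2 i, (0 < i <= l)%N & far x eps (w (tick u d i))].
have mE x : measurable (E x : set (borel D)).
  rewrite (_ : E x = [set w | exists2 i, i \in iota 1 l & [set w : D | far x eps (w (tick u d i))] w]).
    by apply: seq_bigcup_measurable => i _; apply: eval_measurable; exact: far_open.
  by apply/seteqP; split => w [i il fi]; exists i => //; move: il; rewrite mem_iota add1n ltnS.
have mat_ x : measurable ([set w : D | w u = x] : set (borel D)) by exact: at_measurable.
have mB x : x \in grid_pts R n N -> measurable ([set w : D | w u = x] `&` E x : set (borel D)).
  by move=> _; exact: measurableI.
pose B1 : set (borel D) := [set w : D | exists2 x, x \in grid_pts R n N & ([set w : D | w u = x] `&` E x) w].
pose B2 : set (borel D) := ~` [set w : D | w u \in grid_pts R n N].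
have mB1 : measurable B1 by exact: seq_bigcup_measurable.
have mG : measurable ([set w : D | w u \in grid_pts R n N] : set (borel D)).
  rewrite (_ : [set w : D | _] = [set w | exists2 y, y \in grid_pts R n N & [set w : D | w u = y] w]).
    by apply: seq_bigcup_measurable => y _; exact: mat_.
  by apply/seteqP; split => w /=; [move=> h'; exists (w u)|move=> [y yp /= ->]].
have mB2 : measurable B2 by exact: measurableC.
exists (B1 `|` B2); split; first exact: measurableU.
  move=> w [i il fi]; have [wg|wg] := pselect (w u \in grid_pts R n N); last by right.
  by left; exists (w u) => //; split=> //; exists i.
have -> : C * (l%:R * d) * (l%:R * d + N%:R^-1 ^+ 2) =
    C * (l%:R * d) * (l%:R * d + N%:R^-1 ^+ 2) + 0 by rewrite addr0.
apply: (le_trans (prUle _ mB1 mB2)); apply: lerD.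
  apply: (le_trans (pr_bigcup P mB)).
  set q := C * _ * _.
  have q1 : q = q * \sum_(y <- grid_pts R n N) pr P ([set: D] `&` [set w : D | w u = y]).
    rewrite -pr_partition//; last exact: grid_pts_uniq.
    by rewrite (grid_ae N0 law u0 measurableT) prT mulr1.
  rewrite {}q1.
  rewrite mulr_sumr big_seq [leRHS]big_seq; apply: ler_sum => x /(grid_ptsP N0) xg.
  rewrite setTI.
  have uu : 0 <= u <= u by rewrite u0 lexx.
  have nA : natural_filtration u [set w : D | w u = x] by exact: (natural_filtration_eq x uu).
  exact: (CP N xi P x [set w : D | w u = x] u d l N0 law u0 d0 nA xg (@subset_refl _ _)).2.
have := pr_split P (@measurableT _ (borel D)) mG.
rewrite (grid_ae N0 law u0 measurableT) setTI => h.
by move: h; rewrite /B2; lra.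
Qed.

(** [0, K] is covered by K 2^k + 1 windows of length 2^-k, each bad with probability of order 2^-k
    (2^-k + N^-2): the quadratic bound absorbs their number, and the result does not depend on
    [L]. *)
Lemma osc_bound (K : nat) (e : R) : 0 < e -> exists2 C : R, 0 <= C &
  forall N x_init (P : probability (borel D) R) k L,
  (0 < N)%N -> zrp_law r g N x_init P -> (k <= L)%N -> 2 ^- k <= e / 8 ->
  pr P [set w : D | osc n K k L e (bits (@db R n) w)] <= C * (2 ^- k + N%:R^-1 ^+ 2).
Proof.
move=> e0; have e80 : 0 < e / 8 by rewrite divr_gt0.
have [C C0 CP] := window_bound e80.
exists ((K.+1)%:R * C); first by rewrite mulr_ge0.
move=> N xi P k L N0 law kL ke.
have p0 i : 0 < 2 ^+ i :> R := two_exp_gt0 R i.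
pose d : R := 2 ^- L; pose l := (2 ^ (L - k))%N.
have d0 : 0 <= d by rewrite invr_ge0 ltW.
have ld : l%:R * d = 2 ^- k.
  rewrite /l /d natrX -{2}(subnK kL) exprD invfM mulrA divff ?mul1r// gt_eqF//.
have u0 i : 0 <= tm R k i := tm_ge0 R k i.
have /choice[B HB] i := CP N xi P (tm R k i) d l N0 law (u0 i) d0.
have mB i : measurable (B i) by have [] := HB i.
pose s := iota 0 (K * 2 ^ k).+1.
have [MM dpM] := @osc_depends R n K k L e.
have mO : measurable ([set w : D | osc n K k L e (bits (@db R n) w)] : set (borel D)).
  exact: (depends_measurable (@db_measurable' R n) dpM).
have mU : measurable [set w | exists2 i, i \in s & B i w].
  by apply: seq_bigcup_measurable => i _.
apply: (@le_trans _ _ (pr P [set w | exists2 i, i \in s & B i w])); last first.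
  apply: (@le_trans _ _ (\sum_(i <- s) pr P (B i))); first by apply: pr_bigcup => i _.
  apply: (@le_trans _ _ (\sum_(i <- s) C * 2 ^- k * (2 ^- k + N%:R^-1 ^+ 2))).
    by apply: ler_sum => i _; have [_ _] := HB i; rewrite ld.
  rewrite big_const_seq count_predT iter_addr_0 size_iota -[leLHS]mulr_natl.
  set q := 2 ^- k + _.
  have q0 : 0 <= q by rewrite addr_ge0 ?sqr_ge0// invr_ge0 ltW.
  rewrite [leLHS](_ : _ = C * q * ((K * 2 ^ k).+1%:R * 2 ^- k)); last by ring.
  rewrite [leRHS](_ : _ = C * q * K.+1%:R); last by ring.
  rewrite ler_wpM2l ?mulr_ge0// ler_pdivrMr// -natrX -natrM ler_nat mulSn -addn1 addnC.
  by rewrite leq_add2r expn_gt0.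
apply: prS => // w [a1 [a2 [p1 [p2 [[kl1 kl2 pK1 pK2] dist ee]]]]].
apply: contrapT => nB.
have win i q : (i <= K * 2 ^ k)%N -> (0 < q <= l)%N ->
    `|w (tm R k i + q%:R * d) - w (tm R k i)| <= e / 8.
  move=> iK ql; apply: norm_le => [|j]; first exact: ltW.
  rewrite leNgt !mxE; apply/negP => H; apply: nB; exists i; first by rewrite mem_iota add0n ltnS.
  by have [_ sub _] := HB i; apply: sub; exists q => //; exists j.
have win0 i q : (i <= K * 2 ^ k)%N -> (q <= l)%N ->
    `|w (tm R k i + q%:R * d) - w (tm R k i)| <= e / 8.
  move=> iK; case: q => [_|q ql]; last by apply: win.
  by rewrite mul0r addr0 subrr normr0 ltW.
have divl p : (p <= K * 2 ^ L)%N -> (p %/ l <= K * 2 ^ k)%N.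
  move=> /(leq_div2r l); rewrite -{1}(subnKC kL) expnD mulnA mulnK// /l.
  by rewrite expn_gt0.
(* A time of level [L] is compared with the start of its window of level [k], of which it is a
   tick. *)
have key p : (p <= K * 2 ^ L)%N ->
    `|w (tm R L p) - w (tm R k (p %/ l))| <= e / 8.
  move=> pK.
  have -> : tm R L p = tm R k (p %/ l) + (p %% l)%:R * d.
    rewrite {1}(divn_eq p l) /tm natrD natrM mulrDl; congr (_ + _).
    by rewrite -mulrA ld.
  apply: win0; last by rewrite ltnW// ltn_mod expn_gt0.
  exact: divl.
have next i : (i <= K * 2 ^ k)%N -> `|w (tm R k i.+1) - w (tm R k i)| <= e / 8.
  move=> iK; have := win i l iK; rewrite leqnn expn_gt0/= ld => /(_ isT).
  by rewrite (_ : tm R k i + 2 ^- k = tm R k i.+1)// /tm -[i.+1%:R]natr1 mulrDl mul1r.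
pose q1 := (p1 * 2 ^ (L - a1))%N; pose q2 := (p2 * 2 ^ (L - a2))%N.
have /andP[ka1 a1L] := kl1; have /andP[ka2 a2L] := kl2.
have t1 : tm R a1 p1 = tm R L q1 by exact: tm_refine.
have t2 : tm R a2 p2 = tm R L q2 by exact: tm_refine.
rewrite t1 in pK1 dist; rewrite t2 in pK2 dist.
have b1 := tm_le pK1; have b2 := tm_le pK2.
have k1 := key _ b1; have k2 := key _ b2.
have pl a : (k <= a)%N -> 2 ^- a <= e / 8 :> R.
  move=> ka; apply: le_trans ke; rewrite lef_pV2 ?posrE//.
  by rewrite ler_weXn2l// ler1n.
have x1 := xh_db a1 p1 w; have x2 := xh_db a2 p2 w.
rewrite t1 in x1; rewrite t2 in x2.
have l1 := pl _ ka1; have l2 := pl _ ka2.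
have qd : (`|q1%:R - q2%:R| <= l%:R :> R).
  move: dist; rewrite /tm -mulrBl normrM [`|_^-1|]ger0_norm// ler_pdivrMr//.
  by rewrite /l natrX -{1}(subnK kL) exprD mulrCA mulVf ?mulr1// gt_eqF.
(* Times within 2^-k of each other lie in the same window or in adjacent ones. *)
have adj : `|w (tm R k (q1 %/ l)) - w (tm R k (q2 %/ l))| <= e / 8.
  wlog le12 : q1 q2 {t1 t2 k1 k2 x1 x2 pK1 pK2 dist} b1 b2 qd / (q1 <= q2)%N.
    move=> H; have [h|h] := leqP q1 q2; first exact: H.
    by rewrite distrC; apply: H => //; [rewrite distrC|exact: ltnW].
  have q2l : (q2 <= q1 + l)%N.
    by move: qd; rewrite distrC -natrB// normr_nat ler_nat leq_subLR.
  have l0 : (0 < l)%N by rewrite expn_gt0.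
  have d1 := leq_div2r l le12; have := leq_div2r l q2l.
  rewrite divnDr ?dvdnn// divnn l0 addn1 => d2.
  move: d1; rewrite leq_eqVlt => /orP[/eqP ->|d1]; first by rewrite subrr normr0 ltW.
  have -> : (q2 %/ l = (q1 %/ l).+1)%N by apply/eqP; rewrite eqn_leq d2 d1.
  rewrite distrC; apply: next.
  exact: divl.
move: ee; rewrite ltNge => /negP; apply.
set y1 := w (tm R L q1) in k1 x1; set y2 := w (tm R L q2) in k2 x2.
set z1 := w (tm R k _) in k1 adj; set z2 := w (tm R k (q2 %/ l)) in k2 adj.
set X1 := xh R n _ _ _ in x1 *; set X2 := xh R n _ _ _ in x2 *.
(* Five increments of size at most e / 8: rounding, distance to the start of the window, passage
   between the two windows, and back. *)
have -> : X1 - X2 = ((X1 - y1) + (y1 - z1)) + (z1 - z2) - ((X2 - y2) + (y2 - z2)).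
  by apply/rowP => j; rewrite !mxE; ring.
have n1 := ler_normB (((X1 - y1) + (y1 - z1)) + (z1 - z2)) ((X2 - y2) + (y2 - z2)).
have n2 := ler_normD ((X1 - y1) + (y1 - z1)) (z1 - z2).
have n3 := ler_normD (X1 - y1) (y1 - z1).
have n4 := ler_normD (X2 - y2) (y2 - z2).
by move: n1 n2 n3 n4 k1 k2 x1 x2 l1 l2 adj e0; lra.
Qed.

End Oscillation.

(** * The continuous path read from a sequence of bits *)

Section LimitPath.
Variables (R : realType) (n : nat).
Local Notation V := 'rV[R]_n.+1.
Local Notation D := (cadlag_path R n).
Local Notation xh := (xh R n).
Local Notation tm := (tm R).

Definition al (l : nat) (t : R) : nat := Num.truncn (2 ^+ l * t).

Lemma p2_gt0 l : 0 < 2 ^- l :> R.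
Proof. by rewrite invr_gt0 two_exp_gt0. Qed.

Lemma p2_le k l : (k <= l)%N -> 2 ^- l <= 2 ^- k :> R.
Proof. by move=> kl; rewrite lef_pV2 ?posrE ?two_exp_gt0// ler_weXn2l// ler1n. Qed.

Lemma p2S l : 2 ^- l.+1 = 2 ^- l / 2 :> R.
Proof. by rewrite exprS invfM mulrC. Qed.

Lemma p2_small (e : R) : 0 < e -> exists k, forall l, (k <= l)%N -> 2 ^- l <= e :> R.
Proof.
move=> e0; pose k := (Num.truncn e^-1).+1; exists k => l /p2_le; move=> /le_trans; apply.
rewrite -[leRHS]invrK lef_pV2 ?posrE ?two_exp_gt0 ?invr_gt0//.
have /andP[_ h] := truncn_itv (ltW (eqbRL (invr_gt0 e) e0)).
apply: (le_trans (ltW h)); rewrite -/k -natrX ler_nat; exact/ltnW/ltn_expl.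
Qed.

Lemma al_floor l t : 0 <= t -> tm l (al l t) <= t < tm l (al l t) + 2 ^- l.
Proof.
move=> t0; have p0 := two_exp_gt0 R l.
have /andP[h1 h2] := truncn_itv (mulr_ge0 (ltW p0) t0).
rewrite -/(al l t) in h1 h2.
rewrite /tm ler_pdivrMr// mulrC h1/= -[X in _ + X]mul1r -mulrDl ltr_pdivlMr//.
by rewrite natr1 mulrC.
Qed.

Lemma al_neg l t : t <= 0 -> al l t = 0%N.
Proof.
move=> t0; apply/Num.Theory.truncn0Pn; rewrite -ltNge; apply: le_lt_trans ltr01.
by rewrite mulr_ge0_le0// ltW// two_exp_gt0.
Qed.

Lemma al_le l t : tm l (al l t) <= Num.max 0 t.
Proof.
have [t0|t0] := leP 0 t; first by have /andP[] := al_floor l t0.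
by rewrite al_neg ?(ltW t0)// /tm mul0r.
Qed.

Lemma al_near l t : `|tm l (al l t) - Num.max 0 t| <= 2 ^- l.
Proof.
have p0 := p2_gt0 l.
have [t0|t0] := leP 0 t.
  by have /andP[h1 h2] := al_floor l t0; rewrite distrC ger0_norm; move: h1 h2 p0; lra.
by rewrite al_neg ?(ltW t0)// /tm mul0r subrr normr0 ltW.
Qed.

Lemma al_cauchy k l l' t : (k <= l)%N -> (k <= l')%N ->
  `|tm l (al l t) - tm l' (al l' t)| <= 2 ^- k.
Proof.
move=> kl kl'; have [t0|t0] := leP 0 t; last first.
  by rewrite !al_neg ?(ltW t0)// /tm !mul0r subrr normr0 ltW ?p2_gt0.
have /andP[h1 h2] := al_floor l t0; have /andP[h3 h4] := al_floor l' t0.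
have q1 := p2_le kl; have q2 := p2_le kl'.
by rewrite ler_norml; apply/andP; split; move: h1 h2 h3 h4 q1 q2; lra.
Qed.

Definition reg (K k : nat) (e : R) (f : nat -> bool) := forall l l' a a',
  (k <= l)%N -> (k <= l')%N -> tm l a <= K%:R -> tm l' a' <= K%:R ->
  `|tm l a - tm l' a'| <= 2 ^- k -> `|xh l a f - xh l' a' f| <= e.

(** The bits describe points close to the simplex and have a modulus of continuity on every bounded
    interval; the index [i] serves both as horizon and as precision. *)
Definition good (f : nat -> bool) :=
  (forall l a, exists2 z : V, simplex z & `|z - xh l a f| <= 2 ^- l) /\
  forall i, exists k, reg i k i.+1%:R^-1 f.

Definition limit_fun (f : nat -> bool) (t : R) : V := lim (xh l (al l t) f @[l --> \oo]).

Lemma reg_le K K' k e e' f : (K' <= K)%N -> e <= e' -> reg K k e f -> reg K' k e' f.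
Proof.
move=> KK ee H l l' a a' kl kl' aK aK' d; apply: le_trans ee.
by apply: H => //; [apply: (le_trans aK)|apply: (le_trans aK')]; rewrite ler_nat.
Qed.

Lemma good_reg f K e : good f -> 0 < e -> exists k, reg K k e f.
Proof.
move=> [_ gf] e0; pose i := maxn K (Num.truncn e^-1).
have [k Hk] := gf i; exists k; apply: reg_le Hk; first by rewrite leq_maxl.
rewrite -[leRHS]invrK lef_pV2 ?posrE ?invr_gt0//.
have /andP[_ h] := truncn_itv (ltW (eqbRL (invr_gt0 e) e0)).
by apply: (le_trans (ltW h)); rewrite ler_nat ltnS leq_maxr.
Qed.

Lemma al_le_nat l t K : t <= K%:R -> tm l (al l t) <= K%:R.
Proof. by move=> tK; apply: (le_trans (al_le l t)); rewrite ge_max ler0n. Qed.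

Lemma limit_fun_cvg f t : good f -> xh l (al l t) f @[l --> \oo] --> limit_fun f t.
Proof.
move=> gf; apply/cauchy_cvgP; apply: (@cauchy_exP R) => e e0.
pose K := (Num.truncn t).+1.
have tK : t <= K%:R by apply: ltW; exact: truncnS_gt.
have e20 : 0 < e / 2 by rewrite divr_gt0.
have [k Hk] := good_reg K gf e20.
exists (xh k (al k t) f); exists k => // l /= kl.
rewrite -ball_normE/=; apply: (@le_lt_trans _ _ (e / 2)); last by move: e0; lra.
by apply: Hk => //; rewrite ?al_le_nat// al_cauchy.
Qed.

Lemma norm_lim_le (u : nat -> V) (y z : V) (c : R) k : u l @[l --> \oo] --> y ->
  (forall l, (k <= l)%N -> `|u l - z| <= c) -> `|y - z| <= c.
Proof.
move=> uy H.
have h : `|u l - z| @[l --> \oo] --> `|y - z|.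
  by apply: cvg_norm; apply: cvgB => //; exact: cvg_cst.
apply: (@ler_cvg_to _ _ _ _ _ _ _ _ h (cvg_cst c)).
by exists k => // l /= kl; exact: H.
Qed.

Lemma limit_fun_close f K k e t l a : good f -> reg K k e f -> t <= K%:R -> (k < l)%N ->
  tm l a <= K%:R -> `|Num.max 0 t - tm l a| <= 2 ^- k / 2 -> `|limit_fun f t - xh l a f| <= e.
Proof.
move=> gf rf tK kl aK dt; apply: (@norm_lim_le _ _ _ _ k.+1 (@limit_fun_cvg f t gf)) => l' kl'.
apply: rf => //; try exact: ltnW; first exact: al_le_nat.
(* Half of 2^-k pays for rounding t at level [l' > k], the other half is [dt]. *)
have h1 := al_near l' t; have h2 := p2_le kl'; rewrite p2S in h2.
rewrite (_ : _ - _ = (tm l' (al l' t) - Num.max 0 t) + (Num.max 0 t - tm l a)); last by ring.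
by apply: (le_trans (ler_normD _ _)); move: h1 h2 dt; lra.
Qed.

Lemma limit_fun_al f K k e t l : good f -> reg K k e f -> t <= K%:R -> (k < l)%N ->
  `|limit_fun f t - xh l (al l t) f| <= e.
Proof.
move=> gf rf tK kl; apply: (limit_fun_close gf rf tK kl); first exact: al_le_nat.
by rewrite distrC (le_trans (al_near l t))// -p2S p2_le.
Qed.

Lemma limit_fun_mod f K k e s t : good f -> reg K k e f -> s <= K%:R -> t <= K%:R ->
  `|s - t| <= 2 ^- k / 4 -> `|limit_fun f s - limit_fun f t| <= e + e.
Proof.
move=> gf rf sK tK st; pose l := k.+2; pose a := al l t.
have p0 := p2_gt0 k.
have h1 : `|limit_fun f s - xh l a f| <= e.
  have kl : (k < l)%N by exact: ltnW.
  apply: (limit_fun_close gf rf sK kl); first exact: al_le_nat.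
  have h := al_near l t; rewrite -/a distrC in h; rewrite 2!p2S in h.
  have h' : `|Num.max 0 s - Num.max 0 t| <= `|s - t|.
    by have := ler_norm (s - t); have := ler_normlW (lexx `|t - s|); rewrite (distrC t s);
      have [s0|s0] := leP 0 s; have [t0|t0] := leP 0 t => n1 n2;
      rewrite ler_norml; apply/andP; split; move: n1 n2 s0 t0; lra.
  rewrite (_ : _ - _ = (Num.max 0 s - Num.max 0 t) + (Num.max 0 t - tm l a)); last by ring.
  by apply: (le_trans (ler_normD _ _)); move: h h' st; lra.
have h2 : `|limit_fun f t - xh l a f| <= e by apply: (limit_fun_al gf rf tK); exact: ltnW.
rewrite (_ : limit_fun f s - _ = (limit_fun f s - xh l a f) - (limit_fun f t - xh l a f)).
  by apply: (le_trans (ler_normB _ _)); exact: lerD.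
by rewrite opprB addrA subrK.
Qed.

(** The approximations may leave the simplex, but nearby points of it have the same limit, and the
    simplex is closed. *)
Lemma limit_fun_simplex f t : good f -> simplex (limit_fun f t).
Proof.
move=> gf; pose z l := sval (cid2 (gf.1 l (al l t))).
have zS l : simplex (z l) by rewrite /z; case: cid2.
have zx l : `|z l - xh l (al l t) f| <= 2 ^- l by rewrite /z; case: cid2.
have zc : z l @[l --> \oo] --> limit_fun f t.
  apply/cvgrPdist_lt => e e0; have e20 : 0 < e / 2 by rewrite divr_gt0.
  have /cvgrPdist_lt/(_ _ e20)[k1 _ H1] := @limit_fun_cvg f t gf.
  have e40 : 0 < e / 4 by rewrite divr_gt0.
  have [k2 H2] := p2_small e40.
  exists (maxn k1 k2) => // l /=; rewrite geq_max => /andP[kl1 kl2].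
  have q1 := H1 l kl1; have q2 := zx l; have q3 := H2 l kl2.
  rewrite (_ : _ - z l = (limit_fun f t - xh l (al l t) f) - (z l - xh l (al l t) f)).
    by apply: (le_lt_trans (ler_normB _ _)); move: q1 q2 q3 e0 => /=; lra.
  by rewrite opprB addrA subrK.
have cS : closed (simplex : set V).
  by apply: compact_closed; [exact: norm_hausdorff|exact: simplex_compact].
by apply: (@closed_cvg _ _ _ _ _ _ cS _ _ zc); exact: nearW.
Qed.

Lemma limit_fun_continuous f : good f -> continuous (limit_fun f).
Proof.
move=> gf t; apply/cvgrPdist_lt => e e0.
have e40 : 0 < e / 4 by rewrite divr_gt0.
pose K := (Num.truncn t).+2.
have tK : t < K%:R - 1.
  by rewrite /K -natr1 addrK; exact: truncnS_gt.
have [k rk] := good_reg K gf e40.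
have p0 := p2_gt0 k.
apply: (iffRL (nbhs_normP (t : R^o) _)); exists (Num.min 1 (2 ^- k / 4)).
  by rewrite /= lt_min ltr01 divr_gt0.
move=> s /=; rewrite lt_min => /andP[s1 s2].
apply: (@le_lt_trans _ _ (e / 4 + e / 4)); last by move: e0; lra.
apply: (limit_fun_mod gf rk); last exact: ltW.
  by move: tK; lra.
by move: s1 tK; rewrite ltr_norml => /andP[]; lra.
Qed.

Lemma limit_fun_neg f t : t <= 0 -> limit_fun f t = limit_fun f 0.
Proof.
move=> t0; rewrite /limit_fun.
suff -> : (fun l => xh l (al l t) f) = (fun l => xh l (al l 0) f) by [].
by apply/funext => l; rewrite (al_neg l t0) (al_neg l (lexx 0)).
Qed.

Definition limit_path f (gf : good f) : D := @CadlagPath R n (limit_fun f)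
  (fun t => limit_fun_simplex t gf) (@limit_fun_neg f)
  (fun t => cvg_at_right_filter (@limit_fun_continuous f gf t))
  (fun t => cvgP _ (cvg_at_left_filter (@limit_fun_continuous f gf t))).

(** The constant path is a default value on sequences that are not good; these will form a null
    event. *)
Definition path_of (f : nat -> bool) : D :=
  if pselect (good f) is left gf then limit_path gf else cst_path R n.

Lemma path_ofE f t : good f -> path_of f t = limit_fun f t.
Proof. by rewrite /path_of; case: pselect. Qed.

(* The counterpart of limit_fun_al for a jump path: w t is a limit of values of w
   at dyadic times on the right of t. *)
Lemma db_al (w : D) K k e t l : reg K k e (bits (@db R n) w) -> 0 <= t < K%:R -> (k < l)%N ->
  `|w t - xh l (al l t) (bits (@db R n) w)| <= e.
Proof.
move=> rf /andP[t0 tK] kl; apply/ler_addgt0Pr => d d0.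
have d20 : 0 < d / 2 by rewrite divr_gt0.
have /cvgrPdist_lt/(_ _ d20) := @path_right_continuous R n w t.
rewrite near_withinE => /(@nbhs_normP R R^o)[h /= h0 Hh].
have m0 : 0 < Num.min (Num.min h (K%:R - t)) (Num.min (d / 2) (2 ^- k / 2)).
  by rewrite !lt_min h0 subr_gt0 tK d20 divr_gt0// p2_gt0.
have [k' Hk'] := p2_small (divr_gt0 m0 (ltr0n _ 2)).
pose L := maxn k.+1 k'; pose a := (al L t).+1.
have := Hk' L (leq_maxr _ _); set q := 2 ^- L => qm.
have q0 : 0 < q := p2_gt0 L.
have : q < Num.min (Num.min h (K%:R - t)) (Num.min (d / 2) (2 ^- k / 2)) by move: qm m0; lra.
rewrite !lt_min => /andP[/andP[qh qK] /andP[qd qk]].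
have /andP[f1 f2] := al_floor L t0; have /andP[f3 f4] := al_floor l t0.
have ta : tm L a = tm L (al L t) + q by rewrite /a /tm -[_.+1%:R]natr1 mulrDl mul1r.
have l2 : 2 ^- l <= 2 ^- k / 2 :> R by rewrite -p2S p2_le.
rewrite -/q in f2.
have b1 : `|w t - w (tm L a)| < d / 2.
  apply: Hh; last by move: f2; rewrite ta /=; lra.
  by rewrite /= distrC ta ger0_norm; move: f1 f2 qh; lra.
have b2 := xh_db L a w; rewrite -/q in b2.
have b3 : `|xh L a (bits (@db R n) w) - xh l (al l t) (bits (@db R n) w)| <= e.
  apply: rf; [by rewrite ltnW// leq_maxl|exact: ltnW|by rewrite ta; move: f1 qK; lra| |].
    by move: f3 tK; lra.
  by rewrite ler_norml ta; apply/andP; split; move: f1 f2 f3 f4 l2 qk; lra.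
set X := xh L a _ in b2 b3; set Z := xh l _ _ in b3 *; set W := w (tm L a) in b1 b2.
rewrite (_ : w t - Z = (w t - W) - (X - W) + (X - Z)); last by apply/rowP => j; rewrite !mxE; ring.
have n1 := ler_normD ((w t - W) - (X - W)) (X - Z); have n2 := ler_normB (w t - W) (X - W).
by move: n1 n2 b1 b2 b3 qd; lra.
Qed.

End LimitPath.

(** * Integrals of bounded measurable functions *)

Section BoundedIntegral.
Context d (T : measurableType d) (R : realType) (P : probability T R).

Implicit Types (A E : set T) (f g : T -> R) (c eta : R).

Definition bounded_measurable (f : T -> R) :=
  measurable_fun setT f /\ exists B, forall u, `|f u| <= B.

Lemma bm_integrable A f : measurable A -> bounded_measurable f ->
  P.-integrable A (EFin \o f).
Proof.
move=> mA [mf [B HB]]; apply: measurable_bounded_integrable => //.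
- by apply: (le_lt_trans (probability_le1 P mA)); rewrite ltry.
- exact: measurable_funTS.
exists B; split; first exact: num_real.
by move=> B' BB u _; apply: (le_trans (HB u)); exact: ltW.
Qed.

Lemma bmD f g : bounded_measurable f -> bounded_measurable g ->
  bounded_measurable (fun u => f u + g u).
Proof.
move=> [mf [B HB]] [mg [B' HB']]; split; first exact: measurable_funD.
by exists (B + B') => u; apply: (le_trans (ler_normD _ _)); exact: lerD.
Qed.

Lemma bmZ c f : bounded_measurable f -> bounded_measurable (fun u => c * f u).
Proof.
move=> [mf [B HB]]; split; first by apply: measurable_funM => //; exact: measurable_cst.
by exists (`|c| * B) => u; rewrite normrM ler_wpM2l.
Qed.

Lemma bmB f g : bounded_measurable f -> bounded_measurable g ->
  bounded_measurable (fun u => f u - g u).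
Proof.
move=> [mf [B HB]] [mg [B' HB']]; split; first exact: measurable_funB.
by exists (B + B') => u; apply: (le_trans (ler_normB _ _)); exact: lerD.
Qed.

Lemma bm_cst c : bounded_measurable (fun=> c).
Proof. by split; [exact: measurable_cst|exists `|c|]. Qed.

Lemma bm_indic A : measurable A -> bounded_measurable (\1_A : T -> R).
Proof.
move=> mA; split; first exact: measurable_indic.
by exists 1 => u; rewrite indicE; case: (u \in A); rewrite ?normr1 ?normr0.
Qed.

Lemma Rint_cst A c : measurable A -> \int[P]_(u in A) c = c * pr P A.
Proof. by move=> mA; rewrite Rintegral_cst. Qed.

Lemma RintD A f g : measurable A -> bounded_measurable f -> bounded_measurable g ->
  \int[P]_(u in A) (f u + g u) = \int[P]_(u in A) f u + \int[P]_(u in A) g u.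
Proof. by move=> mA bf bg; rewrite RintegralD//; exact: bm_integrable. Qed.

Lemma RintB A f g : measurable A -> bounded_measurable f -> bounded_measurable g ->
  \int[P]_(u in A) (f u - g u) = \int[P]_(u in A) f u - \int[P]_(u in A) g u.
Proof. by move=> mA bf bg; rewrite RintegralB//; exact: bm_integrable. Qed.

Lemma RintZ A c f : measurable A -> bounded_measurable f ->
  \int[P]_(u in A) (c * f u) = c * \int[P]_(u in A) f u.
Proof. by move=> mA bf; rewrite RintegralZl//; exact: bm_integrable. Qed.

Lemma Rint_indic A (B : set T) : measurable A -> measurable B ->
  \int[P]_(u in A) (\1_B u) = pr P (A `&` B).
Proof. by move=> mA mB; rewrite /Rintegral integral_indic// setIC. Qed.

(** The form in which every approximation is used: [f] is small outside a rare event [E] and bounded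
    on it. *)
Lemma Rint_bound A E f eta (B : R) : measurable A -> measurable E -> measurable_fun setT f ->
  0 <= eta -> (forall u, `|f u| <= B) -> (forall u, A u -> ~ E u -> `|f u| <= eta) ->
  `|\int[P]_(u in A) f u| <= eta * pr P A + B * pr P (A `&` E).
Proof.
move=> mA mE mf eta0 HB Heta.
have bf : bounded_measurable f by split=> //; exists B.
apply: (le_trans (le_normr_Rintegral mA (bm_integrable mA bf))).
have bn : bounded_measurable (fun u => `|f u|).
  by split; [exact: measurableT_comp|exists B => u; rewrite normr_id].
have bI : bounded_measurable (fun u => B * (\1_E u : R)) by apply: bmZ; exact: bm_indic.
apply: (@le_trans _ _ (\int[P]_(u in A) (eta + B * (\1_E u : R)))).
  apply: le_Rintegral => //; first exact: bm_integrable.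
    by apply: bm_integrable => //; apply: bmD => //; exact: bm_cst.
  move=> u Au; rewrite indicE; have [Eu|Eu] := pselect (E u).
    by rewrite mem_set// mulr1 (le_trans (HB u))// lerDr.
  by rewrite memNset// mulr0 addr0 Heta.
rewrite RintD//; last exact: bm_cst.
by rewrite Rint_cst// RintZ// ?Rint_indic//; exact: bm_indic.
Qed.

Lemma Rint_setD A (B : set T) f : measurable A -> measurable B -> bounded_measurable f -> B `<=` A ->
  \int[P]_(u in A) f u = \int[P]_(u in B) f u + \int[P]_(u in A `\` B) f u.
Proof.
move=> mA mB bf BA; rewrite -{1}(setDUK BA) Rintegral_setU//.
- exact: measurableD.
- by rewrite setDUK//; exact: bm_integrable.
- by apply/disj_setPS => u [Bu [_ nB]].
Qed.

Lemma Rint_null A (B : set T) f : measurable A -> measurable B -> bounded_measurable f ->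
  pr P (~` B) = 0 -> \int[P]_(u in A) f u = \int[P]_(u in A `&` B) f u.
Proof.
move=> mA mB bf B0; rewrite (@Rint_setD A (A `&` B) f mA (measurableI _ _ mA mB) bf (@subIsetl _ _ _)).
have mD : measurable (A `\` (A `&` B)) by apply: measurableD => //; exact: measurableI.
have [mf [b Hb]] := bf.
have h := @Rint_bound _ setT f 0 b mD measurableT mf (lexx _) Hb (fun u _ n => False_ind _ (n I)).
rewrite [X in _ + X = _](_ : _ = 0) ?addr0//; apply/eqP; rewrite -normr_le0.
apply: (le_trans h); rewrite mul0r add0r setIT.
have -> : pr P (A `\` (A `&` B)) = 0; last by rewrite mulr0.
apply/le_anti; rewrite pr_ge0 andbT -B0; apply: prS => //; first exact: measurableC.
by move=> u [Au nAB] Bu; apply: nAB.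
Qed.

Lemma bm_sum (I : Type) (s : seq I) (F : I -> T -> R) : (forall i, bounded_measurable (F i)) ->
  bounded_measurable (fun u => \sum_(i <- s) F i u).
Proof.
move=> bF; elim: s => [|i s IH].
  by under eq_fun do rewrite big_nil; exact: bm_cst.
by under eq_fun do rewrite big_cons; exact: bmD.
Qed.

Lemma Rint_sum A (I : Type) (s : seq I) (F : I -> T -> R) : measurable A ->
  (forall i, bounded_measurable (F i)) ->
  \int[P]_(u in A) (\sum_(i <- s) F i u) = \sum_(i <- s) \int[P]_(u in A) F i u.
Proof.
move=> mA bF; elim: s => [|i s IH].
  by rewrite big_nil; under eq_Rintegral do rewrite big_nil; rewrite Rint_cst// mul0r.
rewrite big_cons; under eq_Rintegral do rewrite big_cons.
by rewrite RintD ?IH//; exact: bm_sum.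
Qed.

Lemma Rint_finite (W : eqType) (s : seq W) (X : T -> W) (F : W -> R) A :
  uniq s -> measurable A -> (forall y, measurable [set u | X u = y]) ->
  bounded_measurable (F \o X) -> pr P (~` [set u | X u \in s]) = 0 ->
  \int[P]_(u in A) F (X u) = \sum_(y <- s) F y * pr P (A `&` [set u | X u = y]).
Proof.
move=> us mA mX bF s0.
have mS : measurable [set u | X u \in s].
  rewrite (_ : [set u | _] = [set u | exists2 y, y \in s & [set u | X u = y] u]).
    by apply: seq_bigcup_measurable => y _.
  by apply/seteqP; split => u /=; [move=> h; exists (X u)|move=> [y yp /= ->]].
rewrite (Rint_null mA mS bF s0).
transitivity (\int[P]_(u in A `&` [set u | X u \in s])
   \sum_(y <- s) F y * \1_[set u | X u = y] u).
  apply: eq_Rintegral => u; rewrite inE => -[_ /= Xs].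
  rewrite (bigD1_seq (X u))//= indicE mem_set// mulr1 big1 ?addr0// => y yX.
  by rewrite indicE memNset ?mulr0//= => E; move: yX; rewrite -E eqxx.
rewrite Rint_sum; last 2 first.
- exact: measurableI.
- by move=> y; apply: bmZ; exact: bm_indic.
rewrite big_seq [RHS]big_seq; apply: eq_bigr => y ys.
rewrite RintZ ?Rint_indic//; try (by exact: measurableI); last exact: bm_indic.
congr (_ * pr P _); apply/seteqP; split => u /=; first by move=> [[]].
by move=> [Au Xy]; split=> //; split=> //=; rewrite Xy.
Qed.

End BoundedIntegral.

Lemma pr_nd_cvg d (T : measurableType d) (R : realType) (P : probability T R) (F : nat -> set T) :
  (forall i, measurable (F i)) -> (forall i j, (i <= j)%N -> F i `<=` F j) ->
  pr P (F i) @[i --> \oo] --> pr P (\bigcup_i F i).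
Proof.
move=> mF ndF; have mU : measurable (\bigcup_i F i) by exact: bigcup_measurable.
have h : (P \o F) i @[i --> \oo] --> (pr P (\bigcup_i F i))%:E.
  rewrite -prK//; apply: nondecreasing_cvg_mu => // i j ij; exact/subsetPset/ndF.
exact: (fine_cvg h).
Qed.

Lemma pr_nd_le d (T : measurableType d) (R : realType) (P : probability T R) (F : nat -> set T) c :
  (forall i, measurable (F i)) -> (forall i j, (i <= j)%N -> F i `<=` F j) ->
  (forall i, pr P (F i) <= c) -> pr P (\bigcup_i F i) <= c.
Proof.
move=> mF ndF Fc.
by apply: (@ler_cvg_to _ _ _ _ _ _ _ _ (@pr_nd_cvg _ _ _ P F mF ndF) (cvg_cst c)); exact: nearW.
Qed.

Lemma inv_small (R : realType) (e : R) : 0 < e ->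
  exists N0, forall N, (N0 <= N)%N -> (0 < N)%N -> N%:R^-1 <= e /\ N%:R^-1 ^+ 2 <= e :> R.
Proof.
move=> e0; pose N0 := (Num.truncn e^-1).+1; exists N0 => N NN N_gt0.
have /andP[_ h] := truncn_itv (ltW (eqbRL (invr_gt0 e) e0)).
have N0' : 0 < N%:R :> R by rewrite ltr0n.
have h1 : N%:R^-1 <= e.
  rewrite -[leRHS]invrK lef_pV2 ?posrE ?invr_gt0//.
  by apply: (le_trans (ltW h)); rewrite ler_nat.
split=> //; rewrite expr2; apply: le_trans h1; apply: ler_piMr; first by rewrite invr_ge0 ltW.
by rewrite invf_le1// ler1n.
Qed.

(** * Measurability of evaluations and of the limit path *)

Section EvalMeasurable.
Variables (R : realType) (n : nat).
Local Notation S := 'I_n.+1.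
Local Notation V := 'rV[R]_n.+1.
Local Notation D := (cadlag_path R n).

Lemma eval_bm (G : V -> R) (t : R) : unif_cts G ->
  bounded_measurable ((fun w : D => G (w t)) : borel D -> R).
Proof.
move=> uG; split; last first.
  by have [B _ HB] := unif_cts_bounded uG; exists B => w; apply: HB; exact: path_simplex.
apply: (measurability _ (RGenOInfty.measurableE R)) => //.
move=> /= _ [_ [a ->] <-]; rewrite setTI preimage_itvoy.
(* [G] is continuous on the simplex only; this open set of the whole space has the same trace on the
   simplex as the superlevel set. *)
pose O : set V := [set y | exists z d, [/\ `|y - z| < d, 0 < d &
  forall z', simplex z' -> `|z' - z| < d -> a < G z']].
rewrite (_ : [set w | _] = [set w : D | O (w t)]).
  apply: eval_measurable; apply: normP_open => y [z [d [yz d0 H]]].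
  exists (d - `|y - z|) => [|y' y'y]; first by rewrite subr_gt0.
  exists z, d; split => //; rewrite -(subrK y y') -addrA.
  by apply: (le_lt_trans (ler_normD _ _)); rewrite -ltrBrDr.
apply/seteqP; split => w /=.
  move=> aG; have [d d0 Hd] := uG (G (w t) - a) (eqbRL (subr_gt0 _ _) aG).
  exists (w t), d; rewrite subrr normr0; split=> // z' z'S z'w.
  have := Hd z' (w t) z'S (path_simplex w t) z'w.
  by rewrite ltr_norml => /andP[]; lra.
by move=> [z [d [wz d0 H]]]; apply: H => //; exact: path_simplex.
Qed.

End EvalMeasurable.

Section BitEvents.
Variables (R : realType) (n : nat).
Local Notation S := 'I_n.+1.
Local Notation V := 'rV[R]_n.+1.
Local Notation D := (cadlag_path R n).
Context d (T : measurableType d) (P : probability T R) (db' : nat -> T -> bool).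
Hypothesis mdb : forall i, measurable [set w | db' i w].

Lemma osc_mono K k L L' e f : (L <= L')%N -> osc n K k L e f -> @osc R n K k L' e f.
Proof.
move=> LL [l [l' [a [a' [[/andP[kl lL] /andP[kl' lL'] aK aK'] dd ee]]]]].
by exists l, l', a, a'; split => //; split => //; rewrite ?kl ?kl' (leq_trans _ LL).
Qed.

Lemma regE K k (e : R) : [set w | reg n K k e (bits db' w)] =
  ~` \bigcup_L [set w | osc n K k L e (bits db' w)].
Proof.
apply/seteqP; split => w /=.
  move=> H [L _ [l [l' [a [a' [[/andP[kl lL] /andP[kl' lL'] aK aK'] dd ee]]]]]].
  by move: ee; rewrite ltNge H.
move=> H l l' a a' kl kl' aK aK' dd; rewrite leNgt; apply/negP => ee; apply: H.
by exists (maxn l l') => //; exists l, l', a, a'; rewrite kl kl' leq_maxl leq_maxr.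
Qed.

Lemma osc_measurable K k L (e : R) : measurable [set w | osc n K k L e (bits db' w)].
Proof. by have [M dM] := @osc_depends R n K k L e; exact: depends_measurable dM. Qed.

Lemma reg_measurable K k (e : R) : measurable [set w | reg n K k e (bits db' w)].
Proof.
rewrite regE; apply: measurableC; apply: bigcup_measurable => L _; exact: osc_measurable.
Qed.

Lemma pr_reg_le K k (e c : R) :
  (forall L, (k <= L)%N -> pr P [set w | osc n K k L e (bits db' w)] <= c) ->
  pr P (~` [set w | reg n K k e (bits db' w)]) <= c.
Proof.
move=> H; rewrite regE setCK; apply: pr_nd_le => [L|L L' LL w|L].
- exact: osc_measurable.
- exact: osc_mono.
apply: le_trans (H (maxn L k) (leq_maxr _ _)).
by apply: prS; [exact: osc_measurable|exact: osc_measurable|move=> w; apply: osc_mono; exact: leq_maxl].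
Qed.

Lemma near_simplex_depends l a :
  exists M, depends M (fun f => exists2 z : V, simplex z & `|z - xh R n l a f| <= 2 ^- l).
Proof.
have [M HM] := @xh_depends R n l a; exists M => f h fh; by rewrite (HM f h fh).
Qed.

Lemma goodE : [set w | good R n (bits db' w)] =
  (\bigcap_l \bigcap_a [set w | exists2 z : V, simplex z & `|z - xh R n l a (bits db' w)| <= 2 ^- l])
  `&` \bigcap_i \bigcup_k [set w | reg n i k (i.+1%:R^-1 : R) (bits db' w)].
Proof.
apply/seteqP; split => w /= [h1 h2].
  split => [l _ a _|i _]; first exact: h1.
  by have [k Hk] := h2 i; exists k.
split => [l a|i]; first exact: (h1 l I a I).
by have [k _ Hk] := h2 i I; exists k.
Qed.

Lemma good_measurable : measurable [set w | good R n (bits db' w)].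
Proof.
rewrite goodE; apply: measurableI.
  apply: bigcapT_measurable => l; apply: bigcapT_measurable => a.
  by have [M dM] := near_simplex_depends l a; exact: depends_measurable dM.
apply: bigcapT_measurable => i; apply: bigcupT_measurable => k; exact: reg_measurable.
Qed.

End BitEvents.

Lemma pr_null_bigcup d (T : measurableType d) (R : realType) (P : probability T R) (F : nat -> set T) :
  (forall i, measurable (F i)) -> (forall i, pr P (F i) = 0) -> pr P (\bigcup_i F i) = 0.
Proof.
move=> mF F0; have mU : measurable (\bigcup_i F i) by exact: bigcup_measurable.
have : P.-negligible (\bigcup_i F i).
  by apply: negligible_bigcup => i; exists (F i); split=> //; have := prK P (mF i); rewrite F0.
by move=> /(measure_negligible mU) PU; rewrite /pr; move: PU => /= ->.
Qed.

Section PathOfMeasurable.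
Variables (R : realType) (n : nat).
Local Notation D := (cadlag_path R n).
Local Notation xh := (xh R n).
Implicit Types (f : nat -> bool) (O : set D).

Lemma path_close f K k e t l : good R n f -> reg n K k e f -> t <= K%:R -> (k < l)%N ->
  `|path_of R n f t - xh l (al l t) f| <= e.
Proof. by move=> gf rf tK kl; rewrite path_ofE// (limit_fun_al gf rf). Qed.

(** With the identity as time change, uniform closeness on a long interval implies J1 closeness; one
    integer serves as horizon and inverse precision. *)
Lemma deep_open O (w : D) : open O -> O w -> exists J : nat, forall v : D,
  (forall t, 0 <= t <= J%:R -> `|v t - w t| <= J.+1%:R^-1) -> O v.
Proof.
move=> /skorohod_openE oO /oO[T [e [e0 sub]]].
pose J := maxn (Num.truncn T).+1 (Num.truncn e^-1).+1; exists J => v vw; apply: sub.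
exists id; first by split => // u u0; exists u.
move=> t /andP[t0 tT]; rewrite subrr normr0; split => //.
apply: (le_lt_trans (vw t _)).
  rewrite t0 (le_trans tT)// (le_trans (ltW (truncnS_gt T)))// ler_nat leq_max leqnn //.
rewrite -[ltRHS]invrK ltf_pV2 ?posrE ?invr_gt0//.
by apply: (lt_le_trans (truncnS_gt _)); rewrite ler_nat ltnW// ltnS leq_max leqnn orbT.
Qed.

(** The bits certify [O]: every path in the tube of radius 2 e around the position read at level
    [k], up to time [J], lies in [O]. Only finitely many dyadic times matter. *)
Definition pat O (J k : nat) (e : R) f := forall v : D,
  (forall t, 0 <= t <= J%:R -> `|v t - xh k (al k t) f| <= 2 * e) -> O v.

Lemma pat_depends O J k e : exists M, depends M (pat O J k e).
Proof.
have [M HM] := @dep_common _ _ (xh k) _ (iota 0 (J * 2 ^ k).+1) id (xh_depends R n k).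
exists M; suff imp f h : (forall i, (i < M)%N -> f i = h i) -> pat O J k e f -> pat O J k e h.
  by move=> f h fh; apply/propext; split; apply: imp => // i iM; rewrite fh.
move=> fh pf v vh; apply: pf => t t0J; have /andP[t0 tJ] := t0J.
rewrite (HM (al k t) _ f h fh); first exact: vh.
by rewrite mem_iota add0n ltnS; apply: (@tm_le R); exact: al_le_nat.
Qed.

Definition tol (J : nat) : R := (4 * J.+1%:R)^-1.

Lemma tol_gt0 J : 0 < tol J. Proof. by rewrite invr_gt0 mulr_gt0. Qed.

Lemma tol_le J J' : (J <= J')%N -> tol J' <= tol J.
Proof. by move=> JJ; rewrite lef_pV2 ?posrE ?mulr_gt0// ler_pM2l// ler_nat ltnS. Qed.

Lemma tolE J : 4 * tol J = J.+1%:R^-1.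
Proof. by rewrite /tol invfM mulrA divff ?mul1r. Qed.

(** The modulus keeps a path in the tube that [pat] requires. This works for the limit path
    ([inner_path]) and for a jump path with such bits ([pat_db]), which allows the transfer between
    the two. *)
Definition inner O (J k : nat) f := reg n J.+1 k (tol J) f /\ pat O J k.+1 (tol J) f.

Lemma inner_path O J k f : good R n f -> inner O J k f -> O (path_of R n f).
Proof.
move=> gf [rf pf]; apply: pf => t /andP[t0 tJ].
apply: le_trans (path_close gf rf _ _) _ => //; last by have := tol_gt0 J; lra.
by apply: (le_trans tJ); rewrite ler_nat.
Qed.

Lemma path_inner O f : open O -> good R n f -> O (path_of R n f) -> exists J k, inner O J k f.
Proof.
move=> oO gf /(deep_open oO)[J HJ]; exists J.
have [k rk] := good_reg J.+1 gf (tol_gt0 J).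
exists k; split=> // v vx; apply: HJ => t t0J; have /andP[t0 tJ] := t0J.
have h1 := vx t t0J; have tJ1 : t <= J.+1%:R by apply: (le_trans tJ); rewrite ler_nat.
have h2 := path_close gf rk tJ1 (ltnSn k).
rewrite -tolE; set X := xh _ _ _ in h1 h2; have e0 := tol_gt0 J.
rewrite (_ : v t - _ = (v t - X) - (path_of R n f t - X)); last by rewrite opprB addrA subrK.
by apply: (le_trans (ler_normB _ _)); move: h1 h2 e0; lra.
Qed.

Lemma pat_db O J k e (w : D) : 0 <= e -> reg n J.+1 k e (bits (@db R n) w) ->
  pat O J k.+1 e (bits (@db R n) w) -> O w.
Proof.
move=> e0 rw_ pf; apply: pf => t /andP[t0 tJ].
apply: (le_trans (db_al rw_ _ (ltnSn k))); last by move: e0; lra.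
by rewrite t0 (le_lt_trans tJ)// ltr_nat.
Qed.

Context d (T : measurableType d) (db' : nat -> T -> bool).
Hypothesis mdb : forall i, measurable [set w | db' i w].

Lemma inner_measurable O J k : measurable [set w | inner O J k (bits db' w)].
Proof.
apply: measurableI; first exact: reg_measurable.
by have [M dM] := pat_depends O J k.+1 (tol J); exact: depends_measurable dM.
Qed.

(** On good sequences, membership in an open set is the countable union over J and k of the events
    [inner]; elsewhere the path is constant. *)
Lemma path_of_measurable :
  measurable_fun setT ((fun w => path_of R n (bits db' w)) : T -> borel D).
Proof.
apply: (@measurability _ _ T (borel D) _ _ (@open D) erefl) => A [ O oO <-]; rewrite setTI.
have mG := good_measurable R n mdb.
rewrite (_ : _ @^-1` O =
  ([set w | good R n (bits db' w)] `&` \bigcup_J \bigcup_k [set w | inner O J k (bits db' w)])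
  `|` (~` [set w | good R n (bits db' w)] `&` (if `[< O (cst_path R n) >] then setT else set0))).
  apply: measurableU; apply: measurableI => //.
  - apply: bigcupT_measurable => J; apply: bigcupT_measurable => k; exact: inner_measurable.
  - exact: measurableC.
  - by case: asboolP.
apply/seteqP; split => w /=.
  have [gw|gw] := pselect (good R n (bits db' w)) => Ow.
    by left; split=> //; have [J [k Jk]] := path_inner oO gw Ow; exists J => //; exists k.
  right; split => //; move: Ow; rewrite /path_of; case: pselect => // _ Oc.
  by case: asboolP.
move=> [[gw [J _ [k _ Jk]]]|[gw]]; first exact: (inner_path gw Jk).
by rewrite /path_of; case: pselect => // _; case: asboolP.
Qed.

End PathOfMeasurable.

Section BitIntegral.
Context d (T : measurableType d) (R : realType) (P : probability T R) (db' : nat -> T -> bool).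
Hypothesis mdb : forall i, measurable [set w | db' i w].

Lemma depends_bm M (psi : (nat -> bool) -> R) B : depends M psi -> (forall f, `|psi f| <= B) ->
  bounded_measurable (fun w : T => psi (bits db' w)).
Proof.
move=> dp HB; split; last by exists B => w.
move=> _ Y _; rewrite setTI.
by apply: (@depends_measurable _ T db' mdb M (fun f => Y (psi f))) => f h fh; rewrite (dp f h fh).
Qed.

Lemma bitsum_int M (Phi : (nat -> bool) -> Prop) (psi : (nat -> bool) -> R) B :
  depends M Phi -> depends M psi -> (forall f, `|psi f| <= B) ->
  \int[P]_(w in [set w | Phi (bits db' w)]) psi (bits db' w) =
  bitsum P db' M (fun f => (`[< Phi f >])%:R * psi f).
Proof.
move=> dPhi dpsi HB; have mA := depends_measurable mdb dPhi.
pose X (w : T) : M.-tuple bool := [tuple db' i w | i < M].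
have E (s : M.-tuple bool) : [set w | X w = s] = cyl db' s.
  by apply/seteqP; split => w /= /tuple_of_cyl.
have psiX w : psi (bits db' w) = psi (nth false (X w)).
  by apply: depends_cyl dpsi _; exact/tuple_of_cyl.
under eq_Rintegral do rewrite psiX.
rewrite (@Rint_finite _ _ _ P _ (index_enum (M.-tuple bool)) X (fun s => psi (nth false s)))//.
- apply: eq_bigr => s _; rewrite E; case: asboolP => Ps.
    rewrite mul1r; congr (_ * pr P _); apply/seteqP; split => [w []//|w sw]; split=> //=.
    by rewrite (depends_cyl dPhi sw).
  rewrite mul0r (_ : _ `&` _ = set0) ?pr0 ?mulr0 ?mul0r//; apply/seteqP; split => // w [/= Pw sw]; apply: Ps.
  by rewrite -(depends_cyl dPhi sw).
- exact: index_enum_uniq.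
- by move=> s; rewrite E; exact: cyl_measurable.
- rewrite /comp; under eq_fun do rewrite -psiX; exact: depends_bm dpsi HB.
- rewrite (_ : ~` _ = set0) ?pr0//; apply/seteqP; split => // w /=; apply.
  by rewrite mem_index_enum.
Qed.

End BitIntegral.

(** * Regularity and marginals of the limit *)

Section LimitLaw.
Variables (R : realType) (n : nat).
Local Notation S := 'I_n.+1.
Local Notation V := 'rV[R]_n.+1.
Local Notation D := (cadlag_path R n).
Variables (r : S -> S -> R) (m : S -> R) (g : S -> nat -> R) (Cg : R).
Hypothesis r_ge0 : forall j k, 0 <= r j k.
Hypothesis r_irr : forall j k, connect (fun i l => 0 < r i l) j k.
Hypothesis m_inv : forall k, \sum_j m j * r j k = m k * \sum_l r k l.
Hypothesis m_ge0 : forall j, 0 <= m j.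
Hypothesis g_ge0 : forall j k, 0 <= g j k.
Hypothesis g_0 : forall j, g j 0%N = 0.
Hypothesis gC : forall j k, `|g j k - m j| <= Cg.
Hypothesis ngC : forall j k, k%:R * `|g j k - m j| <= Cg.

Lemma reg_bound (K : nat) (e : R) : 0 < e -> exists2 C : R, 0 <= C &
  forall N x_init (P : probability (borel D) R) k,
  (0 < N)%N -> zrp_law r g N x_init P -> 2 ^- k <= e / 8 ->
  pr P (~` [set w : D | reg n K k e (bits (@db R n) w)]) <= C * (2 ^- k + N%:R^-1 ^+ 2).
Proof.
move=> e0; have [C C0 HC] := osc_bound r_ge0 r_irr m_inv m_ge0 g_ge0 g_0 gC ngC K e0.
exists C => // N xi P k N0 law ke.
apply: (@pr_reg_le R n _ (borel D) P (@db R n) (@db_measurable' R n)) => L kL; exact: (HC N xi P k L N0 law kL ke).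
Qed.

Variables (xN : nat -> V) (x : V) (PN : nat -> probability (borel D) R).
Hypothesis PN_law : forall N, (0 < N)%N -> zrp_law r g N (xN N) (PN N).
Hypothesis xN_cvg : xN N @[N --> \oo] --> x.
Variable U : set_system nat.
Hypothesis UU : UltraFilter U.
Hypothesis U_tail : forall N0, U [set N | (N0 <= N)%N].

Let FU : ProperFilter U. Proof. exact: ultra_proper. Qed.
#[local] Existing Instance FU.

Local Notation db := (@db R n).
Local Notation mdb := (@db_measurable' R n).
Local Notation ob := (ob PN db U).
Local Notation fb := (bits ob).
Local Notation mob := (ob_measurable PN db U).
Local Notation uP := (@unitP R).
Local Notation Om := (g_sigma_algebraType R.-ocitv.-measurable).

Definition limit_map (u : Om) : borel D := path_of R n (fb u).

Lemma limit_map_measurable : measurable_fun setT limit_map.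
Proof. exact: path_of_measurable mob. Qed.

Lemma U_eventually N0 (Q : nat -> Prop) :
  (forall N, (N0 <= N)%N -> (0 < N)%N -> Q N) -> U [set N | Q N].
Proof.
move=> H; apply: filterS (U_tail (maxn N0 1)) => N /=.
by rewrite geq_max => /andP[h1 h2]; exact: H.
Qed.

(** At each level [L] the bound is inherited through finitely many bits. Along [U] the term N^-2 is
    eventually at most 2^-k, whence the factor 2. *)
Lemma reg_limit (K : nat) (e : R) : 0 < e -> exists2 C : R, 0 <= C &
  forall k, 2 ^- k <= e / 8 ->
  pr uP (~` [set u | reg n K k e (fb u)]) <= C * 2 ^- k.
Proof.
move=> e0; have [C C0 HC] := osc_bound r_ge0 r_irr m_inv m_ge0 g_ge0 g_0 gC ngC K e0.
exists (C * 2); first by rewrite mulr_ge0.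
move=> k ke; apply: (@pr_reg_le R n _ Om uP ob mob) => L kL.
have [M dM] := @osc_depends R n K k L e.
apply: (pr_bits_le mdb UU dM).
have [N0 HN] := inv_small (p2_gt0 R k).
apply: (@U_eventually N0) => N NN N_gt0.
apply: (le_trans (HC N _ _ k L N_gt0 (PN_law N_gt0) kL ke)).
rewrite -mulrA ler_wpM2l//; have [_ h] := HN N NN N_gt0.
by move: h; lra.
Qed.

(** Proximity to the simplex holds surely for each N, and the probability of having no modulus is
    below C 2^-k for all large k. Both defects are countable unions of null events. *)
Lemma good_limit : pr uP (~` [set u | good R n (fb u)]) = 0.
Proof.
pose A l a := ~` [set u | exists2 z : V, simplex z & `|z - xh R n l a (fb u)| <= 2 ^- l].
pose B i := \bigcap_k ~` [set u | reg n i k (i.+1%:R^-1 : R) (fb u)].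
have mA l a : measurable (A l a).
  by apply: measurableC; have [M dM] := near_simplex_depends R n l a; exact: depends_measurable mob _ _ dM.
have mB i : measurable (B i).
  by apply: bigcapT_measurable => k; apply: measurableC; exact: reg_measurable mob _ _ _.
have A0 l a : pr uP (A l a) = 0.
  apply/le_anti; rewrite pr_ge0 andbT; have [M dM] := near_simplex_depends R n l a.
  have dM' : depends M (fun f => ~ exists2 z : V, simplex z & `|z - xh R n l a f| <= 2 ^- l).
    by move=> f h fh; rewrite (dM f h fh).
  apply: (pr_bits_le mdb UU dM'); apply: (@U_eventually 0) => N _ N_gt0.
  rewrite (_ : [set w | _] = set0) ?pr0//; apply/seteqP; split => // w /=; apply.
  by exists (w (tm R l a)); [exact: path_simplex|rewrite distrC; exact: xh_db].
have B0 i : pr uP (B i) = 0.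
  apply/le_anti; rewrite pr_ge0 andbT; apply/ler_addgt0Pr => c c0; rewrite add0r.
  have i0 : 0 < i.+1%:R^-1 :> R by rewrite invr_gt0.
  have [C C0 HC] := reg_limit i i0.
  have C1 : 0 < C + 1 by rewrite ltr_wpDl.
  have [k1 H1] := p2_small (divr_gt0 i0 (ltr0n _ 8)).
  have [k2 H2] := p2_small (divr_gt0 c0 C1).
  pose k := maxn k1 k2.
  have mk : measurable (~` [set u | reg n i k (i.+1%:R^-1 : R) (fb u)]).
    by apply: measurableC; exact: reg_measurable mob _ _ _.
  apply: (@le_trans _ _ (pr uP (~` [set u | reg n i k (i.+1%:R^-1 : R) (fb u)]))).
    by apply: prS => //; [exact: mB|move=> u; apply].
  apply: (le_trans (HC k (H1 k (leq_maxl _ _)))).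
  have h2 := H2 k (leq_maxr _ _); rewrite ler_pdivlMr// in h2.
  by apply: le_trans h2; rewrite mulrC ler_wpM2l ?(ltW (p2_gt0 _ _))// lerDl.
rewrite (goodE R n ob) (_ : ~` _ = (\bigcup_l \bigcup_a A l a) `|` \bigcup_i B i); last first.
  rewrite setCI !setC_bigcap; congr (_ `|` _).
    by apply: eq_bigcupr => l _; rewrite setC_bigcap.
  by apply: eq_bigcupr => i _; rewrite setC_bigcup.
have mAA l : measurable (\bigcup_a A l a) by exact: bigcup_measurable.
have A00 : pr uP (\bigcup_l \bigcup_a A l a) = 0.
  exact: (@pr_null_bigcup _ Om R uP _ mAA (fun l => @pr_null_bigcup _ Om R uP _ (mA l) (A0 l))).
have B00 : pr uP (\bigcup_i B i) = 0 by exact: (@pr_null_bigcup _ Om R uP _ mB B0).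
apply/le_anti; rewrite pr_ge0 andbT -[leRHS](addr0 0) -{1}A00 -B00.
apply: prUle; first by apply: bigcupT_measurable => l; exact: mAA.
by apply: bigcupT_measurable => i; exact: mB.
Qed.

Lemma pr_good A : measurable A -> pr uP (A `&` [set u | good R n (fb u)]) = pr uP A.
Proof. by move=> mA; apply: pr_null => //; [exact: good_measurable mob|exact: good_limit]. Qed.

Lemma init_limit : pr uP [set u | limit_map u 0 = x] = 1.
Proof.
pose A l := [set u | `|xh R n l 0 (fb u) - x| <= 2 * 2 ^- l].
have dep l : exists M, depends M (fun f => ~ (`|xh R n l 0 f - x| <= 2 * 2 ^- l)).
  by have [M dM] := @xh_depends R n l 0; exists M => f h fh; rewrite (dM f h fh).
have mA l : measurable (~` A l).
  by have [M dM] := dep l; exact: depends_measurable mob _ _ dM.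
have A0 l : pr uP (~` A l) = 0.
  apply/le_anti; rewrite pr_ge0 andbT; have [M dM] := dep l.
  apply: (pr_bits_le mdb UU dM).
  have /cvgrPdist_le/(_ _ (p2_gt0 R l))[N0 _ HN] := xN_cvg.
  apply: (@U_eventually N0) => N NN N_gt0.
  have [law0 _ _] := PN_law N_gt0.
  have mi := at_measurable (xN N) (lexx (0 : R)).
  have i1 : pr (PN N) [set w : D | w 0 = xN N] = 1 by rewrite /pr law0.
  have mB : measurable ([set w : D | ~ (`|xh R n l 0 (bits db w) - x| <= 2 * 2 ^- l)] : set (borel D)).
    exact: depends_measurable mdb _ _ dM.
  have := pr_split (PN N) (@measurableT _ (borel D)) mi; rewrite prT !setTI i1 => h.
  have <- : pr (PN N) (~` [set w : D | w 0 = xN N]) = 0 by move: h; lra.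
  apply: prS => //; first exact: measurableC.
  move=> w /= H w0; apply: H; have h1 := xh_db l 0 w; have h2 := HN N NN.
  rewrite /tm mul0r w0 in h1.
  rewrite (_ : xh R n l 0 _ - x = (xh R n l 0 (bits db w) - xN N) - (x - xN N)).
    by apply: (le_trans (ler_normB _ _)); move: h1 h2 => /=; lra.
  by rewrite opprB addrA subrK.
have mU : measurable (\bigcup_l ~` A l) by exact: bigcup_measurable.
have mG := good_measurable R n mob.
have m0 : measurable [set u | limit_map u 0 = x].
  by rewrite -[X in measurable X]setTI; exact: limit_map_measurable (at_measurable x (lexx 0)).
have G1 := pr_good measurableT; rewrite setTI prT in G1.
have := @pr_null _ Om R uP _ _ mG (measurableC mU); rewrite setCK.
move=> /(_ (@pr_null_bigcup _ Om R uP _ mA A0)) G2.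
apply/le_anti/andP; split; first exact: pr_le1.
rewrite -[leLHS]G1 -[leLHS]G2.
apply: prS => //; first by apply: measurableI => //; exact: measurableC.
move=> u [gu Hu].
rewrite /= /limit_map path_ofE//; apply/eqP; rewrite -subr_eq0 -normr_le0.
apply/ler_addgt0Pr => c c0; rewrite add0r.
have [k Hk] := p2_small (divr_gt0 c0 (ltr0n _ 2)).
apply: (@norm_lim_le _ _ _ _ _ _ k (@limit_fun_cvg _ _ _ 0 gu)) => l kl.
have : A l u by apply: contrapT => nA; apply: Hu; exists l.
rewrite /A /= al_neg// => h.
by apply: (le_trans h); have := Hk l kl; lra.
Qed.

(** [G] at time t is replaced by a function [Gl] of finitely many bits, read at the dyadic floor of
    t. The replacement costs little under PN by [window_bound] and under the limit by [reg_limit];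
    in between, [bitsum] converges. *)
Lemma fdd_cvg (G : V -> R) (t : R) M (Phi : (nat -> bool) -> Prop) :
  unif_cts G -> 0 <= t -> depends M Phi ->
  \int[PN N]_(w in [set w | Phi (bits db w)]) G ((w : D) t) @[N --> U] -->
  \int[uP]_(u in [set u | Phi (fb u)]) G (limit_map u t).
Proof.
move=> uG t0 dPhi; have [B B0 HB] := unif_cts_bounded uG.
have mA : measurable ([set w : D | Phi (bits db w)] : set (borel D)).
  exact: depends_measurable mdb _ _ dPhi.
have mAh : measurable [set u : Om | Phi (fb u)] by exact: depends_measurable mob _ _ dPhi.
pose close l f (z : V) := simplex z /\ `|z - xh R n l (al l t) f| <= 2 ^- l.
(* A point of the simplex near the position read from the bits, since [G] is meaningful only there;
   a vertex is the default. *)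
pose z l f : V := xget (evec ord0) (close l f).
have zS l f : simplex (z l f).
  by rewrite /z; case: xgetP => [y _ []//|_]; exact: simplex_evec.
have zP l f : (exists2 z : V, simplex z & `|z - xh R n l (al l t) f| <= 2 ^- l) ->
    `|z l f - xh R n l (al l t) f| <= 2 ^- l.
  by move=> [y yS yx]; rewrite /z; case: xgetP => [y' _ []//|/(_ y)[]].
pose Gl l f := G (z l f).
have GlB l f : `|Gl l f| <= B by exact: HB.
have dGl l : exists M', depends M' (Gl l).
  have [M' dM'] := @xh_depends R n l (al l t); exists M' => f h fh.
  by rewrite /Gl /z /close (dM' f h fh).
have GY : bounded_measurable (fun u : Om => G (limit_map u t)).
  have [mG [B' HB']] := eval_bm t uG; split; last by exists B' => u; exact: HB'.
  by apply: (measurableT_comp mG); exact: limit_map_measurable.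
apply/cvgrPdist_le => c c0.
have c80 : 0 < c / 8 by rewrite divr_gt0.
have [dl dl0 Hdl] := uG (c / 8) c80.
have d40 : 0 < dl / 4 by rewrite divr_gt0.
have d80 : 0 < dl / 4 / 8 by rewrite divr_gt0.
have [C C0 HC] := window_bound r_ge0 r_irr m_inv m_ge0 g_ge0 g_0 gC ngC d40.
pose K := (Num.truncn t).+1.
have tK : t <= K%:R by apply: ltW; exact: truncnS_gt.
have [C' C'0 HC'] := reg_limit K d40.
(* With 2^-k W at most c / 8, the exceptional events of both comparisons, weighted by 2 B, cost at
   most c / 8 each. *)
pose W := 2 * B * (2 * C + C') + 1.
have W0 : 0 < W by rewrite ltr_wpDl// mulr_ge0 ?addr_ge0 ?mulr_ge0.
have [k1 Hk1] := p2_small (divr_gt0 c80 W0).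
have [k2 Hk2] := p2_small d80.
pose k := maxn k1 k2; pose l := k.+1.
have kc : 2 ^- k * W <= c / 8 by rewrite -ler_pdivlMr// Hk1// leq_maxl.
have kd : 2 ^- k <= dl / 4 / 8 by rewrite Hk2// leq_maxr.
have lk : 2 ^- l <= 2 ^- k :> R by apply: p2_le.
have l1 : 2 ^- l <= 1 :> R by rewrite invf_le1 ?two_exp_gt0// exprn_ege1// ler1n.
have k0 := p2_gt0 R k; have l0 := p2_gt0 R l.
have [M' dM'] := dGl l.
pose MM := maxn M M'.
have dPhi' : depends MM Phi by apply: dependsW dPhi; exact: leq_maxl.
have dGl' : depends MM (Gl l) by apply: dependsW dM'; exact: leq_maxr.
have cv := @bitsum_cvg _ _ R PN db mdb U UU MM (fun f => (`[< Phi f >])%:R * Gl l f).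
have c40 : 0 < c / 4 by rewrite divr_gt0.
have /cvgrPdist_le/(_ _ c40) cvU := cv.
have eY : `|\int[uP]_(u in [set u | Phi (fb u)]) G (limit_map u t) -
    bitsum uP ob MM (fun f => (`[< Phi f >])%:R * Gl l f)| <= c / 4.
  have bGl := @depends_bm _ _ _ ob mob _ _ _ dGl' (GlB l).
  rewrite -(@bitsum_int _ _ _ uP ob mob _ _ _ _ dPhi' dGl' (GlB l)) -RintB//.
  have mreg : measurable [set u : Om | reg n K k (dl / 4) (fb u)] by exact: reg_measurable mob _ _ _.
  have mgood : measurable [set u : Om | good R n (fb u)] by exact: good_measurable mob.
  have mE : measurable (~` ([set u | reg n K k (dl / 4) (fb u)] `&` [set u | good R n (fb u)])).
    by apply: measurableC; exact: measurableI.
  have [mf _] := bmB GY bGl.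
  apply: (le_trans (@Rint_bound _ _ _ uP _ _ _ (c / 8) (2 * B) mAh mE mf (ltW c80) _ _)).
  - move=> u; apply: (le_trans (ler_normB _ _)); rewrite mulr2n mulrDl mul1r.
    by apply: lerD; [apply: HB; exact: path_simplex|exact: GlB].
  - move=> u _ /contrapT[/= ru gu]; apply: ltW; apply: Hdl => //; first exact: path_simplex.
    have h1 := path_close gu ru tK (ltnSn k).
    have h2 := zP l _ (gu.1 l (al l t)).
    rewrite (_ : _ - _ = (limit_map u t - xh R n l (al l t) (fb u)) -
       (z l (fb u) - xh R n l (al l t) (fb u))); last by rewrite opprB addrA subrK.
    apply: (le_lt_trans (ler_normB _ _)).
    by rewrite /limit_map; move: h1 h2 kd lk dl0; rewrite /l; lra.
  have h3 : pr uP ([set u | Phi (fb u)] `&` ~` ([set u | reg n K k (dl / 4) (fb u)] `&` [set u | good R n (fb u)])) <= C' * 2 ^- k.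
    apply: le_trans (HC' k kd).
    rewrite -[leRHS](pr_good (measurableC mreg)) -[leLHS]pr_good; last exact: measurableI.
    apply: prS; do ?apply: measurableI => //; first exact: measurableC.
    by move=> u [[_ H] gu]; split=> // ru; apply: H.
  have h4 := pr_le1 uP mAh.
  have h5 := ler_wpM2l (ltW c80) h4; have h6 := ler_wpM2l (mulr_ge0 (ler0n R 2) B0) h3.
  have h7 : 2 * B * (C' * 2 ^- k) <= 2 ^- k * W.
    rewrite (_ : _ * W = 2 * B * (C' * 2 ^- k) + 2 ^- k * (2 * B * (2 * C) + 1)); last by rewrite /W; ring.
    by rewrite lerDl mulr_ge0 ?addr_ge0 ?mulr_ge0// ltW.
  by move: h5 h6 h7 kc; lra.
suff ev : U [set N | `|\int[PN N]_(w in [set w | Phi (bits db w)]) G ((w : D) t) -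
    bitsum (PN N) db MM (fun f => (`[< Phi f >])%:R * Gl l f)| <= c / 4].
  near=> N.
  have e1 : `|\int[PN N]_(w in [set w | Phi (bits db w)]) G ((w : D) t) -
    bitsum (PN N) db MM (fun f => (`[< Phi f >])%:R * Gl l f)| <= c / 4 by near: N.
  have e2 : `|bitsum uP ob MM (fun f => (`[< Phi f >])%:R * Gl l f) -
    bitsum (PN N) db MM (fun f => (`[< Phi f >])%:R * Gl l f)| <= c / 4 by near: N.
  move: eY e1 e2; rewrite !ler_norml; set a1 := Rintegral _ _ _; set a2 := Rintegral _ _ _.
  set a3 := bitsum _ _ _ _; set a4 := bitsum _ _ _ _ => /andP[? ?] /andP[? ?] /andP[? ?].
  by apply/andP; split; lra.
apply: (@U_eventually 0) => N _ N_gt0.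
have bGl := @depends_bm _ (borel D) _ db mdb _ _ _ dGl' (GlB l).
have bG := eval_bm t uG.
rewrite -(@bitsum_int _ _ _ (PN N) db mdb _ _ _ _ dPhi' dGl' (GlB l)) -RintB//.
have tm0 := tm_ge0 R l (al l t).
have /andP[tl tu] := al_floor l t0.
have dt0 : 0 <= t - tm R l (al l t) by rewrite subr_ge0.
(* A single tick, from the dyadic floor of t to t. *)
have [E [mE subE prE]] := HC N _ _ _ _ 1%N N_gt0 (PN_law N_gt0) tm0 dt0.
have [mf _] := bmB bG bGl.
apply: (le_trans (@Rint_bound _ _ _ (PN N) _ _ _ (c / 8) (2 * B) mA mE mf (ltW c80) _ _)).
- move=> w; apply: (le_trans (ler_normB _ _)); rewrite mulr2n mulrDl mul1r.
  by apply: lerD; [apply: HB; exact: path_simplex|exact: GlB].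
- move=> w _ nE; apply: ltW; apply: Hdl => //; first exact: path_simplex.
  have h0 := xh_db l (al l t) w.
  have h2 := zP l (bits db w).
  have {}h2 := h2 (ex_intro2 _ _ (w (tm R l (al l t))) (path_simplex w _) _).
  have {}h2 : `|z l (bits db w) - xh R n l (al l t) (bits db w)| <= 2 ^- l.
    by apply: h2; rewrite distrC.
  have h1 : `|w t - w (tm R l (al l t))| <= dl / 4.
    apply: norm_le => [|j]; first exact: ltW.
    rewrite leNgt !mxE; apply/negP => H; apply: nE; apply: subE; exists 1%N => //.
    exists j; rewrite (_ : tick _ _ _ = t)//.
    by rewrite /tick mul1r addrC subrK.
  set X := xh R n _ _ _ in h0 h2; set Z := z l _ in h2 *; set Wt := w (tm R l _) in h0 h1.
  rewrite (_ : w t - Z = (w t - Wt) - (X - Wt) - (Z - X)); last by apply/rowP => j; rewrite !mxE; ring.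
  have n1 := ler_normB ((w t - Wt) - (X - Wt)) (Z - X); have n2 := ler_normB (w t - Wt) (X - Wt).
  by move: n1 n2 h0 h1 h2 kd lk dl0; rewrite /l; lra.
have h3 : pr (PN N) ([set w | Phi (bits db w)] `&` E) <= C * 2 * 2 ^- k.
  apply: le_trans (prS _ (measurableI _ _ mA mE) mE (@subIsetr _ _ _)) _.
  apply: (le_trans prE); rewrite mul1r -mulrA -mulrA ler_wpM2l//.
  have N1 : N%:R^-1 ^+ 2 <= 1 :> R.
    by rewrite expr_le1// ?invr_ge0// invf_le1 ?ltr0n// ler1n.
  have dk : t - tm R l (al l t) <= 2 ^- k by move: tu lk; lra.
  have d1 : t - tm R l (al l t) <= 1 by move: tu l1; lra.
  rewrite mulrC; apply: ler_pM => //; last by move: N1 d1; lra.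
  by rewrite addr_ge0// sqr_ge0.
have h4 := pr_le1 (PN N) mA.
have h5 := ler_wpM2l (ltW c80) h4; have h6 := ler_wpM2l (mulr_ge0 (ler0n R 2) B0) h3.
have h7 : 2 * B * (C * 2 * 2 ^- k) <= 2 ^- k * W.
  rewrite (_ : _ * W = 2 * B * (C * 2 * 2 ^- k) + 2 ^- k * (2 * B * C' + 1)); last by rewrite /W; ring.
  by rewrite lerDl mulr_ge0 ?addr_ge0 ?mulr_ge0// ltW.
by move: h5 h6 h7 kc; lra.
Unshelve. all: by end_near.
Qed.

End LimitLaw.

(** * Time integrals along continuous paths *)

Section PathIntegral.
Variables (R : realType) (n : nat).
Local Notation S := 'I_n.+1.
Local Notation V := 'rV[R]_n.+1.
Local Notation D := (cadlag_path R n).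

Lemma path_comp_continuous (G : V -> R) (w : D) : unif_cts G -> continuous w ->
  continuous (fun t => G (w t)).
Proof.
move=> uG cw t; apply/cvgrPdist_lt => e e0.
have [d d0 Hd] := uG e e0.
have /cvgrPdist_lt/(_ _ d0) := cw t; apply: filterS => s ws.
by apply: Hd => //; exact: path_simplex.
Qed.

Lemma path_integrable (G : V -> R) (w : D) (a c : R) : unif_cts G -> continuous w ->
  lebesgue_measure.-integrable `[a, c] (EFin \o (fun t => G (w t))).
Proof.
move=> uG cw; apply: continuous_compact_integrable; first exact: segment_compact.
by apply: continuous_subspaceT; exact: path_comp_continuous.
Qed.

Lemma path_integral_increment (G : V -> R) (w : D) (u h c : R) : unif_cts G -> continuous w ->
  0 <= u -> 0 <= h -> (forall v, u <= v <= u + h -> `|G (w v) - G (w u)| <= c) ->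
  `|\int[lebesgue_measure]_(s in `[0, u + h]) G (w s) -
    \int[lebesgue_measure]_(s in `[0, u]) G (w s) - h * G (w u)| <= h * c.
Proof.
move=> uG cw u0 h0 H.
have iG := path_integrable 0 (u + h) uG cw.
rewrite (@Rintegral_itvB _ _ (BLeft 0) (BRight (u + h)) u)//; last by rewrite bnd_simp lerDl.
have sub : (`]u, (u + h)] : set R) `<=` `[0, (u + h)].
  by move=> v /=; rewrite !in_itv/= => /andP[uv ->]; rewrite andbT (le_trans u0)// ltW.
have mI : measurable (`]u, (u + h)] : set R) by exact: measurable_itv.
have ip (F : V -> R) : unif_cts F ->
    lebesgue_measure.-integrable `]u, (u + h)] (EFin \o (fun t => F (w t))).
  move=> uF; have iF := path_integrable 0 (u + h) uF cw.
  by apply: integrableS iF => //; exact: measurable_itv.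
have len : fine (lebesgue_measure (`]u, (u + h)] : set R)) = h.
  rewrite lebesgue_measure_itv/= lte_fin ltrDl; case: ltP => [_|h0'] /=.
    by rewrite addrC addKr.
  by apply/le_anti; rewrite h0 h0'.
have hG : h * G (w u) = \int[lebesgue_measure]_(s in `]u, (u + h)]) G (w u).
  by rewrite Rintegral_cst// len mulrC.
have ic (k : R) := ip _ (@unif_cts_cst R n k).
have iG' := ip _ uG.
rewrite hG -RintegralB//.
have iB : lebesgue_measure.-integrable `]u, (u + h)] (EFin \o (fun t => G (w t) - G (w u))).
  exact: (ip _ (unif_ctsD uG (@unif_cts_cst R n (- G (w u))))).
apply: le_trans; first exact: le_normr_Rintegral.
have -> : h * c = \int[lebesgue_measure]_(s in `]u, (u + h)]) c.
  by rewrite Rintegral_cst// len mulrC.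
apply: le_Rintegral => //; [exact: integrable_norm|].
move=> v /=; rewrite in_itv/= => /andP[uv vh]; apply: H.
by rewrite vh ltW.
Qed.

Lemma reg_continuous (w : D) :
  (forall K (e : R), 0 < e -> exists k, reg n K k e (bits (@db R n) w)) -> continuous w.
Proof.
move=> H t; apply/cvgrPdist_lt => e e0.
have e80 : 0 < e / 8 by rewrite divr_gt0.
pose K := (Num.truncn t).+2.
have tK : t < K%:R - 1 by rewrite /K -natr1 addrK; exact: truncnS_gt.
have [k rk] := H K _ e80.
have p0 := p2_gt0 R k.
have mod s s' : 0 <= s < K%:R -> 0 <= s' < K%:R -> `|s - s'| <= 2 ^- k / 2 ->
    `|w s - w s'| <= e / 8 + e / 8 + e / 8.
  move=> sK s'K ss; have h1 := db_al rk sK (ltnSn k); have h2 := db_al rk s'K (ltnSn k).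
  move: sK s'K => /andP[s0 sK] /andP[s'0 s'K].
  have h3 : `|xh R n k.+1 (al k.+1 s) (bits (@db R n) w) -
              xh R n k.+1 (al k.+1 s') (bits (@db R n) w)| <= e / 8.
    apply: rk => //; try (by apply: al_le_nat; exact: ltW).
    have /andP[] := al_floor k.+1 s0; have /andP[] := al_floor k.+1 s'0; rewrite p2S => f1 f2 f3 f4.
    by move: ss; rewrite !ler_norml => /andP[? ?]; apply/andP; split; lra.
  set X := xh R n _ _ _ in h1 h3; set Y := xh R n _ _ _ in h2 h3.
  rewrite (_ : w s - _ = (w s - X) + (X - Y) - (w s' - Y)); last by apply/rowP => j; rewrite !mxE; ring.
  have n1 := ler_normB ((w s - X) + (X - Y)) (w s' - Y); have n2 := ler_normD (w s - X) (X - Y).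
  by move: n1 n2 h1 h2 h3; lra.
have pos s : w s = w (Num.max 0 s).
  by have [//|s0] := leP 0 s; rewrite (path_neg w (ltW s0)).
have K1 : 1 <= K%:R :> R by rewrite ler1n.
apply: (iffRL (@nbhs_normP R R^o t _)); exists (Num.min 1 (2 ^- k / 2)).
  by rewrite /= lt_min ltr01 divr_gt0.
move=> s /=; rewrite lt_min => /andP[s1 s2].
apply: (@le_lt_trans _ _ (e / 8 + e / 8 + e / 8)); last by move: e0; lra.
rewrite (pos t) (pos s); apply: mod.
- by rewrite le_max lexx gt_max; apply/andP; split; move: tK K1; lra.
- rewrite le_max lexx gt_max; apply/andP; split; first by move: K1; lra.
  by move: s1 tK; rewrite ltr_norml => /andP[]; lra.
apply: le_trans (ltW s2); have n1 := ler_norm (t - s).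
have n2 : s - t <= `|t - s| by rewrite distrC ler_norm.
by have [t0|t0] := leP 0 t; have [s0|s0] := leP 0 s; rewrite ler_norml; apply/andP; split;
  move: n1 n2 t0 s0; lra.
Qed.

End PathIntegral.

(** * The one-step estimate in the limit *)

Section Martingale.
Variables (R : realType) (n : nat).
Local Notation S := 'I_n.+1.
Local Notation V := 'rV[R]_n.+1.
Local Notation D := (cadlag_path R n).
Variables (r : S -> S -> R) (m : S -> R) (b : R) (g : S -> nat -> R) (Cg : R).
Hypothesis r_ge0 : forall j k, 0 <= r j k.
Hypothesis r_irr : forall j k, connect (fun i l => 0 < r i l) j k.
Hypothesis m_inv : forall k, \sum_j m j * r j k = m k * \sum_l r k l.
Hypothesis m_ge0 : forall j, 0 <= m j.
Hypothesis m_neq0 : exists j, m j != 0.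
Hypothesis g_ge0 : forall j k, 0 <= g j k.
Hypothesis g_0 : forall j, g j 0%N = 0.
Hypothesis gC : forall j k, `|g j k - m j| <= Cg.
Hypothesis ngC : forall j k, k%:R * `|g j k - m j| <= Cg.
Hypothesis g_lim : forall j, k%:R * (g j k - m j) @[k --> \oo] --> b * m j.
Variables (xN : nat -> V) (PN : nat -> probability (borel D) R).
Hypothesis PN_law : forall N, (0 < N)%N -> zrp_law r g N (xN N) (PN N).
Variable U : set_system nat.
Hypothesis UU : UltraFilter U.
Hypothesis U_tail : forall N0, U [set N | (N0 <= N)%N].

Let FU : ProperFilter U. Proof. exact: ultra_proper. Qed.
#[local] Existing Instance FU.

Local Notation db := (@db R n).
Local Notation ob := (ob PN db U).
Local Notation fb := (bits ob).
Local Notation mob := (ob_measurable PN db U).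
Local Notation uP := (@unitP R).
Local Notation Om := (g_sigma_algebraType R.-ocitv.-measurable).
Local Notation LH := (limit_gen r m b).
Local Notation Y := (limit_map PN U).
Local Notation nf := (@natural_filtration R n).

Lemma Ex_int N x_init (P : probability (borel D) R) A t G : (0 < N)%N -> zrp_law r g N x_init P ->
  measurable (A : set (borel D)) -> 0 <= t -> unif_cts G ->
  \int[P]_(w in A) G ((w : D) t) = Ex N P A t G.
Proof.
move=> N0 law mA t0 uG.
have mt y : measurable ([set w : D | w t = y] : set (borel D)) by exact: at_measurable.
rewrite (@Rint_finite _ (borel D) R P _ (grid_pts R n N) (fun w : D => w t) G)//.
- exact: grid_pts_uniq.
- exact: eval_bm.
have mG : measurable ([set w : D | w t \in grid_pts R n N] : set (borel D)).
  rewrite (_ : [set w : D | _] = [set w | exists2 y, y \in grid_pts R n N & [set w : D | w t = y] w]).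
    by apply: seq_bigcup_measurable => y _.
  by apply/seteqP; split => w /=; [move=> h'; exists (w t)|move=> [y yp /= ->]].
have h := pr_split P (@measurableT _ (borel D)) mG.
by rewrite (grid_ae N0 law t0 measurableT) setTI in h; move: h; lra.
Qed.

(** [one_step] is summed over the state at time [u], which removes the condition that [A] fix the
    starting point. *)
Lemma one_step_int H : DS r H -> forall eta, 0 < eta ->
  exists C N0, 0 <= C /\ forall N x_init (P : probability (borel D) R) A u h,
  (N0 <= N)%N -> (0 < N)%N -> zrp_law r g N x_init P -> 0 <= u -> 0 <= h -> nf u A ->
  `|\int[P]_(w in A) H ((w : D) (u + h)) - \int[P]_(w in A) H ((w : D) u) -
    h * \int[P]_(w in A) LH H ((w : D) u)| <= h * (eta + C * h) + C / N%:R.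
Proof.
move=> HDS eta eta0.
have [C [N0 [C0 HC]]] := one_step r_ge0 r_irr m_inv m_ge0 m_neq0 g_ge0 g_0 gC ngC g_lim HDS eta0.
have [uH [_ [_ uL _]]] := gen_expansion r_ge0 m_inv m_ge0 g_ge0 g_0 gC ngC g_lim HDS.
exists C, N0; split=> // N xi P A u h NN N_gt0 law u0 h0 nA.
have mA := natural_filtration_measurable nA.
have uh0 : 0 <= u + h by rewrite addr_ge0.
rewrite !(Ex_int N_gt0 law mA)//.
have mt s y : 0 <= s -> measurable ([set w : D | w s = y] : set (borel D)).
  by move=> s0; exact: at_measurable.
have E1 : Ex N P A (u + h) H = \sum_(x <- grid_pts R n N) Ex N P (A `&` [set w : D | w u = x]) (u + h) H.
  rewrite /Ex exchange_big/=; apply: eq_bigr => y _; rewrite -mulr_sumr; congr (_ * _).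
  rewrite (pr_sum_grid N_gt0 law u0 (measurableI _ _ mA (mt _ y uh0))).
  by apply: eq_bigr => x _; rewrite setIAC.
rewrite E1 {1 2}/Ex mulr_sumr -sumrB -sumrB.
apply: (le_trans (ler_norm_sum _ _ _)).
have c0 : 0 <= h * (eta + C * h) + C / N%:R.
  by rewrite addr_ge0 ?divr_ge0// mulr_ge0// addr_ge0 ?mulr_ge0// ltW.
apply: (@le_trans _ _ (\sum_(x <- grid_pts R n N)
   (h * (eta + C * h) + C / N%:R) * pr P (A `&` [set w : D | w u = x]))).
  rewrite big_seq [leRHS]big_seq; apply: ler_sum => x /(grid_ptsP N_gt0) xg.
  have uu : 0 <= u <= u by rewrite u0 lexx.
  have nA' := natural_filtrationI nA (natural_filtration_eq x uu).
  have := HC N xi P x _ u h NN N_gt0 law u0 h0 nA' xg (@subIsetr _ _ _).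
  by rewrite mulrDl -[h * LH H x * _]mulrA opprD addrA.
rewrite -mulr_sumr -(pr_sum_grid N_gt0 law u0 mA) -[leRHS]mulr1 ler_wpM2l//.
exact: pr_le1.
Qed.

Lemma Y_bm G t : unif_cts G -> bounded_measurable (fun u : Om => G ((Y u : D) t)).
Proof.
move=> uG; have [mG [B HB]] := eval_bm t uG; split; last by exists B => u; exact: HB.
by apply: (measurableT_comp mG); exact: limit_map_measurable.
Qed.

(** The three integrals converge by [fdd_cvg], and C / N vanishes along [U]. Restricting to bits of
    times at most [s] makes the event belong to the past of [s]. *)
Lemma limit_one_step H : DS r H -> forall eta, 0 < eta -> exists2 C, 0 <= C &
  forall M Phi s h, depends_upto n s M Phi -> 0 <= s -> 0 <= h ->
  `|\int[uP]_(u in [set u | Phi (fb u)]) (H ((Y u : D) (s + h)) - H ((Y u : D) s) -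
     h * LH H ((Y u : D) s))| <= h * (eta + C * h).
Proof.
move=> HDS eta eta0.
have [uH [_ [_ uL _]]] := gen_expansion r_ge0 m_inv m_ge0 g_ge0 g_0 gC ngC g_lim HDS.
have [C [N0 [C0 HC]]] := one_step_int HDS eta0.
exists C => // M Phi s h dPhi s0 h0.
have dp := depends_upto_depends dPhi.
have mA : measurable [set u : Om | Phi (fb u)] by exact: depends_measurable mob _ _ dp.
rewrite RintB//; last 2 first.
- by apply: bmB; exact: Y_bm.
- by apply: bmZ; exact: Y_bm.
rewrite RintB//; try exact: Y_bm.
rewrite RintZ//; last exact: Y_bm.
have sh0 : 0 <= s + h by rewrite addr_ge0.
have fdd G t := @fdd_cvg _ _ _ _ _ _ r_ge0 r_irr m_inv m_ge0 g_ge0 g_0 gC ngC _ _ PN_law _ UU U_tail G t M Phi.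
have c1 := fdd H (s + h) uH sh0 dp; have c2 := fdd H s uH s0 dp; have c3 := fdd (LH H) s uL s0 dp.
pose q N := \int[PN N]_(w in [set w | Phi (bits db w)]) H ((w : D) (s + h)) -
  \int[PN N]_(w in [set w | Phi (bits db w)]) H ((w : D) s) -
  h * \int[PN N]_(w in [set w | Phi (bits db w)]) LH H ((w : D) s).
have c4 : `|q N| @[N --> U] --> `|\int[uP]_(u in [set u | Phi (fb u)]) H (Y u (s + h)) -
    \int[uP]_(u in [set u | Phi (fb u)]) H (Y u s) -
    h * \int[uP]_(u in [set u | Phi (fb u)]) LH H (Y u s)|.
  by apply: cvg_norm; apply: cvgB; [exact: cvgB|apply: cvgM => //; exact: cvg_cst].
apply/ler_addgt0Pr => e e0.
apply: (@ler_cvg_to _ _ _ _ _ _ _ _ c4 (cvg_cst (h * (eta + C * h) + e))).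
have C1 : 0 < C + 1 by rewrite ltr_wpDl.
have [N1 HN1] := inv_small (divr_gt0 e0 C1).
apply: (U_eventually UU U_tail (N0 := maxn N0 N1)) => N NN N_gt0 /=.
move: NN; rewrite geq_max => /andP[NN0 NN1].
have nA := depends_past dPhi.
apply: (le_trans (HC N _ _ _ s h NN0 N_gt0 (PN_law N_gt0) s0 h0 nA)).
rewrite lerD2l; have [h1 _] := HN1 N NN1 N_gt0.
apply: (@le_trans _ _ ((C + 1) * (e / (C + 1)))); last by rewrite mulrC divfK// gt_eqF.
by apply: ler_pM => //; rewrite lerDl.
Qed.

End Martingale.

(** * The martingale property of the limit *)

Section MartingaleSolution.
Variables (R : realType) (n : nat).
Local Notation S := 'I_n.+1.
Local Notation V := 'rV[R]_n.+1.
Local Notation D := (cadlag_path R n).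
Variables (r : S -> S -> R) (m : S -> R) (b : R) (g : S -> nat -> R) (Cg : R).
Hypothesis r_ge0 : forall j k, 0 <= r j k.
Hypothesis r_irr : forall j k, connect (fun i l => 0 < r i l) j k.
Hypothesis m_inv : forall k, \sum_j m j * r j k = m k * \sum_l r k l.
Hypothesis m_ge0 : forall j, 0 <= m j.
Hypothesis m_neq0 : exists j, m j != 0.
Hypothesis g_ge0 : forall j k, 0 <= g j k.
Hypothesis g_0 : forall j, g j 0%N = 0.
Hypothesis gC : forall j k, `|g j k - m j| <= Cg.
Hypothesis ngC : forall j k, k%:R * `|g j k - m j| <= Cg.
Hypothesis g_lim : forall j, k%:R * (g j k - m j) @[k --> \oo] --> b * m j.
Variables (xN : nat -> V) (PN : nat -> probability (borel D) R).
Hypothesis PN_law : forall N, (0 < N)%N -> zrp_law r g N (xN N) (PN N).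
Variable U : set_system nat.
Hypothesis UU : UltraFilter U.
Hypothesis U_tail : forall N0, U [set N | (N0 <= N)%N].

Local Notation db := (@db R n).
Local Notation ob := (ob PN db U).
Local Notation fb := (bits ob).
Local Notation mob := (ob_measurable PN db U).
Local Notation uP := (@unitP R).
Local Notation Om := (g_sigma_algebraType R.-ocitv.-measurable).
Local Notation LH := (limit_gen r m b).
Local Notation Y := (limit_map PN U).
Local Notation nf := (@natural_filtration R n).


Definition mart (H : V -> R) (t : R) (w : D) : R :=
  H (w t) - \int[lebesgue_measure]_(s in `[0, t]) LH H (w s).

Lemma path_of_continuous f : continuous (path_of R n f : D).
Proof.
rewrite /path_of; case: pselect => gf; last exact: cst_continuous.
exact: limit_fun_continuous.
Qed.

Lemma depends_upto_le X (s s' : R) M (psi : (nat -> bool) -> X) : s <= s' ->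
  depends_upto n s M psi -> depends_upto n s' M psi.
Proof. by move=> ss dp f h fh; apply: dp => i iM is_; apply: fh => //; exact: le_trans ss. Qed.

Section FixedFunction.
Variable H : V -> R.
Hypothesis HDS : DS r H.
Hypothesis adapted : forall t (B : set R), 0 <= t -> measurable B -> nf t (mart H t @^-1` B).

Let uL : unif_cts (LH H).
Proof. by have [_ [_ [_ ? _]]] := gen_expansion r_ge0 m_inv m_ge0 g_ge0 g_0 gC ngC g_lim HDS. Qed.

Let uH : unif_cts H.
Proof. by have [? _] := gen_expansion r_ge0 m_inv m_ge0 g_ge0 g_0 gC ngC g_lim HDS. Qed.

Lemma mart_increment_bound (w : D) (s h c : R) : continuous w -> 0 <= s -> 0 <= h ->
  (forall v, s <= v <= s + h -> `|LH H (w v) - LH H (w s)| <= c) ->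
  `|(mart H (s + h) w - mart H s w) - (H (w (s + h)) - H (w s) - h * LH H (w s))| <= h * c.
Proof.
move=> cw s0 h0 Hc; have H1 := path_integral_increment uL cw s0 h0 Hc.
rewrite /mart -normrN; move: H1; set I1 := Rintegral _ _ _; set I2 := Rintegral _ _ _ => H1.
apply: le_trans H1; rewrite le_eqVlt; apply/orP; left; apply/eqP; congr `|_|; ring.
Qed.

Lemma mart_bm t : 0 <= t -> bounded_measurable (fun u : Om => mart H t (Y u)).
Proof.
move=> t0; have [B B0 HB] := unif_cts_bounded uL; have [B' B'0 HB'] := unif_cts_bounded uH.
split.
  have mM : measurable_fun setT (mart H t : borel D -> R).
    by move=> _ Z mZ; rewrite setTI; exact: (natural_filtration_measurable (adapted t0 mZ)).
  by apply: (measurableT_comp mM); exact: limit_map_measurable.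
exists (B' + (t * (2 * B) + t * B)) => u; pose w : D := Y u.
have cw : continuous w by exact: path_of_continuous.
have Lb v : `|LH H (w v)| <= B by apply: HB; exact: path_simplex.
have := @path_integral_increment _ _ (LH H) w 0 t (2 * B) uL cw (lexx _) t0.
rewrite add0r set_itv1 Rintegral_set1 subr0 => /(_ _)-H1.
have {}H1 : `|\int[lebesgue_measure]_(s in `[0, t]) LH H (w s) - t * LH H (w 0)| <= t * (2 * B).
  apply: H1 => v _; apply: (le_trans (ler_normB _ _)); rewrite mulr2n mulrDl mul1r.
  exact: lerD.
have h2 : `|H (w t)| <= B' by apply: HB'; exact: path_simplex.
have h3 : `|t * LH H (w 0)| <= t * B by rewrite normrM (ger0_norm t0) ler_wpM2l.
rewrite /mart -/w; move: H1 h2 h3; set I1 := Rintegral _ _ _; set q := t * LH H _ => h1 h2 h3.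
rewrite (_ : _ - I1 = H (w t) - ((I1 - q) + q)); last by ring.
apply: (le_trans (ler_normB _ _)); apply: lerD => //.
by apply: (le_trans (ler_normD _ _)); exact: lerD.
Qed.

(** The time integral is replaced by h times its integrand at [s], legitimate on regular paths and
    bounded otherwise. The factor 4 counts the regular part, the exceptional part, and the terms eta
    h and C h^2 of the one-step estimate. *)
Lemma mart_increment (K : nat) (eta : R) : 0 < eta -> exists2 del, 0 < del &
  forall M Phi s h, depends_upto n s M Phi -> 0 <= s -> 0 <= h -> s + h <= K%:R -> h <= del ->
  `|\int[uP]_(u in [set u | Phi (fb u)]) (mart H (s + h) (Y u) - mart H s (Y u))| <= 4 * eta * h.
Proof.
move=> eta0; have [B B0 HB] := unif_cts_bounded uL.
have [d0 d00 Hd0] := uL eta0.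
have e0 : 0 < d0 / 4 by rewrite divr_gt0.
have [C' C'0 HC'] := reg_limit r_ge0 r_irr m_inv m_ge0 g_ge0 g_0 gC ngC PN_law UU U_tail K e0.
have [C C0 HC] := limit_one_step r_ge0 r_irr m_inv m_ge0 m_neq0 g_ge0 g_0 gC ngC g_lim PN_law UU U_tail HDS eta0.
have W0 : 0 < 2 * B * C' + 1 by rewrite ltr_wpDl// ?mulr_ge0.
have [k1 Hk1] := p2_small (divr_gt0 eta0 W0).
have [k2 Hk2] := p2_small (divr_gt0 e0 (ltr0n _ 8)).
pose k := maxn k1 k2.
have kc : 2 ^- k * (2 * B * C' + 1) <= eta by rewrite -ler_pdivlMr// Hk1// leq_maxl.
have kd : 2 ^- k <= d0 / 4 / 8 by rewrite Hk2// leq_maxr.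
have k0 := p2_gt0 R k.
have C1 : 0 < C + 1 by rewrite ltr_wpDl.
exists (Num.min (2 ^- k / 4) (eta / (C + 1))); first by rewrite lt_min !divr_gt0.
move=> M Phi s h dPhi s0 h0 shK; rewrite le_min => /andP[hk hC].
have dp := depends_upto_depends dPhi.
have mA : measurable [set u : Om | Phi (fb u)] by exact: depends_measurable mob _ _ dp.
have sh0 : 0 <= s + h by rewrite addr_ge0.
have bm1 : bounded_measurable (fun u : Om => mart H (s + h) (Y u) - mart H s (Y u)).
  by apply: bmB; exact: mart_bm.
have bm2 : bounded_measurable (fun u : Om => H ((Y u : D) (s + h)) - H ((Y u : D) s) -
     h * LH H ((Y u : D) s)).
  apply: bmB; last by apply: bmZ; exact: Y_bm.
  by apply: bmB; exact: Y_bm.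
have mreg : measurable [set u : Om | reg n K k (d0 / 4) (fb u)] by exact: reg_measurable mob _ _ _.
have mgood : measurable [set u : Om | good R n (fb u)] by exact: good_measurable mob.
have mE : measurable (~` ([set u : Om | reg n K k (d0 / 4) (fb u)] `&` [set u | good R n (fb u)])).
  by apply: measurableC; exact: measurableI.
have [mf _] := bmB bm1 bm2.
have hB u : `|(mart H (s + h) (Y u) - mart H s (Y u)) - (H ((Y u : D) (s + h)) - H ((Y u : D) s) -
     h * LH H ((Y u : D) s))| <= h * (2 * B).
  apply: mart_increment_bound => //; first exact: path_of_continuous.
  move=> v _; apply: (le_trans (ler_normB _ _)); rewrite mulr2n mulrDl mul1r.
  by apply: lerD; apply: HB; exact: path_simplex.
have step := HC M Phi s h dPhi s0 h0.
have he0 : 0 <= h * eta by rewrite mulr_ge0// ltW.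
have := @Rint_bound _ _ _ uP _ _ _ (h * eta) (h * (2 * B)) mA mE mf he0 hB.
have regb u : [set u | Phi (fb u)] u ->
    ~ (~` ([set u | reg n K k (d0 / 4) (fb u)] `&` [set u | good R n (fb u)])) u ->
    `|(mart H (s + h) (Y u) - mart H s (Y u)) - (H ((Y u : D) (s + h)) - H ((Y u : D) s) -
     h * LH H ((Y u : D) s))| <= h * eta.
  move=> _ /contrapT[/= ru gu]; apply: mart_increment_bound => //; first exact: path_of_continuous.
  move=> v /andP[sv vh]; apply: ltW; apply: Hd0; try exact: path_simplex.
  apply: (@le_lt_trans _ _ (d0 / 4 + d0 / 4)); last by move: d00; lra.
  rewrite /limit_map !path_ofE//; apply: (limit_fun_mod gu ru).
  - exact: le_trans shK.
  - by apply: le_trans shK; rewrite lerDl.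
  - by rewrite ger0_norm ?subr_ge0//; apply: le_trans hk; rewrite lerBlDl.
move=> /(_ regb) bound.
have h3 : pr uP ([set u | Phi (fb u)] `&` ~` ([set u | reg n K k (d0 / 4) (fb u)] `&` [set u | good R n (fb u)])) <= C' * 2 ^- k.
  apply: le_trans (HC' k kd).
  have pg := pr_good r_ge0 r_irr m_inv m_ge0 g_ge0 g_0 gC ngC PN_law UU U_tail.
  rewrite -[leRHS](pg _ (measurableC mreg)) -[leLHS]pg; last exact: measurableI.
  apply: prS; do ?apply: measurableI => //; first exact: measurableC.
  by move=> u [[_ Hu] gu]; split=> // ru; apply: Hu.
have h4 := pr_le1 uP mA.
rewrite RintB// in bound.
have h5 := ler_wpM2l he0 h4.
have hB0 : 0 <= h * (2 * B) by rewrite !mulr_ge0.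
have h6 := ler_wpM2l hB0 h3.
have h7 : h * (2 * B) * (C' * 2 ^- k) <= h * eta.
  rewrite (_ : _ * _ = h * (2 ^- k * (2 * B * C'))); last by ring.
  by rewrite ler_wpM2l// (le_trans _ kc)// ler_wpM2l ?(ltW k0)// lerDl.
have h8 : h * (C * h) <= h * eta.
  rewrite ler_wpM2l// (@le_trans _ _ (C * (eta / (C + 1))))//; first by rewrite ler_wpM2l.
  by rewrite mulrCA ler_piMr ?(ltW eta0)// ler_pdivrMr// mul1r lerDl.
rewrite [h * (_ + _)]mulrDr in step.
set I1 := Rintegral _ _ _ in bound *; set I2 := Rintegral _ _ _ in bound step.
rewrite (_ : I1 = (I1 - I2) + I2); last by rewrite subrK.
apply: (le_trans (ler_normD _ _)).
rewrite (_ : 4 * eta * h = 4 * (h * eta)); last by ring.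
by move: bound step h5 h6 h7 h8; lra.
Qed.

(** [s, t] is cut into equal steps shorter than [del]; an event of the past of [s] is in the past of
    every subdivision point, and the increments add up to at most 4 eta (t - s). *)
Lemma mart_patterns M Phi (s t : R) : depends_upto n s M Phi -> 0 <= s -> s <= t ->
  \int[uP]_(u in [set u | Phi (fb u)]) (mart H t (Y u) - mart H s (Y u)) = 0.
Proof.
move=> dPhi s0 st; apply/eqP; rewrite -normr_le0; apply/ler_addgt0Pr => e e0; rewrite add0r.
have dp := depends_upto_depends dPhi.
have mA : measurable [set u : Om | Phi (fb u)] by exact: depends_measurable mob _ _ dp.
have ts0 : 0 <= t - s by rewrite subr_ge0.
have W0 : 0 < 4 * (t - s + 1) by rewrite mulr_gt0// ltr_wpDl.
have eta0 := divr_gt0 e0 W0; set eta := e / _ in eta0.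
pose K := (Num.truncn t).+1.
have tK : t <= K%:R by apply: ltW; exact: truncnS_gt.
have [del del0 Hdel] := mart_increment K eta0.
pose N := (Num.truncn ((t - s) / del)).+1; pose h := (t - s) / N%:R.
have N0 : 0 < N%:R :> R by rewrite ltr0n.
have h0 : 0 <= h by rewrite divr_ge0// ltW.
have hdel : h <= del.
  by rewrite ler_pdivrMr// mulrC -ler_pdivrMr// ltW// truncnS_gt.
have hN : h * N%:R = t - s by rewrite /h divfK// gt_eqF.
have ind j : (j <= N)%N ->
    `|\int[uP]_(u in [set u | Phi (fb u)]) (mart H (s + j%:R * h) (Y u) - mart H s (Y u))| <=
    4 * eta * h * j%:R.
  elim: j => [_|j IH jN].
    rewrite mul0r addr0; under eq_Rintegral do rewrite subrr.
    by rewrite Rint_cst// mul0r normr0 mulr0.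
  have sj0 : 0 <= s + j%:R * h by rewrite addr_ge0// mulr_ge0.
  have sjK : s + j%:R * h + h <= K%:R.
    apply: le_trans tK; rewrite -addrA -[X in _ + (_ + X)]mul1r -mulrDl natr1.
    rewrite -lerBrDl -hN mulrC; apply: ler_wpM2l => //; by rewrite ler_nat.
  have dj := depends_upto_le (_ : s <= s + j%:R * h) dPhi.
  have {}dj : depends_upto n (s + j%:R * h) M Phi by apply: dj; rewrite lerDl mulr_ge0.
  have H1 := Hdel M Phi _ h dj sj0 h0 sjK hdel.
  have sjh0 : 0 <= s + j%:R * h + h by rewrite addr_ge0.
  have eqs : s + j.+1%:R * h = s + j%:R * h + h by rewrite -[j.+1%:R]natr1 mulrDl mul1r addrA.
  rewrite eqs; under eq_Rintegral => u _.
    rewrite (_ : _ - _ = (mart H (s + j%:R * h + h) (Y u) - mart H (s + j%:R * h) (Y u)) +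
      (mart H (s + j%:R * h) (Y u) - mart H s (Y u))); last by ring.
    over.
  rewrite RintD//; try (by apply: bmB; exact: mart_bm).
  apply: (le_trans (ler_normD _ _)); have H2 := IH (ltnW jN).
  by rewrite -[j.+1%:R]natr1 mulrDr mulr1 addrC; apply: lerD.
have := ind N (leqnn _).
rewrite (_ : s + N%:R * h = t); last by rewrite mulrC hN addrC subrK.
move=> /le_trans; apply; rewrite -mulrA hN.
rewrite (_ : 4 * eta * (t - s) = e * ((t - s) / (t - s + 1))); last first.
  by rewrite /eta; field; rewrite gt_eqF// ltr_wpDl.
by rewrite ler_piMr ?(ltW e0)// ler_pdivrMr ?ltr_wpDl// mul1r lerDl.
Qed.

Definition early_events (s : R) : set (set Om) :=
  [set E | exists M Phi, depends_upto n s M Phi /\ E = [set u : Om | Phi (fb u)]].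

(** Monotone class argument: pattern events are stable under intersection, and the events on which
    the integral vanishes are stable under proper differences and increasing unions. *)
Lemma mart_early (s t : R) (E : set Om) : 0 <= s -> s <= t -> <<s early_events s >> E ->
  \int[uP]_(u in E) (mart H t (Y u) - mart H s (Y u)) = 0.
Proof.
move=> s0 st.
have bf : bounded_measurable (fun u : Om => mart H t (Y u) - mart H s (Y u)).
  by apply: bmB; apply: mart_bm => //; exact: le_trans st.
move: bf; set f := (fun u : Om => _) => bf.
pose L := [set E : set Om | measurable E /\ \int[uP]_(u in E) f u = 0].
suff : <<s early_events s >> `<=` L by move=> h /h[].
apply: lambda_system_subset => //.
- move=> A B [M [Phi [dPhi ->]]] [M' [Phi' [dPhi' ->]]].
  exists (maxn M M'), (fun f => Phi f /\ Phi' f); split => //.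
  move=> f1 f2 h; rewrite (dPhi f1 f2) ?(dPhi' f1 f2)// => i iM; apply: h.
    by rewrite (leq_trans iM)// leq_maxr.
  by rewrite (leq_trans iM)// leq_maxl.
- split => //.
  + split=> //; rewrite (_ : setT = [set u : Om | True])//.
    exact: (@mart_patterns 0 (fun=> True) s t).
  + move=> A B BA [mA A0] [mB B0]; split; first exact: measurableD.
    by move: A0; rewrite (Rint_setD uP mA mB bf BA) B0 add0r.
  + move=> F ndF FL; have mF i : measurable (F i) by have [] := FL i.
    have mU : measurable (\bigcup_i F i) by exact: bigcupT_measurable.
    split=> //; apply/eqP; rewrite -normr_le0; apply/ler_addgt0Pr => e e0; rewrite add0r.
    have [mf [B HB]] := bf.
    have B0 : 0 <= B by apply: le_trans (HB 0).
    have B1 : 0 < B + 1 by rewrite ltr_wpDl.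
    have nd i j : (i <= j)%N -> F i `<=` F j by move=> ij; exact/subsetPset/ndF.
    have /cvgrPdist_le/(_ _ (divr_gt0 e0 B1))[i _ /(_ i (leqnn i)) Hi] := @pr_nd_cvg _ Om R uP F mF nd.
    have sub : F i `<=` \bigcup_i F i by move=> u Fu; exists i.
    have mD := measurableD mU (mF i).
    rewrite (Rint_setD uP mU (mF i) bf sub) (FL i).2 add0r.
    apply: (le_trans (@Rint_bound _ _ _ uP _ setT _ 0 B mD measurableT mf (lexx _) HB _)).
      by move=> u _ /(_ I).
    rewrite mul0r add0r setIT.
    have h := pr_split uP mU (mF i).
    rewrite (setIidr sub) in h; rewrite setDE.
    have h' : pr uP (\bigcup_i F i `&` ~` F i) <= e / (B + 1).
      by move: Hi; rewrite h /= addrAC subrr add0r ger0_norm ?pr_ge0.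
    apply: (@le_trans _ _ ((B + 1) * (e / (B + 1)))); last by rewrite mulrC divfK// gt_eqF.
    by apply: ler_pM => //; [exact: pr_ge0|rewrite lerDl].
- by move=> E' [M [Phi [dPhi ->]]]; split;
    [exact: depends_measurable mob _ _ (depends_upto_depends dPhi)|exact: (mart_patterns dPhi)].
Qed.

(* On good sequences of bits, an open condition on the value at q of the limit
   path is a limit of conditions on dyadic times before q. *)
Lemma past_early (s : R) (A : set D) : nf s A ->
  exists2 E, <<s early_events s >> E & forall u, good R n (fb u) -> (A (Y u) <-> E u).
Proof.
move: A; apply: smallest_sub.
  have [h0 hC hU] := @smallest_sigma_algebra _ setT (early_events s).
  split.
  - by exists set0.
  - move=> A [E hE AE]; exists (setT `\` E); first exact: hC.
    by move=> u gu; split => -[_ nA]; split=> // h; apply: nA; exact/(AE u gu).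
  - move=> A HA.
    have /choice[E HE] k : exists E, <<s early_events s >> E /\
        forall u, good R n (fb u) -> (A k (Y u) <-> E u).
      by have [E] := HA k; exists E.
    exists (\bigcup_k E k); first by apply: hU => k; have [] := HE k.
    move=> u gu; split => -[k _ Ak]; exists k => //.
      by have [_ AE] := HE k; exact/(AE u gu).
    by have [_ AE] := HE k; exact/(AE u gu).
move=> A [q [ O [/andP[q0 qs] oO ->]]].
pose Phi i l (f : nat -> bool) := forall y : V, `|y - xh R n l (al l q) f| < i.+1%:R^-1 -> O y.
pose T := g_sigma_algebraType (early_events s).
have mPhi i l : measurable ([set u | Phi i l (fb u)] : set T).
  apply: sub_sigma_algebra.
  have tq : tm R l (al l q) <= s by apply: le_trans qs; have /andP[] := al_floor l q0.
  have [M dM] := xh_depends_upto n tq; exists M, (Phi i l); split=> // f h fh.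
  by rewrite /Phi (dM f h fh).
exists (\bigcup_i \bigcup_k \bigcap_(l in [set l | (k <= l)%N]) [set u | Phi i l (fb u)]).
  apply: (@bigcupT_measurable _ T) => i; apply: bigcupT_measurable => k.
  by apply: bigcap_measurable => //; exists k => /=.
move=> u gu; rewrite /= /limit_map path_ofE//; have cv := @limit_fun_cvg _ _ _ q gu.
split.
  move=> /(open_normP oO)[e e0 He].
  have e20 : 0 < e / 2 by rewrite divr_gt0.
  have /cvgrPdist_lt/(_ _ e20)[k _ Hk] := cv.
  pose i := Num.truncn (e / 2)^-1.
  have i2 : i.+1%:R^-1 <= e / 2.
    by rewrite -[leRHS]invrK lef_pV2 ?posrE ?invr_gt0// ltW// truncnS_gt.
  exists i => //; exists k => // l kl y yx; apply: He.
  have h := Hk l kl; move: h yx i2 => /=; set X := xh _ _ _ _ _ => h yx i2.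
  rewrite (_ : y - _ = (y - X) - (limit_fun n (fb u) q - X)); last by rewrite opprB addrA subrK.
  have yx2 := lt_le_trans yx i2.
  by apply: (le_lt_trans (ler_normB _ _)); move: h yx2; lra.
move=> [i _ [k _ H']].
have i0 : 0 < i.+1%:R^-1 :> R by rewrite invr_gt0.
have /cvgrPdist_lt/(_ _ i0)[k' _ Hk'] := cv.
apply: (H' (maxn k k') (leq_maxl _ _)).
by apply: Hk'; exact: leq_maxr.
Qed.

Lemma mart_past (s t : R) (A : set D) : 0 <= s -> s <= t -> nf s A ->
  \int[uP]_(u in Y @^-1` A) mart H t (Y u) = \int[uP]_(u in Y @^-1` A) mart H s (Y u).
Proof.
move=> s0 st nA; have t0 := le_trans s0 st.
have mA : measurable (Y @^-1` A).
  by rewrite -[X in measurable X]setTI; apply: limit_map_measurable => //; exact: natural_filtration_measurable nA.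
apply/eqP; rewrite -subr_eq0 -RintB//; try exact: mart_bm.
have [E hE AE] := past_early nA.
have [mE E0] : measurable E /\ \int[uP]_(u in E) (mart H t (Y u) - mart H s (Y u)) = 0.
  split; last exact: mart_early hE.
  move: E hE {AE}; apply: smallest_sub; first exact: sigma_algebra_measurable.
  by move=> E [M [Phi [dPhi ->]]]; exact: depends_measurable mob _ _ (depends_upto_depends dPhi).
have mgood : measurable [set u : Om | good R n (fb u)] by exact: good_measurable mob.
have gl := good_limit r_ge0 r_irr m_inv m_ge0 g_ge0 g_0 gC ngC PN_law UU U_tail.
have bf : bounded_measurable (fun u : Om => mart H t (Y u) - mart H s (Y u)).
  by apply: bmB; exact: mart_bm.
apply/eqP; rewrite -E0 (Rint_null mA mgood bf gl) (Rint_null mE mgood bf gl).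
congr (Rintegral _ _ _); apply/seteqP; split => u [h gu]; split=> //; exact/(AE u gu).
Qed.

End FixedFunction.

End MartingaleSolution.

(** * The limit law solves the martingale problem *)

Section LimitIsSolution.
Variables (R : realType) (n : nat).
Local Notation S := 'I_n.+1.
Local Notation V := 'rV[R]_n.+1.
Local Notation D := (cadlag_path R n).
Variables (r : S -> S -> R) (m : S -> R) (b : R) (g : S -> nat -> R) (Cg : R).
Hypothesis r_ge0 : forall j k, 0 <= r j k.
Hypothesis r_irr : forall j k, connect (fun i l => 0 < r i l) j k.
Hypothesis m_inv : forall k, \sum_j m j * r j k = m k * \sum_l r k l.
Hypothesis m_ge0 : forall j, 0 <= m j.
Hypothesis m_neq0 : exists j, m j != 0.
Hypothesis g_ge0 : forall j k, 0 <= g j k.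
Hypothesis g_0 : forall j, g j 0%N = 0.
Hypothesis gC : forall j k, `|g j k - m j| <= Cg.
Hypothesis ngC : forall j k, k%:R * `|g j k - m j| <= Cg.
Hypothesis g_lim : forall j, k%:R * (g j k - m j) @[k --> \oo] --> b * m j.
Variables (xN : nat -> V) (PN : nat -> probability (borel D) R).
Hypothesis PN_law : forall N, (0 < N)%N -> zrp_law r g N (xN N) (PN N).
Variable U : set_system nat.
Hypothesis UU : UltraFilter U.
Hypothesis U_tail : forall N0, U [set N | (N0 <= N)%N].

Local Notation db := (@db R n).
Local Notation mdb := (@db_measurable' R n).
Local Notation ob := (ob PN db U).
Local Notation fb := (bits ob).
Local Notation mob := (ob_measurable PN db U).
Local Notation uP := (@unitP R).
Local Notation Om := (g_sigma_algebraType R.-ocitv.-measurable).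
Local Notation Y := (limit_map PN U).
Local Notation nf := (@natural_filtration R n).



HB.instance Definition _ := isMeasurableFun.Build _ _ Om (borel D) Y (limit_map_measurable PN U).

Definition limit_law : probability (borel D) R := distribution uP Y.

Let pg := pr_good r_ge0 r_irr m_inv m_ge0 g_ge0 g_0 gC ngC PN_law UU U_tail.

Let mY (A : set D) : measurable (A : set (borel D)) -> measurable (Y @^-1` A : set Om).
Proof. by move=> mA; rewrite -[X in measurable X]setTI; exact: limit_map_measurable. Qed.

(** The bits of the limit path need not be the random bits, as a coordinate sitting on an endpoint c
    / 2^l may be rounded differently; the modulus is transferred through the values of the path. *)
Lemma good_path_reg (u : Om) K (e : R) : good R n (fb u) -> 0 < e ->
  exists k, reg n K k e (bits db (Y u : D)).
Proof.
move=> gu e0; have e80 : 0 < e / 8 by rewrite divr_gt0.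
have [k1 rk] := good_reg K gu e80.
have [k2 Hk2] := p2_small e80.
pose k := maxn k1.+2 k2; exists k => l l' a a' kl kl' aK aK' dd.
have hl i : (k <= i)%N -> 2 ^- i <= e / 8.
  by move=> ki; apply: Hk2; apply: leq_trans ki; exact: leq_maxr.
have h1 := xh_db l a (Y u : D); have h2 := xh_db l' a' (Y u : D).
have dd' : `|tm R l a - tm R l' a'| <= 2 ^- k1 / 4.
  apply: (le_trans dd); have : 2 ^- k <= 2 ^- k1.+2 :> R by apply: p2_le; exact: leq_maxl.
  by rewrite !p2S; lra.
have h3 : `|(Y u : D) (tm R l a) - (Y u : D) (tm R l' a')| <= e / 8 + e / 8.
  by rewrite /limit_map !path_ofE//; exact: (limit_fun_mod gu rk).
have b1 := hl _ kl; have b2 := hl _ kl'.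
move: h1 h2 h3; set X := xh R n _ _ _; set Z := xh R n _ _ _; set W := (Y u : D) _; set W' := (Y u : D) _ => h1 h2 h3.
rewrite (_ : X - Z = (X - W) + (W - W') - (Z - W')); last by apply/rowP => j; rewrite !mxE; ring.
have n1 := ler_normB ((X - W) + (W - W')) (Z - W'); have n2 := ler_normD (X - W) (W - W').
by move: n1 n2 h1 h2 h3 b1 b2 e0; lra.
Qed.

Lemma limit_law_continuous : {ae limit_law, forall w : D, continuous w}.
Proof.
pose C : set D := \bigcap_K \bigcap_i \bigcup_k [set w : D | reg n K k (i.+1%:R^-1 : R) (bits db w)].
have mC : measurable (C : set (borel D)).
  apply: bigcapT_measurable => K; apply: bigcapT_measurable => i; apply: bigcupT_measurable => k.
  exact: reg_measurable mdb _ _ _.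
exists (~` C); split; first exact: measurableC.
  have mYC : measurable (~` (Y @^-1` C) : set Om) by apply: measurableC; exact: mY.
  have -> : limit_law (~` C) = (pr uP (~` (Y @^-1` C)))%:E by rewrite -prK.
  rewrite -(pg mYC) (_ : _ `&` _ = set0) ?pr0//; apply/seteqP; split => // u [nC gu].
  apply: nC => K _ i _.
  have i0 : 0 < i.+1%:R^-1 :> R by rewrite invr_gt0.
  by have [k rk] := good_path_reg K gu i0; exists k.
move=> w /= nc Cw; apply: nc; apply: reg_continuous => K e e0.
pose i := Num.truncn e^-1; have [k _ rk] := Cw K I i I; exists k.
apply: reg_le rk => //.
by rewrite -[leRHS]invrK lef_pV2 ?posrE ?invr_gt0// ltW// truncnS_gt.
Qed.

Lemma limit_law_solution x : xN N @[N --> \oo] --> x ->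
  (forall H, DS r H -> forall t (B : set R), 0 <= t -> measurable B ->
     nf t (mart r m b H t @^-1` B)) ->
  martingale_solution r m b x limit_law.
Proof.
move=> xNx adapted; split; first exact: limit_law_continuous.
  have := init_limit r_ge0 r_irr m_inv m_ge0 g_ge0 g_0 gC ngC PN_law xNx UU U_tail.
  have mx := at_measurable x (lexx (0 : R)).
  by move=> i1; rewrite (prK limit_law mx) -[RHS](congr1 EFin i1).
move=> H HDS; have ad := adapted H HDS.
have bm t (t0 : 0 <= t) : bounded_measurable (fun u : Om => mart r m b H t (Y u)).
  exact: (mart_bm r_ge0 m_inv m_ge0 g_ge0 g_0 gC ngC g_lim PN U HDS ad t0).
have mM t : 0 <= t -> measurable_fun setT (EFin \o mart r m b H t : borel D -> \bar R).
  move=> t0; apply/measurable_EFinP => _ Z mZ; rewrite setTI.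
  exact: (natural_filtration_measurable (ad t Z t0 mZ)).
change (martingale limit_law nf (mart r m b H)).
split; first exact: ad.
  move=> t t0; apply: (integrable_pushforward (limit_map_measurable PN U) (mM t t0)) => //.
  by rewrite preimage_setT; exact: (bm_integrable uP measurableT (bm t t0)).
move=> s t A s0 st nA; have t0 := le_trans s0 st.
have mA := natural_filtration_measurable nA.
have I_ q : 0 <= q -> \int[limit_law]_(w in A) mart r m b H q w =
    \int[uP]_(u in Y @^-1` A) mart r m b H q (Y u).
  move=> q0; rewrite /Rintegral; congr fine.
  apply: (integral_pushforward (limit_map_measurable PN U) (mM q q0)) => //.
  exact: (bm_integrable uP (mY mA) (bm q q0)).
refine (eq_trans (I_ t t0) (eq_trans _ (esym (I_ s s0)))).
exact: (mart_past r_ge0 r_irr m_inv m_ge0 m_neq0 g_ge0 g_0 gC ngC g_lim PN_law UU U_tail HDS ad s0 st nA).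
Qed.

End LimitIsSolution.

(** * The portmanteau inequality along the ultrafilter *)

Section Portmanteau.
Variables (R : realType) (n : nat).
Local Notation S := 'I_n.+1.
Local Notation V := 'rV[R]_n.+1.
Local Notation D := (cadlag_path R n).
Variables (r : S -> S -> R) (m : S -> R) (g : S -> nat -> R) (Cg : R).
Hypothesis r_ge0 : forall j k, 0 <= r j k.
Hypothesis r_irr : forall j k, connect (fun i l => 0 < r i l) j k.
Hypothesis m_inv : forall k, \sum_j m j * r j k = m k * \sum_l r k l.
Hypothesis m_ge0 : forall j, 0 <= m j.
Hypothesis g_ge0 : forall j k, 0 <= g j k.
Hypothesis g_0 : forall j, g j 0%N = 0.
Hypothesis gC : forall j k, `|g j k - m j| <= Cg.
Hypothesis ngC : forall j k, k%:R * `|g j k - m j| <= Cg.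
Variables (xN : nat -> V) (PN : nat -> probability (borel D) R).
Hypothesis PN_law : forall N, (0 < N)%N -> zrp_law r g N (xN N) (PN N).
Variable U : set_system nat.
Hypothesis UU : UltraFilter U.
Hypothesis U_tail : forall N0, U [set N | (N0 <= N)%N].

Let FU : ProperFilter U. Proof. exact: ultra_proper. Qed.
#[local] Existing Instance FU.

Local Notation db := (@db R n).
Local Notation mdb := (@db_measurable' R n).
Local Notation ob := (ob PN db U).
Local Notation fb := (bits ob).
Local Notation mob := (ob_measurable PN db U).
Local Notation uP := (@unitP R).
Local Notation Om := (g_sigma_algebraType R.-ocitv.-measurable).
Local Notation Y := (limit_map PN U).



Let pg := pr_good r_ge0 r_irr m_inv m_ge0 g_ge0 g_0 gC ngC PN_law UU U_tail.

Lemma open_measurable_path (O : set D) : open O -> measurable (O : set (borel D)).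
Proof. exact: sub_sigma_algebra. Qed.

(* An increasing union of the events inner O J k exhausts {Y in O}; at a fixed J
   they are contained, up to a set of small probability, in one event depending on
   finitely many bits, which transfers to PN and there forces the path into O. *)
Lemma portmanteau_open (O : set D) (c : R) : open O -> 0 < c ->
  U [set N | pr (limit_law PN U) O - c <= pr (PN N) O].
Proof.
move=> oO c0; have mO := open_measurable_path oO.
have mYO : measurable (Y @^-1` O : set Om).
  by rewrite -[X in measurable X]setTI; exact: limit_map_measurable.
have mgood : measurable [set u : Om | good R n (fb u)] by exact: good_measurable mob.
pose F i := [set u : Om | exists2 J, J \in iota 0 i & (\bigcup_k [set u | inner O J k (fb u)]) u].
have mF i : measurable (F i).
  by apply: seq_bigcup_measurable => J _; apply: bigcupT_measurable => k; exact: inner_measurable mob _ _ _.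
have ndF i j : (i <= j)%N -> F i `<=` F j.
  move=> ij u [J Ji [k _ Hk]]; exists J; last by exists k.
  by move: Ji; rewrite !mem_iota !add0n => /leq_trans; exact.
have mFU : measurable (\bigcup_i F i) by exact: bigcupT_measurable.
have c40 : 0 < c / 4 by rewrite divr_gt0.
have /cvgrPdist_le/(_ _ c40)[i _ /(_ i (leqnn i)) Hi] := @pr_nd_cvg _ Om R uP F mF ndF.
have FO : pr uP (Y @^-1` O) <= pr uP (\bigcup_i F i).
  rewrite -(pg mYO); apply: prS => //; first exact: measurableI.
  move=> u [Ou gu]; have [J [k Jk]] := path_inner oO gu Ou.
  by exists J.+1 => //; exists J; [rewrite mem_iota add0n ltnSn|exists k].
(* The tube of radius 2 e at level [k] must fit into those of radius 2 tol J for all J < i: the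
   detour adds e + tol J, and 3 e is at most tol i, hence at most tol J. *)
pose e := tol R i / 4.
have ti0 := tol_gt0 R i; have e0 : 0 < e by rewrite divr_gt0.
have [C C0 HC] := reg_bound r_ge0 r_irr m_inv m_ge0 g_ge0 g_0 gC ngC i.+1 e0.
have [C' C'0 HC'] := reg_limit r_ge0 r_irr m_inv m_ge0 g_ge0 g_0 gC ngC PN_law UU U_tail i.+1 e0.
have W0 : 0 < 2 * C + C' + 1 by rewrite ltr_wpDl// addr_ge0// mulr_ge0.
have [k1 Hk1] := p2_small (divr_gt0 c40 W0).
have [k2 Hk2] := p2_small (divr_gt0 e0 (ltr0n _ 8)).
pose k := maxn k1 k2.
have kc : 2 ^- k * (2 * C + C' + 1) <= c / 4 by rewrite -ler_pdivlMr// Hk1// leq_maxl.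
have ke : 2 ^- k <= e / 8 by rewrite Hk2// leq_maxr.
have k0 := p2_gt0 R k.
have [M dM] := pat_depends O i k.+1 e.
have mP : measurable [set u : Om | pat O i k.+1 e (fb u)] by exact: depends_measurable mob _ _ dM.
have mR : measurable [set u : Om | reg n i.+1 k e (fb u)] by exact: reg_measurable mob _ _ _.
(* The level [q] certifying [O] depends on the sample; on regular paths the fixed fine level [k]
   certifies it as well. *)
have sub : F i `&` [set u | good R n (fb u)] `<=`
    [set u | pat O i k.+1 e (fb u)] `|` ~` [set u | reg n i.+1 k e (fb u)].
  move=> u [[J]]; rewrite mem_iota add0n => /andP[_ Ji] [q _ [rq pq]] gu.
  have [ru|] := pselect (reg n i.+1 k e (fb u)); last by right.
  left => v vx; apply: pq => t /andP[t0 tJ].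
  have ti : t <= i%:R by apply: (le_trans tJ); rewrite ler_nat ltnW.
  have h1 : `|v t - xh R n k.+1 (al k.+1 t) (fb u)| <= 2 * e by apply: vx; rewrite t0.
  have h2 : `|(Y u : D) t - xh R n k.+1 (al k.+1 t) (fb u)| <= e.
    by apply: path_close gu ru _ (ltnSn k); apply: (le_trans ti); rewrite ler_nat.
  have h3 : `|(Y u : D) t - xh R n q.+1 (al q.+1 t) (fb u)| <= tol R J.
    by apply: path_close gu rq _ (ltnSn q); apply: (le_trans tJ); rewrite ler_nat.
  have tJi := tol_le R (ltnW Ji).
  move: h1 h2 h3; set X := xh R n k.+1 _ _; set Z := xh R n q.+1 _ _; set W := (Y u : D) t => h1 h2 h3.
  rewrite (_ : v t - Z = (v t - X) - (W - X) + (W - Z)); last by apply/rowP => j; rewrite !mxE; ring.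
  have n1 := ler_normD ((v t - X) - (W - X)) (W - Z); have n2 := ler_normB (v t - X) (W - X).
  by move: n1 n2 h1 h2 h3 tJi ti0; rewrite /e; lra.
have Fle : pr uP (F i) <= pr uP [set u | pat O i k.+1 e (fb u)] + c / 4.
  rewrite -(pg (mF i)); apply: (@le_trans _ _ (pr uP ([set u | pat O i k.+1 e (fb u)] `|` ~` [set u | reg n i.+1 k e (fb u)]))).
    apply: prS => //; first exact: measurableI.
    by apply: measurableU => //; exact: measurableC.
  apply: (le_trans (prUle _ mP (measurableC mR))); rewrite lerD2l.
  apply: (le_trans (HC' k ke)); apply: le_trans kc; rewrite mulrC ler_wpM2l ?(ltW k0)//.
  by move: C0; lra.
have cv := @pr_bits_cvg _ _ R PN db mdb U UU M _ dM.
have [N0 HN] := inv_small k0.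
have evP : U [set N | pr uP [set u | pat O i k.+1 e (fb u)] - c / 4 <= pr (PN N) [set w | pat O i k.+1 e (bits db w)]].
  have /cvgrPdist_le/(_ _ c40) := cv; apply: filterS => N /=.
  by rewrite ler_norml => /andP[_]; lra.
have evR : U [set N | pr (PN N) (~` [set w : D | reg n i.+1 k e (bits db w)]) <= c / 4].
  apply: (U_eventually UU U_tail (N0 := N0)) => N NN N_gt0.
  apply: (le_trans (HC N _ _ k N_gt0 (PN_law N_gt0) ke)); apply: le_trans kc.
  have [_ h] := HN N NN N_gt0; rewrite mulrC.
  apply: (@le_trans _ _ ((2 ^- k + 2 ^- k) * C)); first by rewrite ler_wpM2r// lerD2l.
  have := mulr_ge0 (ltW k0) C'0; have := ltW k0; set p := 2 ^- k; lra.
apply: filterS (filterI evP evR) => N [/= hP hR].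
have mPN : measurable ([set w : D | pat O i k.+1 e (bits db w)] : set (borel D)).
  exact: depends_measurable mdb _ _ dM.
have mRN : measurable ([set w : D | reg n i.+1 k e (bits db w)] : set (borel D)).
  exact: reg_measurable mdb _ _ _.
have h1 := pr_split (PN N) mPN mRN.
have h2 : pr (PN N) ([set w : D | pat O i k.+1 e (bits db w)] `&` [set w : D | reg n i.+1 k e (bits db w)]) <= pr (PN N) O.
  by apply: prS => //; [exact: measurableI|move=> w [/= pw rw_]; exact: (pat_db (ltW e0) rw_ pw)].
have h3 : pr (PN N) ([set w : D | pat O i k.+1 e (bits db w)] `&` ~` [set w : D | reg n i.+1 k e (bits db w)]) <= c / 4.
  apply: le_trans hR; apply: prS; [|exact: measurableC|exact: subIsetr].
  by apply: measurableI => //; exact: measurableC.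
have h4 : pr uP (\bigcup_i F i) - c / 4 <= pr uP (F i).
  by move: Hi; rewrite ler_norml => /andP[_]; lra.
have -> : pr (limit_law PN U) O = pr uP (Y @^-1` O) by [].
by move: FO h4 Fle hP h1 h2 h3; lra.
Qed.

End Portmanteau.

(** * From open sets to bounded continuous functions *)

Section WeakConvergence.
Variable R : realType.

(** The number of integers i with 0 <= i < y is the ceiling of y. *)
Lemma layer_count (K : nat) (y : R) : 0 <= y <= K%:R ->
  y <= \sum_(i < K) (i%:R < y)%R%:R <= y + 1.
Proof.
elim: K => [|K IH] /andP[y0 yK].
  by rewrite big_ord0; apply/andP; split; move: y0 yK; lra.
rewrite big_ord_recr/=; have [yK'|Ky] := leP y K%:R.
  by rewrite addr0; apply: IH; rewrite y0.
rewrite (eq_bigr (fun=> 1)) => [|i _]; last by rewrite (lt_trans _ Ky)// ltr_nat.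
rewrite sumr_const card_ord; apply/andP; split; first by move: yK; rewrite -natr1.
by rewrite lerD2r ltW.
Qed.

Lemma layer_int d (T : measurableType d) (P : probability T R) (f : T -> R) (M : R) (K : nat) :
  measurable_fun setT f -> (forall w, `|f w| <= M) -> 0 < M -> (0 < K)%N ->
  `|\int[P]_w f w - (- M + 2 * M / K%:R *
     \sum_(i < K) pr P [set w | - M + i%:R * (2 * M / K%:R) < f w])| <= 2 * M / K%:R.
Proof.
move=> mf fM M0 K0; have K0' : 0 < K%:R :> R by rewrite ltr0n.
set del := 2 * M / K%:R; have del0 : 0 < del by rewrite divr_gt0// mulr_gt0.
pose G (i : 'I_K) := [set w | - M + i%:R * del < f w].
have mG i : measurable (G i).
  have := mf measurableT `]- M + i%:R * del, +oo[%classic (measurable_itv _).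
  by rewrite setTI; congr measurable; apply/seteqP; split => w; rewrite /= in_itv/= andbT.
have bG : bounded_measurable (fun w => \sum_(i < K) (\1_(G i) w : R)).
  by apply: bm_sum => i; exact: bm_indic.
have bpsi : bounded_measurable (fun w => - M + del * \sum_(i < K) (\1_(G i) w : R)).
  by apply: bmD; [exact: bm_cst|exact: bmZ].
have bf : bounded_measurable f by split=> //; exists M.
have -> : - M + del * \sum_(i < K) pr P (G i) =
    \int[P]_w (- M + del * \sum_(i < K) (\1_(G i) w : R)).
  rewrite RintD//; [|exact: bm_cst|exact: bmZ].
  rewrite Rint_cst// prT mulr1 RintZ// Rint_sum//; last by move=> i; exact: bm_indic.
  congr (_ + _ * _); apply: eq_bigr => i _; rewrite Rint_indic//.
  by rewrite setTI.
rewrite -RintB//.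
have [mD _] := bmB bf bpsi.
have ptw w : `|f w - (- M + del * \sum_(i < K) (\1_(G i) w : R))| <= del.
  pose y := (f w + M) / del.
  have /andP[f1 f2] : - M <= f w <= M by rewrite -ler_norml.
  have y01 : 0 <= y <= K%:R.
    rewrite /y divr_ge0 ?(ltW del0)//=; last by move: f1; lra.
    by rewrite ler_pdivrMr// /del mulrCA divff ?gt_eqF// mulr1; move: f2; lra.
  have /andP[s1 s2] := layer_count y01.
  have -> : \sum_(i < K) (\1_(G i) w : R) = \sum_(i < K) (i%:R < y)%R%:R.
    apply: eq_bigr => i _; rewrite indicE; congr (nat_of_bool _)%:R.
    rewrite /y ltr_pdivlMr// -ltrBlDr [_ - M]addrC.
    by apply/idP/idP => [/set_mem//|h]; exact/mem_set.
  set Sg := \sum_(i < K) _ in s1 s2 *.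
  have fy : f w = y * del - M by rewrite /y divfK ?gt_eqF// addrK.
  have h1 := ler_wpM2l (ltW del0) s1; have h2 := ler_wpM2l (ltW del0) s2.
  rewrite fy ler_norml; apply/andP; split; rewrite -subr_ge0.
    by rewrite (_ : _ - _ = del * (y + 1) - del * Sg); [rewrite subr_ge0|ring].
  rewrite (_ : _ - _ = (del * Sg - del * y) + del); last by ring.
  by rewrite addr_ge0 ?(ltW del0)// subr_ge0.
apply: (le_trans (@Rint_bound _ _ _ P setT set0 _ del del measurableT measurable0 mD (ltW del0) ptw _)) => //.
by rewrite setI0 pr0 mulr0 addr0 prT mulr1.
Qed.

Lemma borel_continuous_measurable (T : ptopologicalType) (f : T -> R) : continuous f ->
  measurable_fun setT (f : borel T -> R).
Proof.
move=> cf; apply: (measurability _ (RGenOInfty.measurableE R)) => //.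
move=> /= _ [_ [a ->] <-]; rewrite setTI preimage_itvoy.
apply: sub_sigma_algebra; rewrite -[X in open X]/(f @^-1` [set y | a < y]).
by apply: open_comp => [x _|]; [exact: cf|exact: open_gt].
Qed.

(** Up to a mesh, the integral of [f] is a positive combination of probabilities of its superlevel
    sets, which are open; finitely many lower bounds hold simultaneously along [U]. *)
Lemma weak_lower (T : ptopologicalType) (U : set_system nat) (FU : Filter U)
    (P : probability (borel T) R) (PN : nat -> probability (borel T) R) (f : T -> R) (B e : R) :
  (forall O c, open O -> 0 < c -> U [set N | pr P O - c <= pr (PN N) O]) ->
  continuous f -> (forall w, `|f w| <= B) -> 0 < e ->
  U [set N | \int[P]_w f w - e <= \int[PN N]_w f w].
Proof.
move=> HO cf fB e0; pose M := `|B| + 1.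
have M0 : 0 < M by rewrite ltr_wpDl.
have fM w : `|f w| <= M.
  by apply: (le_trans (fB w)); apply: (le_trans (ler_norm B)); rewrite lerDl.
have mf := borel_continuous_measurable cf.
pose K := (Num.truncn (8 * M / e)).+1.
have K0 : 0 < K%:R :> R by rewrite ltr0n.
set del := 2 * M / K%:R; have del0 : 0 < del by rewrite divr_gt0// mulr_gt0.
have del_le : 4 * del <= e.
  have h : 8 * M / e <= K%:R by apply: ltW; exact: truncnS_gt.
  rewrite ler_pdivrMr// in h; rewrite /del mulrA ler_pdivrMr//.
  by rewrite mulrA (_ : 4 * 2 = 8) ?[e * _]mulrC//; ring.
(* The K levels, each weighted by del = 2 M / K, then lose e / 2 in all; the two discretisations
   cost the other half. *)
pose c := e / (4 * M); have c0 : 0 < c by rewrite divr_gt0// mulr_gt0.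
pose G (i : 'I_K) := [set w | - M + i%:R * del < f w].
have oG i : open (G i).
  rewrite -[X in open X]/(f @^-1` [set y | - M + i%:R * del < y]).
  by apply: open_comp => [x _|]; [exact: cf|exact: open_gt].
have ev : \forall N \near U, forall i : 'I_K, pr P (G i) - c <= pr (PN N) (G i).
  by apply: filter_forall => i; exact: HO.
apply: filterS ev => N /= HN.
have h1 := @layer_int _ (borel T) P f M K mf fM M0 isT.
have h2 := @layer_int _ (borel T) (PN N) f M K mf fM M0 isT.
move: h1 h2; rewrite -/del !ler_norml => /andP[_ h1] /andP[h2 _].
have s : \sum_(i < K) pr P (G i) - K%:R * c <= \sum_(i < K) pr (PN N) (G i).
  rewrite mulr_natl -[X in _ - X](_ : \sum_(i < K) c = _); last by rewrite sumr_const card_ord.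
  by rewrite -sumrB; apply: ler_sum => i _; exact: HN.
have := ler_wpM2l (ltW del0) s; rewrite mulrBr.
have -> : del * (K%:R * c) = e / 2.
  by rewrite /del /c; field; rewrite !gt_eqF.
move: h1 h2; set S1 := \sum_(i < K) pr P (G i); set S2 := \sum_(i < K) pr (PN N) (G i).
rewrite -/S1 -/S2; move: del_le; set p1 := del * S1; set p2 := del * S2.
by set I1 := Rintegral _ _ _; set I2 := Rintegral _ _ _; lra.
Qed.

End WeakConvergence.

Unset Implicit Arguments.

Theorem theorem2p6 (R : realType) (n : nat)
  (r : 'I_n.+1 -> 'I_n.+1 -> R) (m : 'I_n.+1 -> R) (b : R)
  (g : 'I_n.+1 -> nat -> R)
  (r_ge0 : forall j k, 0 <= r j k)
  (r_diag : forall j, r j j = 0)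
  (r_irr : forall j k, connect (fun i l => 0 < r i l) j k)
  (m_ge0 : forall j, 0 <= m j)
  (m_neq0 : exists j, m j != 0)
  (m_inv : forall k, \sum_j m j * r j k = m k * \sum_l r k l)
  (b_gt1 : 1 < b)
  (g_ge0 : forall j k, 0 <= g j k)
  (g_0 : forall j, g j 0%N = 0)
  (g_lim : forall j, k%:R * (g j k / m j - 1) @[k --> \oo] --> b)
  (xN : nat -> 'rV[R]_n.+1) (x : 'rV[R]_n.+1)
  (xN_grid : forall N, (0 < N)%N -> simplex_grid N (xN N))
  (x_simplex : simplex x)
  (xN_cvg : xN N @[N --> \oo] --> x)
  (PN : nat -> probability (borel (cadlag_path R n)) R)
  (PN_law : forall N, (0 < N)%N -> zrp_law r g N (xN N) (PN N))
  (Px : probability (borel (cadlag_path R n)) R)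
  (Px_sol : unique_martingale_solution r m b x Px) :
  weak_cvg PN Px.
Proof.
have m_gt0 := invariant_gt0 r_ge0 r_irr m_ge0 m_neq0 m_inv.
have glim j : k%:R * (g j k - m j) @[k --> \oo] --> b * m j.
  have -> : (fun k => k%:R * (g j k - m j)) = (fun k => k%:R * (g j k / m j - 1) * m j).
    apply/funext => k; rewrite -mulrA mulrBl mul1r divfK// gt_eqF// m_gt0.
  by apply: cvgM; [exact: g_lim|exact: cvg_cst].
have /choice[Mj HM] j : exists Mj, forall k : nat, `|k%:R * (g j k - m j)| <= Mj.
  have [Mj [_ HMj]] := cvg_seq_bounded (cvgP _ (@glim j)).
  by exists (Mj + 1) => k; apply: (HMj (Mj + 1)) => //; rewrite ltrDl.
have Mj0 j : 0 <= Mj j by apply: le_trans (HM j 0%N).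
pose Cg := \sum_j (Mj j + m j).
have Cgj j : Mj j + m j <= Cg.
  rewrite /Cg (bigD1 j)//= lerDl; apply: sumr_ge0 => i _; exact: addr_ge0.
have ngC j k : k%:R * `|g j k - m j| <= Cg.
  rewrite -[k%:R]ger0_norm// -normrM; apply: (le_trans (HM j k)).
  by apply: le_trans (Cgj j); rewrite lerDl.
have gC j k : `|g j k - m j| <= Cg.
  (* At k = 0 the bound [ngC] is empty; there the difference is simply -m_j. *)
  case: k => [|k].
    by rewrite g_0 sub0r normrN ger0_norm//; apply: le_trans (Cgj j); rewrite lerDr.
  by apply: le_trans (ngC j k.+1); rewrite ler_peMl// ler1n.
move=> f cf [B fB]; apply/cvgrPdist_le => e e0; apply: contrapT => nE.
pose bad := [set N | ~ (`|\int[Px]_w f w - \int[PN N]_w f w| <= e)].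
(* A tail avoiding [bad] would give the convergence; hence an ultrafilter can contain [bad] together
   with all tails. *)
have PW : ProperFilter (within bad \oo).
  apply: Build_ProperFilter => -[N0 _ H]; apply: nE; exists N0 => // N NN.
  by apply: contrapT; exact: H.
have [U [UU subU]] := ultraFilterLemma PW.
have Ubad : U bad by apply: subU; exists 0%N.
have U_tail N0 : U [set N | (N0 <= N)%N].
  by apply: subU; exists N0 => // N /= NN _.
have [[Pxc Px0 Pxm] uniq_] := Px_sol.
(* Adaptedness concerns the functional and the filtration but no measure, so it is read off from the
   solution [Px]. *)
have adapted H : DS r H -> forall t (B : set R), 0 <= t -> measurable B ->
    natural_filtration t (mart r m b H t @^-1` B).
  by move=> HDS; have [ad _ _] := Pxm H HDS; exact: ad.
have sol := limit_law_solution r_ge0 r_irr m_inv m_ge0 m_neq0 g_ge0 g_0 gC ngC glim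
  PN_law UU U_tail xN_cvg adapted.
have HO O c : open O -> 0 < c -> U [set N | pr Px O - c <= pr (PN N) O].
  move=> oO c0; have := portmanteau_open r_ge0 r_irr m_inv m_ge0 g_ge0 g_0 gC ngC
    PN_law UU U_tail oO c0.
  by rewrite /pr (uniq_ _ sol O (open_measurable_path oO)).
have FU : Filter U by exact: ultra_proper.
have low := weak_lower FU HO.
have lf := low f B e cf fB e0.
have cNf : continuous (fun w => - f w).
  by move=> w; apply: continuousN; exact: cf.
have NfB w : `|- f w| <= B by rewrite normrN.
(* The lower bounds for f and -f give a two-sided estimate on a set of [U], which meets [bad]. *)
have lNf := low (fun w => - f w) B e cNf NfB e0.
have mf := borel_continuous_measurable cf.
have IN (P : probability (borel (cadlag_path R n)) R) : \int[P]_w (- f w) = - \int[P]_w f w.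
  have bf : bounded_measurable (f : borel (cadlag_path R n) -> R) by split=> //; exists B.
  have := RintZ P (-1) measurableT bf; rewrite mulN1r => <-.
  by apply: eq_Rintegral => w _; rewrite mulN1r.
have PU : ProperFilter U by exact: ultra_proper.
have [N [/= [h1 h2] bN]] := filter_ex (filterI (filterI lf lNf) Ubad).
apply: bN; move: h1 h2; rewrite !IN ler_norml => h1 h2; apply/andP; split; move: h1 h2; lra.
Qed.
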